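(* Consider the three-user complex Gaussian interference channel and the auxiliary variables described in the context. Let \begin{align*} A=\frac13\Big\{& I(X_{1G};Y_{1G})+I(X_{2G};Y_{2G},S_{2G}\mid X_{1G})+I(X_{3G};Y_{3G}\mid U_{3G})\\ &+I(X_{2G};Y_{2G})+I(X_{3G};Y_{3G},S_{3G}\mid X_{2G})+I(X_{1G};Y_{1G}\mid U_{1G})\\ &+I(X_{3G};Y_{3G})+I(X_{1G};Y_{1G},S_{1G}\mid X_{3G})+I(X_{2G};Y_{2G}\mid U_{2G})\Big\}, \end{align*} $I_0=\frac13\{I(U_{1G};Y_{1G}+\tilde V_{N_3})+I(U_{2G};Y_{2G}+\tilde V_{N_1})+I(U_{3G};Y_{3G}+\tilde V_{N_2})\}$ and $I_1=\frac13\{I(U_{1G};Y_{1G}+\tilde V'_{N_3})+I(U_{2G};Y_{2G}+\tilde V'_{N_1})+I(U_{3G};Y_{3G}+\tilde V'_{N_2})\}$. (a) If $(N_1,N_2,N_3,W_1,W_2,W_3)$ satisfy $\sigma^2_{V_{W_1}}\ge\sigma^2_{N_2}$, $\sigma^2_{V_{N_2}}\ge|h_{13}|^2\sigma^2_{Z_3-W_3}$; $\sigma^2_{V_{W_2}}\ge\sigma^2_{N_3}$, $\sigma^2_{V_{N_3}}\ge|h_{21}|^2\sigma^2_{Z_1-W_1}$; $\sigma^2_{V_{W_3}}\ge\sigma^2_{N_1}$, $\sigma^2_{V_{N_1}}\ge|h_{32}|^2\sigma^2_{Z_2-W_2}$, then every achievable rate triple satisfies $R_1+R_2+R_3\le A+I_0$.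 (b) If $(N_1,N_2,N_3,W_1,W_2,W_3)$ satisfy $\sigma^2_{V_{W_1}}\ge\sigma^2_{W_1}$, $\sigma^2_{V'_{N_2}}\ge|h_{23}|^2\sigma^2_{Z_3-W_3}$; $\sigma^2_{V_{W_2}}\ge\sigma^2_{W_2}$, $\sigma^2_{V'_{N_3}}\ge|h_{31}|^2\sigma^2_{Z_1-W_1}$; $\sigma^2_{V_{W_3}}\ge\sigma^2_{W_3}$, $\sigma^2_{V'_{N_1}}\ge|h_{12}|^2\sigma^2_{Z_2-W_2}$, then every achievable rate triple satisfies $R_1+R_2+R_3\le A+I_1$. In particular the sum capacity is at most $A+\min\{I_0,I_1\}$ when both sets of conditions hold. Moreover, the same bounds hold after any permutation of the user indices (giving $3!$ such bounds).
   Context: Three-user complex Gaussian interference channel: $Y_1=X_1+h_{12}X_2+h_{13}X_3+Z_1$, $Y_2=X_2+h_{23}X_3+h_{21}X_1+Z_2$, $Y_3=X_3+h_{31}X_1+h_{32}X_2+Z_3$, with constant complex coefficients $h_{ij}$ known to all terminals, noises $Z_k\sim\mathcal{CN}(0,1)$ i.i.d. over time and independent of the inputs, and average power constraints $\sum_{t=1}^n|x_{k,t}|^2\le nP_k$ on transmitter $k$'s codewords. A rate triple is achievable if there exist length-$n$ codes with independent messages uniform on $[1:2^{nR_k}]$ and average error probability tending to $0$; the sum capacity is the supremum of $R_1+R_2+R_3$ over achievable triples. Logarithms are base 2. Gaussian evaluation: $X_{kG}\sim\mathcal{CN}(0,P_k)$, mutually independent and independent of all noises; a subscript $G$ means the variable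 is formed with each $X_k$ replaced by $X_{kG}$. For jointly circularly symmetric complex Gaussian $A,B$: $\sigma^2_A=\mathbb{E}|A|^2$, $\sigma^2_{A|B}=\sigma^2_A-|\mathbb{E}[AB^*]|^2/\sigma^2_B$. Noises: for $k=1,2,3$, $W_k\sim\mathcal{CN}(0,\sigma^2_{W_k})$, $N_k\sim\mathcal{CN}(0,\sigma^2_{N_k})$ with $\sigma^2_{W_k},\sigma^2_{N_k}\le1$; $W_k$ is jointly Gaussian with $Z_k$ with $\mathbb{E}[Z_kW_k^*]=\rho_{W_k}\sigma_{W_k}$ and independent of everything else; $N_k$ is jointly Gaussian with $Z_k$ with $\mathbb{E}[Z_kN_k^*]=\rho_{N_k}\sigma_{N_k}$ and independent of everything else. Genie signals: $U_1=h_{12}X_2+h_{13}X_3+W_1$, $U_2=h_{23}X_3+h_{21}X_1+W_2$, $U_3=h_{31}X_1+h_{32}X_2+W_3$; $S_1=h_{31}X_1+h_{32}X_2+N_1$, $S_2=h_{12}X_2+h_{13}X_3+N_2$, $S_3=h_{23}X_3+h_{21}X_1+N_3$. Variances: $\sigma^2_{V_{W_k}}=\sigma^2_{W_k|Z_k-W_k}$; $\sigma^2_{V_{N_1}}=\sigma^2_{N_1|Z_1-h_{12}h_{32}^{-1}N_1}$, $\sigma^2_{V_{N_2}}=\sigma^2_{N_2|Z_2-h_{23}h_{13}^{-1}N_2}$, $\sigma^2_{V_{N_3}}=\sigma^2_{N_3|Z_3-h_{31}h_{21}^{-1}N_3}$; $\sigma^2_{V'_{N_1}}=\sigma^2_{Z_1|N_1-h_{32}h_{12}^{-1}Z_1}$,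 $\sigma^2_{V'_{N_2}}=\sigma^2_{Z_2|N_2-h_{13}h_{23}^{-1}Z_2}$, $\sigma^2_{V'_{N_3}}=\sigma^2_{Z_3|N_3-h_{21}h_{31}^{-1}Z_3}$. $V_{N_k}\sim\mathcal{CN}(0,\sigma^2_{V_{N_k}})$ and $V'_{N_k}\sim\mathcal{CN}(0,\sigma^2_{V'_{N_k}})$ are independent of all other variables, and $\tilde V_{N_1}=\sqrt{|h_{32}|^{-2}-\sigma^{-2}_{V_{N_1}}\sigma^2_{Z_2-W_2}}\,V_{N_1}$, $\tilde V_{N_2}=\sqrt{|h_{13}|^{-2}-\sigma^{-2}_{V_{N_2}}\sigma^2_{Z_3-W_3}}\,V_{N_2}$, $\tilde V_{N_3}=\sqrt{|h_{21}|^{-2}-\sigma^{-2}_{V_{N_3}}\sigma^2_{Z_1-W_1}}\,V_{N_3}$; $\tilde V'_{N_1}=\sqrt{|h_{12}|^{-2}-\sigma^{-2}_{V'_{N_1}}\sigma^2_{Z_2-W_2}}\,V'_{N_1}$, $\tilde V'_{N_2}=\sqrt{|h_{23}|^{-2}-\sigma^{-2}_{V'_{N_2}}\sigma^2_{Z_3-W_3}}\,V'_{N_2}$, $\tilde V'_{N_3}=\sqrt{|h_{31}|^{-2}-\sigma^{-2}_{V'_{N_3}}\sigma^2_{Z_1-W_1}}\,V'_{N_3}$ (the expressions presuppose the cross coefficients with negative exponents are nonzero). *)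

(* Defs.v *)
From HB Require Import structures.
From mathcomp Require Import all_boot all_order all_algebra.
From mathcomp Require Import all_classical all_reals all_analysis.
From mathcomp Require Import complex.

Set Implicit Arguments.
Unset Strict Implicit.
Unset Printing Implicit Defensive.

Import Order.TTheory GRing.Theory Num.Theory.
Import numFieldNormedType.Exports.
Local Open Scope classical_set_scope.
Local Open Scope ring_scope.

Definition u1 : 'I_3 := @inord 2 0.
Definition u2 : 'I_3 := @inord 2 1.
Definition u3 : 'I_3 := @inord 2 2.

Section IC.
Variable R : realType.

Definition sqn (z : R[i]) : R := complex.Re z ^+ 2 + complex.Im z ^+ 2.
Definition rc (x : R) : R[i] := Complex x 0.

Definition log2 (x : R) : R := ln x / ln 2.

(* A length-n code with message sets 'I_(M k) (k = user).  Channel outputs   *)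
(* are seen as n-tuples of (real part, imaginary part) pairs, which carry   *)
(* the (Borel) product sigma-algebra.                                        *)
Record code (n : nat) (M : 'I_3 -> nat) := Code {
  enc : forall k : 'I_3, 'I_(M k) -> 'I_n -> R[i];
  dec : forall k : 'I_3, n.-tuple (R * R)%type -> 'I_(M k) }.

Definition good_code (P : 'I_3 -> R) n M (c : code n M) : Prop :=
  (forall k (m : 'I_(M k)), \sum_(t < n) sqn (enc c m t) <= n%:R * P k) /\
  (forall k (m : 'I_(M k)), measurable (dec c k @^-1` [set m])).

Definition rx_signal (h : 'I_3 -> 'I_3 -> R[i]) n (x : 'I_3 -> 'I_n -> R[i])
    (z : 'I_n -> R[i]) (k : 'I_3) (t : 'I_n) : R[i] :=
  x k t + \sum_(j < 3 | j != k) h k j * x j t + z t.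

Definition to_pairs n (y : 'I_n -> R[i]) : n.-tuple (R * R)%type :=
  [tuple (complex.Re (y t), complex.Im (y t)) | t < n].

(* Noise: Zn k t b = real (b = false) / imaginary (b = true) part of Z_{k,t}. *)
Definition noise_index := ('I_3 * nat * bool)%type.

(* Z_{k,t} i.i.d. CN(0,1) over k and t: all real/imaginary parts are         *)
(* mutually independent N(0,1/2) random variables.                           *)
Definition gauss_noise d (T : measurableType d) (Pr : probability T R)
    (Zn : 'I_3 -> nat -> bool -> T -> R) : Prop :=
  let X (i : noise_index) := Zn i.1.1 i.1.2 i.2 in
  (forall i, measurable_fun setT (X i)) /\
  (forall i (B : set R), measurable B ->
     Pr (X i @^-1` B) = normal_prob 0 (Num.sqrt (2^-1)) B) /\
  (forall (s : seq noise_index) (B : noise_index -> set R),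
     uniq s -> (forall i, measurable (B i)) ->
     Pr (\big[setI/setT]_(i <- s) (X i @^-1` B i)) =
     (\big[*%E/1%E]_(i <- s) Pr (X i @^-1` B i))%E).

Definition avg_error (h : 'I_3 -> 'I_3 -> R[i]) d (T : measurableType d)
    (Pr : probability T R) (Zn : 'I_3 -> nat -> bool -> T -> R)
    n M (c : code n M) : R :=
  (\sum_(w : {dffun forall k : 'I_3, 'I_(M k)})
     fine (Pr [set om | exists k : 'I_3,
        dec c k (to_pairs
          (rx_signal h (fun j => enc c (w j))
             (fun t => Complex (Zn k t false om) (Zn k t true om)) k))
        != w k]))
  / (\prod_(k < 3) M k)%:R.

Definition msize (n : nat) (r : R) : nat := `|Num.ceil (2 `^ (n%:R * r))|%N.

Definition achievable (h : 'I_3 -> 'I_3 -> R[i]) (P : 'I_3 -> R)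
    (Rt : 'I_3 -> R) : Prop :=
  (forall k, 0 <= Rt k) /\
  exists c : forall n : nat, code n (fun k => msize n (Rt k)),
    (forall n, good_code P (c n)) /\
    exists d (T : measurableType d) (Pr : probability T R)
           (Zn : 'I_3 -> nat -> bool -> T -> R),
      gauss_noise Pr Zn /\
      (fun n => avg_error h Pr Zn (c n)) @ \oo --> (0 : R).

Definition sum_capacity (h : 'I_3 -> 'I_3 -> R[i]) (P : 'I_3 -> R) : \bar R :=
  ereal_sup [set (\sum_(k < 3) Rt k)%:E | Rt in achievable h P].

Record genie := Genie {
  sW : 'I_3 -> R; rW : 'I_3 -> R[i]; sN : 'I_3 -> R; rN : 'I_3 -> R[i] }.

(* Base (mutually independent across k) circularly symmetric Gaussians:     *)
(* kind 0 : X_kG, 1 : Z_k, 2 : W_k, 3 : N_k, 4 : V_{N_k}, 5 : V'_{N_k}.     *)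
Definition kX : 'I_6 := @inord 5 0.
Definition kZ : 'I_6 := @inord 5 1.
Definition kW : 'I_6 := @inord 5 2.
Definition kN : 'I_6 := @inord 5 3.
Definition kV : 'I_6 := @inord 5 4.
Definition kV' : 'I_6 := @inord 5 5.

(* a linear combination of the base variables *)
Definition lin := 'I_6 -> 'I_3 -> R[i].
Definition bv (a : 'I_6) (k : 'I_3) : lin :=
  fun a' k' => if (a' == a) && (k' == k) then 1 else 0.
Definition ladd (e1 e2 : lin) : lin := fun a k => e1 a k + e2 a k.
Definition lscale (c : R[i]) (e : lin) : lin := fun a k => c * e a k.
Definition lsub (e1 e2 : lin) : lin := ladd e1 (lscale (-1) e2).
Definition lzero : lin := fun _ _ => 0.

(* E[B_{a,k} B_{b,l}^*] for base variables; vV k, vV' k are the variances *)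
(* of V_{N_k}, V'_{N_k}.  The cross term E[W_k N_k^*] never enters any     *)
(* quantity of the theorem; it is fixed as E[W_k Z_k^*] E[Z_k N_k^*].       *)
Definition base_cov (P : 'I_3 -> R) (g : genie) (vV vV' : 'I_3 -> R)
    (a : 'I_6) (k : 'I_3) (b : 'I_6) (l : 'I_3) : R[i] :=
  if k != l then 0 else
  if (a == kX) && (b == kX) then rc (P k) else
  if (a == kZ) && (b == kZ) then 1 else
  if (a == kW) && (b == kW) then rc (sW g k ^+ 2) else
  if (a == kN) && (b == kN) then rc (sN g k ^+ 2) else
  if (a == kV) && (b == kV) then rc (vV k) else
  if (a == kV') && (b == kV') then rc (vV' k) else
  if (a == kZ) && (b == kW) then rW g k * rc (sW g k) else
  if (a == kW) && (b == kZ) then conjc (rW g k) * rc (sW g k) else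
  if (a == kZ) && (b == kN) then rN g k * rc (sN g k) else
  if (a == kN) && (b == kZ) then conjc (rN g k) * rc (sN g k) else
  if (a == kW) && (b == kN) then
    conjc (rW g k) * rc (sW g k) * rN g k * rc (sN g k) else
  if (a == kN) && (b == kW) then
    rW g k * rc (sW g k) * conjc (rN g k) * rc (sN g k) else
  0.

Section Cov.
Variables (P : 'I_3 -> R) (g : genie) (vV vV' : 'I_3 -> R).

Definition cov (e1 e2 : lin) : R[i] :=
  \sum_(a < 6) \sum_(k < 3) \sum_(b < 6) \sum_(l < 3)
    e1 a k * base_cov P g vV vV' a k b l * conjc (e2 b l).

Definition var (e : lin) : R := complex.Re (cov e e).

Definition condvar (e1 e2 : lin) : R := var e1 - sqn (cov e1 e2) / var e2.

Definition gdet (s : seq lin) : R :=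
  complex.Re (\det (\matrix_(i < size s, j < size s)
                      cov (nth lzero s i) (nth lzero s j))).

(* mutual information I(A;B|C) (base 2) of jointly circularly symmetric     *)
(* complex Gaussian vectors A, B, C: h(A|C) - h(A|B,C) with                 *)
(* h(A|C) = log det(pi e K_{A|C}) and det K_{A|C} = det K_{A,C} / det K_C.   *)
Definition gmi (A B C : seq lin) : R :=
  log2 ((gdet (A ++ C) * gdet (B ++ C)) / (gdet C * gdet (A ++ B ++ C))).

End Cov.

Section Bound.
Variables (h : 'I_3 -> 'I_3 -> R[i]) (P : 'I_3 -> R) (g : genie).

Definition X k := bv kX k.
Definition Z k := bv kZ k.
Definition W k := bv kW k.
Definition N k := bv kN k.

Definition Y k := ladd (X k)
  (ladd (\big[ladd/lzero]_(j < 3 | j != k) lscale (h k j) (X j)) (Z k)).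
Definition U k :=
  ladd (\big[ladd/lzero]_(j < 3 | j != k) lscale (h k j) (X j)) (W k).
Definition S1 := ladd (ladd (lscale (h u3 u1) (X u1)) (lscale (h u3 u2) (X u2))) (N u1).
Definition S2 := ladd (ladd (lscale (h u1 u2) (X u2)) (lscale (h u1 u3) (X u3))) (N u2).
Definition S3 := ladd (ladd (lscale (h u2 u3) (X u3)) (lscale (h u2 u1) (X u1))) (N u3).

(* covariance without the V variables (they do not enter below) *)
Definition cv0 := condvar P g (fun _ => 0) (fun _ => 0).
Definition var0 := var P g (fun _ => 0) (fun _ => 0).

Definition sZW k := var0 (lsub (Z k) (W k)).
Definition sVW k := cv0 (W k) (lsub (Z k) (W k)).

Definition sVN1 := cv0 (N u1) (lsub (Z u1) (lscale (h u1 u2 / h u3 u2) (N u1))).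
Definition sVN2 := cv0 (N u2) (lsub (Z u2) (lscale (h u2 u3 / h u1 u3) (N u2))).
Definition sVN3 := cv0 (N u3) (lsub (Z u3) (lscale (h u3 u1 / h u2 u1) (N u3))).
Definition sVN'1 := cv0 (Z u1) (lsub (N u1) (lscale (h u3 u2 / h u1 u2) (Z u1))).
Definition sVN'2 := cv0 (Z u2) (lsub (N u2) (lscale (h u1 u3 / h u2 u3) (Z u2))).
Definition sVN'3 := cv0 (Z u3) (lsub (N u3) (lscale (h u2 u1 / h u3 u1) (Z u3))).

Definition vVN (k : 'I_3) : R :=
  if k == u1 then sVN1 else if k == u2 then sVN2 else sVN3.
Definition vVN' (k : 'I_3) : R :=
  if k == u1 then sVN'1 else if k == u2 then sVN'2 else sVN'3.

Definition I (A B C : seq lin) : R := gmi P g vVN vVN' A B C.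

Definition tVN1 := lscale (rc (Num.sqrt ((sqn (h u3 u2))^-1 - (sVN1)^-1 * sZW u2))) (bv kV u1).
Definition tVN2 := lscale (rc (Num.sqrt ((sqn (h u1 u3))^-1 - (sVN2)^-1 * sZW u3))) (bv kV u2).
Definition tVN3 := lscale (rc (Num.sqrt ((sqn (h u2 u1))^-1 - (sVN3)^-1 * sZW u1))) (bv kV u3).
Definition tVN'1 := lscale (rc (Num.sqrt ((sqn (h u1 u2))^-1 - (sVN'1)^-1 * sZW u2))) (bv kV' u1).
Definition tVN'2 := lscale (rc (Num.sqrt ((sqn (h u2 u3))^-1 - (sVN'2)^-1 * sZW u3))) (bv kV' u2).
Definition tVN'3 := lscale (rc (Num.sqrt ((sqn (h u3 u1))^-1 - (sVN'3)^-1 * sZW u1))) (bv kV' u3).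

Definition boundA : R := 3^-1 * (
    I [:: X u1] [:: Y u1] [::] + I [:: X u2] [:: Y u2; S2] [:: X u1]
  + I [:: X u3] [:: Y u3] [:: U u3]
  + I [:: X u2] [:: Y u2] [::] + I [:: X u3] [:: Y u3; S3] [:: X u2]
  + I [:: X u1] [:: Y u1] [:: U u1]
  + I [:: X u3] [:: Y u3] [::] + I [:: X u1] [:: Y u1; S1] [:: X u3]
  + I [:: X u2] [:: Y u2] [:: U u2]).

Definition boundI0 : R := 3^-1 * (
    I [:: U u1] [:: ladd (Y u1) tVN3] [::]
  + I [:: U u2] [:: ladd (Y u2) tVN1] [::]
  + I [:: U u3] [:: ladd (Y u3) tVN2] [::]).

Definition boundI1 : R := 3^-1 * (
    I [:: U u1] [:: ladd (Y u1) tVN'3] [::]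
  + I [:: U u2] [:: ladd (Y u2) tVN'1] [::]
  + I [:: U u3] [:: ladd (Y u3) tVN'2] [::]).

(* Standing assumptions on the genie noises (context), together with the     *)
(* non-degeneracy needed for sigma^2_{V_{W_k}} to be defined (sigma^2_B > 0). *)
Definition genie_ok : Prop :=
  forall k, [/\ 0 <= sW g k <= 1, 0 <= sN g k <= 1,
               sqn (rW g k) <= 1, sqn (rN g k) <= 1 & 0 < sZW k].

(* Conditions of part (a), including the presuppositions of the defining   *)
(* expressions (nonzero cross gains inverted, positive conditioning variances). *)
Definition condA : Prop :=
  [/\ h u3 u2 != 0, h u1 u3 != 0, h u2 u1 != 0,
      [/\ 0 < var0 (lsub (Z u1) (lscale (h u1 u2 / h u3 u2) (N u1))),
          0 < var0 (lsub (Z u2) (lscale (h u2 u3 / h u1 u3) (N u2))) &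
          0 < var0 (lsub (Z u3) (lscale (h u3 u1 / h u2 u1) (N u3)))] &
      [/\ sVW u1 >= sN g u2 ^+ 2 /\ sVN2 >= sqn (h u1 u3) * sZW u3,
          sVW u2 >= sN g u3 ^+ 2 /\ sVN3 >= sqn (h u2 u1) * sZW u1 &
          sVW u3 >= sN g u1 ^+ 2 /\ sVN1 >= sqn (h u3 u2) * sZW u2]].

Definition condB : Prop :=
  [/\ h u1 u2 != 0, h u2 u3 != 0, h u3 u1 != 0,
      [/\ 0 < var0 (lsub (N u1) (lscale (h u3 u2 / h u1 u2) (Z u1))),
          0 < var0 (lsub (N u2) (lscale (h u1 u3 / h u2 u3) (Z u2))) &
          0 < var0 (lsub (N u3) (lscale (h u2 u1 / h u3 u1) (Z u3)))] &
      [/\ sVW u1 >= sW g u1 ^+ 2 /\ sVN'2 >= sqn (h u2 u3) * sZW u3,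
          sVW u2 >= sW g u2 ^+ 2 /\ sVN'3 >= sqn (h u3 u1) * sZW u1 &
          sVW u3 >= sW g u3 ^+ 2 /\ sVN'1 >= sqn (h u1 u2) * sZW u2]].

End Bound.
End IC.

(* Main.v *)
Require Import Defs.
From HB Require Import structures.
From mathcomp Require Import all_boot all_order all_algebra.
From mathcomp Require Import all_classical all_reals all_analysis.
From mathcomp Require Import measurable_realfun.
From mathcomp Require Import complex.
From mathcomp Require Import fingroup perm.
From mathcomp Require Import ring lra.
Import Order.TTheory GRing.Theory Num.Theory.
Import numFieldNormedType.Exports.
Local Open Scope classical_set_scope.
Local Open Scope ring_scope.
Set Implicit Arguments.
Unset Strict Implicit.
Unset Printing Implicit Defensive.

(** Write J for the mutual information between the codewords and an observation of some of
    their linear combinations in Gaussian noise.  For every user k, Fano's inequality bounds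
    n R_k three times: from Y_k, from (Y_k, U_k), and, given X_(k-1), from (Y_k, S_k).
    The nine bounds regroup cyclically into
      J(Y_k), J(Y_k, U_k) - J(X_k + noise) - J(I_k + noise),
      J(Y_(k+1), S_(k+1) | X_k) - J(I_k + noise),      I_k = interference at receiver k,
    and the hypotheses on the genie are used only to compare noise levels.  Each of these is
    at most its value for Gaussian inputs, and those values add up to 3A exactly; as I_0 and
    I_1 are nonnegative, A + I_0 and A + I_1 follow.

    The first and third brackets grow along the signal-to-noise ratio at a rate given by a
    minimum mean square error, which a linear estimator bounds.  In the second one X_k and I_k
    are independent but their noises are correlated: moving along r X_k, r I_k with the total
    powers kept fixed, the derivative of the defect is a quadratic form in the scores and
    conditional means, and its sign follows from their Gram relations. *)

(** J is a functional of a finite family of vectors: [minfo] averages the log-likelihood ratio of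
    shifted Gaussians, so no differential entropy occurs, and rotating a family into an orthogonal
    copy shows that only its Gram matrix matters. Genie correlations thus leave the probability
    theory: each pair of observations is replaced by a whitened one with independent unit noises,
    and a change of genie coordinates becomes an identity between Hermitian forms in the
    coefficients. Knowing a codeword translates the family, so conditioning on it deletes a
    coefficient.

    The obstacle is the joint term in (Y_k, U_k). Y_k - U_k and U_k show X_k and I_k separately, but
    in the noises Z_k - W_k and W_k, whose covariance c is in general not zero, so the two
    informations do not simply add up. The path therefore keeps c fixed along with both received
    powers: in the Gaussian value only the noise determinant and the two noise variances move.
    Codewords are centred first, because independence makes mixed moments vanish only for centred
    signals. *)

(** * Measures with a density *)

Section Density.
Local Open Scope ereal_scope.
Context d (T : measurableType d) (R : realType).
Variables (mu : {measure set T -> \bar R}) (f : T -> R).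
Hypothesis mf : measurable_fun setT f.
Hypothesis f0 : forall x, (0 <= f x)%R.

(** The two proofs are arguments so that the measure structure can be attached to the name. *)
Definition density of measurable_fun setT f & (forall x, (0 <= f x)%R) :=
  fun A : set T => \int[mu]_(x in A) (f x)%:E.

Let dens := density mf f0.

Let density0 : dens set0 = 0.
Proof. by rewrite /dens /density integral_set0. Qed.

Let density_ge0 A : 0 <= dens A.
Proof. by apply: integral_ge0 => x _; rewrite lee_fin. Qed.

Let density_sigma_additive : semi_sigma_additive dens.
Proof.
move=> F mF tF mUF; rewrite /dens /density ge0_integral_bigcup//=.
- apply: is_cvg_ereal_nneg_natsum_cond => n _ _.
  by apply: integral_ge0 => x _; rewrite lee_fin.
- exact/measurable_EFinP/measurable_funTS.
- by move=> x _; rewrite lee_fin.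
Qed.

HB.instance Definition _ := isMeasure.Build _ _ _ (density mf f0)
  density0 density_ge0 density_sigma_additive.

Import HBNNSimple.

(** Both sides are limits along the simple approximations of [g]; on indicators the claim is the
    definition of [density]. *)
Lemma integral_density (g : T -> \bar R) :
  measurable_fun setT g -> (forall x, 0 <= g x) ->
  \int[density mf f0]_x g x = \int[mu]_x (g x * (f x)%:E).
Proof.
move=> mg g0; pose g_ := nnsfun_approx measurableT mg.
have mgf n : measurable_fun setT (fun x => (g_ n x)%:E * (f x)%:E).
  by apply: emeasurable_funM; exact/measurable_EFinP.
transitivity (limn (fun n => \int[density mf f0]_x (g_ n x)%:E)).
  rewrite -monotone_convergence//=.
  - by apply: eq_integral => ? _; apply/esym/cvg_lim => //; exact: cvg_nnsfun_approx.
  - by move=> n; exact/measurable_EFinP.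
  - by move=> n ? _; rewrite lee_fin.
  - by move=> ? _ ? ? mn; rewrite lee_fin; exact/lefP/nd_nnsfun_approx.
transitivity (limn (fun n => \int[mu]_x ((g_ n x)%:E * (f x)%:E))); last first.
  rewrite -monotone_convergence//=.
  - apply: eq_integral => x _; apply/cvg_lim => //.
    by apply: cvgeZr => //; exact: cvg_nnsfun_approx.
  - by move=> n ? _; rewrite mule_ge0 ?lee_fin.
  - move=> x _ m n mn; apply: lee_pmul => //; rewrite ?lee_fin//.
    exact/lefP/nd_nnsfun_approx.
apply/congr_lim/funext => n; rewrite integralT_nnsfun sintegralE.
under [RHS]eq_integral => x _.
  rewrite (fimfunE (g_ n)) -fsumEFin// ge0_mule_fsuml; last first.
    by move=> r; rewrite EFinM nnfun_muleindic_ge0.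
  over.
rewrite [RHS]ge0_integral_fsum//; last 2 first.
- move=> r; apply: emeasurable_funM; last exact/measurable_EFinP.
  by apply/measurable_EFinP/measurable_funM => //; exact: measurable_indic.
- by move=> r x _; apply: mule_ge0; rewrite ?lee_fin//; have := nnfun_muleindic_ge0 (g_ n) r x; rewrite -EFinM lee_fin.
apply: eq_fsbigr => r /set_mem [x _ xr].
have r0 : (0 <= r)%R by rewrite -xr.
transitivity (\int[mu]_x (r%:E * ((\1_(g_ n @^-1` [set r]) x)%:E * (f x)%:E)));
  last by apply: eq_integral => y _; rewrite EFinM muleA.
rewrite [RHS]ge0_integralZl//; last 2 first.
- apply: emeasurable_funM; apply/measurable_EFinP => //.
- by move=> ? _; rewrite mule_ge0 ?lee_fin ?indicE//.
congr (_ * _); rewrite -[LHS]/(\int[mu]_(y in g_ n @^-1` [set r]) (f y)%:E) [LHS]integral_mkcond.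
apply: eq_integral => y _; rewrite patchE indicE.
by case: (y \in _); rewrite ?mul1e ?mul0e.
Qed.

End Density.

(** * Translation invariance of Lebesgue integrals *)

Section Translation.
Context {R : realType}.
Local Notation lam := (@lebesgue_measure R).
Local Open Scope ereal_scope.

Lemma integral_lebesgue_shift (a : R) (f : R -> \bar R) :
  measurable_fun setT f -> (forall x, 0 <= f x) ->
  \int[lam]_x f (x + a)%R = \int[lam]_x f x.
Proof.
move=> mf f0.
pose sh : measurableTypeR R -> measurableTypeR R := fun x => (x + a)%R.
have msh : measurable_fun setT sh by exact: measurable_funD.
pose mshm := isMeasurableFun.Build _ _ _ _ _ msh.
pose shm : {mfun _ >-> _} := HB.pack sh mshm.
transitivity (\int[pushforward lam shm]_x f x).
  by rewrite ge0_integral_pushforward.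
apply: eq_measure_integral => A mA _.
apply/esym; apply: lebesgue_measure_unique => // B [[x y] _ <-] /=.
rewrite /pushforward /=.
have -> : sh @^-1` `]x, y]%classic = `](x - a)%R, (y - a)%R]%classic.
  by apply/seteqP; split => z /=; rewrite !in_itv /= ltrBlDr lerBrDr.
rewrite !lebesgue_measure_itv /= !lte_fin ltrD2r.
by case: ifP => // _; rewrite -!EFinB; congr (_%:E); ring.
Qed.

End Translation.

(** * Gaussian vectors and the Cameron-Martin formula *)

Section GaussianTuple.
Context {R : realType}.
Local Open Scope ereal_scope.

(** Real and imaginary part of a unit complex noise have variance 1/2 each; with this value the
    likelihood ratio of a shift by a is exp(2 a x - a^2). *)
Definition hsd : R := Num.sqrt (2^-1).

Lemma hsd2 : (hsd ^+ 2 = 2^-1)%R.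
Proof. by rewrite sqr_sqrtr// invr_ge0. Qed.

Lemma hsd_neq0 : hsd != 0%R.
Proof. by rewrite gt_eqF// sqrtr_gt0 invr_gt0. Qed.

Lemma normal_pdf_shift (a x : R) :
  normal_pdf a hsd x = (expR (2 * a * x - a ^+ 2) * normal_pdf 0 hsd x)%R.
Proof.
rewrite !normal_pdfE ?hsd_neq0//= mulrCA; congr (_ * _)%R.
rewrite /normal_fun -expRD hsd2; congr expR.
by rewrite -mulr_natr mulVf//; field.
Qed.

Lemma integral_normal_prob (s : R) (f : R -> \bar R) :
  measurable_fun setT f -> (forall x, 0 <= f x) ->
  \int[normal_prob 0 s]_x f x =
  \int[lebesgue_measure]_x (f x * (normal_pdf 0 s x)%:E).
Proof.
move=> mf f0.
have mp := measurable_normal_pdf 0%R s.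
have p0 x : (0 <= normal_pdf 0 s x)%R by exact: normal_pdf_ge0.
have <- := @integral_density _ (measurableTypeR R) R lebesgue_measure _ mp p0 f mf f0.
by apply: eq_measure_integral => A mA _.
Qed.

Lemma cameron_martin1 (a : R) (B : set R) : measurable B ->
  \int[normal_prob 0 hsd]_(x in B) (expR (2 * a * x - a ^+ 2))%:E =
  normal_prob 0 hsd ((fun x : R => x + a)%R @^-1` B).
Proof.
move=> mB.
have me : measurable_fun setT (fun x : R => expR (2 * a * x - a ^+ 2)).
  by apply: measurableT_comp => //; apply: measurable_funB => //; exact: measurable_funM.
have mpa := @measurable_normal_pdf R a hsd.
have sE (A : set R) (f : R -> R) : \int[lebesgue_measure]_(x in A) (f x)%:E =
    \int[lebesgue_measure]_x ((\1_A x * f x)%R)%:E.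
  rewrite integral_mkcond; apply: eq_integral => x _.
  by rewrite patchE indicE; case: (x \in A); rewrite ?mul1r ?mul0r.
rewrite integral_mkcond integral_normal_prob; first last.
- by move=> x; rewrite patchE; case: ifP => // _; rewrite lee_fin expR_ge0.
- apply/(measurable_restrictT _ _).1 => //.
  exact/measurable_EFinP/measurable_funTS.
rewrite /normal_prob sE.
rewrite -(integral_lebesgue_shift a); first last.
- move=> x; rewrite mule_ge0// ?lee_fin ?normal_pdf_ge0// patchE.
  by case: ifP => // _; rewrite lee_fin expR_ge0.
- apply: emeasurable_funM; last first.
    have := measurable_normal_pdf 0%R hsd => /measurable_EFinP; apply.
  apply/(measurable_restrictT _ _).1 => //.
  exact/measurable_EFinP/measurable_funTS.
apply: eq_integral => x _; rewrite patchE indicE.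
have -> : (x \in (fun x : R => (x + a)%R) @^-1` B) = ((x + a)%R \in B) by [].
case: (_ \in B); last by rewrite mul0e mul0r.
rewrite -EFinM -normal_pdf_shift mul1r; congr (_%:E).
by rewrite !normal_pdfE ?hsd_neq0//= /normal_fun addrK subr0.
Qed.

Variable N : nat.
Implicit Types (a b : 'I_N -> R) (y : N.-tuple R).

Definition rect (B : 'I_N -> set R) : set (N.-tuple R) :=
  [set y | forall i, B i (tnth y i)].

Lemma measurable_rect B : (forall i, measurable (B i)) -> measurable (rect B).
Proof.
move=> mB; have -> : rect B = \big[setI/setT]_(i < N) ((@tnth N R)^~ i @^-1` B i).
  apply/seteqP; split => [y yB|y]; rewrite -bigcap_seq.
    by move=> i _; exact: yB.
  by move=> yB i; apply: yB; rewrite /= mem_index_enum.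
apply: bigsetI_measurable => i _.
by rewrite -[X in measurable X]setTI; exact: measurable_tnth.
Qed.

(** Rectangles are stable under intersection and generate the product sigma-algebra. *)
Lemma tuple_measure_unique (m1 m2 : {measure set (N.-tuple R) -> \bar R}) :
  (forall B, (forall i, measurable (B i)) -> m1 (rect B) = m2 (rect B)) ->
  m1 setT < +oo -> forall A, measurable A -> m1 A = m2 A.
Proof.
move=> m12 fin1 A mA.
pose G : set (set (N.-tuple R)) := [set rect B | B in [set B | forall i, measurable (B i)]].
have rectT : rect (fun=> setT) = setT by apply/seteqP; split.
apply: (g_sigma_algebra_measure_unique G _ (fun=> setT)) => //.
- by move=> _ [B mB <-]; exact: measurable_rect.
- by move=> _; exists (fun=> setT).
- by rewrite bigcup_const.
- move=> _ _ [B mB <-] [C mC <-]; exists (fun i => B i `&` C i).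
    by move=> i; exact: measurableI.
  apply/seteqP; split=> [y yBC|y [yB yC] i]; last by split; [exact: yB|exact: yC].
  by split=> i; have [] := yBC i.
- by move=> _ [B mB <-]; exact: m12.
have : g_sigma_preimage (fun i (x : N.-tuple R) => tnth x i) `<=` <<s G >>.
  apply: smallest_sub; first exact: smallest_sigma_algebra.
  rewrite -bigcup_seq => C [i _ [B mB <-]]; apply: sub_sigma_algebra.
  exists (fun j => if j == i then B else setT).
    by move=> j; case: ifP.
  apply/seteqP; split=> [y yB|y [_ yB] j]; last by case: eqP => // ->.
  by split=> //=; have := yB i; rewrite eqxx.
by apply.
Qed.

(** A property rather than a construction: the measure that satisfies it is obtained from the
    channel noise itself, in [noise_law]. *)
Definition gaussm (g : probability (N.-tuple R) R) : Prop :=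
  forall B : 'I_N -> set R, (forall i, measurable (B i)) ->
  g (rect B) = \big[*%E/1%E]_(i < N) normal_prob 0 hsd (B i).

Lemma gaussm_unique g1 g2 : gaussm g1 -> gaussm g2 ->
  forall A, measurable A -> g1 A = g2 A.
Proof.
move=> G1 G2; apply: tuple_measure_unique; last by rewrite (_ : _ setT = 1%:E) ?ltry//; exact: (probability_setT g1).
by move=> B mB; exact: etrans (G1 B mB) (esym (G2 B mB)).
Qed.

Definition tadd a y : N.-tuple R := [tuple (tnth y i + a i)%R | i < N].
Definition dot a b : R := (\sum_i a i * b i)%R.

Lemma tnth_tadd a y i : tnth (tadd a y) i = (tnth y i + a i)%R.
Proof. by rewrite tnth_mktuple. Qed.

Lemma measurable_tadd a : measurable_fun setT (tadd a).
Proof.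
apply/measurable_fun_tnthP => i; rewrite (_ : _ \o _ = fun y => (tnth y i + a i)%R).
  by apply: measurable_funD => //; exact: measurable_tnth.
by apply/funext => y /=; rewrite tnth_tadd.
Qed.

Lemma measurable_dot a : measurable_fun setT (fun y : N.-tuple R => dot a (tnth y)).
Proof.
apply: measurable_sum => i; apply: measurable_funM => //; exact: measurable_tnth.
Qed.

Variable g : probability (N.-tuple R) R.
Hypothesis gG : gaussm g.

(** Stated for one shift at a time because such shifts are closed under addition, which reduces the
    general formula to shifts of a single coordinate. *)
Definition shiftable a := forall F : N.-tuple R -> \bar R,
  measurable_fun setT F -> (forall y, 0 <= F y) ->
  \int[g]_y F (tadd a y) =
  \int[g]_y (F y * (expR (2 * dot a (tnth y) - dot a a))%:E).

Lemma dotDl a b c : dot (a \+ b)%R c = (dot a c + dot b c)%R.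
Proof. by rewrite /dot -big_split; apply: eq_bigr => i _ /=; rewrite mulrDl. Qed.

Lemma dotC a b : dot a b = dot b a.
Proof. by apply: eq_bigr => i _; rewrite mulrC. Qed.

Lemma dotDr a b c : dot a (b \+ c)%R = (dot a b + dot a c)%R.
Proof. by rewrite dotC dotDl !(dotC _ a). Qed.

Lemma taddD a b y : tadd (a \+ b)%R y = tadd a (tadd b y).
Proof. by apply: eq_from_tnth => i; rewrite !tnth_tadd /= -addrA (addrC (b i)). Qed.

Lemma tnth_taddE a y : tnth (tadd a y) = (tnth y \+ a)%R.
Proof. by apply/funext => i; rewrite tnth_tadd. Qed.

Lemma measurable_edot a c : measurable_fun setT
  (fun y : N.-tuple R => (expR (2 * dot a (tnth y) + c))).
Proof.
apply: measurableT_comp => //; apply: measurable_funD => //.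
by apply: measurable_funM => //; exact: measurable_dot.
Qed.

Lemma shiftableD a b : shiftable a -> shiftable b -> shiftable (a \+ b)%R.
Proof.
move=> sa sb F mF F0.
under eq_integral do rewrite taddD.
have -> : \int[g]_y F (tadd a (tadd b y)) =
    \int[g]_y (F (tadd a y) * (expR (2 * dot b (tnth y) - dot b b))%:E).
  have mFa := measurableT_comp mF (measurable_tadd a).
  exact: (sb (F \o tadd a) mFa (fun y => F0 _)).
transitivity (\int[g]_y (F (tadd a y) *
  (expR (2 * dot b (tnth (tadd a y)) - (dot b b + 2 * dot b a)))%:E)).
  apply: eq_integral => y _; rewrite tnth_taddE dotDr; congr (_ * (expR _)%:E); ring.
rewrite (sa (fun y => F y *
    (expR (2 * dot b (tnth y) - (dot b b + 2 * dot b a)))%:E)); first last.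
- by move=> y; rewrite mule_ge0 ?lee_fin ?expR_ge0.
- by apply: emeasurable_funM => //; apply/measurable_EFinP; exact: measurable_edot.
apply: eq_integral => y _; rewrite -muleA -EFinM -expRD !dotDl !dotDr (dotC b a).
by congr (_ * (expR _)%:E); ring.
Qed.

Lemma gaussm_slab (i : 'I_N) (B : 'I_N -> set R) (C : set R) :
  (forall j, measurable (B j)) -> measurable C -> B i = setT ->
  g ((fun y => tnth y i) @^-1` C `&` rect B) =
  (\big[*%E/1%E]_(j < N) normal_prob 0 hsd (B j)) * normal_prob 0 hsd C.
Proof.
move=> mB mC Bi.
have -> : (fun y => tnth y i) @^-1` C `&` rect B = rect (fun j => if j == i then C else B j).
  apply/seteqP; split=> [y [yC yB] j|y yCB].
    by case: eqP => [->|_].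
  split; first by have := yCB i; rewrite eqxx.
  by move=> j; have := yCB j; case: eqP => // -> _; rewrite Bi.
rewrite gG; last by move=> j; case: ifP.
rewrite (bigD1 i)//= eqxx [in RHS](bigD1 i)//= Bi probability_setT mul1e muleC.
by congr (_ * _); apply: eq_bigr => j /negbTE ->.
Qed.

(** It suffices to compare the two measures on rectangles. There the other coordinates contribute a
    constant factor [c], and the rest is the one-dimensional formula. *)
Lemma shiftable1 i (v : R) : shiftable (fun j => if j == i then v else 0%R).
Proof.
set a := fun j => _.
pose e (x : R) := expR (2 * v * x - v ^+ 2).
have me : measurable_fun setT e.
  by apply: measurableT_comp => //; apply: measurable_funB => //; exact: measurable_funM.
have e0 x : (0 <= e x)%R by exact: expR_ge0.
have edot y : expR (2 * dot a (tnth y) - dot a a) = e (tnth y i).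
  have da b : dot a b = (v * b i)%R.
    rewrite /dot (bigD1 i)//= /a eqxx big1 ?addr0// => j /negbTE ->.
    by rewrite mul0r.
  by rewrite /e !da /a eqxx mulrA expr2.
have mti := @measurable_tnth _ R N i.
have mei : measurable_fun setT (fun y : N.-tuple R => e (tnth y i)).
  exact: measurableT_comp me mti.
have ei0 y : (0 <= e (tnth y i))%R by [].
pose mtadd := isMeasurableFun.Build _ _ _ _ _ (measurable_tadd a).
pose ta : {mfun _ >-> _} := HB.pack (tadd a) mtadd.
pose mpi := @isMeasurableFun.Build _ _ _ (measurableTypeR R) _ mti.
pose pi : {mfun _ >-> _} := HB.pack ((fun y => tnth y i) : N.-tuple R -> measurableTypeR R) mpi.
move=> F mF F0.
transitivity (\int[pushforward g ta]_y F y).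
  by rewrite ge0_integral_pushforward.
rewrite (eq_measure_integral (density g mei ei0)).
  by rewrite (integral_density g mei ei0 mF F0); apply: eq_integral => y _; rewrite edot.
move=> A mA _; apply: tuple_measure_unique => //; last first.
  by rewrite (_ : _ setT = 1%:E) ?ltry//; exact: (probability_setT g).
move=> B mB; rewrite /pushforward /=.
(* [B'] frees coordinate [i], so that [gaussm_slab] can isolate it. *)
pose B' j := if j == i then setT else B j.
have mB' j : measurable (B' j) by rewrite /B'; case: ifP.
have mr : measurable_fun setT (\1_(rect B') : N.-tuple R -> R).
  by apply: measurable_indic; exact: measurable_rect.
have r0 (y : N.-tuple R) : (0 <= (\1_(rect B') : N.-tuple R -> R) y)%R by rewrite indicE.
pose c := fine (\big[*%E/1%E]_(j < N) normal_prob 0 hsd (B' j)).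
have cE : \big[*%E/1%E]_(j < N) normal_prob 0 hsd (B' j) = c%:E.
  rewrite fineK//; apply: (big_ind (fun x => x \is a fin_num)) => //.
    by move=> x y; exact: fin_numM.
  by move=> j _; apply: fin_num_measure; exact: mB'.
have c0 : (0 <= c)%R.
  rewrite fine_ge0//; apply: (big_ind (fun x : \bar R => 0 <= x)) => //.
  by move=> x y; exact: mule_ge0.
transitivity (c%:E * normal_prob 0 hsd ((fun x : R => x + v)%R @^-1` B i)).
  rewrite -cE -(gaussm_slab (i := i))//.
  - congr (g _); apply/seteqP; split=> [y yB|y [yv yB] j].
      split=> [/=|j]; first by have := yB i; rewrite tnth_tadd /a eqxx.
      by have := yB j; rewrite tnth_tadd /a /B'; case: eqP => // _; rewrite addr0.
    have := yB j; rewrite tnth_tadd /a /B'; case: eqP => [-> _ //|_].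
    by rewrite addr0.
  - rewrite -[X in measurable X]setTI.
    have : measurable_fun setT (fun x : R => (x + v)%R) by exact: measurable_funD.
    exact.
  - by rewrite /B' eqxx.
rewrite -cameron_martin1// /density.
pose G (x : R) := (\1_(B i) x * e x)%R.
have mG : measurable_fun setT G by apply: measurable_funM => //; exact: measurable_indic.
have G0 x : (0 <= G x)%R by rewrite mulr_ge0// indicE.
transitivity (\int[mscale (NngNum c0) (normal_prob 0 hsd)]_x (G x)%:E).
  rewrite ge0_integral_mscale//=; first last.
  - by move=> x _; rewrite lee_fin.
  - by apply/measurable_EFinP; exact: mG.
  congr (_ * _); rewrite integral_mkcond; apply: eq_integral => x _.
  by rewrite patchE /G indicE; case: (x \in _); rewrite ?mul1r ?mul0r.
transitivity (\int[pushforward (density g mr r0) pi]_x (G x)%:E).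
  apply: eq_measure_integral => C mC _.
  transitivity (c%:E * normal_prob 0 hsd C); first by [].
  rewrite -cE -(gaussm_slab (i := i))//; last by rewrite /B' eqxx.
  have mpC : measurable ((fun y : N.-tuple R => tnth y i) @^-1` C).
    by rewrite -[X in measurable X]setTI; exact: (mti measurableT C mC).
  transitivity (\int[g]_(x in (fun y : N.-tuple R => tnth y i) @^-1` C)
      (\1_(rect B') x)%:E); last first.
    by [].
  by rewrite (integral_indic g mpC (measurable_rect mB')) setIC.
rewrite ge0_integral_pushforward//; first last.
- by move=> x _; rewrite lee_fin.
- by apply/measurable_EFinP; exact: mG.
have mGi : measurable_fun setT (fun y : N.-tuple R => (G (tnth y i))%:E).
  by apply/measurable_EFinP; exact: (measurableT_comp mG mti).
have Gi0 (y : N.-tuple R) : 0 <= (G (tnth y i))%:E by rewrite lee_fin.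
transitivity (\int[density g mr r0]_y (G (tnth y i))%:E); first by [].
rewrite (integral_density g mr r0 mGi Gi0).
rewrite [RHS]integral_mkcond; apply: eq_integral => y _.
rewrite patchE /G /= -EFinM indicE indicE.
have -> : (y \in rect B) = (tnth y i \in B i) && (y \in rect B').
  apply/idP/andP => [/set_mem yB|[/set_mem yi /set_mem yB]].
    split; apply: mem_set; first exact: yB.
    by move=> j; rewrite /B'; case: ifP => // _; exact: yB.
  apply: mem_set => j; have := yB j; rewrite /B'; case: eqP => // -> _; exact: yi.
by case: (_ \in B i); case: (_ \in rect B'); rewrite ?mul1r ?mulr1 ?mul0r ?mulr0 ?mule1 ?mule0.
Qed.

Lemma cameron_martin a : shiftable a.
Proof.
have -> : a = \big[(fun a b : 'I_N -> R => a \+ b)%R/(fun=> 0%R)]_i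
    (fun j => if j == i then a i else 0%R).
  apply/funext => j.
  transitivity (\sum_i (if j == i then a i else 0))%R.
    by rewrite -big_mkcond (big_pred1 j).
  by elim/big_rec2: _ => // i x f _ ->.
apply: big_ind => [|b c|i _]; [|exact: shiftableD|exact: shiftable1].
move=> F mF F0; apply: eq_integral => y _.
have -> : tadd (fun=> 0%R) y = y by apply: eq_from_tnth => i; rewrite tnth_tadd addr0.
have d0 b : dot (fun=> 0%R) b = 0%R by rewrite /dot big1// => i _; rewrite mul0r.
by rewrite !d0 mulr0 subrr expR0 mule1.
Qed.

End GaussianTuple.

(** * Functions of exponential growth and their expectations *)

Section Gok.
Context {R : realType} {N : nat}.
Variable g : probability (N.-tuple R) R.
Implicit Types (f k : N.-tuple R -> R) (a b : 'I_N -> R) (y : N.-tuple R).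

Definition snorm y : R := \sum_i `|tnth y i|.

(** This growth class contains the likelihood ratios, is stable under sums, products and shifts, and
    consists of integrable functions, so later integrability questions reduce to closure lemmas. *)
Definition gok f := measurable_fun setT f /\
  exists C c : R, [/\ 0 <= C, 0 <= c & forall y, `|f y| <= C * expR (c * snorm y)].

Lemma snorm_ge0 y : 0 <= snorm y.
Proof. by apply: sumr_ge0. Qed.

Lemma measurable_snorm : measurable_fun setT snorm.
Proof.
apply: measurable_sum => i; apply: measurableT_comp => //; exact: measurable_tnth.
Qed.

Lemma gok_cst (r : R) : gok (fun=> r).
Proof.
split; first exact: measurable_cst.
by exists `|r|, 0; split=> // y; rewrite mul0r expR0 mulr1.
Qed.

Lemma gok_tnth i : gok (fun y => tnth y i).
Proof.
split; first exact: measurable_tnth.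
exists 1, 1; split=> // y; rewrite !mul1r.
apply: le_trans (_ : snorm y <= _).
  by rewrite /snorm (bigD1 i)//= lerDl sumr_ge0.
by apply: le_trans (expR_ge1Dx _); rewrite lerDr.
Qed.

Lemma gokD f k : gok f -> gok k -> gok (fun y => f y + k y).
Proof.
move=> [mf [C [c [C0 c0 fC]]]] [mk [D [d [D0 d0 kD]]]]; split; first exact: measurable_funD.
exists (C + D), (c + d); split; rewrite ?addr_ge0// => y.
apply: le_trans (ler_normD _ _) _; rewrite mulrDl lerD//.
  by apply: le_trans (fC y) _; rewrite ler_wpM2l// ler_expR ler_wpM2r ?snorm_ge0// lerDl.
by apply: le_trans (kD y) _; rewrite ler_wpM2l// ler_expR ler_wpM2r ?snorm_ge0// lerDr.
Qed.

Lemma gokM f k : gok f -> gok k -> gok (fun y => f y * k y).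
Proof.
move=> [mf [C [c [C0 c0 fC]]]] [mk [D [d [D0 d0 kD]]]]; split; first exact: measurable_funM.
exists (C * D), (c + d); split; rewrite ?mulr_ge0 ?addr_ge0// => y.
rewrite normrM mulrDl expRD mulrACA ler_pM//.
Qed.

Lemma gokN f : gok f -> gok (fun y => - f y).
Proof.
move=> [mf [C [c [C0 c0 fC]]]]; split; first exact: measurableT_comp.
by exists C, c; split=> // y; rewrite normrN.
Qed.

Lemma gokB f k : gok f -> gok k -> gok (fun y => f y - k y).
Proof. by move=> gf gk; apply: gokD => //; exact: gokN. Qed.

Lemma gokZ (r : R) f : gok f -> gok (fun y => r * f y).
Proof. by move=> gf; apply: gokM => //; exact: gok_cst. Qed.

Lemma gok_sum (I : Type) (s : seq I) (P : pred I) (F : I -> N.-tuple R -> R) :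
  (forall i, P i -> gok (F i)) -> gok (fun y => \sum_(i <- s | P i) F i y).
Proof.
move=> gF; elim: s => [|i s IH].
  under [X in gok X]funext do rewrite big_nil; exact: gok_cst.
have [Pi|nPi] := boolP (P i).
  by under [X in gok X]funext do rewrite big_cons Pi; apply: gokD => //; exact: gF.
by under [X in gok X]funext do rewrite big_cons (negbTE nPi).
Qed.

Lemma gok_le f k : measurable_fun setT f -> gok k -> (forall y, `|f y| <= k y) -> gok f.
Proof.
move=> mf [_ [C [c [C0 c0 kC]]]] fk; split=> //; exists C, c; split=> // y.
by apply: le_trans (fk y) _; apply: le_trans (ler_norm _) (kC y).
Qed.

Lemma dot_le a y : `|dot a (tnth y)| <= (\sum_i `|a i|) * snorm y.
Proof.
apply: le_trans (ler_norm_sum _ _ _) _; rewrite mulr_suml; apply: ler_sum => i _.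
by rewrite normrM ler_wpM2l// /snorm (bigD1 i)//= lerDl sumr_ge0.
Qed.

Lemma gok_dot a : gok (fun y => dot a (tnth y)).
Proof. by apply: gok_sum => i _; apply: gokZ; exact: gok_tnth. Qed.

Lemma gok_edot a (r : R) : gok (fun y => expR (2 * dot a (tnth y) + r)).
Proof.
split; first exact: measurable_edot.
exists (expR r), (2 * \sum_i `|a i|); split; rewrite ?expR_ge0 ?mulr_ge0 ?sumr_ge0// => y.
rewrite ger0_norm ?expR_ge0// expRD mulrC ler_wpM2l ?expR_ge0// ler_expR.
by rewrite -mulrA ler_wpM2l//; apply: le_trans (ler_norm _) (dot_le a y).
Qed.

Lemma snorm_tadd a y : snorm (tadd a y) <= snorm y + \sum_i `|a i|.
Proof.
by rewrite /snorm -big_split; apply: ler_sum => i _; rewrite tnth_tadd ler_normD.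
Qed.

Lemma gok_tadd a f : gok f -> gok (fun y => f (tadd a y)).
Proof.
move=> [mf [C [c [C0 c0 fC]]]]; split.
  exact: (measurableT_comp mf (measurable_tadd a)).
exists (C * expR (c * \sum_i `|a i|)), c; split; rewrite ?mulr_ge0 ?expR_ge0// => y.
apply: le_trans (fC _) _; rewrite -mulrA ler_wpM2l// -expRD ler_expR -mulrDr.
by rewrite ler_wpM2l// addrC snorm_tadd.
Qed.

Lemma gok_esnorm (C c : R) : 0 <= C -> 0 <= c -> gok (fun y => C * expR (c * snorm y)).
Proof.
move=> C0 c0; split.
  apply: measurable_funM => //; apply: measurableT_comp => //.
  by apply: measurable_funM => //; exact: measurable_snorm.
by exists C, c; split=> // y; rewrite ger0_norm// mulr_ge0 ?expR_ge0.
Qed.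

Hypothesis gG : gaussm g.

Lemma integral_edot a (r : R) :
  (\int[g]_y (expR (2 * dot a (tnth y) + r))%:E = (expR (dot a a + r))%:E)%E.
Proof.
have h0 : (0 <= (expR (dot a a + r))%:E)%E by rewrite lee_fin expR_ge0.
have := cameron_martin gG a (measurable_cst (expR (dot a a + r))%:E) (fun=> h0).
rewrite integral_cst//= probability_setT mule1 => ->.
by apply: eq_integral => y _; rewrite -EFinM -expRD; congr (expR _)%:E; ring.
Qed.

(** Each factor exp(c |y_i|) is at most exp(c y_i) + exp(- c y_i); expanding the product gives one
    exponential of a linear form per sign pattern, each with a known expectation. *)
Lemma esnorm_le (c : R) y : 0 <= c ->
  expR (c * snorm y) <= \sum_(s : {ffun 'I_N -> bool})
     expR (2 * dot (fun i => (if s i then c else - c) / 2) (tnth y) + 0).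
Proof.
move=> c0.
have -> : \sum_(s : {ffun 'I_N -> bool})
     expR (2 * dot (fun i => (if s i then c else - c) / 2) (tnth y) + 0) =
   \prod_i \sum_(b : bool) expR ((if b then c else - c) * tnth y i).
  rewrite bigA_distr_bigA; apply: eq_bigr => s _; rewrite addr0 /dot mulr_sumr.
  rewrite -expR_sum; congr expR; apply: eq_bigr => i _; by case: (s i); field.
rewrite /snorm mulr_sumr expR_sum; apply: ler_prod => i _.
rewrite expR_ge0/= big_bool/=; case: (lerP 0 (tnth y i)) => yi.
  by rewrite ger0_norm// lerDl expR_ge0.
by rewrite ltr0_norm// mulrN mulNr lerDr expR_ge0.
Qed.

Lemma gok_integrable f : gok f -> g.-integrable setT (EFin \o f).
Proof.
move=> [mf [C [c [C0 c0 fC]]]].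
pose k y := C * \sum_(s : {ffun 'I_N -> bool})
     expR (2 * dot (fun i => (if s i then c else - c) / 2) (tnth y) + 0).
have gk : measurable_fun setT k.
  by apply: measurable_funM => //; apply: measurable_sum => s; exact: measurable_edot.
apply: (@le_integrable _ _ _ _ _ _ _ (EFin \o k)) => //.
- exact/measurable_EFinP.
- move=> y _ /=; rewrite lee_fin; apply: le_trans (fC y) _.
  by apply: le_trans (ler_norm _); rewrite ler_wpM2l// esnorm_le.
rewrite (_ : EFin \o k = fun y => C%:E * (\sum_(s : {ffun 'I_N -> bool})
     expR (2 * dot (fun i => (if s i then c else - c) / 2) (tnth y) + 0))%:E)%E; last first.
  by apply/funext => y /=; rewrite EFinM.
apply: integrableZl => //.
under eq_fun do rewrite -sumEFin.
apply: integrable_sum => // s _.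
apply/integrableP; split; first by apply/measurable_EFinP; exact: measurable_edot.
under eq_integral do rewrite /= ger0_norm ?expR_ge0//.
by rewrite integral_edot ltry.
Qed.

Definition Ex f : R := (\int[g]_y f y)%R.

Lemma eq_Ex f k : f =1 k -> Ex f = Ex k.
Proof. by move=> /funext ->. Qed.

Lemma Ex_cst (r : R) : Ex (fun=> r) = r.
Proof. by rewrite /Ex Rintegral_cst//= probability_setT mulr1. Qed.

Lemma ExD f k : gok f -> gok k -> Ex (fun y => f y + k y) = Ex f + Ex k.
Proof. by move=> gf gk; rewrite /Ex RintegralD//; exact: gok_integrable. Qed.

Lemma ExB f k : gok f -> gok k -> Ex (fun y => f y - k y) = Ex f - Ex k.
Proof. by move=> gf gk; rewrite /Ex RintegralB//; exact: gok_integrable. Qed.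

Lemma ExZ (r : R) f : gok f -> Ex (fun y => r * f y) = r * Ex f.
Proof. by move=> gf; rewrite /Ex RintegralZl//; exact: gok_integrable. Qed.

Lemma Ex_sum (I : Type) (s : seq I) (P : pred I) (F : I -> N.-tuple R -> R) :
  (forall i, gok (F i)) ->
  Ex (fun y => \sum_(i <- s | P i) F i y) = \sum_(i <- s | P i) Ex (F i).
Proof.
move=> gF; elim: s => [|i s IH].
  by rewrite big_nil -[RHS](Ex_cst 0); apply: eq_Ex => y; rewrite big_nil.
rewrite big_cons -IH; case: ifP => Pi.
  rewrite -ExD//; last by apply: gok_sum => j _; exact: gF.
  by apply: eq_Ex => y; rewrite big_cons Pi.
by apply: eq_Ex => y; rewrite big_cons Pi.
Qed.

Lemma Ex_ge0 f : (forall y, 0 <= f y) -> 0 <= Ex f.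
Proof. by move=> f0; rewrite /Ex; apply: Rintegral_ge0. Qed.

Lemma Ex_le f k : gok f -> gok k -> (forall y, f y <= k y) -> Ex f <= Ex k.
Proof.
move=> gf gk fk; rewrite -subr_ge0 -ExB//; apply: Ex_ge0 => y.
by rewrite subr_ge0.
Qed.

Lemma Ex_tadd_ge0 a f : gok f -> (forall y, 0 <= f y) ->
  Ex (fun y => f (tadd a y)) = Ex (fun y => f y * expR (2 * dot a (tnth y) - dot a a)).
Proof.
move=> gf f0; rewrite /Ex /Rintegral.
have mf : measurable_fun setT (EFin \o f) by apply/measurable_EFinP; case: gf.
have h0 y : (0 <= (EFin \o f) y)%E by rewrite lee_fin.
congr fine; rewrite (cameron_martin gG a mf h0).
by apply: eq_integral => y _; rewrite EFinM.
Qed.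

(** The nonnegative case is applied to [h] and to [f + h], where [h] dominates the absolute value of
    [f]. *)
Lemma Ex_tadd a f : gok f ->
  Ex (fun y => f (tadd a y)) = Ex (fun y => f y * expR (2 * dot a (tnth y) - dot a a)).
Proof.
move=> gf; have [mf [C [c [C0 c0 fC]]]] := gf.
pose h y := C * expR (c * snorm y).
have gh : gok h by exact: gok_esnorm.
have h0 y : 0 <= h y by rewrite mulr_ge0 ?expR_ge0.
have fh0 y : 0 <= f y + h y.
  by rewrite -lerBlDr sub0r; have := fC y; rewrite ler_norml => /andP[].
have ge := gok_edot a (- dot a a).
have gfh := gokD gf gh.
have E1 := Ex_tadd_ge0 a gfh fh0.
have E2 := Ex_tadd_ge0 a gh h0.
rewrite (ExD (gok_tadd a gf) (gok_tadd a gh)) in E1.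
move: E1; rewrite E2.
under [X in _ = X -> _]eq_Ex do rewrite mulrDl.
by rewrite (ExD (gokM gf ge) (gokM gh ge)) => /addIr.
Qed.

End Gok.

(** * Differentiation under the expectation; Gaussian integration by parts *)

Section DerivEx.
Context {R : realType} {N : nat}.
Variable g : probability (N.-tuple R) R.
Hypothesis gG : gaussm g.
Implicit Types (f k : N.-tuple R -> R) (a b : 'I_N -> R) (y : N.-tuple R).

Lemma is_derive_Ex (F F' : R -> N.-tuple R -> R) (r u v C c : R) :
  u < r < v -> 0 <= C -> 0 <= c ->
  (forall t, u < t < v -> gok (F t)) ->
  (forall t y, u < t < v -> is_derive t 1 (F ^~ y) (F' t y)) ->
  (forall t y, u < t < v -> `|F' t y| <= C * expR (c * snorm y)) ->
  is_derive r 1 (fun t => Ex g (F t)) (Ex g (F' r)).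
Proof.
move=> ruv C0 c0 gF dF F'C.
pose G y := C * expR (c * snorm y).
have inuv t : `]u, v[%classic t -> u < t < v by rewrite /= in_itv.
have Ir : `]u, v[%classic r by rewrite /= in_itv.
have gG' : gok G by exact: gok_esnorm.
have G0 y : 0 <= G y by rewrite mulr_ge0 ?expR_ge0.
have intF t : `]u, v[%classic t -> g.-integrable setT (EFin \o F t).
  by move=> /inuv tuv; apply: gok_integrable => //; exact: gF.
have derF t y : `]u, v[%classic t -> setT y -> derivable (F ^~ y) t 1.
  by move=> /inuv tuv _; have [] := dF t y tuv.
have intG : g.-integrable setT (EFin \o G) by exact: gok_integrable.
have dE t y : `]u, v[%classic t -> partial1of2 F t y = F' t y.
  by move=> /inuv tuv; rewrite partial1of2E; have [_ ->] := dF t y tuv.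
have ubG t y : `]u, v[%classic t -> setT y -> `|partial1of2 F t y| <= G y.
  by move=> tuv _; rewrite dE//; apply: F'C; exact: inuv.
apply: DeriveDef.
  exact: (derivable_under_integral measurableT Ir intF derF G0 intG ubG).
rewrite -derive1E (differentiation_under_integral measurableT Ir intF derF G0 intG ubG).
by apply: eq_Rintegral => y _; exact: dE.
Qed.

(** Both sides are the derivative at t = 0 of the mean of f(y + t v): once f is differentiated, once
    the shift is first moved into the likelihood ratio. *)
Lemma gauss_ibp (v : 'I_N -> R) f f' : gok f -> gok f' ->
  (forall y (t : R), is_derive t 1 (fun s : R => f (tadd (fun i => s * v i) y))
                         (f' (tadd (fun i => t * v i) y))) ->
  Ex g f' = Ex g (fun y => 2 * dot v (tnth y) * f y).
Proof.
move=> gf gf' df.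
have tadd0 y : tadd (fun i => 0 * v i) y = y.
  by apply: eq_from_tnth => i; rewrite tnth_tadd mul0r addr0.
have dotZ t b : dot (fun i => t * v i) b = t * dot v b.
  by rewrite /dot mulr_sumr; apply: eq_bigr => i _; rewrite mulrA.
pose K := \sum_i `|v i|.
have K0 : 0 <= K by apply: sumr_ge0 => i _.
have KE t : \sum_i `|t * v i| = `|t| * K.
  by rewrite mulr_sumr; apply: eq_bigr => i _; rewrite normrM.
have i11 : (- 1 < 0 :> R) && (0 < 1 :> R) by rewrite ltrN10 ltr01.
have t1 (t : R) : -1 < t < 1 -> `|t| <= 1.
  by move=> /andP[t1 t2]; rewrite ler_norml !ltW.
have D1 : is_derive (0 : R) 1 (fun t => Ex g (fun y => f (tadd (fun i => t * v i) y)))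
    (Ex g (fun y => f' (tadd (fun i => 0 * v i) y))).
  have [_ [C [c [C0 c0 fC]]]] := gf'.
  apply: (is_derive_Ex (F := fun t y => f (tadd (fun i => t * v i) y))
     (F' := fun t y => f' (tadd (fun i => t * v i) y))
     (u := -1) (v := 1) (C := C * expR (c * K)) (c := c)) => //.
  - by rewrite mulr_ge0 ?expR_ge0.
  - by move=> t _; exact: gok_tadd.
  - move=> t y /t1 tt; apply: le_trans (fC _) _; rewrite -mulrA ler_wpM2l//.
    rewrite -expRD ler_expR -mulrDr ler_wpM2l// addrC.
    apply: le_trans (snorm_tadd _ _) _; rewrite lerD2l KE.
    by rewrite ler_piMl.
have D2 : is_derive (0 : R) 1
   (fun t => Ex g (fun y => f y * expR (2 * (t * dot v (tnth y)) - t * (t * dot v v))))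
   (Ex g (fun y => f y * ((2 * dot v (tnth y) - 2 * 0 * dot v v) *
      expR (2 * (0 * dot v (tnth y)) - 0 * (0 * dot v v))))).
  have [_ [C [c [C0 c0 fC]]]] := gf.
  have vv0 : 0 <= dot v v by apply: sumr_ge0 => i _; rewrite -expr2 sqr_ge0.
  apply: (is_derive_Ex
     (F := fun t y => f y * expR (2 * (t * dot v (tnth y)) - t * (t * dot v v)))
     (F' := fun t y => f y * ((2 * dot v (tnth y) - 2 * t * dot v v) *
        expR (2 * (t * dot v (tnth y)) - t * (t * dot v v))))
     (u := -1) (v := 1) (C := C * (2 * K + 2 * dot v v)) (c := c + 1 + 2 * K)) => //.
  - by rewrite mulr_ge0 ?addr_ge0 ?mulr_ge0.
  - by rewrite !addr_ge0 ?mulr_ge0.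
  - move=> t _; apply: gokM => //.
    have := gok_edot (fun i => t * v i) (- (t * (t * dot v v))).
    by under eq_fun do rewrite dotZ.
  - move=> t y _; apply: is_derive_eq; rewrite /GRing.scale /=; ring.
  - move=> t y /t1 tt; rewrite normrM.
    have vy := dot_le v y; rewrite -/K in vy.
    have S0 := snorm_ge0 y.
    have H1 : `|2 * dot v (tnth y) - 2 * t * dot v v| <= (2 * K + 2 * dot v v) * expR (snorm y).
      have e1 : 1 + snorm y <= expR (snorm y) by exact: expR_ge1Dx.
      apply: le_trans (_ : (2 * K + 2 * dot v v) * (1 + snorm y) <= _); last first.
        by rewrite ler_wpM2l// addr_ge0 ?mulr_ge0.
      apply: le_trans (ler_normB _ _) _; rewrite (mulrDl (2 * K)) !normrM (ger0_norm (ler0n R 2)).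
      apply: lerD; first by rewrite -!mulrA ler_wpM2l//; nra.
      rewrite -!mulrA ler_wpM2l// (ger0_norm vv0); nra.
    have H2 : expR (2 * (t * dot v (tnth y)) - t * (t * dot v v)) <= expR (2 * K * snorm y).
      rewrite ler_expR.
      have : t * dot v (tnth y) <= K * snorm y.
        apply: le_trans (ler_norm _) _; rewrite normrM.
        by apply: le_trans (_ : 1 * `|dot v (tnth y)| <= _); rewrite ?ler_wpM2r// mul1r.
      by nra.
    have H3 : `|(2 * dot v (tnth y) - 2 * t * dot v v) *
          expR (2 * (t * dot v (tnth y)) - t * (t * dot v v))| <=
        ((2 * K + 2 * dot v v) * expR (snorm y)) * expR (2 * K * snorm y).
      by rewrite normrM ler_pM ?normr_ge0// ger0_norm ?expR_ge0//; exact: H2.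
    apply: le_trans (ler_pM (normr_ge0 _) (normr_ge0 _) (fC y) H3) _.
    rewrite (_ : (c + 1 + 2 * K) * snorm y = c * snorm y + snorm y + 2 * K * snorm y); last by ring.
    by rewrite !expRD le_eqVlt; apply/orP; left; apply/eqP; ring.
have E12 : (fun t => Ex g (fun y => f (tadd (fun i => t * v i) y))) =
   (fun t => Ex g (fun y => f y * expR (2 * (t * dot v (tnth y)) - t * (t * dot v v)))).
  apply/funext => t; rewrite (Ex_tadd gG)//; apply: eq_Ex => y.
  by rewrite !dotZ (dotC v (fun i => t * v i)) dotZ.
rewrite E12 in D1.
have [_ d1] := D1; have [_ d2] := D2.
transitivity (Ex g (fun y => f' (tadd (fun i => 0 * v i) y))).
  by apply: eq_Ex => y; rewrite tadd0.
rewrite -d1 d2; apply: eq_Ex => y.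
by rewrite !(mul0r, mulr0, subr0, expR0, mulr1) mulrC.
Qed.

End DerivEx.

(** * Averages over a finite message set *)

Section Average.
Context {R : realType} {M : finType}.
Implicit Types f h : M -> R.

Definition avg f : R := (#|M|%:R)^-1 * \sum_m f m.

Lemma eq_avg f h : f =1 h -> avg f = avg h.
Proof. by move=> /funext ->. Qed.

Lemma avgD f h : avg (fun m => f m + h m) = avg f + avg h.
Proof. by rewrite /avg big_split mulrDr. Qed.

Lemma avgZ (r : R) f : avg (fun m => r * f m) = r * avg f.
Proof. by rewrite /avg -mulr_sumr mulrCA. Qed.

Lemma avgN f : avg (fun m => - f m) = - avg f.
Proof. by rewrite /avg sumrN mulrN. Qed.

Lemma avgB f h : avg (fun m => f m - h m) = avg f - avg h.
Proof. by rewrite avgD avgN. Qed.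

Lemma avg_sum (I : Type) (s : seq I) (P : pred I) (F : I -> M -> R) :
  avg (fun m => \sum_(i <- s | P i) F i m) = \sum_(i <- s | P i) avg (F i).
Proof. by rewrite /avg exchange_big -mulr_sumr. Qed.

Lemma avg_ge0 f : (forall m, 0 <= f m) -> 0 <= avg f.
Proof. by move=> f0; rewrite mulr_ge0 ?invr_ge0// sumr_ge0. Qed.

Lemma avg_le f h : (forall m, f m <= h m) -> avg f <= avg h.
Proof.
move=> fh; rewrite -subr_ge0 -avgB; apply: avg_ge0 => m; by rewrite subr_ge0.
Qed.

Hypothesis M0 : (0 < #|M|)%N.

Lemma avg_cst (r : R) : avg (fun=> r) = r.
Proof.
rewrite /avg sumr_const -[r *+ _]mulr_natl mulrA mulVf ?mul1r//.
by rewrite pnatr_eq0 -lt0n.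
Qed.

Lemma avg_gt0 f : (forall m, 0 < f m) -> 0 < avg f.
Proof.
move=> f0; rewrite mulr_gt0 ?invr_gt0 ?ltr0n//.
have /card_gt0P[m _] := M0.
by rewrite (bigD1 m)//= ltr_pwDl// sumr_ge0// => i _; exact: ltW.
Qed.

Lemma avg_norm_le f (r : R) : (forall m, `|f m| <= r) -> `|avg f| <= r.
Proof.
move=> fr; rewrite ler_norml; apply/andP; split.
  rewrite -[X in X <= _]avg_cst; apply: avg_le => m.
  by have := fr m; rewrite ler_norml => /andP[].
rewrite -[X in _ <= X]avg_cst; apply: avg_le => m.
by have := fr m; rewrite ler_norml => /andP[].
Qed.

End Average.

(** * Gaussian mixtures: likelihood, conditional mean, mutual information *)

Section Mixture.
Context {R : realType} {N : nat} {M : finType}.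
Hypothesis M0 : (0 < #|M|)%N.
Implicit Types (a b : M -> 'I_N -> R) (y : N.-tuple R) (m : M).

(** Densities relative to the noise law: [lik a m] is that of the output given message [m], [mixt a]
    that of the output. Then [pmean a f] is the conditional mean of [f] given the output. *)
Definition lik a m y : R := expR (2 * dot (a m) (tnth y) - dot (a m) (a m)).
Definition mixt a y : R := avg (fun m => lik a m y).
Definition pmean a (f : M -> R) y : R := avg (fun m => lik a m y * f m) / mixt a y.

Lemma lik_gt0 a m y : 0 < lik a m y. Proof. exact: expR_gt0. Qed.
Lemma mixt_gt0 a y : 0 < mixt a y.
Proof. by apply: avg_gt0 => // m; exact: lik_gt0. Qed.

Lemma gok_lik a m : gok (lik a m).
Proof. exact: gok_edot. Qed.

Lemma gok_avg (F : M -> N.-tuple R -> R) :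
  (forall m, gok (F m)) -> gok (fun y => avg (fun m => F m y)).
Proof. by move=> gF; apply: gokZ; apply: gok_sum => m _. Qed.

Lemma gok_mixt a : gok (mixt a).
Proof. by apply: gok_avg => m; exact: gok_lik. Qed.

Lemma avg_lik_pmean a f y : avg (fun m => lik a m y * f m) = mixt a y * pmean a f y.
Proof. by rewrite mulrC divfK// gt_eqF// mixt_gt0. Qed.

Lemma pmean_le a f h y : (forall m, f m <= h m) -> pmean a f y <= pmean a h y.
Proof.
move=> fh; rewrite ler_pM2r ?invr_gt0 ?mixt_gt0//; apply: avg_le => m.
by rewrite ler_wpM2l ?expR_ge0.
Qed.

Lemma pmean_cst a (r : R) y : pmean a (fun=> r) y = r.
Proof.
rewrite /pmean (_ : avg _ = r * mixt a y) ?mulfK ?gt_eqF ?mixt_gt0//.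
by rewrite -avgZ; apply: eq_avg => m; rewrite mulrC.
Qed.

Lemma pmean_norm_le a f y : `|pmean a f y| <= \sum_m `|f m|.
Proof.
have fle m : `|f m| <= \sum_m `|f m| by rewrite (bigD1 m)//= lerDl sumr_ge0.
rewrite ler_norml; apply/andP; split.
  rewrite -[X in X <= _](pmean_cst a _ y); apply: pmean_le => m.
  by have := fle m; rewrite ler_norml => /andP[].
rewrite -[X in _ <= X](pmean_cst a _ y); apply: pmean_le => m.
exact: le_trans (ler_norm _) (fle m).
Qed.

Lemma measurable_mixtV a : measurable_fun setT (fun y => (mixt a y)^-1).
Proof.
have -> : (fun y => (mixt a y)^-1) = (fun y => expR (- ln (mixt a y))).
  by apply/funext => y; rewrite expRN lnK// posrE mixt_gt0.
apply: measurableT_comp => //; apply: measurableT_comp => //.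
by apply: measurableT_comp => //; case: (gok_mixt a).
Qed.

Lemma gok_pmean a f : gok (pmean a f).
Proof.
apply: (gok_le _ (gok_cst (\sum_m `|f m|))); last exact: pmean_norm_le.
apply: measurable_funM; last exact: measurable_mixtV.
by have [] := gok_avg (fun m => gokM (gok_lik a m) (gok_cst (f m))).
Qed.

Lemma dot_snorm (K : R) (c : 'I_N -> R) y : (forall i, `|c i| <= K) ->
  `|dot c (tnth y)| <= K * snorm y.
Proof.
move=> cK; apply: le_trans (ler_norm_sum _ _ _) _; rewrite mulr_sumr.
by apply: ler_sum => i _; rewrite normrM ler_wpM2r.
Qed.

Lemma dot_bound (K : R) (c e : 'I_N -> R) : (forall i, `|c i| <= K) ->
  (forall i, `|e i| <= K) -> `|dot c e| <= N%:R * K ^+ 2.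
Proof.
move=> cK eK; apply: le_trans (ler_norm_sum _ _ _) _.
apply: le_trans (_ : \sum_(i < N) K ^+ 2 <= _).
  by apply: ler_sum => i _; rewrite normrM expr2 ler_pM.
by rewrite sumr_const card_ord mulr_natl.
Qed.

Lemma dot_ge0 (c : 'I_N -> R) : 0 <= dot c c.
Proof. by apply: sumr_ge0 => i _; rewrite -expr2 sqr_ge0. Qed.

Lemma lik_le (K : R) a m y : (forall i, `|a m i| <= K) ->
  expR (- (2 * K * snorm y + N%:R * K ^+ 2)) <= lik a m y <= expR (2 * K * snorm y).
Proof.
move=> aK; rewrite !ler_expR.
have := dot_snorm y aK; rewrite ler_norml => /andP[d1 d2].
have := dot_bound aK aK; rewrite ler_norml => /andP[_ d4].
have d3 := dot_ge0 (a m).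
by apply/andP; split; lra.
Qed.

Lemma ln_mixt_le (K : R) a y : (forall m i, `|a m i| <= K) ->
  `|ln (mixt a y)| <= 2 * K * snorm y + N%:R * K ^+ 2.
Proof.
move=> aK; have lk m := lik_le y (aK m).
have p0 := mixt_gt0 a y.
have l1 : expR (- (2 * K * snorm y + N%:R * K ^+ 2)) <= mixt a y.
  rewrite -[X in X <= _](avg_cst M0); apply: avg_le => m; by have /andP[] := lk m.
have l2 : mixt a y <= expR (2 * K * snorm y).
  rewrite -[X in _ <= X](avg_cst M0); apply: avg_le => m; by have /andP[] := lk m.
rewrite ler_norml; apply/andP; split.
  by rewrite -[X in X <= _]expRK ler_ln ?posrE ?expR_gt0.
apply: le_trans (_ : 2 * K * snorm y <= _).
  by rewrite -[X in _ <= X]expRK ler_ln ?posrE ?expR_gt0.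
by rewrite lerDl mulr_ge0 ?sqr_ge0.
Qed.

Lemma fam_bounded a : exists K : R, 0 <= K /\ forall m i, `|a m i| <= K.
Proof.
exists (\sum_m \sum_i `|a m i|); split.
  by apply: sumr_ge0 => m _; apply: sumr_ge0.
move=> m i; rewrite (bigD1 m)//= (bigD1 i)//= -addrA lerDl.
by rewrite addr_ge0 ?sumr_ge0// => j _; apply: sumr_ge0.
Qed.

Lemma gok_ln_mixt a : gok (fun y => ln (mixt a y)).
Proof.
have [K [K0 aK]] := fam_bounded a.
apply: (gok_le (k := fun y => 2 * K * snorm y + N%:R * K ^+ 2)).
- by apply: measurableT_comp => //; case: (gok_mixt a).
- apply: gokD; last exact: gok_cst.
  apply: gokZ; apply: gok_sum => i _.
  have [mt [C [c [C0 c0 fC]]]] := @gok_tnth R N i.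
  split; first exact: measurableT_comp.
  by exists C, c; split=> // y; rewrite normr_id.
- by move=> y; exact: ln_mixt_le.
Qed.

Variable g : probability (N.-tuple R) R.
Hypothesis gG : gaussm g.

(** Joint expectation over a uniform message and its noisy output; [EE_shift] gives the form in
    which the output is [a m] plus noise. *)
Definition EE a (F : M -> N.-tuple R -> R) : R :=
  Ex g (fun y => avg (fun m => lik a m y * F m y)).

(** Mutual information, in nats, of the message and [a m] plus noise: the joint mean of ln lik - ln
    mixt, whose first half is the mean squared norm of the signal. *)
Definition minfo a : R :=
  avg (fun m => dot (a m) (a m)) - Ex g (fun y => mixt a y * ln (mixt a y)).

Lemma gok_lavg a F : (forall m, gok (F m)) ->
  gok (fun y => avg (fun m => lik a m y * F m y)).
Proof. by move=> gF; apply: gok_avg => m; apply: gokM => //; exact: gok_lik. Qed.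

Lemma eq_EE a F G : (forall m y, F m y = G m y) -> EE a F = EE a G.
Proof. by move=> FG; apply: eq_Ex => y; apply: eq_avg => m; rewrite FG. Qed.

Lemma EED a F G : (forall m, gok (F m)) -> (forall m, gok (G m)) ->
  EE a (fun m y => F m y + G m y) = EE a F + EE a G.
Proof.
move=> gF gG'; rewrite -(ExD gG (gok_lavg a gF) (gok_lavg a gG')).
by apply: eq_Ex => y; rewrite -avgD; apply: eq_avg => m; rewrite mulrDr.
Qed.

Lemma EEZ a (r : R) F : (forall m, gok (F m)) ->
  EE a (fun m y => r * F m y) = r * EE a F.
Proof.
move=> gF; rewrite -(ExZ gG); last exact: gok_lavg.
by apply: eq_Ex => y; rewrite -avgZ; apply: eq_avg => m; rewrite mulrCA.
Qed.

Lemma EEN a F : (forall m, gok (F m)) -> EE a (fun m y => - F m y) = - EE a F.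
Proof.
move=> gF; rewrite -mulN1r -EEZ//; apply: eq_EE => m y; by rewrite mulN1r.
Qed.

Lemma EEB a F G : (forall m, gok (F m)) -> (forall m, gok (G m)) ->
  EE a (fun m y => F m y - G m y) = EE a F - EE a G.
Proof. by move=> gF gG'; rewrite EED ?EEN// => m; exact: gokN. Qed.

Lemma EE_sum a (I : Type) (s : seq I) (P : pred I) (F : I -> M -> N.-tuple R -> R) :
  (forall i m, gok (F i m)) ->
  EE a (fun m y => \sum_(i <- s | P i) F i m y) = \sum_(i <- s | P i) EE a (F i).
Proof.
move=> gF; rewrite /EE -(Ex_sum gG); last by move=> i; exact: gok_lavg.
by apply: eq_Ex => y; rewrite -avg_sum; apply: eq_avg => m; rewrite mulr_sumr.
Qed.

Lemma EE_ge0 a F : (forall m y, 0 <= F m y) -> 0 <= EE a F.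
Proof.
move=> F0; apply: Ex_ge0 => y; apply: avg_ge0 => m.
by rewrite mulr_ge0 ?expR_ge0.
Qed.

Lemma EE_shift a F : (forall m, gok (F m)) ->
  EE a F = avg (fun m => Ex g (fun y => F m (tadd (a m) y))).
Proof.
move=> gF; rewrite /EE /avg (ExZ gG); last first.
  by apply: gok_sum => m _; apply: gokM => //; exact: gok_lik.
rewrite (Ex_sum gG); last by move=> m; apply: gokM => //; exact: gok_lik.
congr (_ * _); apply: eq_bigr => m _; rewrite (Ex_tadd gG)//.
by apply: eq_Ex => y; rewrite mulrC.
Qed.

Lemma EE_msg a (f : M -> R) : EE a (fun m _ => f m) = avg f.
Proof.
rewrite EE_shift; last by move=> m; exact: gok_cst.
by apply: eq_avg => m; rewrite Ex_cst.
Qed.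

Lemma EE_obs a f : EE a (fun=> f) = Ex g (fun y => mixt a y * f y).
Proof.
apply: eq_Ex => y; rewrite mulrC -avgZ; apply: eq_avg => m; by rewrite mulrC.
Qed.

Lemma EE_tower a (f : M -> R) k :
  EE a (fun m y => f m * k y) = EE a (fun _ y => pmean a f y * k y).
Proof.
rewrite EE_obs; apply: eq_Ex => y.
rewrite mulrA -avg_lik_pmean mulrC -avgZ; apply: eq_avg => m; ring.
Qed.

(** Pythagoras: the error of the conditional mean is uncorrelated with every function of the
    output. *)
Lemma EE_mmse a (f : M -> R) k : gok k ->
  EE a (fun m y => (f m - pmean a f y) ^+ 2) <= EE a (fun m y => (f m - k y) ^+ 2).
Proof.
move=> gk; have gp := gok_pmean a f.
have gf m : gok (fun _ : N.-tuple R => f m) by exact: gok_cst.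
pose d y := pmean a f y - k y.
have gd : gok d by exact: gokB.
have E0 : EE a (fun m y => (f m - pmean a f y) * d y) = 0.
  under eq_EE do rewrite mulrBl.
  rewrite EEB; try by move=> m; exact: gokM.
  by rewrite EE_tower subrr.
have -> : EE a (fun m y => (f m - k y) ^+ 2) =
    EE a (fun m y => (f m - pmean a f y) ^+ 2 +
       (2 * ((f m - pmean a f y) * d y) + d y * d y)).
  by apply: eq_EE => m y; rewrite /d; ring.
have gfp m : gok (fun y => f m - pmean a f y) by exact: gokB.
have gq m : gok (fun y => (f m - pmean a f y) * d y) by exact: gokM.
have gq2 m : gok (fun y => 2 * ((f m - pmean a f y) * d y)) by exact: gokZ.
have gdd (m : M) : gok (fun y => d y * d y) by exact: gokM.
rewrite EED; last 2 first.
- by move=> m; under eq_fun do rewrite expr2; exact: gokM.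
- by move=> m; exact: (gokD (gq2 m) (gdd m)).
rewrite lerDl EED// EEZ// E0 mulr0 add0r; apply: EE_ge0 => m y.
by rewrite -expr2 sqr_ge0.
Qed.

(** The direction [v m] may depend on the message, since after the shift by [a m] the claim is
    [gauss_ibp] for each message separately. *)
Lemma mixt_ibp a (v : M -> 'I_N -> R) f (f' : M -> N.-tuple R -> R) :
  gok f -> (forall m, gok (f' m)) ->
  (forall m y (t : R), is_derive t 1 (fun s : R => f (tadd (fun i => s * v m i) y))
                         (f' m (tadd (fun i => t * v m i) y))) ->
  EE a (fun m y => 2 * dot (v m) (fun i => tnth y i - a m i) * f y) = EE a f'.
Proof.
move=> gf gf' df.
have gd m : gok (fun y => dot (v m) (fun i => tnth y i - a m i)).
  apply: gok_sum => i _; apply: gokZ; apply: gokB; [exact: gok_tnth|exact: gok_cst].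
rewrite !EE_shift//; last by move=> m; apply: gokM => //; exact: gokZ.
apply: eq_avg => m.
rewrite [RHS](gauss_ibp gG (v := v m) (f := fun y => f (tadd (a m) y)))//.
- apply: eq_Ex => y; congr (2 * _ * _); apply: eq_bigr => i _.
  by rewrite tnth_tadd addrK.
- exact: gok_tadd.
- exact: gok_tadd.
- move=> y t.
  have tE s : tadd (a m) (tadd (fun i => s * v m i) y) =
      tadd (fun i => s * v m i) (tadd (a m) y).
    by apply: eq_from_tnth => i; rewrite !tnth_tadd addrAC.
  by under eq_fun do rewrite tE; rewrite tE; exact: df.
Qed.

End Mixture.

Lemma is_derive_bigsum {R : realType} (I : Type) (s : seq I) (P : pred I)
    (F : I -> R -> R) (F' : I -> R) (r : R) :
  (forall i, P i -> is_derive r 1 (F i) (F' i)) ->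
  is_derive r 1 (fun t => \sum_(i <- s | P i) F i t) (\sum_(i <- s | P i) F' i).
Proof.
move=> dF; elim: s => [|i s IH].
  rewrite big_nil; under [X in is_derive _ _ X]eq_fun do rewrite big_nil.
  exact: is_derive_cst.
rewrite big_cons; under [X in is_derive _ _ X]eq_fun do rewrite big_cons.
by case: ifP => // Pi; have := dF i Pi => ?; apply: is_deriveD.
Qed.

(** * Derivative of the mutual information in the signal *)

Section InfoDerivative.
Context {R : realType} {N : nat} {M : finType}.
Hypothesis M0 : (0 < #|M|)%N.
Variable g : probability (N.-tuple R) R.
Hypothesis gG : gaussm g.
Implicit Types (a b : M -> 'I_N -> R) (y : N.-tuple R) (m : M).

Lemma is_derive_avg (F : M -> R -> R) (F' : M -> R) (r : R) :
  (forall m, is_derive r 1 (F m) (F' m)) ->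
  is_derive r 1 (fun t => avg (fun m => F m t)) (avg F').
Proof.
move=> dF; rewrite /avg.
have dS := is_derive_bigsum (index_enum M) (P := xpredT) (fun m _ => dF m).
by apply: is_derive_eq; rewrite /GRing.scale /=; ring.
Qed.

Lemma is_derive_dot (c e : R -> 'I_N -> R) (c' e' : 'I_N -> R) (r : R) :
  (forall i, is_derive r 1 (c ^~ i) (c' i)) ->
  (forall i, is_derive r 1 (e ^~ i) (e' i)) ->
  is_derive r 1 (fun t => dot (c t) (e t)) (dot (c r) e' + dot c' (e r)).
Proof.
move=> dc de; rewrite /dot -big_split/=; apply: is_derive_bigsum => i _.
have := dc i; have := de i => ? ?.
by apply: is_derive_eq; rewrite /GRing.scale /=; ring.
Qed.

Lemma is_derive_mixt_dir a (v : 'I_N -> R) y (t : R) :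
  is_derive t 1 (fun s : R => mixt a (tadd (fun i => s * v i) y))
    (mixt a (tadd (fun i => t * v i) y) *
     pmean a (fun l => 2 * dot (a l) v) (tadd (fun i => t * v i) y)).
Proof.
rewrite -avg_lik_pmean//; apply: is_derive_avg => m; rewrite /lik.
have dd : is_derive t 1 (fun s : R => dot (a m) (tnth (tadd (fun i => s * v i) y)))
    (dot (a m) v).
  apply: is_derive_bigsum => i _.
  under [X in is_derive _ _ X]eq_fun do rewrite tnth_tadd.
  by apply: is_derive_eq; rewrite /GRing.scale /=; ring.
by apply: is_derive_eq; rewrite /GRing.scale /=; ring.
Qed.

Lemma is_derive_ln_mixt_dir a (v : 'I_N -> R) y (t : R) :
  is_derive t 1 (fun s : R => ln (mixt a (tadd (fun i => s * v i) y)))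
     (pmean a (fun l => 2 * dot (a l) v) (tadd (fun i => t * v i) y)).
Proof.
have p0 : 0 < mixt a (tadd (fun i => t * v i) y) by exact: mixt_gt0.
have d1 := is_derive_mixt_dir a v y t.
have d2 := is_derive1_ln p0.
have := @is_derive1_comp _ (@ln R) (fun s : R => mixt a (tadd (fun i => s * v i) y)) _ _ _ d2 d1.
by rewrite /GRing.scale /= mulrA mulVf ?mul1r// gt_eqF.
Qed.

(** Differentiating the likelihoods produces the factor y - a(m) in the direction a'(m). Integration
    by parts turns it into the gradient of [ln mixt], which is a conditional mean. The bound [K]
    dominates the integrands uniformly in t. *)
Lemma is_derive_minfo (a a' : R -> M -> 'I_N -> R) (r u v K : R) :
  u < r < v -> 0 <= K ->
  (forall t m i, u < t < v -> is_derive t 1 (fun s => a s m i) (a' t m i)) ->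
  (forall t m i, u < t < v -> `|a t m i| <= K) ->
  (forall t m i, u < t < v -> `|a' t m i| <= K) ->
  is_derive r 1 (fun t => minfo g (a t))
    (2 * (avg (fun m => dot (a r m) (a' r m)) -
          EE g (a r) (fun m y => pmean (a r) (fun l => dot (a r l) (a' r m)) y))).
Proof.
move=> ruv K0 da aK a'K.
pose lp t m y := 2 * dot (a' t m) (tnth y) - 2 * dot (a t m) (a' t m).
pose F t y := mixt (a t) y * ln (mixt (a t) y).
pose F' t y := avg (fun m => lik (a t) m y * lp t m y) * (ln (mixt (a t) y) + 1).
have dp t y : u < t < v ->
    is_derive t 1 (fun s => mixt (a s) y) (avg (fun m => lik (a t) m y * lp t m y)).
  move=> tuv; apply: is_derive_avg => m; rewrite /lik.
  have d1 : is_derive t 1 (fun s => dot (a s m) (tnth y)) (dot (a' t m) (tnth y)).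
    have := is_derive_dot (c := fun s => a s m) (c' := a' t m) (e := fun=> tnth y)
      (e' := fun=> 0) (fun i => da t m i tuv) (fun i => is_derive_cst (tnth y i) t 1).
    by rewrite /(dot _ (fun=> 0)) big1 ?add0r// => i _; rewrite mulr0.
  have d2 := is_derive_dot (c := fun s => a s m) (c' := a' t m) (e := fun s => a s m)
     (e' := a' t m) (fun i => da t m i tuv) (fun i => da t m i tuv).
  by apply: is_derive_eq; rewrite /GRing.scale /lp /= (dotC (a' t m) (a t m)); ring.
have dF t y : u < t < v -> is_derive t 1 (F ^~ y) (F' t y).
  move=> tuv; have d1 := dp t y tuv.
  have p0 : 0 < mixt (a t) y by exact: mixt_gt0.
  have d2 := @is_derive1_comp _ (@ln R) (fun s => mixt (a s) y) _ _ _ (is_derive1_ln p0) d1.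
  rewrite /F /F'; apply: is_derive_eq.
  by rewrite /GRing.scale /=; field; rewrite gt_eqF.
have F'K t y : u < t < v ->
    `|F' t y| <= ((2 * K + 2 * (N%:R * K ^+ 2)) * (2 * K + N%:R * K ^+ 2 + 1)) *
       expR ((2 * K + 1 + 1) * snorm y).
  move=> tuv; have S0 := snorm_ge0 y.
  have NK : 0 <= N%:R * K ^+ 2 by rewrite mulr_ge0 ?sqr_ge0.
  have eS : 1 + snorm y <= expR (snorm y) by exact: expR_ge1Dx.
  have H1 m : `|lp t m y| <= (2 * K + 2 * (N%:R * K ^+ 2)) * expR (snorm y).
    apply: le_trans (_ : (2 * K + 2 * (N%:R * K ^+ 2)) * (1 + snorm y) <= _); last first.
      by rewrite ler_wpM2l// addr_ge0 ?mulr_ge0// mulr_ge0.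
    apply: le_trans (ler_normB _ _) _; rewrite !normrM (ger0_norm (ler0n R 2)).
    have := dot_snorm y (fun i => a'K t m i tuv).
    have := dot_bound (fun i => aK t m i tuv) (fun i => a'K t m i tuv).
    by nra.
  have H2 : `|avg (fun m => lik (a t) m y * lp t m y)| <=
      expR (2 * K * snorm y) * ((2 * K + 2 * (N%:R * K ^+ 2)) * expR (snorm y)).
    apply: avg_norm_le => // m; rewrite normrM ler_pM// ger0_norm ?expR_ge0//.
    by have /andP[] := lik_le y (fun i => aK t m i tuv).
  have H3 : `|ln (mixt (a t) y) + 1| <= (2 * K + N%:R * K ^+ 2 + 1) * expR (snorm y).
    apply: le_trans (_ : (2 * K + N%:R * K ^+ 2 + 1) * (1 + snorm y) <= _); last first.
      by rewrite ler_wpM2l// !addr_ge0 ?mulr_ge0.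
    apply: le_trans (ler_normD _ _) _; rewrite normr1.
    have := ln_mixt_le M0 y (fun m i => aK t m i tuv).
    by nra.
  rewrite /F' normrM; apply: le_trans (ler_pM (normr_ge0 _) (normr_ge0 _) H2 H3) _.
  rewrite (_ : (2 * K + 1 + 1) * snorm y = 2 * K * snorm y + snorm y + snorm y); last by ring.
  by rewrite !expRD le_eqVlt; apply/orP; left; apply/eqP; ring.
have C0 : 0 <= (2 * K + 2 * (N%:R * K ^+ 2)) * (2 * K + N%:R * K ^+ 2 + 1).
  by rewrite mulr_ge0 ?addr_ge0 ?mulr_ge0 ?sqr_ge0.
have c0 : 0 <= 2 * K + 1 + 1 by rewrite !addr_ge0 ?mulr_ge0.
have gF t : u < t < v -> gok (F t).
  by move=> _; apply: gokM; [exact: gok_mixt|exact: gok_ln_mixt].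
have D1 := is_derive_Ex gG ruv C0 c0 gF dF F'K.
have D2 : is_derive r 1 (fun t => avg (fun m => dot (a t m) (a t m)))
    (avg (fun m => 2 * dot (a r m) (a' r m))).
  apply: is_derive_avg => m.
  have := is_derive_dot (c := fun s => a s m) (c' := a' r m) (e := fun s => a s m)
     (e' := a' r m) (fun i => da r m i ruv) (fun i => da r m i ruv) => /=.
  by rewrite (dotC (a' r m)) => h; apply: is_derive_eq; ring.
have -> : 2 * (avg (fun m => dot (a r m) (a' r m)) -
          EE g (a r) (fun m y => pmean (a r) (fun l => dot (a r l) (a' r m)) y)) =
   avg (fun m => 2 * dot (a r m) (a' r m)) - Ex g (F' r).
  rewrite mulrBr -avgZ; congr (_ - _).
  rewrite -(EEZ gG); last by move=> m; exact: gok_pmean.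
  transitivity (EE g (a r) (fun m y => pmean (a r) (fun l => 2 * dot (a r l) (a' r m)) y)).
    apply: eq_EE => m y; rewrite /pmean mulrA -avgZ; congr (_ / _).
    by apply: eq_avg => l; rewrite mulrCA.
  (* The added 1 is the constant in the derivative of x ln x; the directional derivative removes
     it. *)
  have H1 m y (t : R) : is_derive t 1
      (fun s : R => ln (mixt (a r) (tadd (fun i => s * a' r m i) y)) + 1)
      (pmean (a r) (fun l => 2 * dot (a r l) (a' r m)) (tadd (fun i => t * a' r m i) y)).
    have d1 := is_derive_ln_mixt_dir (a r) (a' r m) y t.
    by apply: is_derive_eq; rewrite addr0.
  rewrite -(@mixt_ibp _ _ _ g gG (a r) (a' r) (fun y => ln (mixt (a r) y) + 1) _ _ _ H1); first last.
  - by move=> m; exact: gok_pmean.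
  - by apply: gokD; [exact: gok_ln_mixt|exact: gok_cst].
  apply: eq_Ex => y; rewrite /F' [RHS]mulrC -avgZ; apply: eq_avg => m.
  have -> : dot (a' r m) (fun i => tnth y i - a r m i) =
      dot (a' r m) (tnth y) - dot (a r m) (a' r m).
    by rewrite (dotC (a r m)) /dot -sumrB; apply: eq_bigr => i _; rewrite mulrBr.
  by rewrite /lp; ring.
exact: is_deriveB.
Qed.

End InfoDerivative.

(** * Paths of signals, invariances, and the error form of the slope *)

Section PathInfo.
Context {R : realType} {N : nat} {M : finType}.
Hypothesis M0 : (0 < #|M|)%N.
Variable g : probability (N.-tuple R) R.
Hypothesis gG : gaussm g.
Implicit Types (a b : M -> 'I_N -> R) (y : N.-tuple R) (m : M).

Definition dminfo a a' : R :=
  2 * (avg (fun m => dot (a m) (a' m)) -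
       EE g a (fun m y => pmean a (fun l => dot (a l) (a' m)) y)).

(** Continuity of signal and velocity at [r] yields an interval around [r] on which both are
    bounded, as [is_derive_minfo] requires. *)
Lemma is_derive_path (a a' : R -> M -> 'I_N -> R) (r p q : R) :
  p < r < q ->
  (forall t m i, p < t < q -> is_derive t 1 (fun s => a s m i) (a' t m i)) ->
  (forall m i, {for r, continuous (fun s => a' s m i)}) ->
  is_derive r 1 (fun t => minfo g (a t)) (dminfo (a r) (a' r)).
Proof.
move=> prq da ca'.
have ca m i : {for r, continuous (fun s => a s m i)}.
  apply: differentiable_continuous; apply/derivable1_diffP.
  by have [] := da r m i prq.
pose K := \sum_m \sum_i (`|a r m i| + `|a' r m i|) + 1.
have S0 : 0 <= \sum_m \sum_i (`|a r m i| + `|a' r m i|).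
  by apply: sumr_ge0 => m _; apply: sumr_ge0 => i _; rewrite addr_ge0.
have K0 : 0 <= K by rewrite addr_ge0.
have leK m i : `|a r m i| + `|a' r m i| + 1 <= K.
  rewrite lerD2r (bigD1 m)//= (bigD1 i)//= -addrA lerDl; apply: addr_ge0.
    by apply: sumr_ge0 => j _; rewrite addr_ge0.
  by apply: sumr_ge0 => j _; apply: sumr_ge0 => k _; rewrite addr_ge0.
have nearK (c : R -> M -> 'I_N -> R) :
    (forall m i, {for r, continuous (fun s => c s m i)}) ->
    (forall m i, `|c r m i| + 1 <= K) ->
    \forall t \near r, forall m i, `|c t m i| <= K.
  move=> cc cK.
  apply: (@filter_forall _ M (fun m t => forall i, `|c t m i| <= K) (nbhs r)) => m.
  apply: (@filter_forall _ 'I_N (fun i t => `|c t m i| <= K) (nbhs r)) => i.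
  have /cvgrPdist_le /(_ 1 ltr01) := cc m i; apply: filterS => t ht.
  apply: le_trans (cK m i).
  rewrite -[X in `|X|](subKr (c r m i)); apply: le_trans (ler_normB _ _) _.
  by rewrite lerD2l.
have /nbhs_ballP[e /= e0 ball_e] : \forall t \near r,
    (forall m i, `|a t m i| <= K) /\ (forall m i, `|a' t m i| <= K).
  by apply: filterI; apply: nearK => // m i; apply: le_trans (leK m i);
    rewrite lerD2r ?lerDl ?lerDr.
have /andP[pr rq] := prq.
pose u := Num.max p (r - e); pose v := Num.min q (r + e).
have uv : u < r < v.
  by rewrite /u /v gt_max lt_min pr rq ltrDl ltrBlDr ltrDl e0.
have uvpq t : u < t < v -> p < t < q.
  by rewrite /u /v gt_max lt_min => /andP[/andP[-> _] /andP[-> _]].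
have uvball t : u < t < v -> ball r e t.
  rewrite /u /v gt_max lt_min => /andP[/andP[_ h1] /andP[_ h2]].
  by rewrite /ball /= ltr_norml; apply/andP; split; lra.
apply: (is_derive_minfo M0 gG uv K0).
- by move=> t m i /uvpq; exact: da.
- by move=> t m i /uvball /ball_e [].
- by move=> t m i /uvball /ball_e [].
Qed.

Lemma ge0_derive_le (f f' : R -> R) (s t : R) : s <= t ->
  (forall x, s <= x <= t -> is_derive x 1 f (f' x)) ->
  (forall x, s < x < t -> 0 <= f' x) -> f s <= f t.
Proof.
rewrite le_eqVlt => /predU1P[->//|st] df f0.
have cf : {within `[s, t], continuous f}.
  apply: derivable_within_continuous => x; rewrite in_itv /= => xst.
  by have [] := df x xst.
have [] := MVT st _ cf (df := f').
  move=> x; rewrite in_itv /= => /andP[sx xt].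
  by apply: df; rewrite !ltW.
move=> c; rewrite in_itv /= => csr E.
by rewrite -subr_ge0 E mulr_ge0 ?f0// subr_ge0 ltW.
Qed.

Lemma cst_derive0 (f : R -> R) (s t : R) : s <= t ->
  (forall x, s <= x <= t -> is_derive x 1 f 0) -> f s = f t.
Proof.
move=> st df; apply/le_anti/andP; split.
  exact: (ge0_derive_le (f' := fun=> 0) st df).
rewrite -lerN2; apply: (ge0_derive_le (f := fun x => - f x) (f' := fun=> 0) st) => // x xst.
by have := df x xst => ?; apply: is_derive_eq; rewrite oppr0.
Qed.

Lemma EE_pmean a (f : M -> R) : EE g a (fun _ y => pmean a f y) = avg f.
Proof.
have := EE_tower M0 g a f (fun=> 1).
under eq_EE do rewrite mulr1.
rewrite EE_msg// => ->.
by apply: eq_EE => m y; rewrite mulr1.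
Qed.

(** The quarter turn cos t a + sin t b joins the families. Equal Gram matrices and mutual
    orthogonality make every velocity orthogonal to every point of the path, so the slope
    vanishes. *)
Lemma minfo_gram a b : (forall m l, dot (a m) (a l) = dot (b m) (b l)) ->
  (forall m l, dot (a m) (b l) = 0) -> minfo g a = minfo g b.
Proof.
move=> gab ab0.
pose c (t : R) m i := cos t * a m i + sin t * b m i.
pose c' (t : R) m i := - sin t * a m i + cos t * b m i.
have dc (t : R) m i : is_derive t 1 (fun s => c s m i) (c' t m i).
  by apply: is_derive_eq; rewrite /c' /GRing.scale /=; ring.
have cc' (t : R) m i : {for t, continuous (fun s => c' s m i)}.
  apply: differentiable_continuous; apply/derivable1_diffP.
  by apply: ex_derive.
have d0 t m l : dot (c t l) (c' t m) = 0.
  have -> : dot (c t l) (c' t m) = - (cos t * sin t) * dot (a l) (a m)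
     + cos t * cos t * dot (a l) (b m) - sin t * sin t * dot (a m) (b l)
     + sin t * cos t * dot (b l) (b m).
    rewrite /dot !mulr_sumr -big_split /= -sumrB -big_split /=.
    by apply: eq_bigr => i _; rewrite /c /c'; ring.
  by rewrite !ab0 gab; ring.
have D (t : R) : is_derive t 1 (fun s => minfo g (c s)) 0.
  have := @is_derive_path c c' t (t - 1) (t + 1) _ (fun s m i _ => dc s m i) (cc' t).
  have -> : dminfo (c t) (c' t) = 0.
    rewrite /dminfo.
    under eq_avg do rewrite d0.
    rewrite avg_cst// sub0r; under eq_EE => m y.
      have -> : pmean (c t) (fun l => dot (c t l) (c' t m)) y = 0.
        rewrite -[RHS](pmean_cst M0 (c t) 0 y); congr (_ / _).
        by apply: eq_avg => l; rewrite d0.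
      over.
    by rewrite EE_msg// avg_cst// oppr0 mulr0.
  by apply; rewrite ltrBlDr !ltrDl ltr01.
have pi0 : (0 : R) <= pi / 2 by rewrite divr_ge0// pi_ge0.
have := cst_derive0 pi0 (fun x _ => D x).
have -> : c 0 = a.
  by apply/funext => m; apply/funext => i; rewrite /c cos0 sin0 mul1r mul0r addr0.
have -> // : c (pi / 2) = b.
by apply/funext => m; apply/funext => i; rewrite /c cos_pihalf sin_pihalf mul1r mul0r add0r.
Qed.

(** For a velocity common to all messages the slope compares a mean with the mean of a conditional
    mean. *)
Lemma minfo_translate a (c : 'I_N -> R) : minfo g (fun m i => a m i + c i) = minfo g a.
Proof.
pose b (t : R) m i := a m i + t * c i.
have db (t : R) m i : is_derive t 1 (fun s => b s m i) (c i).
  by apply: is_derive_eq; rewrite /GRing.scale /=; ring.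
have D (t : R) : is_derive t 1 (fun s => minfo g (b s)) 0.
  have cc (m : M) i : {for t, continuous (fun _ : R => c i)} by exact: cvg_cst.
  have := @is_derive_path b (fun _ _ => c) t (t - 1) (t + 1) _ (fun s m i _ => db s m i)
     cc.
  rewrite /dminfo EE_pmean subrr mulr0.
  by apply; rewrite ltrBlDr !ltrDl ltr01.
have := cst_derive0 (@ler01 R) (fun x _ => D x).
have -> : b 0 = a by apply/funext => m; apply/funext => i; rewrite /b mul0r addr0.
move=> ->; congr minfo.
by apply/funext => m; apply/funext => i; rewrite /b mul1r.
Qed.

Definition err a (f : M -> R) m y : R := f m - pmean a f y.

Lemma gok_err a f m : gok (err a f m).
Proof. by apply: gokB; [exact: gok_cst|exact: gok_pmean]. Qed.

Lemma EE_err_obs a f k : gok k -> EE g a (fun m y => err a f m y * k y) = 0.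
Proof.
move=> gk; under eq_EE do rewrite /err mulrBl.
rewrite EEB//.
- by rewrite EE_tower// subrr.
- by move=> m; apply: gokM => //; exact: gok_cst.
- by move=> m; apply: gokM => //; exact: gok_pmean.
Qed.

(** Polarised I-MMSE relation: the errors are uncorrelated with functions of the output, which lets
    the conditional mean be subtracted from the velocity too. *)
Lemma dminfo_err a a' : dminfo a a' =
  2 * \sum_i EE g a (fun m y => err a (fun l => a l i) m y * err a (fun l => a' l i) m y).
Proof.
congr (2 * _).
have pE m y : pmean a (fun l => dot (a l) (a' m)) y =
    \sum_i pmean a (fun l => a l i) y * a' m i.
  rewrite /pmean /dot; under eq_avg do rewrite mulr_sumr.
  rewrite avg_sum mulr_suml; apply: eq_bigr => i _.
  rewrite [RHS]mulrAC; congr (_ / _); rewrite [RHS]mulrC -avgZ.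
  by apply: eq_avg => l; rewrite [RHS]mulrCA (mulrC (a' m i)).
under eq_EE do rewrite pE.
rewrite EE_sum//; last by move=> i m; apply: gokM; [exact: gok_pmean|exact: gok_cst].
rewrite /dot avg_sum -sumrB; apply: eq_bigr => i _.
have -> : EE g a (fun m y => err a (fun l => a l i) m y * err a (fun l => a' l i) m y) =
    EE g a (fun m y => err a (fun l => a l i) m y * a' m i -
                err a (fun l => a l i) m y * pmean a (fun l => a' l i) y).
  by apply: eq_EE => m y; rewrite -mulrBr.
rewrite EEB//; last 2 first.
- by move=> m; apply: gokM; [exact: gok_err|exact: gok_cst].
- by move=> m; apply: gokM; [exact: gok_err|exact: gok_pmean].
rewrite EE_err_obs; last exact: gok_pmean.
rewrite subr0 -[in LHS](EE_msg gG a).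
rewrite -EEB//; last 2 first.
- by move=> m; exact: gok_cst.
- by move=> m; apply: gokM; [exact: gok_pmean|exact: gok_cst].
by apply: eq_EE => m y; rewrite mulrBl.
Qed.

End PathInfo.

(** * Strengthening one observation in the presence of another *)

Section AddObservation.
Context {R : realType} {N : nat} {M : finType}.
Hypothesis M0 : (0 < #|M|)%N.
Variable g : probability (N.-tuple R) R.
Hypothesis gG : gaussm g.
Implicit Types (a b : M -> 'I_N -> R) (y : N.-tuple R) (m : M).

Lemma Ex_dot_sq (v : 'I_N -> R) (c : R) :
  Ex g (fun y => (c - dot v (tnth y)) ^+ 2) = c ^+ 2 + dot v v / 2.
Proof.
have gd : gok (fun y => dot v (tnth y)) by exact: gok_dot.
have g0 (r : R) : gok (fun _ : N.-tuple R => r) by exact: gok_cst.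
have E1 : Ex g (fun y => dot v (tnth y)) = 0.
  have := @gauss_ibp _ _ g gG v (fun=> 1) (fun=> 0) (g0 _) (g0 _)
    (fun y t => is_derive_cst (1 : R) t 1).
  rewrite Ex_cst; under eq_Ex do rewrite mulr1.
  by rewrite (ExZ gG)// => /esym/eqP; rewrite mulf_eq0 pnatr_eq0 /= => /eqP.
have E2 : Ex g (fun y => dot v (tnth y) * dot v (tnth y)) = dot v v / 2.
  have dd y (t : R) : is_derive t 1
      (fun s : R => dot v (tnth (tadd (fun i => s * v i) y))) (dot v v).
    apply: is_derive_bigsum => i _.
    under [X in is_derive _ _ X]eq_fun do rewrite tnth_tadd.
    by apply: is_derive_eq; rewrite /GRing.scale /=; ring.
  have := @gauss_ibp _ _ g gG v (fun y => dot v (tnth y)) (fun=> dot v v) gd (g0 _) dd.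
  rewrite Ex_cst; under eq_Ex do rewrite -mulrA.
  rewrite (ExZ gG); last exact: gokM.
  by move=> ->; rewrite mulrAC mulfV ?mul1r.
transitivity (Ex g (fun y => c ^+ 2 + (- (2 * c) * dot v (tnth y) +
    dot v (tnth y) * dot v (tnth y)))).
  by apply: eq_Ex => y; ring.
have gdd : gok (fun y => dot v (tnth y) * dot v (tnth y)) by exact: gokM.
have gcd : gok (fun y => - (2 * c) * dot v (tnth y)) by exact: gokZ.
rewrite (ExD gG (g0 _) (gokD gcd gdd)) (ExD gG gcd gdd) (ExZ gG _ gd) E1 E2.
by rewrite Ex_cst mulr0 add0r.
Qed.

Lemma pmeanZ a (r : R) (f : M -> R) y : pmean a (fun m => r * f m) y = r * pmean a f y.
Proof.
rewrite /pmean mulrA -avgZ; congr (_ / _).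
by apply: eq_avg => m; rewrite mulrCA.
Qed.

(** Coordinates in [D] carry [b] at amplitude r, the others carry [a], and [w] predicts [b] from the
    outputs off [D] with total squared error at most n s2. The slope in r is a minimum mean square
    error; a linear estimator bounds it by the slope of n ln(1 + r^2 s2). *)
Lemma minfo_add a b (D : {set 'I_N}) (w : 'I_N -> 'I_N -> R) (n s2 r0 r1 : R) :
  (forall m i, i \in D -> a m i = 0) -> (forall m i, i \notin D -> b m i = 0) ->
  (forall i j, i \in D -> j \in D -> w i j = 0) ->
  #|D|%:R = 2 * n -> 0 <= s2 ->
  \sum_(i in D) (avg (fun m => (b m i - dot (w i) (a m)) ^+ 2) + dot (w i) (w i) / 2)
    <= n * s2 ->
  0 <= r0 <= r1 ->
  minfo g (fun m i => a m i + r1 * b m i) - minfo g (fun m i => a m i + r0 * b m i)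
   <= n * (ln (1 + r1 ^+ 2 * s2) - ln (1 + r0 ^+ 2 * s2)).
Proof.
move=> aD bD wD Dn s20 sle /andP[r00 r01].
have gap (k p0 q0 p1 q1 : R) : k * p0 - q0 <= k * p1 - q1 -> q1 - q0 <= k * (p1 - p0).
  by rewrite mulrBr; lra.
pose c (t : R) m i := a m i + t * b m i.
have dc (t : R) m i : is_derive t 1 (fun s => c s m i) (b m i).
  by apply: is_derive_eq; rewrite /GRing.scale /=; ring.
have dJ (t : R) : is_derive t 1 (fun s => minfo g (c s)) (dminfo g (c t) b).
  have cc m i : {for t, continuous (fun _ : R => b m i)} by exact: cvg_cst.
  have tt : t - 1 < t < t + 1 by rewrite ltrBlDr !ltrDl ltr01.
  exact: (is_derive_path M0 gG (a' := fun=> b) tt (fun s m i _ => dc s m i) cc).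
have pos (t : R) : 0 < 1 + t ^+ 2 * s2 by rewrite ltr_pwDl// mulr_ge0 ?sqr_ge0.
pose f (t : R) := n * ln (1 + t ^+ 2 * s2) - minfo g (c t).
pose f' (t : R) := n * (2 * t * s2 / (1 + t ^+ 2 * s2)) - dminfo g (c t) b.
have df (t : R) : is_derive t 1 f (f' t).
  have d1 : is_derive t 1 (fun s : R => 1 + s ^+ 2 * s2) (2 * t * s2).
    by apply: is_derive_eq; rewrite /GRing.scale /=; ring.
  have d2 := @is_derive1_comp _ (@ln R) (fun s : R => 1 + s ^+ 2 * s2) _ _ _
     (is_derive1_ln (pos t)) d1.
  have d3 := dJ t.
  by apply: is_derive_eq; rewrite /f' /GRing.scale /=; ring.
have f'0 (t : R) : r0 < t < r1 -> 0 <= f' t.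
  move=> /andP[r0t _]; have t0 : 0 <= t by exact: le_trans r00 (ltW r0t).
  (* Wiener gain for a signal of variance s2 / 2 seen at amplitude t in noise of variance 1 / 2. *)
  pose mu := t * s2 / (1 + t ^+ 2 * s2).
  have E1 : dminfo g (c t) b =
     2 * t * \sum_(i in D) EE g (c t) (fun m y => err (c t) (fun l => b l i) m y ^+ 2).
    rewrite dminfo_err// -mulrA; congr (2 * _).
    have errb0 i m y : i \notin D -> err (c t) (fun l => b l i) m y = 0.
      move=> iD; rewrite /err bD// (_ : (fun l => b l i) = fun=> 0) ?pmean_cst ?subrr//.
      by apply/funext => l; rewrite bD.
    rewrite (bigID (mem D)) /= [X in _ + X]big1 ?addr0; last first.
      move=> i iD; rewrite -[RHS](avg_cst M0) -(EE_msg gG (c t)).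
      by apply: eq_EE => m y; rewrite errb0// mulr0.
    rewrite mulr_sumr; apply: eq_bigr => i iD.
    rewrite -(EEZ gG); last by move=> m; under eq_fun do rewrite expr2;
      apply: gokM; exact: gok_err.
    apply: eq_EE => m y; rewrite expr2 mulrA; congr (_ * _).
    rewrite /err /c aD// add0r mulrBr -pmeanZ; congr (_ - _).
    by rewrite /pmean; congr (_ / _); apply: eq_avg => l; rewrite aD// add0r.
  have E2 i : i \in D -> EE g (c t) (fun m y => err (c t) (fun l => b l i) m y ^+ 2) <=
     (1 - mu * t) ^+ 2 * (avg (fun m => (b m i - dot (w i) (a m)) ^+ 2) + dot (w i) (w i) / 2)
       + mu ^+ 2 / 2.
    (* The prediction by [w i], corrected by [mu] times the innovation in coordinate [i]. *)
    move=> iD; pose k y := dot (w i) (tnth y) + mu * (tnth y i - t * dot (w i) (tnth y)).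
    have gk : gok k.
      have gw := gok_dot (w i).
      by apply: gokD => //; apply: gokZ; apply: gokB; [exact: gok_tnth|exact: gokZ].
    apply: le_trans (EE_mmse M0 gG (c t) (fun l => b l i) gk) _.
    rewrite (EE_shift gG); last first.
      by move=> m; under eq_fun do rewrite expr2; apply: gokM; apply: gokB => //; exact: gok_cst.
    pose v j := (1 - mu * t) * w i j + (if j == i then mu else 0).
    have dwc m : dot (w i) (c t m) = dot (w i) (a m).
      apply: eq_bigr => j _; rewrite /c; have [jD|jD] := boolP (j \in D).
        by rewrite wD// !mul0r.
      by rewrite bD// mulr0 addr0.
    have de e : dot (fun j => if j == i then mu else 0) e = mu * e i.
      rewrite /dot (bigD1 i)//= eqxx big1 ?addr0// => j /negbTE ->.
      by rewrite mul0r.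
    have dv e : dot v e = (1 - mu * t) * dot (w i) e + mu * e i.
      rewrite -de /dot mulr_sumr -big_split; apply: eq_bigr => j _ /=.
      by rewrite /v mulrDl mulrA.
    have vv : dot v v = (1 - mu * t) ^+ 2 * dot (w i) (w i) + mu ^+ 2.
      by rewrite dv dotC dv /v eqxx wD//; ring.
    have -> : avg (fun m => Ex g (fun y => (b m i - k (tadd (c t m) y)) ^+ 2)) =
       avg (fun m => ((1 - mu * t) * (b m i - dot (w i) (a m))) ^+ 2 + dot v v / 2).
      apply: eq_avg => m; rewrite -Ex_dot_sq; apply: eq_Ex => y; congr (_ ^+ 2).
      rewrite /k tnth_taddE dotDr dwc dv /= /c aD// add0r; ring.
    rewrite avgD avg_cst// vv; under eq_avg do rewrite exprMn.
    by rewrite avgZ le_eqVlt; apply/orP; left; apply/eqP; field.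
  have E3 : \sum_(i in D) EE g (c t) (fun m y => err (c t) (fun l => b l i) m y ^+ 2) <=
      n * (s2 / (1 + t ^+ 2 * s2)).
    apply: le_trans (ler_sum _ E2) _.
    rewrite big_split /= -mulr_sumr sumr_const -[_ *+ #|_|]mulr_natl Dn.
    apply: le_trans (lerD (ler_wpM2l (sqr_ge0 _) sle) (lexx _)) _.
    rewrite le_eqVlt; apply/orP; left; apply/eqP; rewrite /mu.
    by field; rewrite gt_eqF// pos.
  rewrite /f' subr_ge0 E1.
  apply: le_trans (ler_wpM2l _ E3) _; first by rewrite mulr_ge0.
  by rewrite le_eqVlt; apply/orP; left; apply/eqP; ring.
exact: gap (ge0_derive_le r01 (fun x _ => df x) f'0).
Qed.

End AddObservation.

(** * Conditional information, monotonicity and Fano's inequality *)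

Section Conditional.
Context {R : realType} {N : nat} {M : finType}.
Hypothesis M0 : (0 < #|M|)%N.
Variable g : probability (N.-tuple R) R.
Hypothesis gG : gaussm g.
Implicit Types (a b : M -> 'I_N -> R) (y : N.-tuple R) (m : M).

(* [mix w v] keeps one component of the message [w] and takes the others from [v]. *)
Variable mix : M -> M -> M.
Hypothesis mixP : forall f : M -> R, avg (fun w => avg (fun v => f (mix w v))) = avg f.

(** Information left once the component kept by [mix] is known. By the chain rule
    [minfo g a - cinfo a] is the information about that component. *)
Definition cinfo a : R := avg (fun w => minfo g (fun v => a (mix w v))).

Lemma mixt_mix a y : avg (fun w => mixt (fun v => a (mix w v)) y) = mixt a y.
Proof. exact: (mixP (fun m => lik a m y)). Qed.

Lemma ln_ge_1BV (x : R) : 0 < x -> 1 - x^-1 <= ln x.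
Proof.
move=> x0; rewrite -[ln x]opprK -lnV ?posrE// -lerN2 opprK opprB.
have := @le_ln1Dx R (x^-1 - 1); rewrite ltrBrDl subrr invr_gt0 => /(_ x0).
by rewrite addrCA subrr addr0.
Qed.

(** Gibbs' inequality for the density [q / avg q] against the subprobability density [s], from ln x
    >= 1 - 1/x. *)
Lemma log_sum_ge0 (q s : M -> R) : (forall w, 0 < q w) -> (forall w, 0 < s w) ->
  avg s <= 1 -> 0 <= avg (fun w => q w * (ln (q w) - ln (avg q) - ln (s w))).
Proof.
move=> q0 s0 s1.
have aq0 : 0 < avg q by exact: avg_gt0.
apply: le_trans (_ : avg (fun w => q w - avg q * s w) <= _).
  by rewrite avgB avgZ subr_ge0 ler_piMr// ltW.
apply: avg_le => w.
have aw0 : 0 < avg q * s w by rewrite mulr_gt0.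
have := ln_ge_1BV (divr_gt0 (q0 w) aw0).
rewrite ln_div ?posrE// lnM ?posrE// opprD addrA invf_div => h.
apply: le_trans (ler_wpM2l (ltW (q0 w)) h).
by rewrite mulrBr mulr1 [q w * (_ / _)]mulrC divfK// gt_eqF.
Qed.

Lemma info_condE a :
  minfo g a - cinfo a = Ex g (fun y => avg (fun w => mixt (fun v => a (mix w v)) y *
    (ln (mixt (fun v => a (mix w v)) y) - ln (mixt a y)))).
Proof.
have gp (b : M -> 'I_N -> R) : gok (fun y => mixt b y * ln (mixt b y)).
  by apply: gokM; [exact: gok_mixt|exact: gok_ln_mixt].
rewrite /cinfo /minfo avgB (mixP (fun m => dot (a m) (a m))).
rewrite opprB addrC addrA addrNK.
have -> : avg (fun w => Ex g (fun y => mixt (fun v => a (mix w v)) y *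
     ln (mixt (fun v => a (mix w v)) y))) =
   Ex g (fun y => avg (fun w => mixt (fun v => a (mix w v)) y *
     ln (mixt (fun v => a (mix w v)) y))).
  by rewrite /avg (ExZ gG) ?(Ex_sum gG)//; apply: gok_sum.
rewrite -(ExB gG)//; last by apply: gok_avg => w.
apply: eq_Ex => y; rewrite -{1}mixt_mix mulrC -avgZ -avgB.
by apply: eq_avg => w; rewrite mulrBr; congr (_ - _); rewrite mulrC.
Qed.

Lemma dot_shift0 (c e : 'I_N -> R) y : dot c e = 0 ->
  dot c (tnth (tadd e y)) = dot c (tnth y).
Proof. by move=> ce; rewrite tnth_taddE dotDr ce addr0. Qed.

Lemma mixt_orth a (e : 'I_N -> R) y : (forall m, dot (a m) e = 0) ->
  mixt a (tadd e y) = mixt a y.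
Proof. by move=> ae; apply: eq_avg => m; rewrite /lik dot_shift0. Qed.

Lemma Ex_mixt_orth a b (h : N.-tuple R -> R) : gok h ->
  (forall m y, h (tadd (b m) y) = h y) ->
  Ex g (fun y => mixt (fun m => (a m \+ b m)%R) y * h y) = Ex g (fun y => mixt a y * h y).
Proof.
move=> gh hb; rewrite -!EE_obs !(EE_shift gG)//.
apply: eq_avg => m; apply: eq_Ex => y.
rewrite (_ : (a m \+ b m)%R = (b m \+ a m)%R) ?taddD ?hb//; apply/funext => i; exact: addrC.
Qed.

(** The directions of [b] are orthogonal to [a], so adding them does not change what is seen of [a].
    Pointwise, the gain is a relative entropy between the posterior given both and the posterior
    given [a] alone. *)
Lemma info_cond_mono a b : (forall m l, dot (a m) (b l) = 0) ->
  minfo g a - cinfo a <=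
  minfo g (fun m => (a m \+ b m)%R) - cinfo (fun m => (a m \+ b m)%R).
Proof.
move=> ab0; have le_eq2 (r r' t t' : R) : r = r' -> t = t' -> r' <= t' -> r <= t.
  by move=> -> ->.
apply: (le_eq2 _ _ _ _ (info_condE a) (info_condE (fun m => (a m \+ b m)%R))).
pose p w y := mixt (fun v => a (mix w v)) y.
pose q w y := mixt (fun v => (a (mix w v) \+ b (mix w v))%R) y.
pose q0 := mixt (fun m => (a m \+ b m)%R).
have p0 w y : 0 < p w y by exact: mixt_gt0.
have q_gt0 w y : 0 < q w y by exact: mixt_gt0.
have ab_gt0 y : 0 < mixt a y by exact: mixt_gt0.
have gh w : gok (fun y => ln (p w y) - ln (mixt a y)).
  by apply: gokB; exact: gok_ln_mixt.
have gh' w : gok (fun y => ln (q w y) - ln (q0 y)).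
  by apply: gokB; exact: gok_ln_mixt.
have gp w : gok (p w) by exact: gok_mixt.
have gq w : gok (q w) by exact: gok_mixt.
have avgEx (F : M -> N.-tuple R -> R) : (forall w, gok (F w)) ->
    Ex g (fun y => avg (fun w => F w y)) = avg (fun w => Ex g (F w)).
  by move=> gF; rewrite /avg (ExZ gG) ?(Ex_sum gG)//; apply: gok_sum.
have -> : Ex g (fun y => avg (fun w => p w y * (ln (p w y) - ln (mixt a y)))) =
    Ex g (fun y => avg (fun w => q w y * (ln (p w y) - ln (mixt a y)))).
  rewrite !avgEx; try by move=> w; exact: gokM.
  apply: eq_avg => w; rewrite (@Ex_mixt_orth (fun v => a (mix w v)) (fun v => b (mix w v))
     (fun y => ln (p w y) - ln (mixt a y)))//.
  by move=> m y; rewrite /p !mixt_orth.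
have H1 w := gokM (gq w) (gh' w); have H2 w := gokM (gq w) (gh w).
rewrite -subr_ge0 -(ExB gG (gok_avg H1) (gok_avg H2)).
apply: Ex_ge0 => y; rewrite -avgB.
have := @log_sum_ge0 (q ^~ y) (fun w => p w y / mixt a y) (q_gt0 ^~ y).
have q0E : avg (q ^~ y) = q0 y by exact: (mixt_mix (fun m => (a m \+ b m)%R)).
rewrite q0E => /(_ (fun w => divr_gt0 (p0 w y) (ab_gt0 y))).
have -> : avg (fun w => p w y / mixt a y) = 1.
  under eq_avg do rewrite mulrC.
  by rewrite avgZ /p mixt_mix mulVf// gt_eqF.
move=> /(_ (lexx _)); congr (_ <= _); apply: eq_avg => w.
by rewrite ln_div ?posrE// -mulrBr.
Qed.

Variables (A : finType) (lab : M -> A).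
Hypothesis lab_mix : forall w v, lab (mix w v) = lab w.
Hypothesis lab_unif : forall x, avg (fun w => (lab w == x)%:R) = (#|A|%:R)^-1 :> R.

(** Gibbs' inequality against the test density s = (|A| 1[correct] + 1) / 2. It averages to 1
    because the label is uniform, and ln s >= 1[correct] ln |A| - ln 2. *)
Lemma fano a (dec : N.-tuple R -> A) : (0 < #|A|)%N ->
  (forall x, measurable (dec @^-1` [set x])) ->
  EE g a (fun m y => (dec y == lab m)%:R) * ln #|A|%:R - ln 2 <= minfo g a - cinfo a.
Proof.
move=> A0 mdec; rewrite info_condE.
have A1 : 0 < #|A|%:R :> R by rewrite ltr0n.
have gI x : gok (fun y => (dec y == x)%:R : R).
  split.
    rewrite (_ : (fun y => _) = \1_(dec @^-1` [set x])); first exact: measurable_indic.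
    apply/funext => y; rewrite indicE; congr (nat_of_bool _)%:R.
    by apply/eqP/idP => [h|/set_mem //]; apply/mem_set.
  by exists 1, 0; split=> // y; rewrite mul0r expR0 mulr1; case: (_ == _);
    rewrite ?normr1 ?normr0.
pose p w y := mixt (fun v => a (mix w v)) y.
have p0 w y : 0 < p w y by exact: mixt_gt0.
have gp w : gok (p w) by exact: gok_mixt.
pose k w y : R := (dec y == lab w)%:R * ln #|A|%:R - ln 2.
have gk w : gok (k w) by apply: gokB; [apply: gokM => //|]; exact: gok_cst.
have avgEx (F : M -> N.-tuple R -> R) : (forall w, gok (F w)) ->
    Ex g (fun y => avg (fun w => F w y)) = avg (fun w => Ex g (F w)).
  by move=> gF; rewrite /avg (ExZ gG) ?(Ex_sum gG)//; apply: gok_sum.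
have -> : EE g a (fun m y => (dec y == lab m)%:R) * ln #|A|%:R - ln 2 =
    Ex g (fun y => avg (fun w => p w y * k w y)).
  transitivity (EE g a (fun m y => k m y)).
    rewrite /k EEB//; last 2 first.
    - by move=> m; apply: gokM => //; exact: gok_cst.
    - by move=> m; exact: gok_cst.
    rewrite (EE_msg gG) avg_cst//; congr (_ - _); rewrite mulrC -(EEZ gG)//.
    by apply: eq_EE => m y; rewrite mulrC.
  rewrite avgEx; last by move=> w; exact: gokM.
  rewrite /EE avgEx; last by move=> m; apply: gokM => //; exact: gok_lik.
  rewrite -mixP; apply: eq_avg => w.
  rewrite -avgEx; last by move=> v; apply: gokM => //; exact: gok_lik.
  apply: eq_Ex => y; rewrite mulrC /p /mixt -avgZ; apply: eq_avg => v.
  by rewrite /k lab_mix mulrC.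
have gkp w : gok (fun y => ln (p w y) - ln (mixt a y)).
  by apply: gokB; exact: gok_ln_mixt.
have H1 w := gokM (gp w) (gk w); have H2 w := gokM (gp w) (gkp w).
apply: (Ex_le gG (gok_avg H1) (gok_avg H2)) => y.
pose s w : R := (#|A|%:R * (dec y == lab w)%:R + 1) / 2.
have s0 w : 0 < s w by rewrite divr_gt0// ltr_wpDl// mulr_ge0.
have s1 : avg s <= 1.
  rewrite (_ : avg s = 2^-1 * (#|A|%:R * avg (fun w => (lab w == dec y)%:R) + 1)).
    by rewrite lab_unif mulfV ?gt_eqF//; lra.
  rewrite -avgZ -[X in _ * (_ + X)](avg_cst M0) -avgD -avgZ; apply: eq_avg => w.
  by rewrite /s mulrC eq_sym.
have := log_sum_ge0 (p0 ^~ y) s0 s1.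
rewrite /p mixt_mix -/(p _ _) => h.
rewrite -subr_ge0 -avgB; apply: le_trans h _; apply: avg_le => w.
rewrite -mulrBr ler_wpM2l ?(ltW (p0 w y))// -/(p w y) lerB// /k /s.
case: (_ == _); last by rewrite mulr0 mul0r !add0r mul1r lnV ?posrE.
rewrite mulr1 mul1r -ln_div ?posrE//.
by rewrite ler_ln ?posrE ?divr_gt0// ?addr_gt0// ler_pM2r// lerDl.
Qed.

End Conditional.

(** * A quadratic inequality from Gram relations *)

Section QuadraticForm.
Context {R : realType}.

(* The Gram relations of the normalised scores [A], [B], observations [t], [u] and
   conditional means [b], [w]; [A + B] and [A - B] are tested against the best
   combinations of [t +- u] and [b +- w]. *)
Lemma score_gram_ineq (n r AA BB AB tt uu mb mw m3 : R) :
  0 <= r < 1 -> 0 <= n -> tt <= n -> uu <= n ->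
  (forall xA xB xt xu xb xw : R,
    0 <= xA ^+ 2 * AA + xB ^+ 2 * BB + xt ^+ 2 * tt + xu ^+ 2 * uu
       + xb ^+ 2 * mb + xw ^+ 2 * mw
       + 2 * (xA * xB * AB + xA * xu * (r * mb) + xA * xw * m3
            + xB * xt * (r * mw) + xB * xb * m3
            + xt * xu * (n * r) + xt * xb * n + xt * xw * (r * mw)
            + xu * xb * (r * mb) + xu * xw * n + xb * xw * m3)) ->
  2 * r * m3 <= AA + BB + 2 * r * AB.
Proof.
move=> /andP[r0 r1] n0 ttn uun H.
have mbn : n <= mb by have := H 0 0 1 0 (-1) 0; lra.
have mwn : n <= mw by have := H 0 0 0 1 0 (-1); lra.
have I3 : m3 <= r * (mb + mw) - r * n + (mb + mw) / 2 - n.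
  by have := H 0 0 (-1) 1 1 (-1); lra.
have r1' : 1 + r != 0 by rewrite gt_eqF// ltr_pwDl.
have r2' : 1 - r != 0 by rewrite gt_eqF// subr_gt0.
(* Up to sign, the weights on [t + u] and [t - u] that minimise the two forms when mb = mw = n and
   [b +- w] has weight r / 2. *)
pose x := r * (1 - r) / (2 * (1 + r)); pose x1 := r * (1 + r) / (2 * (1 - r)).
have I1 := H 1 1 (- x) (- x) (- (r / 2)) (- (r / 2)).
have I2 := H 1 (-1) x1 (- x1) (r / 2) (- (r / 2)).
have hx : x ^+ 2 * (tt + uu) <= x ^+ 2 * (2 * n) by apply: ler_wpM2l; [exact: sqr_ge0|lra].
have hx1 : x1 ^+ 2 * (tt + uu) <= x1 ^+ 2 * (2 * n) by apply: ler_wpM2l; [exact: sqr_ge0|lra].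
(* The weights (1 + r) / 2 and (1 - r) / 2 recombine the squares of [A + B] and [A - B] into AA + BB
   + 2 r AB. *)
have J1 : 0 <= (1 + r) / 2 * (AA + BB + 2 * AB - 2 * (x * r * (mb + mw) + r * m3)
    + x ^+ 2 * (2 * n * (1 + r)) + x * r * (2 * n + r * (mb + mw))
    + r ^+ 2 / 4 * (mb + mw + 2 * m3)).
  by apply: mulr_ge0; [lra|lra].
have J2 : 0 <= (1 - r) / 2 * (AA + BB - 2 * AB - 2 * (x1 * r * (mb + mw) + r * m3)
    + x1 ^+ 2 * (2 * n * (1 - r)) + x1 * r * (2 * n - r * (mb + mw))
    + r ^+ 2 / 4 * (mb + mw - 2 * m3)).
  by apply: mulr_ge0; [lra|lra].
have E1 : (1 + r) / 2 * (AA + BB + 2 * AB - 2 * (x * r * (mb + mw) + r * m3)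
    + x ^+ 2 * (2 * n * (1 + r)) + x * r * (2 * n + r * (mb + mw))
    + r ^+ 2 / 4 * (mb + mw + 2 * m3)) =
  (1 + r) / 2 * (AA + BB + 2 * AB - 2 * r * m3 + r ^+ 2 / 4 * (mb + mw + 2 * m3))
   - r ^+ 2 * (1 - r) / 2 * (mb + mw) + r ^+ 2 * (1 - r) ^+ 2 / 4 * n
   + r ^+ 2 * (1 - r) / 4 * (2 * n + r * (mb + mw)).
  by rewrite /x; field.
have E2 : (1 - r) / 2 * (AA + BB - 2 * AB - 2 * (x1 * r * (mb + mw) + r * m3)
    + x1 ^+ 2 * (2 * n * (1 - r)) + x1 * r * (2 * n - r * (mb + mw))
    + r ^+ 2 / 4 * (mb + mw - 2 * m3)) =
  (1 - r) / 2 * (AA + BB - 2 * AB - 2 * r * m3 + r ^+ 2 / 4 * (mb + mw - 2 * m3))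
   - r ^+ 2 * (1 + r) / 2 * (mb + mw) + r ^+ 2 * (1 + r) ^+ 2 / 4 * n
   + r ^+ 2 * (1 + r) / 4 * (2 * n - r * (mb + mw)).
  by rewrite /x1; field.
rewrite E1 in J1; rewrite E2 in J2.
(* [K3] uses the slack in [I3], [K4] that in [mbn] and [mwn]; together they cancel what [J1] and
   [J2] leave over. *)
have K3 : 0 <= r ^+ 3 / 2 * (r * (mb + mw) - r * n + (mb + mw) / 2 - n - m3).
  by apply: mulr_ge0; [rewrite divr_ge0 ?exprn_ge0|lra].
have K4 : 0 <= r ^+ 2 / 4 * (3 - r) * (mb + mw - 2 * n).
  by rewrite !mulr_ge0 ?sqr_ge0 ?invr_ge0//; lra.
rewrite -subr_ge0; apply: le_trans (addr_ge0 (addr_ge0 J1 J2) (addr_ge0 K3 K4)) _.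
by rewrite le_eqVlt; apply/orP; left; apply/eqP; field.
Qed.

End QuadraticForm.

(** * Orthonormal frames, noise estimates and marginals *)

Section Frames.
Context {R : realType} {N : nat} {M J : finType}.
Hypothesis M0 : (0 < #|M|)%N.
Variable g : probability (N.-tuple R) R.
Hypothesis gG : gaussm g.
Implicit Types (a : M -> 'I_N -> R) (y : N.-tuple R) (m : M) (v e : 'I_N -> R).
Implicit Types (k : N.-tuple R -> R) (d : J -> 'I_N -> R).

Definition comb d (c : J -> R) : 'I_N -> R := fun i => \sum_j c j * d j i.

Lemma dot_comb d (c : J -> R) e : dot (comb d c) e = \sum_j c j * dot (d j) e.
Proof.
rewrite /dot /comb; under eq_bigr do rewrite mulr_suml.
rewrite exchange_big; apply: eq_bigr => j _; rewrite mulr_sumr.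
by apply: eq_bigr => i _; rewrite mulrA.
Qed.

Definition orthonormal d := forall j l, dot (d j) (d l) = (j == l)%:R.

Lemma dot_comb_frame d (c : J -> R) j : orthonormal d -> dot (d j) (comb d c) = c j.
Proof.
move=> od; rewrite dotC dot_comb (bigD1 j)//= od eqxx mulr1 big1 ?addr0// => l.
by rewrite od => /negbTE ->; rewrite mulr0.
Qed.

Definition noise a v m y : R := dot v (tnth y) - dot v (a m).

Lemma gok_noise a v m : gok (noise a v m).
Proof. by apply: gokB; [exact: gok_dot|exact: gok_cst]. Qed.

Lemma noiseE a v m y : noise a v m y = dot v (fun i => tnth y i - a m i).
Proof. by rewrite /noise /dot -sumrB; apply: eq_bigr => i _; rewrite mulrBr. Qed.

Lemma Ex_dot_dot v e : Ex g (fun y => dot v (tnth y) * dot e (tnth y)) = dot v e / 2.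
Proof.
have dd y (t : R) : is_derive t 1
    (fun s : R => dot e (tnth (tadd (fun i => s * v i) y))) (dot e v).
  apply: is_derive_bigsum => i _.
  under [X in is_derive _ _ X]eq_fun do rewrite tnth_tadd.
  by apply: is_derive_eq; rewrite /GRing.scale /=; ring.
have := @gauss_ibp _ _ g gG v (fun y => dot e (tnth y)) (fun=> dot e v)
  (gok_dot e) (gok_cst _) dd.
rewrite Ex_cst; under eq_Ex do rewrite -mulrA.
rewrite (ExZ gG); last by apply: gokM; exact: gok_dot.
by rewrite dotC => ->; rewrite mulrAC mulfV ?mul1r.
Qed.

Lemma Ex_dot v : Ex g (fun y => dot v (tnth y)) = 0.
Proof.
have := @gauss_ibp _ _ g gG v (fun=> 1) (fun=> 0) (gok_cst _) (gok_cst _)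
  (fun y t => is_derive_cst (1 : R) t 1).
rewrite Ex_cst; under eq_Ex do rewrite mulr1.
rewrite (ExZ gG); last exact: gok_dot.
by move=> /esym/eqP; rewrite mulf_eq0 pnatr_eq0 /= => /eqP.
Qed.

Lemma EE_noise_msg a v (f : M -> R) : EE g a (fun m y => noise a v m y * f m) = 0.
Proof.
rewrite (EE_shift gG); last by move=> m; apply: gokM; [exact: gok_noise|exact: gok_cst].
rewrite -[RHS](avg_cst M0); apply: eq_avg => m.
under eq_Ex do rewrite /noise tnth_taddE dotDr addrK mulrC.
by rewrite (ExZ gG) ?Ex_dot ?mulr0//; exact: gok_dot.
Qed.

Lemma EE_noise_noise a v e : EE g a (fun m y => noise a v m y * noise a e m y) = dot v e / 2.
Proof.
rewrite (EE_shift gG); last by move=> m; apply: gokM; exact: gok_noise.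
rewrite -[RHS](avg_cst M0); apply: eq_avg => m; rewrite -Ex_dot_dot.
by apply: eq_Ex => y; rewrite /noise !tnth_taddE !dotDr !addrK.
Qed.

Lemma EE_noise_dot a v e : EE g a (fun m y => noise a v m y * dot e (tnth y)) = dot v e / 2.
Proof.
rewrite -(EE_noise_noise a) -[RHS]addr0 -(EE_noise_msg a v (fun m => dot e (a m))).
rewrite -(EED gG); last 2 first.
- by move=> m; apply: gokM; exact: gok_noise.
- by move=> m; apply: gokM; [exact: gok_noise|exact: gok_cst].
by apply: eq_EE => m y; rewrite /noise; ring.
Qed.

(** Integration by parts along [v], where [k] has derivative zero. *)
Lemma EE_noise_inv a v k : gok k ->
  (forall (s : R) y, k (tadd (fun i => s * v i) y) = k y) ->
  EE g a (fun m y => noise a v m y * k y) = 0.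
Proof.
move=> gk kv.
have dk m y (t : R) : is_derive t 1 (fun s : R => k (tadd (fun i => s * v i) y)) 0.
  under [X in is_derive _ _ X]eq_fun do rewrite kv.
  exact: is_derive_cst.
have := @mixt_ibp _ _ _ g gG a (fun=> v) k (fun _ _ => 0) gk (fun=> gok_cst _) dk.
rewrite (EE_msg gG a (fun=> 0)) avg_cst//.
under eq_EE do rewrite -noiseE -mulrA.
rewrite (EEZ gG); last by move=> m; apply: gokM => //; exact: gok_noise.
by move=> /eqP; rewrite mulf_eq0 pnatr_eq0 /= => /eqP.
Qed.

(** The conditional mean of [noise a v] given the whole output; minus twice it is the derivative
    along [v] of the log density of the output. *)
Definition nuhat a v y : R := dot v (tnth y) - pmean a (fun l => dot v (a l)) y.

Lemma gok_nuhat a v : gok (nuhat a v).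
Proof. by apply: gokB; [exact: gok_dot|exact: gok_pmean]. Qed.

Lemma EE_nuhat a v k : gok k ->
  EE g a (fun m y => nuhat a v y * k y) = EE g a (fun m y => noise a v m y * k y).
Proof.
move=> gk; apply/eqP; rewrite -subr_eq0 -(EEB gG); last 2 first.
- by move=> m; apply: gokM => //; exact: gok_nuhat.
- by move=> m; apply: gokM => //; exact: gok_noise.
rewrite -[X in _ == X](EE_err_obs M0 gG a (fun l => dot v (a l)) gk); apply/eqP.
by apply: eq_EE => m y; rewrite /noise /nuhat /err; ring.
Qed.

Lemma pmeanD a (f h : M -> R) y : pmean a (fun m => f m + h m) y = pmean a f y + pmean a h y.
Proof.
rewrite /pmean -mulrDl -avgD; congr (_ / _).
by apply: eq_avg => m; rewrite mulrDr.
Qed.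

Lemma nuhat_comb a v e (s t : R) y :
  nuhat a (fun i => s * v i + t * e i) y = s * nuhat a v y + t * nuhat a e y.
Proof.
have dE b : dot (fun i => s * v i + t * e i) b = s * dot v b + t * dot e b.
  by rewrite /dot !mulr_sumr -big_split; apply: eq_bigr => i _ /=; ring.
rewrite /nuhat dE; under [X in pmean a X]funext do rewrite dE.
by rewrite pmeanD !pmeanZ; ring.
Qed.

Lemma noise_comb a v e (s t : R) m y :
  noise a (fun i => s * v i + t * e i) m y = s * noise a v m y + t * noise a e m y.
Proof.
have dE b : dot (fun i => s * v i + t * e i) b = s * dot v b + t * dot e b.
  by rewrite /dot !mulr_sumr -big_split; apply: eq_bigr => i _ /=; ring.
by rewrite /noise !dE; ring.
Qed.

Section Marginal.
Variables (a : M -> 'I_N -> R) (d : J -> 'I_N -> R).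
Hypothesis od : orthonormal d.

(** The signal projected on the frame: functions of the projected output do not distinguish it from
    the original signal, see [EE_marg]. *)
Definition marg m : 'I_N -> R := comb d (fun j => dot (d j) (a m)).

Definition depends_on k := forall e y, (forall j, dot (d j) e = 0) -> k (tadd e y) = k y.

Lemma EE_marg (f : M -> R) k : gok k -> depends_on k ->
  EE g a (fun m y => f m * k y) = EE g marg (fun m y => f m * k y).
Proof.
move=> gk dk; rewrite !(EE_shift gG); try by move=> m; apply: gokM => //; exact: gok_cst.
apply: eq_avg => m; apply: eq_Ex => y; congr (_ * _).
rewrite -[RHS](dk (fun i => a m i - marg m i)).
  by congr k; apply: eq_from_tnth => i; rewrite !tnth_tadd; ring.
move=> j; rewrite (_ : dot (d j) _ = dot (d j) (a m) - dot (d j) (marg m)).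
  by rewrite dot_comb_frame// subrr.
by rewrite /dot -sumrB; apply: eq_bigr => i _; rewrite mulrBr.
Qed.

Lemma depends_on_dot j : depends_on (fun y => dot (d j) (tnth y)).
Proof. by move=> e y de; rewrite tnth_taddE dotDr de addr0. Qed.

Lemma depends_on_pmean (f : M -> R) : depends_on (pmean marg f).
Proof.
move=> e y de.
have le m : lik marg m (tadd e y) = lik marg m y.
  rewrite /lik tnth_taddE dotDr (_ : dot (marg m) e = 0) ?addr0//.
  by rewrite dot_comb big1// => j _; rewrite de mulr0.
by rewrite /pmean /mixt; under eq_avg do rewrite le; under [in X in _ / X]eq_avg do rewrite le.
Qed.

(* the conditional mean of the noise along [d j] given the projection of the output on [d] *)
Definition beta j y : R := dot (d j) (tnth y) - pmean marg (fun m => dot (d j) (a m)) y.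

Lemma gok_beta j : gok (beta j).
Proof. by apply: gokB; [exact: gok_dot|exact: gok_pmean]. Qed.

Lemma depends_on_beta j : depends_on (beta j).
Proof.
by move=> e y de; rewrite /beta depends_on_pmean// (depends_on_dot j y de).
Qed.

Lemma EE_beta j k : gok k -> depends_on k ->
  EE g a (fun m y => beta j y * k y) = EE g a (fun m y => noise a (d j) m y * k y).
Proof.
move=> gk dk.
have gpk : gok (fun y => pmean marg (fun m => dot (d j) (a m)) y * k y).
  by apply: gokM => //; exact: gok_pmean.
have gdk : gok (fun y => dot (d j) (tnth y) * k y) by apply: gokM => //; exact: gok_dot.
under eq_EE do rewrite /beta mulrBl.
under [RHS]eq_EE do rewrite /noise mulrBl.
rewrite !(EEB gG)//; last by move=> m; apply: gokM => //; exact: gok_cst.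
congr (_ - _); rewrite (EE_marg _ gk dk) (EE_tower M0).
have h : depends_on (fun y => pmean marg (fun m => dot (d j) (a m)) y * k y).
  by move=> e y de; rewrite dk// depends_on_pmean.
transitivity (EE g a (fun _ y => 1 * (pmean marg (fun m => dot (d j) (a m)) y * k y))).
  by apply: eq_EE => m y; rewrite mul1r.
by rewrite (EE_marg (fun=> 1) gpk h); apply: eq_EE => m y; rewrite mul1r.
Qed.

(** [v - s d_j] is orthogonal to the frame, hence its noise is uncorrelated with [k]; only the
    component along [d j] remains. *)
Lemma EE_noise_depends v j (s : R) k : gok k -> depends_on k ->
  (forall l, dot (d l) v = s * (l == j)%:R) ->
  EE g a (fun m y => noise a v m y * k y) = s * EE g a (fun m y => beta j y * k y).
Proof.
move=> gk dk dv; rewrite (EE_beta j gk dk).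
pose u i := v i - s * d j i.
have u0 l : dot (d l) u = 0.
  rewrite (_ : dot (d l) u = dot (d l) v - s * dot (d l) (d j)).
    by rewrite dv od subrr.
  by rewrite /dot mulr_sumr -sumrB; apply: eq_bigr => i _; rewrite /u; ring.
have su (t : R) y : k (tadd (fun i => t * u i) y) = k y.
  apply: dk => l; transitivity (t * dot (d l) u); last by rewrite u0 mulr0.
  by rewrite /dot mulr_sumr; apply: eq_bigr => i _; ring.
have := EE_noise_inv a gk su.
have gn m e : gok (fun y => noise a e m y * k y) by apply: gokM => //; exact: gok_noise.
have -> : EE g a (fun m y => noise a u m y * k y) =
    EE g a (fun m y => noise a v m y * k y - s * (noise a (d j) m y * k y)).
  apply: eq_EE => m y; rewrite (_ : u = (fun i => 1 * v i + (- s) * d j i)).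
    by rewrite noise_comb; ring.
  by apply/funext => i; rewrite /u; ring.
rewrite (EEB gG)//; last by move=> m; exact: gokZ.
by rewrite (EEZ gG)// => /subr0_eq.
Qed.

End Marginal.

End Frames.

Lemma quadratic_form6 {R : realType} (x0 x1 x2 x3 x4 x5 : R) (G : nat -> nat -> R) :
  (forall i k, G i k = G k i) ->
  let x i := nth 0 [:: x0; x1; x2; x3; x4; x5] i in
  \sum_(i < 6) \sum_(k < 6) x i * x k * G i k =
  x0 ^+ 2 * G 0%N 0%N + x1 ^+ 2 * G 1%N 1%N + x2 ^+ 2 * G 2%N 2%N + x3 ^+ 2 * G 3%N 3%N
  + x4 ^+ 2 * G 4%N 4%N + x5 ^+ 2 * G 5%N 5%N
  + 2 * (x0 * x1 * G 0%N 1%N + x0 * x2 * G 0%N 2%N + x0 * x3 * G 0%N 3%N + x0 * x4 * G 0%N 4%N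
   + x0 * x5 * G 0%N 5%N + x1 * x2 * G 1%N 2%N + x1 * x3 * G 1%N 3%N + x1 * x4 * G 1%N 4%N
   + x1 * x5 * G 1%N 5%N + x2 * x3 * G 2%N 3%N + x2 * x4 * G 2%N 4%N + x2 * x5 * G 2%N 5%N
   + x3 * x4 * G 3%N 4%N + x3 * x5 * G 3%N 5%N + x4 * x5 * G 4%N 5%N).
Proof.
move=> GC x; rewrite !big_ord_recl !big_ord0 /= /bump /= /x /=.
rewrite (GC 1%N 0%N) (GC 2%N 0%N) (GC 3%N 0%N) (GC 4%N 0%N) (GC 5%N 0%N) (GC 2%N 1%N) (GC 3%N 1%N) (GC 4%N 1%N) (GC 5%N 1%N).
by rewrite (GC 3%N 2%N) (GC 4%N 2%N) (GC 5%N 2%N) (GC 4%N 3%N) (GC 5%N 3%N) (GC 5%N 4%N); ring.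
Qed.

(** * The score inequality for two observations in correlated noise *)

Section ScoreInequality.
Context {R : realType} {N : nat} {M J : finType}.
Hypothesis M0 : (0 < #|M|)%N.
Variable g : probability (N.-tuple R) R.
Hypothesis gG : gaussm g.
Variables (d1 d2 : J -> 'I_N -> R).
Hypotheses (od1 : orthonormal d1) (od2 : orthonormal d2).
Hypothesis d12 : forall j l, dot (d1 j) (d2 l) = 0.

Lemma dot_comb2 (v e b : 'I_N -> R) (s t : R) :
  dot b (fun i => s * v i + t * e i) = s * dot b v + t * dot b e.
Proof. by rewrite /dot !mulr_sumr -big_split; apply: eq_bigr => i _ /=; ring. Qed.

Variables (sz sd sw sp sq c n : R).
Hypotheses (sz0 : 0 < sz) (sd0 : 0 < sd) (sw0 : 0 < sw) (sp0 : 0 < sp) (sq0 : 0 < sq).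
Hypotheses (c0 : 0 <= c) (cpq : c < sp * sq) (swE : sw ^+ 2 = sd ^+ 2 + c ^+ 2 / sz ^+ 2).
Hypothesis Jn : #|J|%:R = 2 * n.

(** Think of observations T and U with noise variances sz^2 and sw^2 and noise covariance c. Then
    [d1] is T normalised, [d2] the normalised part of U whose noise is uncorrelated with that of T,
    and [dirU] is U normalised. *)
Definition dirU j : 'I_N -> R := fun i => c / (sz * sw) * d1 j i + sd / sw * d2 j i.

Lemma dot_d1_dirU j l : dot (d1 j) (dirU l) = c / (sz * sw) * (j == l)%:R.
Proof. by rewrite dot_comb2 od1 d12 mulr0 addr0. Qed.

Lemma dot_d2_dirU j l : dot (d2 j) (dirU l) = sd / sw * (j == l)%:R.
Proof. by rewrite dot_comb2 od2 dotC d12 mulr0 add0r. Qed.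

Lemma orthonormal_dirU : orthonormal dirU.
Proof.
move=> j l; rewrite dot_comb2 ![dot (dirU j) _]dotC dot_d1_dirU dot_d2_dirU.
rewrite [l == j]eq_sym; case: (j == l); last by rewrite !mulr0 addr0.
rewrite !mulr1.
have -> : c / (sz * sw) * (c / (sz * sw)) + sd / sw * (sd / sw) =
   (sd ^+ 2 + c ^+ 2 / sz ^+ 2) / sw ^+ 2 by field; rewrite !gt_eqF.
by rewrite -swE mulfV// expf_neq0// gt_eqF.
Qed.

Lemma received_power_le (s p A : R) : 0 < s -> 0 < p -> A <= n * (p ^+ 2 / s ^+ 2 - 1) ->
  s ^+ 2 / p ^+ 2 * (2 * n * 2^-1 + A) <= n.
Proof.
move=> s0 p0 hA; rewrite mulrAC ler_pdivrMr ?exprn_gt0//.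
have := ler_wpM2r (sqr_ge0 s) hA.
have -> : n * (p ^+ 2 / s ^+ 2 - 1) * s ^+ 2 = n * p ^+ 2 - n * s ^+ 2.
  by field; rewrite gt_eqF.
by move=> h; have -> : 2 * n * 2^-1 = n by [field]; rewrite mulrDr; lra.
Qed.

Variable a : M -> 'I_N -> R.
Hypothesis H1 : \sum_j avg (fun m => dot (d1 j) (a m) ^+ 2) <= n * (sp ^+ 2 / sz ^+ 2 - 1).
Hypothesis HU : \sum_j avg (fun m => dot (dirU j) (a m) ^+ 2) <= n * (sq ^+ 2 / sw ^+ 2 - 1).
Hypothesis HU1 : forall k j, gok k -> depends_on d1 k ->
  EE g a (fun m y => dot (dirU j) (a m) * k y) = 0.
Hypothesis H1U : forall k j, gok k -> depends_on dirU k ->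
  EE g a (fun m y => dot (d1 j) (a m) * k y) = 0.

(** Directions dual to the two observations: [vT] moves T by one and leaves U fixed, [vU] the
    converse. Hence [sT] and [sU] are half the partial derivatives of the log density of the
    output. *)
Definition vT j : 'I_N -> R := fun i => sz^-1 * d1 j i + (- (c / (sz ^+ 2 * sd))) * d2 j i.
Definition vU j : 'I_N -> R := fun i => 0 * d1 j i + sd^-1 * d2 j i.
Definition sT j y : R := - nuhat a (vT j) y.
Definition sU j y : R := - nuhat a (vU j) y.

Local Notation be := (beta a d1).
Local Notation om := (beta a dirU).
Local Notation E f := (EE g a (fun _ y => f y)).

Lemma gok_sT j : gok (sT j). Proof. by apply: gokN; exact: gok_nuhat. Qed.
Lemma gok_sU j : gok (sU j). Proof. by apply: gokN; exact: gok_nuhat. Qed.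

Lemma EE_sT j k : gok k ->
  EE g a (fun _ y => sT j y * k y) = - EE g a (fun m y => noise a (vT j) m y * k y).
Proof.
move=> gk; rewrite -(EE_nuhat M0 gG _ _ gk) -(EEN gG); last first.
  by move=> m; apply: gokM => //; exact: gok_nuhat.
by apply: eq_EE => m y; rewrite /sT mulNr.
Qed.

Lemma EE_sU j k : gok k ->
  EE g a (fun _ y => sU j y * k y) = - EE g a (fun m y => noise a (vU j) m y * k y).
Proof.
move=> gk; rewrite -(EE_nuhat M0 gG _ _ gk) -(EEN gG); last first.
  by move=> m; apply: gokM => //; exact: gok_nuhat.
by apply: eq_EE => m y; rewrite /sU mulNr.
Qed.

Lemma d1_vT l j : dot (d1 l) (vT j) = sz^-1 * (l == j)%:R.
Proof. by rewrite dot_comb2 od1 d12 mulr0 addr0. Qed.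
Lemma d1_vU l j : dot (d1 l) (vU j) = 0 * (l == j)%:R.
Proof. by rewrite dot_comb2 od1 d12 mulr0 addr0. Qed.
Lemma d2_vT l j : dot (d2 l) (vT j) = - (c / (sz ^+ 2 * sd)) * (l == j)%:R.
Proof. by rewrite dot_comb2 od2 (dotC (d2 l)) d12 mulr0 add0r. Qed.
Lemma d2_vU l j : dot (d2 l) (vU j) = sd^-1 * (l == j)%:R.
Proof. by rewrite dot_comb2 od2 mul0r add0r. Qed.
Lemma dirU_vT l j : dot (dirU l) (vT j) = 0 * (l == j)%:R.
Proof.
rewrite dotC dot_comb2 ![dot (vT j) _]dotC d1_vT d2_vT.
by rewrite mul0r; case: (l == j); rewrite ?mulr0 ?addr0// !mulr1; field; rewrite !gt_eqF.
Qed.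

Lemma dirU_vU l j : dot (dirU l) (vU j) = sw^-1 * (l == j)%:R.
Proof.
rewrite dotC dot_comb2 ![dot (vU j) _]dotC d1_vU d2_vU.
by rewrite mul0r mulr0 add0r; case: (l == j); rewrite ?mulr0// !mulr1; field; rewrite !gt_eqF.
Qed.

(* Never named below: [//] discharges side conditions with these facts. *)
Let gbe j : gok (be j) := gok_beta M0 a d1 j.
Let gom j : gok (om j) := gok_beta M0 a dirU j.
Let dbe j : depends_on d1 (be j) := @depends_on_beta _ _ _ _ a d1 j.
Let dom j : depends_on dirU (om j) := @depends_on_beta _ _ _ _ a dirU j.
Let gy1 j : gok (fun y => dot (d1 j) (tnth y)) := gok_dot (d1 j).
Let gyU j : gok (fun y => dot (dirU j) (tnth y)) := gok_dot (dirU j).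

Let E_T_be j : EE g a (fun _ y => sT j y * be j y) = - sz^-1 * EE g a (fun _ y => be j y * be j y).
Proof.
rewrite EE_sT// (EE_noise_depends M0 gG a od1 (j := j) (s := sz^-1)) ?mulNr//.
by move=> l; exact: d1_vT.
Qed.

Let E_T_om j : EE g a (fun _ y => sT j y * om j y) = 0.
Proof.
rewrite EE_sT// (EE_noise_depends M0 gG a orthonormal_dirU (j := j) (s := 0)) ?mul0r ?oppr0//.
by move=> l; exact: dirU_vT.
Qed.

Let E_U_be j : EE g a (fun _ y => sU j y * be j y) = 0.
Proof.
rewrite EE_sU// (EE_noise_depends M0 gG a od1 (j := j) (s := 0)) ?mul0r ?oppr0//.
by move=> l; exact: d1_vU.
Qed.

Let E_U_om j : EE g a (fun _ y => sU j y * om j y) = - sw^-1 * EE g a (fun _ y => om j y * om j y).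
Proof.
rewrite EE_sU// (EE_noise_depends M0 gG a orthonormal_dirU (j := j) (s := sw^-1)) ?mulNr//.
by move=> l; exact: dirU_vU.
Qed.

Let E_T_y1 j : EE g a (fun _ y => sT j y * dot (d1 j) (tnth y)) = - (sz^-1 / 2).
Proof. by rewrite EE_sT// (EE_noise_dot M0 gG) dotC d1_vT eqxx mulr1. Qed.

Let E_T_yU j : EE g a (fun _ y => sT j y * dot (dirU j) (tnth y)) = 0.
Proof. by rewrite EE_sT// (EE_noise_dot M0 gG) dotC dirU_vT !mul0r oppr0. Qed.

Let E_U_y1 j : EE g a (fun _ y => sU j y * dot (d1 j) (tnth y)) = 0.
Proof. by rewrite EE_sU// (EE_noise_dot M0 gG) dotC d1_vU !mul0r oppr0. Qed.

Let E_U_yU j : EE g a (fun _ y => sU j y * dot (dirU j) (tnth y)) = - (sw^-1 / 2).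
Proof. by rewrite EE_sU// (EE_noise_dot M0 gG) dotC dirU_vU eqxx mulr1. Qed.

(* splits the observation [dot v y] into its noise and its signal part *)
Let E_split v k : gok k -> EE g a (fun _ y => dot v (tnth y) * k y) =
  EE g a (fun m y => noise a v m y * k y) + EE g a (fun m y => dot v (a m) * k y).
Proof.
move=> gk; rewrite -(EED gG).
- by apply: eq_EE => m y; rewrite /noise; ring.
- by move=> m; apply: gokM => //; exact: gok_noise.
- by move=> m; apply: gokM => //; exact: gok_cst.
Qed.

Let E_msg_dot v e : EE g a (fun m y => dot v (a m) * dot e (tnth y)) =
  avg (fun m => dot v (a m) * dot e (a m)).
Proof.
rewrite -(EE_msg gG a) -[LHS]subr0 -(EE_noise_msg M0 gG a e (fun m => dot v (a m))).
rewrite -(EEB gG); last 2 first.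
- by move=> m; apply: gokM; [exact: gok_cst|exact: gok_dot].
- by move=> m; apply: gokM; [exact: gok_noise|exact: gok_cst].
by apply: eq_EE => m y; rewrite /noise; ring.
Qed.

Let E_y1_y1 j : EE g a (fun _ y => dot (d1 j) (tnth y) * dot (d1 j) (tnth y)) =
  2^-1 + avg (fun m => dot (d1 j) (a m) ^+ 2).
Proof. by rewrite E_split// (EE_noise_dot M0 gG) E_msg_dot od1 eqxx mul1r. Qed.

Let E_yU_yU j : EE g a (fun _ y => dot (dirU j) (tnth y) * dot (dirU j) (tnth y)) =
  2^-1 + avg (fun m => dot (dirU j) (a m) ^+ 2).
Proof. by rewrite E_split// (EE_noise_dot M0 gG) E_msg_dot orthonormal_dirU eqxx mul1r. Qed.

Let E_y1_yU j : EE g a (fun _ y => dot (d1 j) (tnth y) * dot (dirU j) (tnth y)) =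
  c / (sz * sw) / 2.
Proof.
under eq_EE do rewrite mulrC.
rewrite E_split// (EE_noise_dot M0 gG) dotC dot_d1_dirU eqxx mulr1 HU1 ?addr0//.
exact: depends_on_dot.
Qed.

Let E_y1_be j : EE g a (fun _ y => dot (d1 j) (tnth y) * be j y) = 2^-1.
Proof.
under eq_EE do rewrite mulrC.
rewrite (EE_beta M0 gG a od1)//; last exact: depends_on_dot.
by rewrite (EE_noise_dot M0 gG) od1 eqxx mul1r.
Qed.

Let E_yU_om j : EE g a (fun _ y => dot (dirU j) (tnth y) * om j y) = 2^-1.
Proof.
under eq_EE do rewrite mulrC.
rewrite (EE_beta M0 gG a orthonormal_dirU)//; last exact: depends_on_dot.
by rewrite (EE_noise_dot M0 gG) orthonormal_dirU eqxx mul1r.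
Qed.

Let E_yU_be j : EE g a (fun _ y => dot (dirU j) (tnth y) * be j y) =
  c / (sz * sw) * EE g a (fun _ y => be j y * be j y).
Proof.
rewrite E_split// HU1// addr0 (EE_noise_depends M0 gG a od1 (j := j) (s := c / (sz * sw)))//.
by move=> l; exact: dot_d1_dirU.
Qed.

Let E_y1_om j : EE g a (fun _ y => dot (d1 j) (tnth y) * om j y) =
  c / (sz * sw) * EE g a (fun _ y => om j y * om j y).
Proof.
rewrite E_split// H1U// addr0.
rewrite (EE_noise_depends M0 gG a orthonormal_dirU (j := j) (s := c / (sz * sw)))//.
by move=> l; rewrite dotC dot_d1_dirU eq_sym.
Qed.

Local Notation Q f h := (\sum_j EE g a (fun _ y => f j y * h j y)).

Let base (i : nat) : J -> N.-tuple R -> R :=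
  nth sT [:: sT; sU; (fun j y => dot (d1 j) (tnth y));
            (fun j y => dot (dirU j) (tnth y)); be; om] i.

Let gbase (i : 'I_6) j : gok (base i j).
Proof. by case: i => [[|[|[|[|[|[|//]]]]]]] /=; rewrite /base /=; auto using gok_sT, gok_sU. Qed.

Let base_psd (x : 'I_6 -> R) :
  0 <= \sum_i \sum_k x i * x k * Q (base i) (base k).
Proof.
apply: le_trans (_ : 0 <= \sum_j EE g a (fun _ y => (\sum_i x i * base i j y) ^+ 2)) _.
  by apply: sumr_ge0 => j _; apply: EE_ge0 => // m y; rewrite sqr_ge0.
rewrite le_eqVlt; apply/orP; left; apply/eqP.
under eq_bigr => j _.
  have -> : EE g a (fun _ y => (\sum_i x i * base i j y) ^+ 2) =
      \sum_i \sum_k x i * x k * EE g a (fun _ y => base i j y * base k j y).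
    have gi i k : gok (fun y => x i * x k * (base i j y * base k j y)).
      by apply: gokZ; apply: gokM; exact: gbase.
    transitivity (EE g a (fun _ y => \sum_i \sum_k x i * x k * (base i j y * base k j y))).
      apply: eq_EE => m y; rewrite expr2 mulr_suml; apply: eq_bigr => i _.
      by rewrite mulr_sumr; apply: eq_bigr => k _; ring.
    rewrite (EE_sum gG); last by move=> i m; apply: gok_sum.
    apply: eq_bigr => i _; rewrite (EE_sum gG)//; apply: eq_bigr => k _.
    by rewrite (EEZ gG)// => m; apply: gokM; exact: gbase.
  over.
rewrite exchange_big; apply: eq_bigr => i _.
by rewrite exchange_big; apply: eq_bigr => k _; rewrite mulr_sumr.
Qed.

(** The two scores, the two observations and the two estimates from one observation alone have a
    positive semidefinite Gram matrix. Integration by parts and independence determine enough of its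
    entries for [score_gram_ineq] to apply. *)
Lemma score_ineq :
  \sum_j (sp ^+ 2 / sz ^+ 2 * EE g a (fun _ y => be j y * be j y) +
          sq ^+ 2 / sw ^+ 2 * EE g a (fun _ y => om j y * om j y)) <=
  \sum_j EE g a (fun _ y => sp ^+ 2 * (sT j y * sT j y) + sq ^+ 2 * (sU j y * sU j y)
                          + 2 * c * (sT j y * sU j y)).
Proof.
have n0 : 0 <= n by rewrite -(pmulr_rge0 _ (ltr0n R 2)) -Jn ler0n.
pose TT := Q sT sT; pose UU := Q sU sU; pose TU := Q sT sU.
pose Bb := Q be be; pose Ww := Q om om; pose Bw := Q be om.
have QC (f h : J -> N.-tuple R -> R) : Q f h = Q h f.
  by apply: eq_bigr => j _; apply: eq_EE => m y; rewrite mulrC.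
have sumJ (x : R) : \sum_(j : J) x = 2 * n * x.
  by rewrite sumr_const -[_ *+ #|_|]mulr_natl Jn.
have sumZ (x : R) (F : J -> R) : \sum_j x * F j = x * \sum_j F j by rewrite mulr_sumr.
have q02 : Q sT (fun j y => dot (d1 j) (tnth y)) = - (n / sz).
  transitivity (\sum_(j : J) - (sz^-1 / 2)); first by apply: eq_bigr => j _; exact: E_T_y1.
  by rewrite sumJ; field; rewrite gt_eqF.
have q03 : Q sT (fun j y => dot (dirU j) (tnth y)) = 0.
  transitivity (\sum_(j : J) (0 : R)); first by apply: eq_bigr => j _; exact: E_T_yU.
  by rewrite sumJ mulr0.
have q04 : Q sT be = - (Bb / sz).
  transitivity (\sum_(j : J) (- sz^-1 * EE g a (fun _ y => be j y * be j y))); first by apply: eq_bigr => j _; exact: E_T_be.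
  by rewrite sumZ mulNr mulrC.
have q05 : Q sT om = 0.
  transitivity (\sum_(j : J) (0 : R)); first by apply: eq_bigr => j _; exact: E_T_om.
  by rewrite sumJ mulr0.
have q12 : Q sU (fun j y => dot (d1 j) (tnth y)) = 0.
  transitivity (\sum_(j : J) (0 : R)); first by apply: eq_bigr => j _; exact: E_U_y1.
  by rewrite sumJ mulr0.
have q13 : Q sU (fun j y => dot (dirU j) (tnth y)) = - (n / sw).
  transitivity (\sum_(j : J) - (sw^-1 / 2)); first by apply: eq_bigr => j _; exact: E_U_yU.
  by rewrite sumJ; field; rewrite gt_eqF.
have q14 : Q sU be = 0.
  transitivity (\sum_(j : J) (0 : R)); first by apply: eq_bigr => j _; exact: E_U_be.
  by rewrite sumJ mulr0.
have q15 : Q sU om = - (Ww / sw).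
  transitivity (\sum_(j : J) (- sw^-1 * EE g a (fun _ y => om j y * om j y))); first by apply: eq_bigr => j _; exact: E_U_om.
  by rewrite sumZ mulNr mulrC.
have q23 : Q (fun j y => dot (d1 j) (tnth y)) (fun j y => dot (dirU j) (tnth y)) =
    n * (c / (sz * sw)).
  transitivity (\sum_(j : J) (c / (sz * sw) / 2)); first by apply: eq_bigr => j _; exact: E_y1_yU.
  by rewrite sumJ; field; rewrite !gt_eqF.
have q24 : Q (fun j y => dot (d1 j) (tnth y)) be = n.
  transitivity (\sum_(j : J) (2^-1 : R)); first by apply: eq_bigr => j _; exact: E_y1_be.
  by rewrite sumJ; field.
have q25 : Q (fun j y => dot (d1 j) (tnth y)) om = c / (sz * sw) * Ww.
  transitivity (\sum_(j : J) (c / (sz * sw) * EE g a (fun _ y => om j y * om j y))); first by apply: eq_bigr => j _; exact: E_y1_om.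
  exact: sumZ.
have q34 : Q (fun j y => dot (dirU j) (tnth y)) be = c / (sz * sw) * Bb.
  transitivity (\sum_(j : J) (c / (sz * sw) * EE g a (fun _ y => be j y * be j y))); first by apply: eq_bigr => j _; exact: E_yU_be.
  exact: sumZ.
have q35 : Q (fun j y => dot (dirU j) (tnth y)) om = n.
  transitivity (\sum_(j : J) (2^-1 : R)); first by apply: eq_bigr => j _; exact: E_yU_om.
  by rewrite sumJ; field.
pose YY1 := Q (fun j y => dot (d1 j) (tnth y)) (fun j y => dot (d1 j) (tnth y)).
pose YYU := Q (fun j y => dot (dirU j) (tnth y)) (fun j y => dot (dirU j) (tnth y)).
have YY1n : sz ^+ 2 / sp ^+ 2 * YY1 <= n.
  have -> : YY1 = \sum_(j : J) (2^-1 + avg (fun m => dot (d1 j) (a m) ^+ 2)).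
    by apply: eq_bigr => j _; exact: E_y1_y1.
  by rewrite big_split /= sumJ; exact: received_power_le.
have YYUn : sw ^+ 2 / sq ^+ 2 * YYU <= n.
  have -> : YYU = \sum_(j : J) (2^-1 + avg (fun m => dot (dirU j) (a m) ^+ 2)).
    by apply: eq_bigr => j _; exact: E_yU_yU.
  by rewrite big_split /= sumJ; exact: received_power_le.
have psd (x0 x1 x2 x3 x4 x5 : R) :
  0 <= x0 ^+ 2 * TT + x1 ^+ 2 * UU + x2 ^+ 2 * YY1 + x3 ^+ 2 * YYU + x4 ^+ 2 * Bb
     + x5 ^+ 2 * Ww
   + 2 * (x0 * x1 * TU - x0 * x2 * (n / sz) - x0 * x4 * (Bb / sz)
     - x1 * x3 * (n / sw) - x1 * x5 * (Ww / sw) + x2 * x3 * (n * (c / (sz * sw)))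
     + x2 * x4 * n + x2 * x5 * (c / (sz * sw) * Ww) + x3 * x4 * (c / (sz * sw) * Bb)
     + x3 * x5 * n + x4 * x5 * Bw).
  pose G i k := Q (base i) (base k).
  have GC i k : G i k = G k i by exact: QC.
  have := base_psd (fun i => nth 0 [:: x0; x1; x2; x3; x4; x5] i).
  rewrite (quadratic_form6 x0 x1 x2 x3 x4 x5 GC).
  rewrite (_ : G 0%N 2%N = - (n / sz)); last exact: q02.
  rewrite (_ : G 0%N 3%N = 0); last exact: q03.
  rewrite (_ : G 0%N 4%N = - (Bb / sz)); last exact: q04.
  rewrite (_ : G 0%N 5%N = 0); last exact: q05.
  rewrite (_ : G 1%N 2%N = 0); last exact: q12.
  rewrite (_ : G 1%N 3%N = - (n / sw)); last exact: q13.
  rewrite (_ : G 1%N 4%N = 0); last exact: q14.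
  rewrite (_ : G 1%N 5%N = - (Ww / sw)); last exact: q15.
  rewrite (_ : G 2%N 3%N = n * (c / (sz * sw))); last exact: q23.
  rewrite (_ : G 2%N 4%N = n); last exact: q24.
  rewrite (_ : G 2%N 5%N = c / (sz * sw) * Ww); last exact: q25.
  rewrite (_ : G 3%N 4%N = c / (sz * sw) * Bb); last exact: q34.
  rewrite (_ : G 3%N 5%N = n); last exact: q35.
  rewrite -[G 0%N 0%N]/TT -[G 1%N 1%N]/UU -[G 0%N 1%N]/TU -[G 2%N 2%N]/YY1.
  rewrite -[G 3%N 3%N]/YYU -[G 4%N 4%N]/Bb -[G 5%N 5%N]/Ww -[G 4%N 5%N]/Bw.
  by clearbody TT UU TU YY1 YYU Bb Ww Bw; congr (_ <= _); ring.
have LE : \sum_j (sp ^+ 2 / sz ^+ 2 * EE g a (fun _ y => be j y * be j y) +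
          sq ^+ 2 / sw ^+ 2 * EE g a (fun _ y => om j y * om j y)) =
    sp ^+ 2 / sz ^+ 2 * Bb + sq ^+ 2 / sw ^+ 2 * Ww.
  by rewrite big_split /= !mulr_sumr.
have RE : \sum_j EE g a (fun _ y => sp ^+ 2 * (sT j y * sT j y) + sq ^+ 2 * (sU j y * sU j y)
                          + 2 * c * (sT j y * sU j y)) =
    sp ^+ 2 * TT + sq ^+ 2 * UU + 2 * c * TU.
  rewrite !mulr_sumr -!big_split /=; apply: eq_bigr => j _.
  have gTT (m : M) : gok (fun y => sT j y * sT j y) by apply: gokM; exact: gok_sT.
  have gUU (m : M) : gok (fun y => sU j y * sU j y) by apply: gokM; exact: gok_sU.
  have gTU (m : M) : gok (fun y => sT j y * sU j y).
    by apply: gokM; [exact: gok_sT|exact: gok_sU].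
  have gA (m : M) := gokZ (sp ^+ 2) (gTT m); have gB (m : M) := gokZ (sq ^+ 2) (gUU m).
  have gC (m : M) := gokZ (2 * c) (gTU m); have gAB (m : M) := gokD (gA m) (gB m).
  by rewrite (EED gG a gAB gC) (EED gG a gA gB) !(EEZ gG).
rewrite LE RE.
have spq : 0 < sp * sq by exact: mulr_gt0.
have r01 : 0 <= c / (sp * sq) < 1.
  by rewrite divr_ge0 ?(ltW spq)//= ltr_pdivrMr// mul1r.
(* The normalised score [A = sp sT + (sp / sz) be] is the score less its mean given T alone, and
   likewise [B] for U; c / (sp sq) plays the role of the correlation of the two received signals. *)
have := @score_gram_ineq R n (c / (sp * sq))
  (sp ^+ 2 * TT - sp ^+ 2 / sz ^+ 2 * Bb) (sq ^+ 2 * UU - sq ^+ 2 / sw ^+ 2 * Ww)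
  (sp * sq * TU + sp * sq / (sz * sw) * Bw) (sz ^+ 2 / sp ^+ 2 * YY1) (sw ^+ 2 / sq ^+ 2 * YYU)
  (sp ^+ 2 / sz ^+ 2 * Bb) (sq ^+ 2 / sw ^+ 2 * Ww) (sp * sq / (sz * sw) * Bw)
  r01 n0 YY1n YYUn _.
move=> h; rewrite -subr_ge0.
have -> : sp ^+ 2 * TT + sq ^+ 2 * UU + 2 * c * TU - (sp ^+ 2 / sz ^+ 2 * Bb + sq ^+ 2 / sw ^+ 2 * Ww) =
  sp ^+ 2 * TT - sp ^+ 2 / sz ^+ 2 * Bb + (sq ^+ 2 * UU - sq ^+ 2 / sw ^+ 2 * Ww) +
   2 * (c / (sp * sq)) * (sp * sq * TU + sp * sq / (sz * sw) * Bw)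
   - 2 * (c / (sp * sq)) * (sp * sq / (sz * sw) * Bw).
  by field; rewrite !gt_eqF.
rewrite subr_ge0; apply: h => xA xB xt xu xb xw.
have := psd (xA * sp) (xB * sq) (xt * (sz / sp)) (xu * (sw / sq))
  ((xA + xb) * (sp / sz)) ((xB + xw) * (sq / sw)).
congr (_ <= _); field; rewrite !gt_eqF//.
Qed.

End ScoreInequality.

(** * Slopes in frame coordinates *)

Section FrameDerivative.
Context {R : realType} {N : nat} {M : finType}.
Hypothesis M0 : (0 < #|M|)%N.
Variable g : probability (N.-tuple R) R.
Hypothesis gG : gaussm g.
Implicit Types (a : M -> 'I_N -> R) (y : N.-tuple R) (m : M).

Lemma EE_err_err a (f h : M -> R) :
  EE g a (fun m y => err a f m y * err a h m y) =
  avg (fun m => f m * h m) - EE g a (fun m y => pmean a f y * h m).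
Proof.
have -> : EE g a (fun m y => err a f m y * err a h m y) =
    EE g a (fun m y => err a f m y * h m - err a f m y * pmean a h y).
  by apply: eq_EE => m y; rewrite -mulrBr.
rewrite (EEB gG); last 2 first.
- by move=> m; apply: gokM; [exact: gok_err|exact: gok_cst].
- by move=> m; apply: gokM; [exact: gok_err|exact: gok_pmean].
rewrite (EE_err_obs M0 gG) ?subr0; last exact: gok_pmean.
rewrite -(EE_msg gG a) -(EEB gG); last 2 first.
- by move=> m; exact: gok_cst.
- by move=> m; apply: gokM; [exact: gok_pmean|exact: gok_cst].
by apply: eq_EE => m y; rewrite /err mulrBl.
Qed.

Lemma pmean_sum a (I : finType) (F : I -> M -> R) y :
  pmean a (fun m => \sum_i F i m) y = \sum_i pmean a (F i) y.
Proof.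
rewrite /pmean -mulr_suml; congr (_ / _); rewrite -avg_sum.
by apply: eq_avg => m; rewrite mulr_sumr.
Qed.

Lemma dminfo_comb (K : finType) (d : K -> 'I_N -> R) (x x' : M -> K -> R) :
  orthonormal d ->
  let a := fun m => comb d (x m) in
  dminfo g a (fun m => comb d (x' m)) =
  2 * \sum_k EE g a (fun m y => err a (fun l => x l k) m y * err a (fun l => x' l k) m y).
Proof.
move=> od a; congr (2 * _).
have dE l m : dot (a l) (comb d (x' m)) = \sum_k x l k * x' m k.
  rewrite dot_comb; apply: eq_bigr => k _.
  by rewrite dot_comb_frame.
under eq_avg do rewrite dE; rewrite avg_sum.
have -> : EE g a (fun m y => pmean a (fun l => dot (a l) (comb d (x' m))) y) =
    EE g a (fun m y => \sum_k pmean a (fun l => x l k) y * x' m k).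
  apply: eq_EE => m y; under [X in pmean a X]funext do rewrite dE.
  rewrite pmean_sum; apply: eq_bigr => k _.
  rewrite mulrC -pmeanZ; congr pmean; apply/funext => l; exact: mulrC.
rewrite (EE_sum gG); last by move=> k m; apply: gokM; [exact: gok_pmean|exact: gok_cst].
by rewrite -sumrB; apply: eq_bigr => k _; rewrite EE_err_err.
Qed.

(** The output is known, so the error on the signal along a direction is minus the error on the
    noise along it. *)
Lemma EE_err_nuhat a (v e : 'I_N -> R) :
  EE g a (fun m y => err a (fun l => dot v (a l)) m y * err a (fun l => dot e (a l)) m y) =
  dot v e / 2 - EE g a (fun _ y => nuhat a v y * nuhat a e y).
Proof.
have gn u m : gok (noise a u m) by exact: gok_noise.
have gnu u : gok (nuhat a u) by exact: gok_nuhat.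
have -> : EE g a (fun m y => err a (fun l => dot v (a l)) m y * err a (fun l => dot e (a l)) m y) =
  EE g a (fun m y => nuhat a v y * nuhat a e y - noise a v m y * nuhat a e y
    - (noise a e m y * nuhat a v y - noise a v m y * noise a e m y)).
  by apply: eq_EE => m y; rewrite /err /nuhat /noise; ring.
have g1 (m : M) : gok (fun y => nuhat a v y * nuhat a e y) by exact: gokM.
have g2 m : gok (fun y => noise a v m y * nuhat a e y) by exact: gokM.
have g3 m : gok (fun y => noise a e m y * nuhat a v y) by exact: gokM.
have g4 m : gok (fun y => noise a v m y * noise a e m y) by exact: gokM.
have g12 m := gokB (g1 m) (g2 m); have g34 m := gokB (g3 m) (g4 m).
rewrite (EEB gG a g12 g34) (EEB gG a g1 g2) (EEB gG a g3 g4).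
rewrite (EE_noise_noise M0 gG) -!(EE_nuhat M0 gG)//.
have -> : EE g a (fun _ y => nuhat a e y * nuhat a v y) =
  EE g a (fun _ y => nuhat a v y * nuhat a e y).
  by apply: eq_EE => m y; rewrite mulrC.
by ring.
Qed.

Lemma orthonormal_sum (J : finType) (d1 d2 : J -> 'I_N -> R) :
  orthonormal d1 -> orthonormal d2 -> (forall j l, dot (d1 j) (d2 l) = 0) ->
  orthonormal (fun k : J + J => match k with inl j => d1 j | inr j => d2 j end).
Proof.
move=> o1 o2 o12 [j|j] [l|l]; rewrite ?o1 ?o2 ?o12//.
by rewrite dotC o12.
Qed.

Lemma is_derive_isqrt (f : R -> R) (f' t : R) : 0 < f t -> is_derive t 1 f f' ->
  is_derive t 1 (fun s => (Num.sqrt (f s))^-1) (- f' / (2 * f t * Num.sqrt (f t))).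
Proof.
move=> f0 df.
have s0 : 0 < Num.sqrt (f t) by rewrite sqrtr_gt0.
have d1 := @is_derive1_comp _ (@Num.sqrt R) f _ _ _ (is_derive1_sqrt f0) df.
have d2 := @is_deriveV R (Num.sqrt \o f) t _ 1 (lt0r_neq0 s0) d1.
apply: is_derive_eq.
have E := sqr_sqrtr (ltW f0); rewrite /GRing.scale /=.
move: E s0; set S := Num.sqrt (f t) => E s0.
by rewrite -E; field; rewrite gt_eqF.
Qed.

End FrameDerivative.

(** * Slope of the information of a pair of signals *)

Section PairSlope.
Context {R : realType} {N : nat} {M J : finType}.
Hypothesis M0 : (0 < #|M|)%N.
Variable g : probability (N.-tuple R) R.
Hypothesis gG : gaussm g.
Variable mix : M -> M -> M.
Hypothesis mixP : forall f : M -> R, avg (fun w => avg (fun v => f (mix w v))) = avg f.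

(** On a scaling path the velocity is s' / s times the signal, so the slope is a mean square error:
    the noise variance less the variance of its estimate. That estimate may be evaluated in the
    larger family [a], since it depends on the projected output only. *)
Lemma marg_dminfo (a : M -> 'I_N -> R) (d : J -> 'I_N -> R) (x : M -> J -> R) (s s' : R) :
  orthonormal d -> s != 0 -> (forall m j, dot (d j) (a m) = s * x m j) ->
  dminfo g (fun m => comb d (fun j => s * x m j)) (fun m => comb d (fun j => s' * x m j)) =
  2 * (s' / s) * (#|J|%:R / 2 - \sum_j EE g a (fun _ y => beta a d j y * beta a d j y)).
Proof.
move=> od s0 ax; rewrite dminfo_comb// -mulrA; congr (2 * _).
pose b m := comb d (fun j => s * x m j).
have mb : marg a d = b.
  by apply/funext => m; rewrite /marg /b; congr comb; apply/funext => j; exact: ax.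
have dEb j m : dot (d j) (b m) = s * x m j by rewrite dot_comb_frame.
rewrite -[X in _ = _ * (X - _)]mulr1 -[X in _ = _ * (X - _)]mulr1.
have -> : #|J|%:R / 2 * 1 * 1 = \sum_(j : J) (2^-1 : R).
  by rewrite sumr_const !mulr1 -[RHS]mulr_natl.
rewrite -sumrB mulr_sumr; apply: eq_bigr => j _.
have bE : beta a d j = nuhat b (d j).
  apply/funext => y; rewrite /beta mb /nuhat; congr (_ - pmean _ _ _).
  by apply/funext => m; rewrite dEb ax.
have -> : EE g a (fun _ y => beta a d j y * beta a d j y) =
    EE g b (fun _ y => nuhat b (d j) y * nuhat b (d j) y).
  have gbb : gok (fun y => beta a d j y * beta a d j y) by apply: gokM; exact: gok_beta.
  have dbb : depends_on d (fun y => beta a d j y * beta a d j y).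
    by move=> e y de; rewrite !(depends_on_beta a j y de).
  transitivity (EE g a (fun _ y => 1 * (beta a d j y * beta a d j y))).
    by apply: eq_EE => m y; rewrite mul1r.
  rewrite (EE_marg gG a od (fun=> 1) gbb dbb) mb.
  by apply: eq_EE => m y; rewrite mul1r bE.
have -> : 2^-1 - EE g b (fun _ y => nuhat b (d j) y * nuhat b (d j) y) =
  EE g b (fun m y => err b (fun l => s * x l j) m y * err b (fun l => s * x l j) m y).
  have := EE_err_nuhat M0 gG b (d j) (d j); rewrite od eqxx mul1r => <-.
  apply: eq_EE => m y; congr (err b _ m y * err b _ m y);
    by apply/funext => l; rewrite dEb.
rewrite -(EEZ gG); last by move=> m; apply: gokM; exact: gok_err.
apply: eq_EE => m y; rewrite mulrCA; congr (_ * _).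
by rewrite /err !pmeanZ; field.
Qed.

(** The projected signal follows the first argument of [mix] and [f] the second, so the expectation
    factorises and the centred factor vanishes; [EE_indep'] exchanges the roles. *)
Lemma EE_indep (a : M -> 'I_N -> R) (d : J -> 'I_N -> R) (f : M -> R) k :
  orthonormal d -> gok k -> depends_on d k ->
  (forall w v, marg a d (mix w v) = marg a d w) -> (forall w v, f (mix w v) = f v) ->
  avg f = 0 -> EE g a (fun m y => f m * k y) = 0.
Proof.
move=> od gk dk md fv f0.
rewrite (EE_marg gG a od f gk dk) (EE_shift gG); last first.
  by move=> m; apply: gokM => //; exact: gok_cst.
rewrite -mixP -[RHS](avg_cst M0); apply: eq_avg => w.
transitivity (avg (fun v => Ex g (fun y => k (tadd (marg a d w) y)) * f v)).
  apply: eq_avg => v; rewrite md fv (ExZ gG) ?(mulrC (f v))//.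
  exact: gok_tadd.
by rewrite avgZ f0 mulr0.
Qed.

Lemma EE_indep' (a : M -> 'I_N -> R) (d : J -> 'I_N -> R) (f : M -> R) k :
  orthonormal d -> gok k -> depends_on d k ->
  (forall w v, marg a d (mix w v) = marg a d v) -> (forall w v, f (mix w v) = f w) ->
  avg f = 0 -> EE g a (fun m y => f m * k y) = 0.
Proof.
move=> od gk dk md fv f0.
rewrite (EE_marg gG a od f gk dk) (EE_shift gG); last first.
  by move=> m; apply: gokM => //; exact: gok_cst.
rewrite -mixP.
transitivity (avg (fun w => avg (fun v => Ex g (fun y => k (tadd (marg a d v) y))) * f w)).
  apply: eq_avg => w; rewrite mulrC -avgZ; apply: eq_avg => v; rewrite md fv (ExZ gG)//.
  exact: gok_tadd.
by rewrite avgZ f0 mulr0.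
Qed.

Variables (d1 d2 : J -> 'I_N -> R).
Hypotheses (od1 : orthonormal d1) (od2 : orthonormal d2).
Hypothesis d12 : forall j l, dot (d1 j) (d2 l) = 0.
Variables (Xs Is : M -> J -> R).
Hypotheses (mixX : forall w v, Xs (mix w v) = Xs w) (mixI : forall w v, Is (mix w v) = Is v).
Hypotheses (X0 : forall j, avg (fun m => Xs m j) = 0) (I0 : forall j, avg (fun m => Is m j) = 0).
Variables (n P Q c : R).
Hypothesis Jn : #|J|%:R = 2 * n.
Hypothesis XP : \sum_j avg (fun m => Xs m j ^+ 2) <= n * P.
Hypothesis IQ : \sum_j avg (fun m => Is m j ^+ 2) <= n * Q.
Hypotheses (P0 : 0 <= P) (Q0 : 0 <= Q) (c0 : 0 <= c).

(** A whitened pair. The second coordinate carries a negative multiple of X because decorrelating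
    the noises subtracts part of the first observation. *)
Definition pairfam (s t u : R) m : 'I_N -> R :=
  fun i => comb d1 (fun j => s * Xs m j) i + comb d2 (fun j => t * Is m j - u * Xs m j) i.

Lemma dot_d1_pairfam s t u m j : dot (d1 j) (pairfam s t u m) = s * Xs m j.
Proof.
rewrite /pairfam dotDr dot_comb_frame// dotC dot_comb big1 ?addr0// => l _.
by rewrite dotC d12 mulr0.
Qed.

Lemma dot_d2_pairfam s t u m j : dot (d2 j) (pairfam s t u m) = t * Is m j - u * Xs m j.
Proof.
rewrite /pairfam dotDr dot_comb_frame// dotC dot_comb big1 ?add0r// => l _.
by rewrite d12 mulr0.
Qed.

Definition pairframe (k : J + J) : 'I_N -> R :=
  match k with inl j => d1 j | inr j => d2 j end.

Definition pairsig (s t u : R) m (k : J + J) : R :=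
  match k with inl j => s * Xs m j | inr j => t * Is m j - u * Xs m j end.

Lemma pairfamE s t u m : pairfam s t u m = comb pairframe (pairsig s t u m).
Proof. by apply/funext => i; rewrite /pairfam /comb big_sumType. Qed.

Variables (r z w : R).
Hypotheses (r0 : 0 < r) (z0 : 0 < z) (w0 : 0 < w) (czw : c ^+ 2 < z * w).
Let p := z + r ^+ 2 * P.
Let q := w + r ^+ 2 * Q.
Let dl := w - c ^+ 2 / z.
Let sz := Num.sqrt z.
Let sw := Num.sqrt w.
Let sd := Num.sqrt dl.
(** [e'] and [f'] are the velocities of [r / sd] and [c / z * (r / sd)] when the noise variances
    move so that [p], [q] and [c] stay fixed. *)
Let e' := (q - 2 * c ^+ 2 / z + p * c ^+ 2 / z ^+ 2) / (dl * sd).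
Let f' := c / z * e' + 2 * r * P * c / z ^+ 2 * (r / sd).
Let a := pairfam (r / sz) (r / sd) (c / z * (r / sd)).
Let a' := pairfam (p / (z * sz)) e' f'.

(** The slope of the joint information less the slopes of the two observations taken alone. In terms
    of noise estimates the joint slope contains the quadratic form bounded in [score_ineq], and the
    single slopes contain its lower bound. *)
Lemma pair_slope :
  dminfo g a a'
  - 2 * (p / (r * z)) * (n - \sum_j EE g a (fun _ y => beta a d1 j y * beta a d1 j y))
  - 2 * (q / (r * w)) * (n - \sum_j EE g a (fun _ y =>
        beta a (dirU d1 d2 sz sd sw c) j y * beta a (dirU d1 d2 sz sd sw c) j y))
  <= n * (2 / r) * ((p * w + q * z - 2 * c ^+ 2) / (z * w - c ^+ 2) - p / z - q / w).
Proof.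
have dl0 : 0 < dl by rewrite /dl subr_gt0 ltr_pdivrMr// mulrC.
have sz0 : 0 < sz by rewrite sqrtr_gt0.
have sw0 : 0 < sw by rewrite sqrtr_gt0.
have sd0 : 0 < sd by rewrite sqrtr_gt0.
have szE : sz ^+ 2 = z by rewrite sqr_sqrtr// ltW.
have swE : sw ^+ 2 = w by rewrite sqr_sqrtr// ltW.
have sdE : sd ^+ 2 = dl by rewrite sqr_sqrtr// ltW.
have p0 : 0 < p by rewrite /p ltr_wpDr// mulr_ge0 ?sqr_ge0.
have q0 : 0 < q by rewrite /q ltr_wpDr// mulr_ge0 ?sqr_ge0.
pose sp := Num.sqrt p; pose sq := Num.sqrt q.
have sp0 : 0 < sp by rewrite sqrtr_gt0.
have sq0 : 0 < sq by rewrite sqrtr_gt0.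
have spE : sp ^+ 2 = p by rewrite sqr_sqrtr// ltW.
have sqE : sq ^+ 2 = q by rewrite sqr_sqrtr// ltW.
have cpq : c < sp * sq.
  have spq : 0 <= sp * sq by rewrite mulr_ge0 ?sqrtr_ge0.
  rewrite -ltr_sqr ?nnegrE// exprMn spE sqE.
  apply: lt_le_trans czw _; apply: ler_pM; rewrite ?(ltW z0) ?(ltW w0)//.
    by rewrite /p lerDl mulr_ge0 ?sqr_ge0.
  by rewrite /q lerDl mulr_ge0 ?sqr_ge0.
have swE' : sw ^+ 2 = sd ^+ 2 + c ^+ 2 / sz ^+ 2 by rewrite swE sdE szE /dl subrK.
have aU m j : dot (dirU d1 d2 sz sd sw c j) (a m) = r / sw * Is m j.
  rewrite dotC dot_comb2 ![dot (a m) _]dotC dot_d1_pairfam dot_d2_pairfam -szE.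
  by field; rewrite !gt_eqF.
have a1 m j : dot (d1 j) (a m) = r / sz * Xs m j by exact: dot_d1_pairfam.
have avgsq (k : R) (x : M -> J -> R) : \sum_j avg (fun m => (k * x m j) ^+ 2) =
    k ^+ 2 * \sum_j avg (fun m => x m j ^+ 2).
  rewrite mulr_sumr; apply: eq_bigr => j _; rewrite -avgZ.
  by apply: eq_avg => m; rewrite exprMn.
have H1 : \sum_j avg (fun m => dot (d1 j) (a m) ^+ 2) <= n * (sp ^+ 2 / sz ^+ 2 - 1).
  under eq_bigr do under eq_avg do rewrite a1.
  rewrite avgsq; apply: le_trans (ler_wpM2l (sqr_ge0 _) XP) _.
  rewrite spE /p -szE le_eqVlt; apply/orP; left; apply/eqP.
  by field; rewrite gt_eqF.
have HU : \sum_j avg (fun m => dot (dirU d1 d2 sz sd sw c j) (a m) ^+ 2) <=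
    n * (sq ^+ 2 / sw ^+ 2 - 1).
  under eq_bigr do under eq_avg do rewrite aU.
  rewrite avgsq; apply: le_trans (ler_wpM2l (sqr_ge0 _) IQ) _.
  rewrite sqE /q -swE le_eqVlt; apply/orP; left; apply/eqP.
  by field; rewrite gt_eqF.
have oU := orthonormal_dirU od1 od2 d12 sz0 sw0 swE'.
have HU1 k j : gok k -> depends_on d1 k ->
    EE g a (fun m y => dot (dirU d1 d2 sz sd sw c j) (a m) * k y) = 0.
  move=> gk dk; apply: (EE_indep od1 gk dk).
  - move=> w1 v; rewrite /marg; congr comb; apply/funext => l.
    by rewrite !a1 mixX.
  - by move=> w1 v; rewrite !aU mixI.
  - by under eq_avg do rewrite aU; rewrite avgZ I0 mulr0.
have H1U k j : gok k -> depends_on (dirU d1 d2 sz sd sw c) k ->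
    EE g a (fun m y => dot (d1 j) (a m) * k y) = 0.
  move=> gk dk; apply: (EE_indep' oU gk dk).
  - move=> w1 v; rewrite /marg; congr comb; apply/funext => l.
    by rewrite !aU mixI.
  - by move=> w1 v; rewrite !a1 mixX.
  - by under eq_avg do rewrite a1; rewrite avgZ X0 mulr0.
have S := score_ineq M0 gG od1 od2 d12 sz0 sd0 sw0 sp0 sq0 c0 cpq swE' Jn H1 HU HU1 H1U.
rewrite spE szE sqE swE in S.
pose n1 j := nuhat a (d1 j); pose n2 j := nuhat a (d2 j).
(* Entries of the triangular matrix that sends the signal to its velocity in the frame [d1],
   [d2]. *)
pose G11 := p / (r * z); pose G22 := (q - 2 * c ^+ 2 / z + p * c ^+ 2 / z ^+ 2) / (r * dl).
pose G21 := - (2 * c * r * P / (z * (sz * sd))).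
have gn v : gok (nuhat a v) by exact: gok_nuhat.
have gnn v e (m : M) : gok (fun y => nuhat a v y * nuhat a e y) by exact: gokM.
have D : dminfo g a a' =
   2 * \sum_j (G11 * (2^-1 - EE g a (fun _ y => n1 j y * n1 j y))
             - G21 * EE g a (fun _ y => n1 j y * n2 j y)
             + G22 * (2^-1 - EE g a (fun _ y => n2 j y * n2 j y))).
  have aE : a = fun m => comb pairframe (pairsig (r / sz) (r / sd) (c / z * (r / sd)) m).
    by apply/funext => m; exact: pairfamE.
  have a'E : a' = fun m => comb pairframe (pairsig (p / (z * sz)) e' f' m).
    by apply/funext => m; exact: pairfamE.
  have osum := orthonormal_sum od1 od2 d12.
  have := @dminfo_comb _ _ _ M0 g gG _ pairframe
     (pairsig (r / sz) (r / sd) (c / z * (r / sd))) (pairsig (p / (z * sz)) e' f') osum.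
  rewrite -aE -a'E /= => ->; congr (2 * _).
  rewrite big_sumType /= -big_split /=; apply: eq_bigr => j _.
  have d1f : (fun l => r / sz * Xs l j) = fun l => dot (d1 j) (a l).
    by apply/funext => l; rewrite a1.
  have d2f : (fun l => r / sd * Is l j - c / z * (r / sd) * Xs l j) = fun l => dot (d2 j) (a l).
    by apply/funext => l; rewrite dot_d2_pairfam.
  have errZ (k : R) (f : M -> R) m y : err a (fun l => k * f l) m y = k * err a f m y.
    by rewrite /err pmeanZ mulrBr.
  have errD (f h : M -> R) m y : err a (fun l => f l + h l) m y = err a f m y + err a h m y.
    by rewrite /err pmeanD; ring.
  have e1 : (fun l => p / (z * sz) * Xs l j) = fun l => G11 * dot (d1 j) (a l).
    apply/funext => l; rewrite a1 /G11 -szE; field; by rewrite !gt_eqF.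
  have e2 : (fun l => e' * Is l j - f' * Xs l j) =
      fun l => G21 * dot (d1 j) (a l) + G22 * dot (d2 j) (a l).
    apply/funext => l; rewrite a1 dot_d2_pairfam /G21 /G22 /f' /e' -sdE -szE.
    by field; rewrite !gt_eqF.
  rewrite d1f d2f e1 e2.
  have gE v e m : gok (fun y => err a (fun l => dot v (a l)) m y * err a (fun l => dot e (a l)) m y).
    by apply: gokM; exact: gok_err.
  transitivity (G11 * EE g a (fun m y => err a (fun l => dot (d1 j) (a l)) m y *
       err a (fun l => dot (d1 j) (a l)) m y) +
     (G21 * EE g a (fun m y => err a (fun l => dot (d1 j) (a l)) m y *
       err a (fun l => dot (d2 j) (a l)) m y) +
     G22 * EE g a (fun m y => err a (fun l => dot (d2 j) (a l)) m y *
       err a (fun l => dot (d2 j) (a l)) m y))).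
    congr (_ + _).
      rewrite -(EEZ gG)//; apply: eq_EE => m y; by rewrite errZ; ring.
    rewrite -!(EEZ gG)// -(EED gG); try by move=> m; apply: gokZ.
    by apply: eq_EE => m y; rewrite errD !errZ; ring.
  rewrite !(EE_err_nuhat M0 gG) od1 od2 d12 !eqxx /= /n1 /n2.
  by ring.
have T j : EE g a (fun _ y => p * (sT d1 d2 sz sd c a j y * sT d1 d2 sz sd c a j y)
      + q * (sU d1 d2 sd a j y * sU d1 d2 sd a j y)
      + 2 * c * (sT d1 d2 sz sd c a j y * sU d1 d2 sd a j y)) =
   r * (G11 * EE g a (fun _ y => n1 j y * n1 j y) + G21 * EE g a (fun _ y => n1 j y * n2 j y)
        + G22 * EE g a (fun _ y => n2 j y * n2 j y)).
  have g11 := gnn (d1 j) (d1 j); have g12 := gnn (d1 j) (d2 j).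
  have g22 := gnn (d2 j) (d2 j).
  have h1 (m : M) := gokZ G11 (g11 m); have h2 (m : M) := gokZ G21 (g12 m).
  have h3 (m : M) := gokZ G22 (g22 m); have h12 (m : M) := gokD (h1 m) (h2 m).
  have h123 (m : M) := gokD (h12 m) (h3 m).
  rewrite -(EEZ gG a G11 g11) -(EEZ gG a G21 g12) -(EEZ gG a G22 g22).
  rewrite -(EED gG a h1 h2) -(EED gG a h12 h3) -(EEZ gG a r h123).
  apply: eq_EE => m y; rewrite /sT /sU /vT /vU !nuhat_comb /G11 /G21 /G22 -/(n1 j y) -/(n2 j y).
  rewrite -sdE /p -!szE; field; by rewrite !gt_eqF.
move: S; rewrite (eq_bigr _ (fun j _ => T j)) D => S.
pose Bb := \sum_j EE g a (fun _ y => beta a d1 j y * beta a d1 j y).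
pose Ww := \sum_j EE g a (fun _ y => beta a (dirU d1 d2 sz sd sw c) j y *
  beta a (dirU d1 d2 sz sd sw c) j y).
pose ST := \sum_j (G11 * EE g a (fun _ y => n1 j y * n1 j y)
  + G21 * EE g a (fun _ y => n1 j y * n2 j y) + G22 * EE g a (fun _ y => n2 j y * n2 j y)).
have SE : p / z * Bb + q / w * Ww <= r * ST.
  by rewrite !mulr_sumr -big_split /=; exact: S.
have -> : \sum_j (G11 * (2^-1 - EE g a (fun _ y => n1 j y * n1 j y))
             - G21 * EE g a (fun _ y => n1 j y * n2 j y)
             + G22 * (2^-1 - EE g a (fun _ y => n2 j y * n2 j y))) = n * (G11 + G22) - ST.
  have -> : n * (G11 + G22) = \sum_(j : J) ((G11 + G22) / 2).
    by rewrite sumr_const -[RHS]mulr_natl Jn; field.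
  by rewrite -sumrB; apply: eq_bigr => j _; ring.
suff : 2 * (n * (G11 + G22) - ST) - 2 * (p / (r * z)) * (n - Bb)
    - 2 * (q / (r * w)) * (n - Ww) <=
  n * (2 / r) * ((p * w + q * z - 2 * c ^+ 2) / (z * w - c ^+ 2) - p / z - q / w) by exact.
have zwc : 0 < z * w - c ^+ 2 by rewrite subr_gt0.
have -> : n * (2 / r) * ((p * w + q * z - 2 * c ^+ 2) / (z * w - c ^+ 2) - p / z - q / w) =
   2 * (n * (G11 + G22)) - 2 * (p / (r * z)) * n - 2 * (q / (r * w)) * n.
  rewrite /G11 /G22 /dl; field.
  by rewrite !gt_eqF//= mulrC.
have h : 2 / r * (p / z * Bb + q / w * Ww) <= 2 * ST.
  have := ler_wpM2l (_ : 0 <= 2 / r) SE; rewrite mulrA divfK ?gt_eqF//.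
  by apply; rewrite divr_ge0// ltW.
have e1 : 2 / r * (p / z * Bb + q / w * Ww) = 2 * (p / (r * z)) * Bb + 2 * (q / (r * w)) * Ww.
  by field; rewrite !gt_eqF.
rewrite e1 -subr_ge0 in h; rewrite -subr_ge0; move: h.
by congr (_ <= _); ring.
Qed.

End PairSlope.

(** * Amplitudes along the path of constant received power *)

Section NoiseProfile.
Context {R : realType}.
Variables z P : R.

(** The noise variance that keeps the received power at [z + P] when the signal is scaled by [s];
    [amp] is the resulting amplitude in unit noise. *)
Definition nvar (s : R) : R := z + (1 - s ^+ 2) * P.

Lemma is_derive_nvar (s : R) : is_derive s 1 nvar (- (2 * s * P)).
Proof. by apply: is_derive_eq; rewrite /GRing.scale /=; ring. Qed.

Lemma is_derive_nvarV (s : R) : 0 < nvar s ->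
  is_derive s 1 (fun s : R => (nvar s)^-1) (2 * s * P * (nvar s)^-1 ^+ 2).
Proof.
move=> n0; have h := is_derive_nvar s.
have := @is_deriveV R nvar s _ 1 (lt0r_neq0 n0) h => d.
by apply: is_derive_eq; rewrite /GRing.scale /= exprVn; ring.
Qed.

Lemma is_derive_nvar_isqrt (s : R) : 0 < nvar s ->
  is_derive s 1 (fun s : R => (Num.sqrt (nvar s))^-1)
    (s * P * ((nvar s)^-1 * (Num.sqrt (nvar s))^-1)).
Proof.
move=> n0; have d := is_derive_isqrt n0 (is_derive_nvar s).
have s0 : 0 < Num.sqrt (nvar s) by rewrite sqrtr_gt0.
by apply: is_derive_eq; field; rewrite !gt_eqF.
Qed.

Definition amp s : R := s * (Num.sqrt (nvar s))^-1.
Definition amp' s : R := (nvar s + s ^+ 2 * P) * ((nvar s)^-1 * (Num.sqrt (nvar s))^-1).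

Lemma is_derive_amp (s : R) : 0 < nvar s -> is_derive s 1 amp (amp' s).
Proof.
move=> n0; have d := is_derive_nvar_isqrt n0.
have s0 : 0 < Num.sqrt (nvar s) by rewrite sqrtr_gt0.
apply: is_derive_eq; rewrite /GRing.scale /= /amp'; field.
by rewrite !gt_eqF.
Qed.

Lemma continuous_amp' s : 0 < nvar s -> {for s, continuous amp'}.
Proof.
move=> n0; apply: differentiable_continuous; apply/derivable1_diffP.
have d1 := is_derive_nvar s; have d2 := is_derive_nvarV n0.
have d3 := is_derive_nvar_isqrt n0.
by apply: ex_derive.
Qed.

End NoiseProfile.

(** * Amplitudes of the whitened pair along the path *)

Section PairProfile.
Context {R : realType}.
Variables z P w Q c : R.

(** The variance of the second noise given the first; their covariance [c] does not move. *)
Definition cvar (s : R) : R := nvar w Q s - c ^+ 2 * (nvar z P s)^-1.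
Let cvar' (s : R) : R := - (2 * s * Q) - c ^+ 2 * (2 * s * P * (nvar z P s)^-1 ^+ 2).

Lemma is_derive_cvar (s : R) : 0 < nvar z P s -> is_derive s 1 cvar (cvar' s).
Proof.
move=> n0; have d1 := is_derive_nvarV n0; have d2 := is_derive_nvar w Q s.
by apply: is_derive_eq; rewrite /GRing.scale /= /cvar'; ring.
Qed.

Definition ampU s : R := s * (Num.sqrt (cvar s))^-1.
Definition ampU' s : R :=
  (nvar w Q s + s ^+ 2 * Q - 2 * c ^+ 2 * (nvar z P s)^-1
   + (nvar z P s + s ^+ 2 * P) * c ^+ 2 * (nvar z P s)^-1 ^+ 2)
  * ((cvar s)^-1 * (Num.sqrt (cvar s))^-1).
Definition ampX s : R := c * (nvar z P s)^-1 * ampU s.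
Definition ampX' s : R := c * (nvar z P s)^-1 * ampU' s
  + 2 * s * P * c * (nvar z P s)^-1 ^+ 2 * ampU s.

Let is_derive_cvarV (s : R) : 0 < nvar z P s -> 0 < cvar s ->
  is_derive s 1 (fun s : R => (cvar s)^-1) (- cvar' s * (cvar s)^-1 ^+ 2).
Proof.
move=> n0 k0; have h := is_derive_cvar n0.
have := @is_deriveV R cvar s _ 1 (lt0r_neq0 k0) h => d.
by apply: is_derive_eq; rewrite /GRing.scale /= exprVn; ring.
Qed.

Let is_derive_cvar_isqrt (s : R) : 0 < nvar z P s -> 0 < cvar s ->
  is_derive s 1 (fun s : R => (Num.sqrt (cvar s))^-1)
    (- cvar' s / 2 * ((cvar s)^-1 * (Num.sqrt (cvar s))^-1)).
Proof.
move=> n0 k0; have d := is_derive_isqrt k0 (is_derive_cvar n0).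
have s0 : 0 < Num.sqrt (cvar s) by rewrite sqrtr_gt0.
by apply: is_derive_eq; field; rewrite !gt_eqF.
Qed.

Lemma is_derive_ampU (s : R) : 0 < nvar z P s -> 0 < cvar s -> is_derive s 1 ampU (ampU' s).
Proof.
move=> n0 k0; have d := is_derive_cvar_isqrt n0 k0.
have s0 : 0 < Num.sqrt (cvar s) by rewrite sqrtr_gt0.
apply: is_derive_eq; rewrite /GRing.scale /= /ampU' /cvar'.
have -> : nvar w Q s = cvar s + c ^+ 2 * (nvar z P s)^-1 by rewrite /cvar subrK.
by field; rewrite !gt_eqF.
Qed.

Lemma is_derive_ampX (s : R) : 0 < nvar z P s -> 0 < cvar s -> is_derive s 1 ampX (ampX' s).
Proof.
move=> n0 k0; have d := is_derive_ampU n0 k0; have d2 := is_derive_nvarV n0.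
by apply: is_derive_eq; rewrite /GRing.scale /= /ampX'; ring.
Qed.

Lemma continuous_ampU' s : 0 < nvar z P s -> 0 < cvar s -> {for s, continuous ampU'}.
Proof.
move=> n0 k0; apply: differentiable_continuous; apply/derivable1_diffP.
have d1 := is_derive_nvar z P s; have d1' := is_derive_nvar w Q s.
have d2 := is_derive_nvarV n0; have d3 := is_derive_cvarV n0 k0.
have d4 := is_derive_cvar_isqrt n0 k0.
by apply: ex_derive.
Qed.

Lemma continuous_ampX' s : 0 < nvar z P s -> 0 < cvar s -> {for s, continuous ampX'}.
Proof.
move=> n0 k0; have d := is_derive_ampU n0 k0; have d2 := is_derive_nvarV n0.
have cU' := continuous_ampU' n0 k0.
have cV : {for s, continuous (fun s => (nvar z P s)^-1)}.
  by apply: differentiable_continuous; apply/derivable1_diffP; exact: ex_derive.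
have cU : {for s, continuous ampU}.
  by apply: differentiable_continuous; apply/derivable1_diffP; exact: ex_derive.
have cW : {for s, continuous (fun s : R => 2 * s * P * c * (nvar z P s)^-1 ^+ 2)}.
  by apply: differentiable_continuous; apply/derivable1_diffP; apply: ex_derive.
have cX : {for s, continuous (fun s : R => c * (nvar z P s)^-1)}.
  by apply: differentiable_continuous; apply/derivable1_diffP; apply: ex_derive.
exact: (cvgD (cvgM cX cU') (cvgM cW cU)).
Qed.

End PairProfile.

Lemma pair_slope_arith {R : realFieldType} (n x z w P Q c D B W : R) :
  0 < x -> 0 < z -> 0 < w -> 0 < z * w - c ^+ 2 ->
  let p := z + x ^+ 2 * P in let q := w + x ^+ 2 * Q in
  D - 2 * (p / (x * z)) * (n - B) - 2 * (q / (x * w)) * (n - W) <=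
  n * (2 / x) * ((p * w + q * z - 2 * c ^+ 2) / (z * w - c ^+ 2) - p / z - q / w) ->
  0 <= n * (- (2 * x * P) / z - 2 * x * Q / w
     + (2 * x * P * w + 2 * x * Q * z) / (z * w - c ^+ 2))
     - D + 2 * (p / (x * z)) * (n - B) + 2 * (q / (x * w)) * (n - W).
Proof.
move=> x0 z0 w0 h0 p q; rewrite -subr_ge0; congr (_ <= _).
by rewrite /p /q; field; rewrite !gt_eqF.
Qed.

Lemma pair_info_arith {R : realFieldType} (n a b c d e f A B C : R) :
  n * (a + b - c) - 0 + 0 + 0 <= n * (d + e - f) - A + B + C ->
  A - B - C <= n * (c - f - (a - d) - (b - e)).
Proof.
by move=> h; rewrite -subr_ge0; move: h; rewrite -subr_ge0; congr (_ <= _); ring.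
Qed.

(** * The information inequality for a pair in correlated noise *)

Section PairInfo.
Context {R : realType} {N : nat} {M J : finType}.
Hypothesis M0 : (0 < #|M|)%N.
Variable g : probability (N.-tuple R) R.
Hypothesis gG : gaussm g.

Lemma minfo0 : minfo g (fun (_ : M) (_ : 'I_N) => 0) = 0.
Proof.
have d0 e : dot (fun=> 0 : R) e = 0 :> R by rewrite /dot big1// => i _; rewrite mul0r.
have p1 y : mixt (fun (_ : M) (_ : 'I_N) => 0) y = 1 :> R.
  rewrite -[RHS](avg_cst M0); apply: eq_avg => m.
  by rewrite /lik !d0 mulr0 subrr expR0.
rewrite /minfo [X in _ - X](_ : _ = 0); last first.
  by rewrite -[RHS](Ex_cst g 0); apply: eq_Ex => y; rewrite p1 ln1 mulr0.
by rewrite subr0 -[RHS](avg_cst M0); apply: eq_avg => m; rewrite d0.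
Qed.

Lemma combZ (d : J -> 'I_N -> R) (k : R) (x : J -> R) i :
  comb d (fun j => k * x j) i = k * comb d x i.
Proof. by rewrite /comb mulr_sumr; apply: eq_bigr => j _; rewrite mulrA. Qed.

Lemma is_derive_scale_path (d : J -> 'I_N -> R) (x : M -> J -> R) (k k' : R -> R) (r p q : R) :
  p < r < q -> (forall t : R, p < t < q -> is_derive t 1 k (k' t)) ->
  {for r, continuous k'} ->
  is_derive r 1 (fun t => minfo g (fun m => comb d (fun j => k t * x m j)))
    (dminfo g (fun m => comb d (fun j => k r * x m j)) (fun m => comb d (fun j => k' r * x m j))).
Proof.
move=> prq dk ck.
apply: (is_derive_path M0 gG (a := fun t m => comb d (fun j => k t * x m j))
  (a' := fun t m => comb d (fun j => k' t * x m j)) prq).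
- move=> t m i /dk h; rewrite combZ.
  under [X in is_derive _ _ X]eq_fun do rewrite combZ.
  by apply: is_derive_eq; rewrite /GRing.scale /=; ring.
- move=> m i; under [X in {for _, continuous X}]eq_fun do rewrite combZ.
  by apply: cvgM => //; exact: cvg_cst.
Qed.

Variable mix : M -> M -> M.
Hypothesis mixP : forall f : M -> R, avg (fun w => avg (fun v => f (mix w v))) = avg f.
Variables (d1 d2 d3 : J -> 'I_N -> R).
Hypotheses (od1 : orthonormal d1) (od2 : orthonormal d2) (od3 : orthonormal d3).
Hypotheses (d12 : forall j l, dot (d1 j) (d2 l) = 0)
  (d13 : forall j l, dot (d1 j) (d3 l) = 0) (d23 : forall j l, dot (d2 j) (d3 l) = 0).
Variables (Xs Is : M -> J -> R).
Hypotheses (mixX : forall w v, Xs (mix w v) = Xs w) (mixI : forall w v, Is (mix w v) = Is v).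
Hypotheses (X0 : forall j, avg (fun m => Xs m j) = 0) (I0 : forall j, avg (fun m => Is m j) = 0).
Variables (n P Q c z w : R).
Hypothesis Jn : #|J|%:R = 2 * n.
Hypothesis XP : \sum_j avg (fun m => Xs m j ^+ 2) <= n * P.
Hypothesis IQ : \sum_j avg (fun m => Is m j ^+ 2) <= n * Q.
Hypotheses (P0 : 0 <= P) (Q0 : 0 <= Q) (c0 : 0 <= c) (z0 : 0 < z) (w0 : 0 < w).
Hypothesis czw : c ^+ 2 < z * w.

(** A margin beyond s = 1, needed for a derivative at that end point: while s^2 < 1 + [ka] the noise
    covariance stays positive definite. *)
Let ka := (z * w - c ^+ 2) / (P * w + Q * z + 1).
Let zf := nvar z P.
Let wf := nvar w Q.

Lemma nvar_dom (s : R) : -1 < s < Num.sqrt (1 + ka) ->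
  [/\ 0 < zf s, 0 < wf s & c ^+ 2 < zf s * wf s].
Proof.
move=> /andP[s1 s2].
have D0 : 0 < P * w + Q * z + 1 by rewrite ltr_wpDl// addr_ge0// mulr_ge0// ltW.
have ka0 : 0 < ka by rewrite divr_gt0// subr_gt0.
have s2k : s ^+ 2 < 1 + ka.
  have [s0|s0] := lerP 0 s.
    rewrite -[X in _ < X]sqr_sqrtr; last by rewrite addr_ge0// ltW.
    by rewrite ltr_sqr ?nnegrE// sqrtr_ge0.
  nra.
have kaE : ka * (P * w + Q * z + 1) = z * w - c ^+ 2 by rewrite /ka divfK// gt_eqF.
set u := 1 - s ^+ 2.
have uk : - ka < u by rewrite /u; lra.
have [u0|u0] := lerP 0 u.
  have h1 : z <= zf s by rewrite /zf /nvar -/u lerDl mulr_ge0.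
  have h2 : w <= wf s by rewrite /wf /nvar -/u lerDl mulr_ge0.
  split; [exact: lt_le_trans h1|exact: lt_le_trans h2|].
  by apply: lt_le_trans czw _; apply: ler_pM => //; exact: ltW.
have Pw : 0 <= P * w by rewrite mulr_ge0// ltW.
have Qz : 0 <= Q * z by rewrite mulr_ge0// ltW.
have uD : c ^+ 2 < z * w + u * (P * w + Q * z).
  have : - ka * (P * w + Q * z + 1) < u * (P * w + Q * z + 1) by rewrite ltr_pM2r.
  rewrite mulNr kaE => h; have : u * (P * w + Q * z + 1) <= u * (P * w + Q * z) by nra.
  by lra.
have c20 : 0 <= c ^+ 2 by exact: sqr_ge0.
have hz : 0 < z + u * P.
  have : 0 < (z + u * P) * w by nra.
  by rewrite pmulr_lgt0.
have hw : 0 < w + u * Q.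
  have : 0 < (w + u * Q) * z by nra.
  by rewrite pmulr_lgt0.
split=> //; rewrite /zf /wf /nvar -/u; apply: lt_le_trans uD _.
have : 0 <= u * u * (P * Q).
  by apply: mulr_ge0; [rewrite -expr2 sqr_ge0|exact: mulr_ge0].
by nra.
Qed.

Lemma pair_info :
  minfo g (pairfam d1 d2 Xs Is (Num.sqrt z)^-1 (Num.sqrt (w - c ^+ 2 / z))^-1
     (c / z * (Num.sqrt (w - c ^+ 2 / z))^-1))
  - minfo g (fun m => comb d1 (fun j => (Num.sqrt z)^-1 * Xs m j))
  - minfo g (fun m => comb d3 (fun j => (Num.sqrt w)^-1 * Is m j)) <=
  n * (ln ((z + P) * (w + Q) - c ^+ 2) - ln (z * w - c ^+ 2)
       - (ln (z + P) - ln z) - (ln (w + Q) - ln w)).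
Proof.
have JnE : #|J|%:R / 2 = n by rewrite Jn; field.
pose q0 := Num.sqrt (1 + ka).
have ka0 : 0 < ka.
  by rewrite divr_gt0 ?subr_gt0// ltr_wpDl// addr_ge0// mulr_ge0// ltW.
have q01 : 1 < q0.
  by rewrite -[X in X < _]sqrtr1 ltr_sqrt ltr_pwDr// ltr_pwDr.
pose J1 s := minfo g (pairfam d1 d2 Xs Is (amp z P s) (ampU z P w Q c s) (ampX z P w Q c s)).
pose J2 s := minfo g (fun m => comb d1 (fun j => amp z P s * Xs m j)).
pose J3 s := minfo g (fun m => comb d3 (fun j => amp w Q s * Is m j)).
pose DJ1 s := dminfo g (pairfam d1 d2 Xs Is (amp z P s) (ampU z P w Q c s) (ampX z P w Q c s))
   (pairfam d1 d2 Xs Is (amp' z P s) (ampU' z P w Q c s) (ampX' z P w Q c s)).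
pose DJ2 s := dminfo g (fun m => comb d1 (fun j => amp z P s * Xs m j))
   (fun m => comb d1 (fun j => amp' z P s * Xs m j)).
pose DJ3 s := dminfo g (fun m => comb d3 (fun j => amp w Q s * Is m j))
   (fun m => comb d3 (fun j => amp' w Q s * Is m j)).
have cvar0 s : 0 < zf s -> c ^+ 2 < zf s * wf s -> 0 < cvar z P w Q c s.
  by move=> h1 h2; rewrite /cvar subr_gt0 ltr_pdivrMr// mulrC.
have dJ1 s : -1 < s < q0 -> is_derive s 1 J1 (DJ1 s).
  move=> sd; have [h1 h2 h3] := nvar_dom sd; have h4 := cvar0 s h1 h3.
  apply: (is_derive_path M0 gG
    (a := fun t => pairfam d1 d2 Xs Is (amp z P t) (ampU z P w Q c t) (ampX z P w Q c t))
    (a' := fun t => pairfam d1 d2 Xs Is (amp' z P t) (ampU' z P w Q c t) (ampX' z P w Q c t)) sd).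
  - move=> t m i td; have [k1 k2 k3] := nvar_dom td; have k4 := cvar0 t k1 k3.
    have e1 := is_derive_amp k1; have e2 := is_derive_ampU k1 k4.
    have e3 := is_derive_ampX k1 k4.
    have pE (a b e : R) : pairfam d1 d2 Xs Is a b e m i =
        a * comb d1 (Xs m) i + b * comb d2 (Is m) i - e * comb d2 (Xs m) i.
      rewrite /pairfam combZ -addrA; congr (_ + _).
      by rewrite /comb !mulr_sumr -sumrB; apply: eq_bigr => j _; ring.
    rewrite pE; under [X in is_derive _ _ X]eq_fun do rewrite pE.
    by apply: is_derive_eq; rewrite /GRing.scale /=; ring.
  - move=> m i.
    have pE (a b e : R) : pairfam d1 d2 Xs Is a b e m i =
        a * comb d1 (Xs m) i + b * comb d2 (Is m) i - e * comb d2 (Xs m) i.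
      rewrite /pairfam combZ -addrA; congr (_ + _).
      by rewrite /comb !mulr_sumr -sumrB; apply: eq_bigr => j _; ring.
    under [X in {for _, continuous X}]eq_fun do rewrite pE.
    apply: cvgB; first apply: cvgD.
    + by apply: cvgM; [exact: continuous_amp'|exact: cvg_cst].
    + by apply: cvgM; [exact: continuous_ampU'|exact: cvg_cst].
    + by apply: cvgM; [exact: continuous_ampX'|exact: cvg_cst].
have dJ2 s : -1 < s < q0 -> is_derive s 1 J2 (DJ2 s).
  move=> sd; have [h1 h2 h3] := nvar_dom sd.
  apply: (is_derive_scale_path _ _ sd) => //; last exact: continuous_amp'.
  by move=> t td; have [k1 _ _] := nvar_dom td; exact: is_derive_amp.
have dJ3' (d : J -> 'I_N -> R) s : -1 < s < q0 ->
   is_derive s 1 (fun s => minfo g (fun m => comb d (fun j => amp w Q s * Is m j)))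
    (dminfo g (fun m => comb d (fun j => amp w Q s * Is m j))
   (fun m => comb d (fun j => amp' w Q s * Is m j))).
  move=> sd; have [h1 h2 h3] := nvar_dom sd.
  apply: (is_derive_scale_path _ _ sd) => //; last exact: continuous_amp'.
  by move=> t td; have [_ k1 _] := nvar_dom td; exact: is_derive_amp.
(* The Gaussian defect less the actual one, up to the terms in the received powers, which are
   constant. At s = 0 all signals vanish and s = 1 is the given channel, so monotonicity of [f] is
   the claim. *)
pose f s := n * (ln (zf s) + ln (wf s) - ln (zf s * wf s - c ^+ 2)) - J1 s + J2 s + J3 s.
pose f' s := n * (- (2 * s * P) / zf s - 2 * s * Q / wf s
   + (2 * s * P * wf s + 2 * s * Q * zf s) / (zf s * wf s - c ^+ 2)) - DJ1 s + DJ2 s + DJ3 s.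
have in01 (x : R) : 0 <= x <= 1 -> -1 < x < q0.
  by move=> /andP[x0 x1]; apply/andP; split; [lra|exact: le_lt_trans x1 q01].
have df (x : R) : 0 <= x <= 1 -> is_derive x 1 f (f' x).
  move=> x01; have xd := in01 x x01; have [h1 h2 h3] := nvar_dom xd.
  have h4 : 0 < zf x * wf x - c ^+ 2 by rewrite subr_gt0.
  have e1 := dJ1 x xd; have e2 := dJ2 x xd; have e3 : is_derive x 1 J3 (DJ3 x) := dJ3' d3 x xd.
  have ez := is_derive_nvar z P x; have ew := is_derive_nvar w Q x.
  have ec : is_derive x 1 (fun s => zf s * wf s - c ^+ 2)
     (- (2 * x * P * wf x + 2 * x * Q * zf x)).
    by apply: is_derive_eq; rewrite /GRing.scale /= /zf /wf; ring.
  have l1 := @is_derive1_comp _ (@ln R) zf _ _ _ (is_derive1_ln h1) ez.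
  have l2 := @is_derive1_comp _ (@ln R) wf _ _ _ (is_derive1_ln h2) ew.
  have l3 := @is_derive1_comp _ (@ln R) (fun s => zf s * wf s - c ^+ 2) _ _ _
    (is_derive1_ln h4) ec.
  apply: is_derive_eq; rewrite /f' /GRing.scale /=.
  by ring.
have f'0 (x : R) : 0 < x < 1 -> 0 <= f' x.
  move=> /andP[x0 x1]; have xd : -1 < x < q0 by apply: in01; rewrite !ltW.
  have [h1 h2 h3] := nvar_dom xd.
  have h4 : 0 < zf x * wf x - c ^+ 2 by rewrite subr_gt0.
  have hc := cvar0 x h1 h3.
  pose sz := Num.sqrt (zf x); pose sw := Num.sqrt (wf x).
  pose dl := wf x - c ^+ 2 / zf x; pose sd := Num.sqrt dl.
  have sz0 : 0 < sz by rewrite sqrtr_gt0.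
  have sw0 : 0 < sw by rewrite sqrtr_gt0.
  have dl0 : 0 < dl by exact: hc.
  have sd0 : 0 < sd by rewrite sqrtr_gt0.
  have szE : sz ^+ 2 = zf x by rewrite sqr_sqrtr// ltW.
  have swE : sw ^+ 2 = wf x by rewrite sqr_sqrtr// ltW.
  have sdE : sd ^+ 2 = dl by rewrite sqr_sqrtr// ltW.
  have swE' : sw ^+ 2 = sd ^+ 2 + c ^+ 2 / sz ^+ 2 by rewrite swE sdE szE /dl subrK.
  pose dU := dirU d1 d2 sz sd sw c.
  have oU : orthonormal dU := orthonormal_dirU od1 od2 d12 sz0 sw0 swE'.
  pose a := pairfam d1 d2 Xs Is (x / sz) (x / sd) (c / zf x * (x / sd)).
  have a1 m j : dot (d1 j) (a m) = x / sz * Xs m j.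
    exact: (dot_d1_pairfam od1 d12).
  have aU m j : dot (dU j) (a m) = x / sw * Is m j.
    rewrite dotC dot_comb2 ![dot (a m) _]dotC (dot_d1_pairfam od1 d12) (dot_d2_pairfam od2 d12).
    by rewrite -szE; field; rewrite !gt_eqF.
  have E2 : DJ2 x = 2 * ((zf x + x ^+ 2 * P) / (x * zf x)) *
      (n - \sum_j EE g a (fun _ y => beta a d1 j y * beta a d1 j y)).
    have xs : x / sz != 0 by rewrite mulf_neq0 ?invr_eq0 ?gt_eqF.
    have := marg_dminfo M0 gG (amp' z P x) od1 xs a1.
    rewrite /DJ2 => ->; rewrite JnE; congr (2 * _ * _).
    by rewrite /amp' -/zf -/sz; field; rewrite !gt_eqF.
  have E3 : DJ3 x = 2 * ((wf x + x ^+ 2 * Q) / (x * wf x)) *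
      (n - \sum_j EE g a (fun _ y => beta a dU j y * beta a dU j y)).
    have xs : x / sw != 0 by rewrite mulf_neq0 ?invr_eq0 ?gt_eqF.
    have := marg_dminfo M0 gG (amp' w Q x) oU xs aU.
    (* The second signal is moved from the spare frame [d3] to [dU], inside the span of [d1] and
       [d2]. The two information functions agree by Gram invariance, hence so do their
       derivatives. *)
    have -> : DJ3 x = dminfo g (fun m => comb dU (fun j => amp w Q x * Is m j))
        (fun m => comb dU (fun j => amp' w Q x * Is m j)).
      have EJ : (fun s => minfo g (fun m => comb d3 (fun j => amp w Q s * Is m j))) =
          (fun s => minfo g (fun m => comb dU (fun j => amp w Q s * Is m j))).
        apply/funext => s; apply: minfo_gram => // m l.
          rewrite !dot_comb; apply: eq_bigr => j _; congr (_ * _).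
          by rewrite !dot_comb_frame.
        rewrite dot_comb big1// => j _; rewrite dotC dot_comb big1 ?mulr0// => k _.
        by rewrite dotC dot_comb2 dotC d13 dotC d23 !mulr0 addr0 mulr0.
      have u1 := dJ3' d3 x xd; rewrite EJ in u1.
      have [_ v1] := u1; have [_ v2] := dJ3' dU x xd.
      exact: etrans (esym v1) v2.
    rewrite /amp -/wf -/sw => ->; rewrite JnE; congr (2 * _ * _).
    by rewrite /amp' -/wf -/sw; field; rewrite !gt_eqF.
  have x2P : \sum_j avg (fun m => Xs m j ^+ 2) <= n * P by [].
  have S := pair_slope M0 gG mixP od1 od2 d12 mixX mixI X0 I0 Jn XP IQ P0 Q0 c0 x0 h1 h2 h3.
  rewrite /f' E2 E3.
  have E1 : DJ1 x = dminfo g a (pairfam d1 d2 Xs Is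
     ((zf x + x ^+ 2 * P) / (zf x * sz))
     ((wf x + x ^+ 2 * Q - 2 * c ^+ 2 / zf x + (zf x + x ^+ 2 * P) * c ^+ 2 / zf x ^+ 2) / (dl * sd))
     (c / zf x * ((wf x + x ^+ 2 * Q - 2 * c ^+ 2 / zf x + (zf x + x ^+ 2 * P) * c ^+ 2 / zf x ^+ 2)
        / (dl * sd)) + 2 * x * P * c / zf x ^+ 2 * (x / sd))).
    rewrite /DJ1 /ampX' /ampX /ampU' /ampU /amp' /amp /cvar -/zf -/wf -/dl -/sz -/sd.
    congr (dminfo g _ (pairfam d1 d2 Xs Is _ _ _)); rewrite !(invfM, exprVn, expr2)//;
      ring.
  rewrite E1; exact: (pair_slope_arith x0 h1 h2 h4 S).
have := ge0_derive_le (@ler01 R) df f'0.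
have amp0 (a b : R) : amp a b 0 = 0 by rewrite /amp mul0r.
have nvar1 (a b : R) : nvar a b 1 = a by rewrite /nvar expr1n subrr mul0r addr0.
have nvar0 (a b : R) : nvar a b 0 = a + b by rewrite /nvar expr0n subr0 mul1r.
have amp1 (a b : R) : amp a b 1 = (Num.sqrt a)^-1 by rewrite /amp nvar1 mul1r.
have ampU1 : ampU z P w Q c 1 = (Num.sqrt (w - c ^+ 2 / z))^-1.
  by rewrite /ampU /cvar !nvar1 mul1r.
have comb0 (d : J -> 'I_N -> R) (x : M -> J -> R) :
    (fun m => comb d (fun j => 0 * x m j)) = fun _ _ => 0.
  by apply/funext => m; apply/funext => i; rewrite combZ mul0r.
have J10 : J1 0 = 0.
  rewrite /J1 /ampX /ampU amp0 mul0r mulr0.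
  rewrite (_ : pairfam _ _ _ _ _ _ _ = fun _ _ => 0) ?minfo0//.
  apply/funext => m; apply/funext => i; rewrite /pairfam /comb big1 ?big1 ?addr0//.
    by move=> j _; rewrite !mul0r subr0 mul0r.
  by move=> j _; rewrite !mul0r.
have J20 : J2 0 = 0 by rewrite /J2 amp0 comb0 minfo0.
have J30 : J3 0 = 0 by rewrite /J3 amp0 comb0 minfo0.
rewrite /f J10 J20 J30 /J1 /J2 /J3 /ampX ampU1 !amp1 /zf /wf !nvar1 !nvar0.
exact: pair_info_arith.
Qed.

End PairInfo.

(** * Complex codewords as real vectors *)

Section Signals.
Context {R : realType} {n : nat} {M : finType}.
Local Notation JJ := ('I_n * bool)%type.
Local Notation IX := (bool * bool * JJ)%type.
Local Notation N := #|{: IX}|.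
Local Notation C := R[i].

(** An index consists of a bank, one of two observations, a time, and a flag for the imaginary part.
    The second bank is spare room, because [minfo_gram] compares only orthogonal families. *)
Definition bas (i : IX) : 'I_N -> R := fun l => (l == enum_rank i)%:R.

Lemma dot_bas i e : dot (bas i) e = e (enum_rank i).
Proof.
rewrite /dot (bigD1 (enum_rank i))//= /bas eqxx mul1r big1 ?addr0// => l /negbTE ->.
by rewrite mul0r.
Qed.

Lemma dot_bas_bas i i' : dot (bas i) (bas i') = (i == i')%:R.
Proof. by rewrite dot_bas /bas (inj_eq enum_rank_inj). Qed.

Definition frame b s : JJ -> 'I_N -> R := fun j => bas (b, s, j).

Lemma orthonormal_frame b s : orthonormal (frame b s).
Proof. by move=> j l; rewrite dot_bas_bas xpair_eqE eqxx. Qed.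

Lemma frame_orth b s b' s' j l : (b, s) != (b', s') -> dot (frame b s j) (frame b' s' l) = 0.
Proof. by move=> h; rewrite dot_bas_bas xpair_eqE (negbTE h). Qed.

Definition comp (u : 'I_n -> C) (j : JJ) : R :=
  if j.2 then complex.Im (u j.1) else complex.Re (u j.1).

Definition cdot (u v : 'I_n -> C) : R := \sum_j comp u j * comp v j.

Lemma cdotE u v : cdot u v = \sum_t complex.Re (u t * conjc (v t)).
Proof.
rewrite /cdot -(pair_bigA _ (fun t b => comp u (t, b) * comp v (t, b))) /=.
apply: eq_bigr => t _; rewrite big_bool /comp /=.
by case: (u t) => a b; case: (v t) => e f /=; ring.
Qed.

Lemma cardJJ : #|{: JJ}|%:R = 2 * n%:R :> R.
Proof. by rewrite card_prod card_ord card_bool natrM mulrC. Qed.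

Variable x : 'I_3 -> M -> 'I_n -> C.
Implicit Types (c e : 'I_3 -> C).

Definition row c m t : C := \sum_k c k * x k m t.

(** Two observations in independent unit noises; correlated noises are expressed by whitening the
    coefficients [c0], [c1]. *)
Definition fam b c0 c1 m : 'I_N -> R :=
  fun i => comb (frame b false) (comp (row c0 m)) i + comb (frame b true) (comp (row c1 m)) i.

Lemma dot_comb_comb b s b' s' (u v : JJ -> R) :
  dot (comb (frame b s) u) (comb (frame b' s') v) =
  if (b, s) == (b', s') then \sum_j u j * v j else 0.
Proof.
rewrite dot_comb; case: eqP => [[<- <-]|/eqP h].
  by apply: eq_bigr => j _; rewrite dot_comb_frame//; exact: orthonormal_frame.
rewrite big1// => j _; rewrite dotC dot_comb big1 ?mulr0// => l _.
by rewrite frame_orth ?mulr0// eq_sym.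
Qed.

Lemma dot_fam b b' c0 c1 e0 e1 m l : dot (fam b c0 c1 m) (fam b' e0 e1 l) =
  if b == b' then cdot (row c0 m) (row e0 l) + cdot (row c1 m) (row e1 l) else 0.
Proof.
rewrite /fam dotDl !dotDr !dot_comb_comb !xpair_eqE /= !andbF addr0 add0r !andbT.
by case: eqP => _; rewrite ?addr0.
Qed.

Lemma cdot_row c e m l : cdot (row c m) (row e l) =
  complex.Re (\sum_t \sum_k \sum_k' (c k * conjc (e k')) * (x k m t * conjc (x k' l t))).
Proof.
rewrite cdotE raddf_sum; apply: eq_bigr => t _; congr complex.Re.
rewrite /row mulr_suml; apply: eq_bigr => k _.
rewrite rmorph_sum mulr_sumr; apply: eq_bigr => k' _.
by rewrite rmorphM /=; ring.
Qed.

Hypothesis M0 : (0 < #|M|)%N.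
Variable g : probability (N.-tuple R) R.
Hypothesis gG : gaussm g.

Definition Jf c0 c1 : R := minfo g (fam false c0 c1).

Definition gram c0 c1 k k' : C := c0 k * conjc (c0 k') + c1 k * conjc (c1 k').

Lemma minfo_fam_bank b c0 c1 e0 e1 : (forall k k', gram c0 c1 k k' = gram e0 e1 k k') ->
  minfo g (fam b c0 c1) = minfo g (fam (~~ b) e0 e1).
Proof.
move=> h; apply: minfo_gram => // m l; rewrite !dot_fam; last by case: b.
rewrite !eqxx !cdot_row -!raddfD; congr complex.Re; rewrite -!big_split /=.
apply: eq_bigr => t _; rewrite -!big_split /=; apply: eq_bigr => k _.
rewrite -!big_split /=; apply: eq_bigr => k' _; rewrite -!mulrDl; congr (_ * _).
exact: h.
Qed.

(** Passing to the other bank and back. Every later change of genie coordinates is an equality of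
    these 3 by 3 Gram matrices. *)
Lemma Jf_gram c0 c1 e0 e1 : (forall k k', gram c0 c1 k k' = gram e0 e1 k k') ->
  Jf c0 c1 = Jf e0 e1.
Proof.
move=> h; rewrite /Jf (minfo_fam_bank false h).
exact: (minfo_fam_bank true (fun k k' => erefl)).
Qed.

Variable mix : 'I_3 -> M -> M -> M.
Hypothesis mixP : forall k (f : M -> R), avg (fun w => avg (fun v => f (mix k w v))) = avg f.
Hypothesis mixX : forall k j w v, x j (mix k w v) = if j == k then x j w else x j v.

Definition drop k c : 'I_3 -> C := fun j => if j == k then 0 else c j.

Lemma row_mix k c w v t : row c (mix k w v) t = row (drop k c) v t + c k * x k w t.
Proof.
rewrite /row (bigD1 k)//= mixX eqxx addrC; congr (_ + _).
rewrite [RHS](bigD1 k)//= /drop eqxx mul0r add0r; apply: eq_bigr => j jk.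
by rewrite mixX (negbTE jk).
Qed.

Lemma compD u v : comp (fun t => u t + v t) = fun j => comp u j + comp v j.
Proof.
by apply/funext => -[t b]; rewrite /comp /=; case: b; case: (u t) => ? ?; case: (v t).
Qed.

Lemma combD (d : JJ -> 'I_N -> R) u v i :
  comb d (fun j => u j + v j) i = comb d u i + comb d v i.
Proof. by rewrite /comb -big_split; apply: eq_bigr => j _ /=; rewrite mulrDl. Qed.

Lemma fam_mix b k c0 c1 w v : fam b c0 c1 (mix k w v) =
  fun i => fam b (drop k c0) (drop k c1) v i +
   (comb (frame b false) (comp (fun t => c0 k * x k w t)) i +
    comb (frame b true) (comp (fun t => c1 k * x k w t)) i).
Proof.
apply/funext => i; rewrite /fam.
have rE c : row c (mix k w v) = fun t => row (drop k c) v t + c k * x k w t.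
  by apply/funext => t; exact: row_mix.
by rewrite !rE !compD !combD; ring.
Qed.

(** A known codeword only translates the family. *)
Lemma cinfo_fam k c0 c1 : cinfo g (mix k) (fam false c0 c1) = Jf (drop k c0) (drop k c1).
Proof.
rewrite -[RHS](avg_cst M0); apply: eq_avg => w.
under [X in minfo g X]funext do rewrite fam_mix.
exact: minfo_translate.
Qed.

Definition row0 : 'I_3 -> C := fun=> 0.

(** Both sides are information about the message of user [k]; the second observation plays the part
    of [b] in [info_cond_mono]. *)
Lemma Jf_mono k c0 c1 :
  Jf c0 row0 - Jf (drop k c0) row0 <= Jf c0 c1 - Jf (drop k c0) (drop k c1).
Proof.
have d0 : drop k row0 = row0 by apply/funext => j; rewrite /drop /row0; case: ifP.
have -> : Jf (drop k c0) row0 = cinfo g (mix k) (fam false c0 row0).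
  by rewrite cinfo_fam d0.
rewrite -cinfo_fam.
pose a := fam false c0 row0; pose b := fam false row0 c1.
have r0 m : comp (row row0 m) = fun=> 0.
  have -> : row row0 m = fun=> 0.
    by apply/funext => t; rewrite /row big1// => j _; rewrite mul0r.
  by apply/funext => -[t []].
have comb0 s : comb (frame false s) (fun=> 0) = (fun=> 0).
  by apply/funext => i; rewrite /comb big1// => j _; rewrite mul0r.
have abE : fam false c0 c1 = fun m => (a m \+ b m)%R.
  by apply/funext => m; apply/funext => i; rewrite /a /b /fam !r0 !comb0 /= addr0 add0r.
have ab0 m l : dot (a m) (b l) = 0.
  rewrite dot_fam eqxx.
  have cd0 u : cdot u (row row0 l) = 0 by rewrite /cdot r0 big1// => j _; rewrite mulr0.
  have cd0' u : cdot (row row0 m) u = 0 by rewrite /cdot r0 big1// => j _; rewrite mul0r.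
  by rewrite cd0 cd0' addr0.
have := info_cond_mono M0 gG (mixP k) ab0.
by rewrite -abE -/(Jf c0 c1) -/(Jf c0 row0).
Qed.

End Signals.

(** * Growth of the information with the signal-to-noise ratio *)

Section SignalSNR.
Context {R : realType} {n : nat} {M : finType}.
Local Notation JJ := ('I_n * bool)%type.
Local Notation IX := (bool * bool * JJ)%type.
Local Notation N := #|{: IX}|.
Local Notation C := R[i].
Variable x : 'I_3 -> M -> 'I_n -> C.
Hypothesis M0 : (0 < #|M|)%N.
Variable g : probability (N.-tuple R) R.
Hypothesis gG : gaussm g.
Variable mix : 'I_3 -> M -> M -> M.
Hypothesis mixP : forall k (f : M -> R), avg (fun w => avg (fun v => f (mix k w v))) = avg f.
Hypothesis mixX : forall k j w v, x j (mix k w v) = if j == k then x j w else x j v.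
Hypothesis x0 : forall k j, avg (fun m => comp (x k m) j) = 0.
Variable P : 'I_3 -> R.
Hypothesis xP : forall k, avg (fun m => \sum_t sqn (x k m t)) <= n%:R * P k.
Implicit Types (c e : 'I_3 -> C).

Lemma comp_row c m j : comp (row x c m) j = \sum_k comp (fun t => c k * x k m t) j.
Proof. by case: j => t b; rewrite /comp /=; case: b; rewrite raddf_sum. Qed.

Lemma avg_comp_scale (a : C) k j : avg (fun m => comp (fun t => a * x k m t) j) = 0.
Proof.
case: j => t b; have := x0 k (t, false); have := x0 k (t, true); rewrite /comp /=.
case: a => a1 a2 xi xr; rewrite (_ : (fun m => _) = fun m =>
    (if b then a2 else a1) * complex.Re (x k m t) +
    (if b then a1 else - a2) * complex.Im (x k m t)).
  by rewrite avgD !avgZ xi xr !mulr0 addr0.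
by apply/funext => m; case: (x k m t) => p q; case: b => /=; ring.
Qed.

Lemma avg_indep k (f h : M -> R) : (forall w v, f (mix k w v) = f w) ->
  (forall w v, h (mix k w v) = h v) -> avg (fun m => f m * h m) = avg f * avg h.
Proof.
move=> fk hk; rewrite -(mixP k).
under eq_avg do under eq_avg do rewrite fk hk.
under eq_avg do rewrite avgZ mulrC.
by rewrite avgZ mulrC.
Qed.

Lemma sqnM (a b : C) : sqn (a * b) = sqn a * sqn b.
Proof. by case: a b => a1 a2 [b1 b2]; rewrite /sqn /=; ring. Qed.

Lemma sqn_ge0 (a : C) : 0 <= sqn a.
Proof. by rewrite addr_ge0 ?sqr_ge0. Qed.

Lemma sum_comp_sqr (u : 'I_n -> C) : \sum_j comp u j ^+ 2 = \sum_t sqn (u t).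
Proof.
rewrite -(pair_bigA _ (fun t b => comp u (t, b) ^+ 2)) /=.
by apply: eq_bigr => t _; rewrite big_bool /comp /sqn /= addrC.
Qed.

(** Codewords of different users are independent and centred, so the cross terms vanish. *)
Lemma avg_row_sqr c : \sum_j avg (fun m => comp (row x c m) j ^+ 2) <=
  n%:R * \sum_k sqn (c k) * P k.
Proof.
have E j : avg (fun m => comp (row x c m) j ^+ 2) =
    \sum_k avg (fun m => comp (fun t => c k * x k m t) j ^+ 2).
  have -> : (fun m => comp (row x c m) j ^+ 2) = fun m => \sum_k \sum_k'
      comp (fun t => c k * x k m t) j * comp (fun t => c k' * x k' m t) j.
    apply/funext => m; rewrite comp_row expr2 mulr_suml; apply: eq_bigr => k _.
    by rewrite mulr_sumr.
  rewrite avg_sum; apply: eq_bigr => k _; rewrite avg_sum (bigD1 k)//= big1 ?addr0// => k' kk'.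
  rewrite (@avg_indep k) ?avg_comp_scale ?mul0r// => w v.
    by rewrite mixX eqxx.
  by rewrite mixX (negbTE kk').
under eq_bigr do rewrite E.
rewrite exchange_big mulr_sumr; apply: ler_sum => k _ /=.
rewrite mulrCA -avg_sum; under eq_avg do rewrite sum_comp_sqr.
under eq_avg do under eq_bigr do rewrite sqnM.
under eq_avg do rewrite -mulr_sumr.
by rewrite avgZ ler_wpM2l ?sqn_ge0.
Qed.

Lemma comb_at b s b' s' (u : JJ -> R) (j : JJ) :
  comb (frame b s) u (enum_rank (b', s', j)) = if (b, s) == (b', s') then u j else 0.
Proof.
rewrite -dot_bas dotC dot_comb; case: eqP => [[<- <-]|/eqP h].
  rewrite (bigD1 j)//= dot_bas_bas eqxx mulr1 big1 ?addr0// => l lj.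
  by rewrite dot_bas_bas xpair_eqE eqxx /= (negbTE lj) mulr0.
by rewrite big1// => l _; rewrite frame_orth ?mulr0.
Qed.

Lemma rowZ (lam : C) c m : row x (fun k => lam * c k) m = fun t => lam * row x c m t.
Proof.
by apply/funext => t; rewrite /row mulr_sumr; apply: eq_bigr => k _; rewrite mulrA.
Qed.

Lemma comp_rc (r : R) (u : 'I_n -> C) j : comp (fun t => rc r * u t) j = r * comp u j.
Proof. by rewrite /comp; case: j => t [] /=; case: (u t) => a b /=; ring. Qed.

(** [lam] times the first output is a linear estimate of the second signal. The sum in the
    hypothesis is its error at full power: a codeword part plus the noise part |lam|^2. *)
Lemma Jf_add c0 c1 (lam : C) (s2 r0 r1 : R) : 0 <= r0 <= r1 ->
  \sum_k sqn (c1 k - lam * c0 k) * P k + sqn lam <= s2 -> 0 <= s2 ->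
  Jf x g c0 (fun k => rc r1 * c1 k) - Jf x g c0 (fun k => rc r0 * c1 k)
   <= n%:R * (ln (1 + r1 ^+ 2 * s2) - ln (1 + r0 ^+ 2 * s2)).
Proof.
move=> r01 hs s20.
pose D := [set i : 'I_N | ~~ (enum_val i).1.1 && (enum_val i).1.2]%SET.
pose a m : 'I_N -> R := comb (frame false false) (comp (row x c0 m)).
pose b m : 'I_N -> R := comb (frame false true) (comp (row x c1 m)).
(* A row of the real 2 by 2 matrix of multiplication by [lam]. *)
pose wj (j : JJ) : 'I_N -> R := fun i => complex.Re lam * frame false false j i +
  (if j.2 then complex.Im lam else - complex.Im lam) * frame false false (j.1, ~~ j.2) i.
pose w (i : 'I_N) : 'I_N -> R := wj (@enum_val IX predT i).2.
have famE r : fam x false c0 (fun k => rc r * c1 k) = fun m i => a m i + r * b m i.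
  apply/funext => m; apply/funext => i; rewrite /fam rowZ /a /b; congr (_ + _).
  by rewrite /comb mulr_sumr; apply: eq_bigr => j _; rewrite comp_rc mulrA.
rewrite /Jf !famE.
have valE (i : 'I_N) : exists b s j, i = enum_rank (b, s, j).
  by exists (enum_val i).1.1, (enum_val i).1.2, (enum_val i).2; rewrite -!surjective_pairing enum_valK.
have DE b' s' j : (enum_rank (b', s', j) \in D) = (~~ b' && s').
  by rewrite inE enum_rankK.
have sumD (F : 'I_N -> R) : \sum_(i in D) F i = \sum_j F (enum_rank (false, true, j)).
  rewrite (reindex_onto (fun j : JJ => enum_rank (false, true, j)) (fun i => (enum_val i).2)).
    by apply: eq_bigl => j; rewrite DE enum_rankK eqxx.
  move=> i; have [b' [s' [j ->]]] := valE i; rewrite DE => /andP[/negbTE -> ->].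
  by rewrite enum_rankK.
have H := minfo_add M0 gG (a := a) (b := b) (D := D) (w := w) (n := n%:R) (s2 := s2) _ _ _ _ _ _ r01.
apply: H => //.
- move=> m i; have [b' [s' [j ->]]] := valE i; rewrite DE /a comb_at.
  by case: b' s' => [] [].
- move=> m i; have [b' [s' [j ->]]] := valE i; rewrite DE /b comb_at.
  by case: b' s' => [] [].
- move=> i i' _; have [b' [s' [j ->]]] := valE i'; rewrite DE => /andP[b0 s0].
  rewrite /w /wj /frame /bas !(inj_eq enum_rank_inj) !xpair_eqE.
  by move: b0 s0; case: b' s' => [] [] //= _ _; rewrite !mulr0 addr0.
- rewrite -cardJJ -[LHS]mulr_natl mulr1 -sum1_card natr_sum (sumD (fun=> 1)).
  by rewrite sumr_const.
have dotwa m j : dot (wj j) (a m) = comp (fun t => lam * row x c0 m t) j.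
  rewrite /wj (_ : (fun i => _) = (fun i => complex.Re lam * frame false false j i) \+
      (fun i => (if j.2 then complex.Im lam else - complex.Im lam) *
                frame false false (j.1, ~~ j.2) i))//.
  have dZ (r : R) (e f : 'I_N -> R) : dot (fun i => r * e i) f = r * dot e f.
    by rewrite /dot mulr_sumr; apply: eq_bigr => i _; rewrite mulrA.
  rewrite dotDl !dZ !dot_bas /a !comb_at eqxx /comp; case: j => t s /=.
  by case: (row x c0 m t) => p q; case: (lam) => l1 l2; case: s => /=; ring.
have dotww j : dot (wj j) (wj j) = sqn lam.
  pose e : 'I_N -> R := frame false false j; pose e' : 'I_N -> R := frame false false (j.1, ~~ j.2).
  have ee : dot e e = 1 by rewrite dot_bas_bas eqxx.
  have e'e' : dot e' e' = 1 by rewrite dot_bas_bas eqxx.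
  have ee' : dot e e' = 0.
    rewrite dot_bas_bas; case: (j) => t s /=; rewrite !xpair_eqE !eqxx /=.
    by case: s.
  pose be := (if j.2 then complex.Im lam else - complex.Im lam).
  have -> : dot (wj j) (wj j) = complex.Re lam ^+ 2 * dot e e + be ^+ 2 * dot e' e'
      + 2 * complex.Re lam * be * dot e e'.
    rewrite /dot !mulr_sumr -!big_split /=; apply: eq_bigr => i _.
    by rewrite /wj -/be /e /e'; ring.
  by rewrite ee e'e' ee' /be /sqn; case: (j.2); ring.
rewrite (sumD (fun i => _)).
under eq_bigr => j _.
  rewrite {1 2 3}/w enum_rankK dotww.
  rewrite (_ : (fun m => _) = fun m => comp (row x (fun k => c1 k - lam * c0 k) m) j ^+ 2); last first.
    apply/funext => m; rewrite dotwa /b comb_at eqxx; congr (_ ^+ 2).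
    have -> : row x (fun k => c1 k - lam * c0 k) m = fun t => row x c1 m t - lam * row x c0 m t.
      apply/funext => t; rewrite /row mulr_sumr -sumrB; apply: eq_bigr => k _; ring.
    by rewrite /comp; case: (j) => t [] /=; rewrite raddfB.
  over.
rewrite big_split /= sumr_const -[_ *+ _]mulr_natl.
have -> : #|{: JJ}|%:R * (sqn lam / 2) = n%:R * sqn lam.
  by rewrite cardJJ; field.
apply: le_trans (_ : n%:R * (\sum_k sqn (c1 k - lam * c0 k) * P k + sqn lam) <= _).
  by rewrite [leRHS]mulrDr lerD2r; exact: avg_row_sqr.
by rewrite ler_wpM2l.
Qed.

End SignalSNR.

(** * The pair inequality with complex covariance *)

Section SignalPair.
Context {R : realType} {n : nat} {M : finType}.
Local Notation JJ := ('I_n * bool)%type.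
Local Notation IX := (bool * bool * JJ)%type.
Local Notation N := #|{: IX}|.
Local Notation C := R[i].
Variable x : 'I_3 -> M -> 'I_n -> C.
Hypothesis M0 : (0 < #|M|)%N.
Variable g : probability (N.-tuple R) R.
Hypothesis gG : gaussm g.
Variable mix : 'I_3 -> M -> M -> M.
Hypothesis mixP : forall k (f : M -> R), avg (fun w => avg (fun v => f (mix k w v))) = avg f.
Hypothesis mixX : forall k j w v, x j (mix k w v) = if j == k then x j w else x j v.
Hypothesis x0 : forall k j, avg (fun m => comp (x k m) j) = 0.
Variable P : 'I_3 -> R.
Hypothesis P0 : forall k, 0 < P k.
Hypothesis xP : forall k, avg (fun m => \sum_t sqn (x k m t)) <= n%:R * P k.
Implicit Types (c e : 'I_3 -> C).

Definition only k (a : C) : 'I_3 -> C := fun j => if j == k then a else 0.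
Definition scl (a : C) c : 'I_3 -> C := fun j => a * c j.

Lemma row_only k (a : C) m : row x (only k a) m = fun t => a * x k m t.
Proof.
apply/funext => t; rewrite /row (bigD1 k)//= /only eqxx big1 ?addr0// => j /negbTE ->.
by rewrite mul0r.
Qed.

Lemma fam_row0 b c m : fam x b c row0 m = comb (frame b false) (comp (row x c m)).
Proof.
apply/funext => i; rewrite /fam (_ : comp (row x row0 m) = fun=> 0); last first.
  have -> : row x row0 m = fun=> 0.
    by apply/funext => t; rewrite /row big1// => j _; rewrite mul0r.
  by apply/funext => -[t []].
by rewrite [X in _ + X](_ : _ = 0) ?addr0// /comb big1// => j _; rewrite mul0r.
Qed.

Lemma scl_rc_comp (r : R) c m j : comp (row x (scl (rc r) c) m) j = r * comp (row x c m) j.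
Proof. by rewrite rowZ comp_rc. Qed.

Lemma sqn_rc (r : R) : sqn (rc r) = r ^+ 2.
Proof. by rewrite /sqn /= expr0n addr0. Qed.

Lemma rcM (r t : R) : rc (r * t) = rc r * rc t.
Proof. exact: (rmorphM (real_complex R)). Qed.

Lemma mulC_conj (a : C) : a * conjc a = rc (sqn a).
Proof. by case: a => p q; rewrite /sqn /rc; apply/eqP; rewrite eq_complex /=; apply/andP; split; apply/eqP; ring. Qed.

Lemma gram_phase (u : C) c0 c1 k k' : sqn u = 1 ->
  gram c0 c1 k k' = gram c0 (scl u c1) k k'.
Proof.
move=> u1; have uu : u * conjc u = 1 by rewrite mulC_conj u1.
rewrite /gram /scl rmorphM /= -[c1 k in LHS]mul1r -uu; congr (_ + _); ring.
Qed.

Lemma gram_phase0 (u : C) c k k' : sqn u = 1 -> gram c row0 k k' = gram (scl u c) row0 k k'.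
Proof.
move=> u1; have uu : u * conjc u = 1 by rewrite mulC_conj u1.
rewrite /gram /scl rmorphM /= -[c k in LHS]mul1r -uu; congr (_ + _); ring.
Qed.

Variables (k : 'I_3) (e : 'I_3 -> C) (ek : e k = 0) (z w : R) (cc : C).
Hypotheses (z0 : 0 < z) (w0 : 0 < w) (czw : sqn cc < z * w).

(** Rotating the interference by [u] makes the noise covariance real and nonnegative, as [pair_info]
    assumes; a phase on one observation does not change the Gram matrix. *)
Lemma phaseP : exists u : C, sqn u = 1 /\ u * conjc cc = rc (Num.sqrt (sqn cc)).
Proof.
have [cc0|ccN] := eqVneq (sqn cc) 0.
  exists 1; split; first by rewrite /sqn /= expr1n expr0n addr0.
  rewrite cc0 sqrtr0; move: cc0; case: (cc) => p q; rewrite /sqn /= => /eqP.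
  by rewrite paddr_eq0 ?sqr_ge0// !sqrf_eq0 => /andP[/eqP -> /eqP ->]; rewrite mul1r oppr0.
have s0 : 0 < sqn cc by rewrite lt_neqAle eq_sym ccN sqn_ge0.
have q0 : 0 < Num.sqrt (sqn cc) by rewrite sqrtr_gt0.
have qq : Num.sqrt (sqn cc) ^+ 2 = sqn cc by rewrite sqr_sqrtr ?sqn_ge0.
have uE : rc (Num.sqrt (sqn cc))^-1 * rc (sqn cc) = rc (Num.sqrt (sqn cc)).
  rewrite /rc -{2}qq; apply/eqP; rewrite eq_complex /=; apply/andP; split; apply/eqP; last by ring.
  by rewrite mulr0 subr0 expr2 mulKf ?gt_eqF.
exists (rc (Num.sqrt (sqn cc))^-1 * cc); split.
  by rewrite sqnM sqn_rc exprVn qq mulVf.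
by rewrite -mulrA mulC_conj uE.
Qed.

(** The first term is the whitened form of X_k in noise of variance [z] together with [e] in noise
    of variance [w], the two noises having covariance [cc]. *)
Lemma Jf_pair :
  Jf x g (only k (rc (Num.sqrt z)^-1))
    (scl (rc (Num.sqrt (w - sqn cc / z))^-1) (fun j => e j - only k (conjc cc * rc z^-1) j))
  - Jf x g (only k (rc (Num.sqrt z)^-1)) row0
  - Jf x g (scl (rc (Num.sqrt w)^-1) e) row0 <=
  n%:R * (ln ((z + P k) * (w + \sum_j sqn (e j) * P j) - sqn cc) - ln (z * w - sqn cc)
       - (ln (z + P k) - ln z) - (ln (w + \sum_j sqn (e j) * P j) - ln w)).
Proof.
have [u [u1 ucc]] := phaseP.
set c := Num.sqrt (sqn cc) in ucc.
have c2 : c ^+ 2 = sqn cc by rewrite sqr_sqrtr ?sqn_ge0.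
have uV : u * (conjc cc * rc z^-1) = rc (c / z) by rewrite mulrA ucc -rcM.
set t1 := (Num.sqrt z)^-1; set t2 := (Num.sqrt (w - sqn cc / z))^-1.
pose Xs m := comp (x k m); pose Is m := comp (row x (scl u e) m).
pose d1 := @frame R n false false; pose d2 := @frame R n false true.
pose d3 := @frame R n true false.
have -> : Jf x g (only k (rc t1)) (scl (rc t2) (fun j => e j - only k (conjc cc * rc z^-1) j)) =
    minfo g (pairfam d1 d2 Xs Is t1 t2 (c / z * t2)).
  rewrite (Jf_gram x M0 gG (fun i j => gram_phase _ _ i j u1)) /Jf; congr minfo.
  apply/funext => m; apply/funext => i; rewrite /fam /pairfam; congr (_ + _).
    by rewrite row_only /comb; apply: eq_bigr => j _; rewrite comp_rc.
  rewrite /comb; apply: eq_bigr => j _; congr (_ * _).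
  rewrite (_ : row x _ m = fun t => rc t2 * row x (scl u e) m t - rc (c / z * t2) * x k m t).
    have -> : comp (fun t => rc t2 * row x (scl u e) m t - rc (c / z * t2) * x k m t) j =
      comp (fun t => rc t2 * row x (scl u e) m t) j - comp (fun t => rc (c / z * t2) * x k m t) j.
      by rewrite /comp; case: (j) => t [] /=; rewrite raddfB.
    by rewrite !comp_rc.
  apply/funext => t; rewrite /row [in LHS](bigD1 k)//= [in RHS](bigD1 k)//= /scl /only eqxx ek.
  rewrite (rcM (c / z)) -uV.
  rewrite [X in _ + X = _](_ : _ = rc t2 * \sum_(i < 3 | i != k) u * e i * x i m t).
    by ring.
  by rewrite mulr_sumr; apply: eq_bigr => j' j'k; rewrite (negbTE j'k); ring.
have -> : Jf x g (only k (rc t1)) row0 = minfo g (fun m => comb d1 (fun j => t1 * Xs m j)).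
  rewrite /Jf; congr minfo; apply/funext => m; rewrite fam_row0 row_only.
  by congr comb; apply/funext => j; rewrite comp_rc.
have -> : Jf x g (scl (rc (Num.sqrt w)^-1) e) row0 =
    minfo g (fun m => comb d3 (fun j => (Num.sqrt w)^-1 * Is m j)).
  rewrite (Jf_gram x M0 gG (fun i j => gram_phase0 _ i j u1)) /Jf.
  rewrite (minfo_fam_bank x M0 gG false (fun i j => erefl)); congr minfo.
  apply/funext => m; rewrite fam_row0; congr comb; apply/funext => j.
  rewrite -scl_rc_comp; congr comp; congr row.
  by apply/funext => i; rewrite /scl mulrCA.
have Q0 : 0 <= \sum_j sqn (e j) * P j.
  by rewrite sumr_ge0// => j _; rewrite mulr_ge0 ?sqn_ge0// ltW.
have t2E : t2 = (Num.sqrt (w - c ^+ 2 / z))^-1 by rewrite c2.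
rewrite -c2 t2E.
have od b s : orthonormal (@frame R n b s) by exact: orthonormal_frame.
have o12 j l : dot (d1 j) (d2 l) = 0 by rewrite frame_orth.
have o13 j l : dot (d1 j) (d3 l) = 0 by rewrite frame_orth.
have o23 j l : dot (d2 j) (d3 l) = 0 by rewrite frame_orth.
have mX v v' : Xs (mix k v v') = Xs v by rewrite /Xs mixX eqxx.
have mI v v' : Is (mix k v v') = Is v'.
  rewrite /Is; congr comp; apply/funext => t.
  rewrite (row_mix (mix := mix) mixX) /scl ek !mulr0 mul0r addr0; congr row.
  by apply/funext => j; rewrite /drop; case: eqP => // ->; rewrite ek mulr0.
have I0 j : avg (fun m => Is m j) = 0.
  under eq_avg do rewrite /Is comp_row.
  by rewrite avg_sum big1// => i _; exact: avg_comp_scale.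
have XP : \sum_j avg (fun m => Xs m j ^+ 2) <= n%:R * P k.
  have := avg_row_sqr mixP mixX x0 xP (only k 1).
  have -> : \sum_j sqn (only k 1 j) * P j = P k.
    rewrite (bigD1 k)//= /only eqxx /sqn /= expr1n expr0n addr0 mul1r big1 ?addr0// => j jk.
    by rewrite (negbTE jk) /= expr0n addr0 mul0r.
  apply: le_trans.
  rewrite le_eqVlt; apply/orP; left; apply/eqP; apply: eq_bigr => j _; apply: eq_avg => m.
  by rewrite /Xs row_only; congr (_ ^+ 2); congr comp; apply/funext => t; rewrite mul1r.
have IQ : \sum_j avg (fun m => Is m j ^+ 2) <= n%:R * \sum_j sqn (e j) * P j.
  have := avg_row_sqr mixP mixX x0 xP (scl u e).
  by under [X in _ * X]eq_bigr do rewrite /scl sqnM u1 mul1r.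
have c0 : 0 <= c by exact: sqrtr_ge0.
have cz : c ^+ 2 < z * w by rewrite c2.
have Jn : #|{: JJ}|%:R = 2 * n%:R :> R by exact: cardJJ.
have X0 j : avg (fun m => Xs m j) = 0 by exact: x0.
exact: (pair_info M0 gG (mixP k) (od false false) (od false true) (od true false) o12 o13 o23
  mX mI X0 I0 Jn XP IQ (ltW (P0 k)) Q0 c0 z0 w0 cz).
Qed.

End SignalPair.

(** * Fano's inequality with side information *)

Section PinnedFano.
Context {R : realType} {N : nat} {M : finType}.
Hypothesis M0 : (0 < #|M|)%N.
Variable g : probability (N.-tuple R) R.
Hypothesis gG : gaussm g.
Variable mix : M -> M -> M.
Hypothesis mixP : forall f : M -> R, avg (fun w => avg (fun v => f (mix w v))) = avg f.
Variables (A : finType) (lab : M -> A).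
Hypothesis lab_mix : forall w v, lab (mix w v) = lab w.
Hypothesis lab_unif : forall x, avg (fun w => (lab w == x)%:R) = (#|A|%:R)^-1 :> R.
Hypothesis A0 : (0 < #|A|)%N.
Variable dec : N.-tuple R -> A.
Hypothesis mdec : forall x, measurable (dec @^-1` [set x]).

Definition hit (a : M -> 'I_N -> R) : R :=
  avg (fun m => Ex g (fun y => (dec (tadd (a m) y) == lab m)%:R)).

Lemma fano_hit a : hit a * ln #|A|%:R - ln 2 <= minfo g a - cinfo g mix a.
Proof.
apply: le_trans (fano M0 gG mixP lab_mix lab_unif a A0 mdec).
rewrite (EE_shift gG) // => m; split.
  rewrite (_ : (fun y => _) = \1_(dec @^-1` [set lab m])).
    by apply: measurable_indic; exact: mdec.
  apply/funext => y; rewrite indicE; congr (nat_of_bool _)%:R.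
  by apply/eqP/idP => [h|/set_mem //]; apply/mem_set.
by exists 1, 0; split=> // y; rewrite mul0r expR0 mulr1; case: (_ == _);
  rewrite ?normr1 ?normr0.
Qed.

Variables (T : finType) (pin : T -> M -> M).
Hypothesis T0 : (0 < #|T|)%N.
Hypothesis pinP : forall f : M -> R, avg (fun t => avg (fun v => f (pin t v))) = avg f.
Hypothesis lab_pin : forall t v, lab (pin t v) = lab v.

(** [pin t] fixes the codewords given as side information. The success probability is an average
    over the pinned values, so Fano's inequality can be applied on each slice. *)
Lemma fano_pin a : hit a * ln #|A|%:R - ln 2 <=
  avg (fun t => minfo g (fun v => a (pin t v)) - cinfo g mix (fun v => a (pin t v))).
Proof.
apply: le_trans (avg_le (fun t => fano_hit (fun v => a (pin t v)))).
rewrite avgB avg_cst// lerD2r; under [leRHS]eq_avg do rewrite mulrC.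
rewrite avgZ mulrC le_eqVlt; apply/orP; left; apply/eqP; congr (_ * _).
rewrite -[LHS](pinP (fun m => Ex g (fun y => (dec (tadd (a m) y) == lab m)%:R))).
by apply: eq_avg => t; apply: eq_avg => v; rewrite lab_pin.
Qed.

End PinnedFano.

(** * Rate bounds given none, one or both of the other codewords *)

Section Rates.
Context {R : realType} {n : nat} {M : finType}.
Local Notation JJ := ('I_n * bool)%type.
Local Notation IX := (bool * bool * JJ)%type.
Local Notation N := #|{: IX}|.
Local Notation C := R[i].
Variable x : 'I_3 -> M -> 'I_n -> C.
Hypothesis M0 : (0 < #|M|)%N.
Variable g : probability (N.-tuple R) R.
Hypothesis gG : gaussm g.
Variable mix : 'I_3 -> M -> M -> M.
Hypothesis mixP : forall k (f : M -> R), avg (fun w => avg (fun v => f (mix k w v))) = avg f.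
Hypothesis mixX : forall k j w v, x j (mix k w v) = if j == k then x j w else x j v.
Variable k : 'I_3.
Variables (A : finType) (lab : M -> A).
Hypothesis lab_mix : forall j w v, lab (mix j w v) = if j == k then lab w else lab v.
Hypothesis lab_unif : forall x, avg (fun w => (lab w == x)%:R) = (#|A|%:R)^-1 :> R.
Hypothesis A0 : (0 < #|A|)%N.
Variable dec : N.-tuple R -> A.
Hypothesis mdec : forall x, measurable (dec @^-1` [set x]).
Variable y : 'I_3 -> C.
Let L := hit g lab dec (fam x false y row0) * ln #|A|%:R - ln 2.

Lemma lab_mixk w v : lab (mix k w v) = lab w. Proof. by rewrite lab_mix eqxx. Qed.

Lemma drop_row0 j : drop j row0 = row0 :> ('I_3 -> C).
Proof. by apply/funext => i; rewrite /drop; case: ifP. Qed.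

Lemma minfo_fam_mix j c w : minfo g (fun v => fam x false c row0 (mix j w v)) =
  Jf x g (drop j c) row0.
Proof.
under [X in minfo g X]funext do rewrite (fam_mix mixX).
by rewrite (minfo_translate M0 gG) drop_row0.
Qed.

Lemma cinfo_shift a (c : 'I_N -> R) :
  cinfo g (mix k) (fun v i => a v i + c i) = cinfo g (mix k) a.
Proof. by apply: eq_avg => w; rewrite (minfo_translate M0 gG). Qed.

Lemma rate_cond0 : L <= Jf x g y row0 - Jf x g (drop k y) row0.
Proof.
apply: le_trans (fano_hit M0 gG (mixP k) lab_mixk lab_unif A0 mdec _) _.
by rewrite (cinfo_fam M0 gG mixX) drop_row0.
Qed.

Lemma rate_cond1 j : j != k ->
  L <= Jf x g (drop j y) row0 - Jf x g (drop k (drop j y)) row0.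
Proof.
move=> jk; have lj w v : lab (mix j w v) = lab v by rewrite lab_mix (negbTE jk).
apply: le_trans (fano_pin M0 gG (mixP k) lab_mixk lab_unif A0 mdec M0 (mixP j) lj _) _.
rewrite -[leRHS](avg_cst M0); apply: avg_le => w.
rewrite minfo_fam_mix lerD2l lerN2.
under [X in cinfo g _ X]funext do rewrite (fam_mix mixX).
by rewrite cinfo_shift (cinfo_fam M0 gG mixX) !drop_row0.
Qed.

Lemma avg_pair (T1 T2 : finType) (f : T1 * T2 -> R) :
  avg f = avg (fun s => avg (fun t => f (s, t))).
Proof.
rewrite /avg card_prod natrM invfM -mulr_sumr mulrA; congr (_ * _).
by rewrite pair_bigA; apply: eq_bigr => -[].
Qed.

Lemma rate_cond2 j j' : j != k -> j' != k ->
  L <= Jf x g (drop j' (drop j y)) row0 - Jf x g (drop k (drop j' (drop j y))) row0.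
Proof.
move=> jk j'k; pose pin (p : M * M) v := mix j p.1 (mix j' p.2 v).
have MM0 : (0 < #|{: M * M}|)%N by rewrite card_prod muln_gt0 M0.
have pinP f : avg (fun p => avg (fun v => f (pin p v))) = avg f :> R.
  rewrite avg_pair -(mixP j f); apply: eq_avg => s.
  exact: (mixP j' (fun v => f (mix j s v))).
have lp p v : lab (pin p v) = lab v by rewrite !lab_mix (negbTE jk) (negbTE j'k).
apply: le_trans (fano_pin M0 gG (mixP k) lab_mixk lab_unif A0 mdec MM0 pinP lp _) _.
rewrite -[leRHS](avg_cst MM0); apply: avg_le => p.
have -> : (fun v => fam x false y row0 (pin p v)) =
    fun v => fun i => (fam x false (drop j y) row0 (mix j' p.2 v) i +
     (comb (frame false false) (comp (fun t => y j * x j p.1 t)) i +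
      comb (frame false true) (comp (fun t => row0 j * x j p.1 t)) i)).
  by apply/funext => v; rewrite /pin (fam_mix mixX) drop_row0.
rewrite cinfo_shift (minfo_translate M0 gG) minfo_fam_mix lerD2l lerN2.
under [X in cinfo g _ X]funext do rewrite (fam_mix mixX).
by rewrite cinfo_shift (cinfo_fam M0 gG mixX) !drop_row0.
Qed.

End Rates.

(** * Bounds by Gaussian values; whitened genie signals *)

Section GroupBounds.
Context {R : realType} {n : nat} {M : finType}.
Local Notation JJ := ('I_n * bool)%type.
Local Notation IX := (bool * bool * JJ)%type.
Local Notation N := #|{: IX}|.
Local Notation C := R[i].
Variable x : 'I_3 -> M -> 'I_n -> C.
Hypothesis M0 : (0 < #|M|)%N.
Variable g : probability (N.-tuple R) R.
Hypothesis gG : gaussm g.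
Variable mix : 'I_3 -> M -> M -> M.
Hypothesis mixP : forall k (f : M -> R), avg (fun w => avg (fun v => f (mix k w v))) = avg f.
Hypothesis mixX : forall k j w v, x j (mix k w v) = if j == k then x j w else x j v.
Hypothesis x0 : forall k j, avg (fun m => comp (x k m) j) = 0.
Variable P : 'I_3 -> R.
Hypothesis P0 : forall k, 0 < P k.
Hypothesis xP : forall k, avg (fun m => \sum_t sqn (x k m t)) <= n%:R * P k.
Implicit Types (c e : 'I_3 -> C).

Definition nrm c : R := \sum_j sqn (c j) * P j.

Lemma nrm_ge0 c : 0 <= nrm c.
Proof. by apply: sumr_ge0 => j _; rewrite mulr_ge0 ?sqn_ge0// ltW. Qed.

Lemma nrm_only k (a : C) : nrm (only k a) = sqn a * P k.
Proof.
rewrite /nrm (bigD1 k)//= /only eqxx big1 ?addr0// => j /negbTE ->.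
by rewrite /sqn /= expr0n addr0 mul0r.
Qed.

Lemma rc1 : rc 1 = 1 :> C. Proof. by []. Qed.
Lemma rc0 : rc 0 = 0 :> C. Proof. by []. Qed.
Lemma rcB (r t : R) : rc (r - t) = rc r - rc t.
Proof. exact: (rmorphB (real_complex R)). Qed.
Lemma rcD (r t : R) : rc (r + t) = rc r + rc t.
Proof. exact: (rmorphD (real_complex R)). Qed.
Lemma rcV (r : R) : rc r^-1 = (rc r)^-1.
Proof. exact: (fmorphV (real_complex R)). Qed.
Lemma rc_neq0 (r : R) : r != 0 -> rc r != 0.
Proof. by apply: contraNneq => -[] ->. Qed.
Lemma conj_rc (r : R) : conjc (rc r) = rc r.
Proof. by rewrite /rc /= oppr0. Qed.
Lemma conjM (a b : C) : conjc (a * b) = conjc a * conjc b.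
Proof. exact: rmorphM. Qed.
Lemma conjB (a b : C) : conjc (a - b) = conjc a - conjc b.
Proof. exact: rmorphB. Qed.
Lemma rc_sqn (a : C) : rc (sqn a) = a * conjc a. Proof. by rewrite mulC_conj. Qed.

Lemma rc_re2 (a : C) : rc (2 * complex.Re a) = a + conjc a.
Proof. by case: a => p q; apply/eqP; rewrite eq_complex /= subrr eqxx andbT; apply/eqP; ring. Qed.

Lemma sqrtV2 (r : R) : 0 <= r -> ((Num.sqrt r)^-1) ^+ 2 = r^-1.
Proof. by move=> r0; rewrite exprVn sqr_sqrtr. Qed.

Lemma gram_scl c0 (t : R) c1 k k' : gram c0 (scl (rc t) c1) k k' =
  c0 k * conjc (c0 k') + rc (t ^+ 2) * (c1 k * conjc (c1 k')).
Proof.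
by rewrite /gram /scl expr2 rcM conjM conj_rc; congr (_ + _); ring.
Qed.

Lemma Jf_swap c0 c1 : Jf x g c0 c1 = Jf x g c1 c0.
Proof. by apply: Jf_gram => // k k'; rewrite /gram addrC. Qed.

Lemma scl1 c : scl 1 c = c. Proof. by apply/funext => j; rewrite /scl mul1r. Qed.

Lemma Jf00 : Jf x g row0 row0 = 0.
Proof.
rewrite /Jf (_ : fam x false row0 row0 = fun=> fun=> 0); first exact: minfo0.
apply/funext => m; rewrite fam_row0 (_ : comp _ = fun=> 0).
  by apply/funext => i; rewrite /comb big1// => j _; rewrite mul0r.
have -> : row x row0 m = fun=> 0.
  by apply/funext => t; rewrite /row big1// => j _; rewrite mul0r.
by apply/funext => -[t []].
Qed.

Lemma scl0 c : scl (rc 0) c = row0.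
Proof. by apply/funext => j; rewrite /scl rc0 mul0r. Qed.

(** [Jf_add] with a first observation that carries no signal, hence with nothing to predict from. *)
Lemma Jf_snr c (r0 r1 : R) : 0 <= r0 <= r1 ->
  Jf x g (scl (rc r1) c) row0 - Jf x g (scl (rc r0) c) row0 <=
  n%:R * (ln (1 + r1 ^+ 2 * nrm c) - ln (1 + r0 ^+ 2 * nrm c)).
Proof.
move=> r01; rewrite !(Jf_swap _ row0).
have H := Jf_add M0 gG mixP mixX x0 xP (c0 := row0) (c1 := c) (lam := 0) r01 _ (nrm_ge0 c).
apply: H.
rewrite [sqn 0]/sqn /= expr0n addr0 addr0 le_eqVlt; apply/orP; left; apply/eqP.
by apply: eq_bigr => j _; rewrite mul0r subr0.
Qed.

Lemma Jf_ub c : Jf x g c row0 <= n%:R * ln (1 + nrm c).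
Proof.
have := @Jf_snr c 0 1; rewrite lexx ler01 => /(_ isT).
by rewrite scl0 Jf00 subr0 expr1n mul1r expr0n mul0r addr0 ln1 subr0 rc1 scl1.
Qed.

Lemma Jf_snrV c (z v : R) : 0 < z <= v ->
  Jf x g (scl (rc (Num.sqrt z)^-1) c) row0 - Jf x g (scl (rc (Num.sqrt v)^-1) c) row0 <=
  n%:R * (ln (1 + nrm c / z) - ln (1 + nrm c / v)).
Proof.
move=> /andP[z0 zv]; have v0 := lt_le_trans z0 zv.
rewrite [_ / z]mulrC [_ / v]mulrC -(sqrtV2 (ltW z0)) -(sqrtV2 (ltW v0)); apply: Jf_snr.
rewrite invr_ge0 sqrtr_ge0 /= lef_pV2 ?posrE ?sqrtr_gt0 //.
exact: ler_wsqrtr.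
Qed.

Section Genie.
Variables (y s : 'I_3 -> C) (lam : C) (w : R).
Hypothesis lw : sqn lam < w.
Let ka := w - sqn lam.

(** [y] is seen in unit noise Z and [s] in noise W of variance [w] with E[W Z^*] = [lam].
    Subtracting [lam] times the first observation leaves a noise of variance [ka] uncorrelated with
    Z. *)
Definition wit : 'I_3 -> C := scl (rc (Num.sqrt ka)^-1) (fun j => s j - lam * y j).

Lemma ka_gt0 : 0 < ka. Proof. by rewrite subr_gt0. Qed.
Lemma w_gt0 : 0 < w. Proof. exact: le_lt_trans (sqn_ge0 _) lw. Qed.
Lemma rc_ka : rc ka = rc w - lam * conjc lam.
Proof. by rewrite rcB rc_sqn. Qed.
Lemma rc_ka0 : rc w - lam * conjc lam != 0.
Proof. by rewrite -rc_ka rc_neq0// gt_eqF// ka_gt0. Qed.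

Lemma gram_wit k k' : gram y wit k k' =
  y k * conjc (y k') + (rc w - lam * conjc lam)^-1 *
    ((s k - lam * y k) * (conjc (s k') - conjc lam * conjc (y k'))).
Proof.
by rewrite gram_scl (sqrtV2 (ltW ka_gt0)) rcV rc_ka conjB conjM.
Qed.

(* Eliminates in the other order: the genie signal [s] first, then [y]. *)
Lemma Jf_wit_swap : Jf x g y wit =
  Jf x g (scl (rc (Num.sqrt w)^-1) s)
   (scl (rc (Num.sqrt (ka / w))^-1) (fun j => y j - conjc lam * rc w^-1 * s j)).
Proof.
have w0 := w_gt0; have k0 := ka_gt0; have kC := rc_ka0.
have wC : rc w != 0 by rewrite rc_neq0// gt_eqF.
apply: Jf_gram => // k k'; rewrite gram_wit.
have -> : gram (scl (rc (Num.sqrt w)^-1) s)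
   (scl (rc (Num.sqrt (ka / w))^-1) (fun j => y j - conjc lam * rc w^-1 * s j)) k k' =
   (rc w)^-1 * (s k * conjc (s k')) + rc w / (rc w - lam * conjc lam) *
   ((y k - conjc lam / rc w * s k) * (conjc (y k') - lam / rc w * conjc (s k'))).
  rewrite gram_scl (sqrtV2 (ltW (divr_gt0 k0 w0))) invf_div rcM (rcV ka) rc_ka; congr (_ + _).
    rewrite /scl conjM conj_rc mulrACA -rcM -expr2 (sqrtV2 (ltW w0)).
    by rewrite rcV.
  by rewrite conjB !conjM conjcK conj_rc rcV.
by field; rewrite kC wC.
Qed.

End Genie.
End GroupBounds.

(** * Genie signals in special positions *)

Section GenieBounds.
Context {R : realType} {n : nat} {M : finType}.
Local Notation JJ := ('I_n * bool)%type.
Local Notation IX := (bool * bool * JJ)%type.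
Local Notation N := #|{: IX}|.
Local Notation C := R[i].
Variable x : 'I_3 -> M -> 'I_n -> C.
Hypothesis M0 : (0 < #|M|)%N.
Variable g : probability (N.-tuple R) R.
Hypothesis gG : gaussm g.
Variable mix : 'I_3 -> M -> M -> M.
Hypothesis mixP : forall k (f : M -> R), avg (fun w => avg (fun v => f (mix k w v))) = avg f.
Hypothesis mixX : forall k j w v, x j (mix k w v) = if j == k then x j w else x j v.
Hypothesis x0 : forall k j, avg (fun m => comp (x k m) j) = 0.
Variable P : 'I_3 -> R.
Hypothesis P0 : forall k, 0 < P k.
Hypothesis xP : forall k, avg (fun m => \sum_t sqn (x k m t)) <= n%:R * P k.
Implicit Types (c e y s : 'I_3 -> C).

Lemma wit_drop k y s (lam : C) (w : R) :
  drop k (wit y s lam w) = wit (drop k y) (drop k s) lam w.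
Proof.
by apply/funext => j; rewrite /drop /wit /scl; case: ifP => // _; rewrite mulr0 subr0 mulr0.
Qed.

Definition ip y s : C := \sum_j y j * conjc (s j) * rc (P j).

Lemma nrm_sub y s (p : C) :
  nrm P (fun j => y j - p * s j) =
  nrm P y - 2 * complex.Re (conjc p * ip y s) + sqn p * nrm P s.
Proof.
rewrite /nrm /ip !mulr_sumr raddf_sum mulr_sumr -sumrB -big_split /=.
apply: eq_bigr => j _; case: (y j) (s j) p => a b [c d] [p q]; rewrite /sqn /=; ring.
Qed.

Section Genie.
Variables (lam : C) (w : R).
Hypothesis lw : sqn lam < w.
Let ka := w - sqn lam.
(** The variance of Z - W. *)
Let z := 1 + w - 2 * complex.Re lam.

Lemma z_gt0 : 0 < z.
Proof.
have k0 : 0 < ka by rewrite subr_gt0.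
rewrite /z; move: k0; rewrite /ka /sqn; case: (lam) => p q /= h.
have : 0 <= (1 - p) ^+ 2 + q ^+ 2 by rewrite addr_ge0 ?sqr_ge0.
by move: h; nra.
Qed.

(** (Z, W) and (Z - W, W) differ by a unimodular change of variables, so their covariance
    determinants agree. *)
Lemma det_z : z * w - sqn (conjc lam - rc w) = ka.
Proof. by rewrite /z /ka; case: (lam) => p q; rewrite /sqn /=; ring. Qed.

Lemma rc_z : rc z = 1 + rc w - lam - conjc lam.
Proof. by rewrite /z rcB rcD rc_re2 rc1 opprD addrA. Qed.

Let zC : 1 + rc w - lam - conjc lam != 0.
Proof. by rewrite -rc_z rc_neq0// gt_eqF// z_gt0. Qed.

(** Seeing the same signal in Z and in W amounts to seeing it once in noise of the variance of W
    given Z - W, which is [ka / z]. *)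
Lemma Jf_wit_same e : Jf x g e (wit e e lam w) =
  Jf x g (scl (rc (Num.sqrt (ka / z))^-1) e) row0.
Proof.
rewrite [RHS](Jf_swap x M0 gG); apply: (Jf_gram x M0 gG) => k k'; rewrite (gram_wit _ _ lw) gram_scl.
have kz : 0 < ka / z by rewrite divr_gt0 ?z_gt0// subr_gt0.
rewrite (sqrtV2 (ltW kz)) invf_div rcM rcV rc_ka rc_z /row0 mul0r add0r.
by have kC := rc_ka0 lw; field.
Qed.

(** With a single user left the two whitened observations merge, and their signal-to-noise ratios
    add. *)
Lemma Jf_wit_only k (a b : C) (v : R) : 0 < v ->
  v^-1 = sqn a + sqn (b - lam * a) / ka ->
  Jf x g (only k a) (wit (only k a) (only k b) lam w) =
  Jf x g (only k (rc (Num.sqrt v)^-1)) row0.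
Proof.
move=> v0 vE; apply: (Jf_gram x M0 gG) => i j; rewrite (gram_wit _ _ lw).
rewrite /gram /only /row0; case: (i == k) (j == k) => [] [];
  rewrite ?(mulr0, mul0r, rmorph0, subr0, sub0r, oppr0, addr0)//;
  try by rewrite ?(mulr0, mul0r, conjc0, rmorph0, subr0, addr0).
rewrite conj_rc -rcM -expr2 (sqrtV2 (ltW v0)) vE rcD rcM rcV -/(ka) rc_ka !rc_sqn.
by rewrite conjB conjM [X in _ = _ + X]mulrC.
Qed.

Definition withsig k e : 'I_3 -> C := fun j => if j == k then 1 else e j.

(** Subtracting the genie signal from the received one removes the interference: the pair becomes
    X_k + Z - W and e + W, whose noises have covariance conj(lam) - w. *)
Lemma Jf_wit_pairE k e : e k = 0 ->
  Jf x g (withsig k e) (wit (withsig k e) e lam w) =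
  Jf x g (only k (rc (Num.sqrt z)^-1))
    (scl (rc (Num.sqrt (w - sqn (conjc lam - rc w) / z))^-1)
      (fun j => e j - only k (conjc (conjc lam - rc w) * rc z^-1) j)).
Proof.
move=> ek; have z0 := z_gt0; have zN : z != 0 by rewrite gt_eqF.
have -> : w - sqn (conjc lam - rc w) / z = ka / z.
  by rewrite -det_z mulrBl mulrAC mulfV// mul1r.
have kz : 0 < ka / z by rewrite divr_gt0// subr_gt0.
apply: (Jf_gram x M0 gG) => i j; rewrite (gram_wit _ _ lw) gram_scl (sqrtV2 (ltW kz)) invf_div.
rewrite (rcM z) (rcV ka) (rcV z) rc_ka rc_z.
have -> : withsig k e i = e i + only k 1 i.
  by rewrite /withsig /only; case: eqP => [->|_]; rewrite ?ek ?add0r ?addr0.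
have -> : withsig k e j = e j + only k 1 j.
  by rewrite /withsig /only; case: eqP => [->|_]; rewrite ?ek ?add0r ?addr0.
have oE (a : C) l : only k a l = a * only k 1 l.
  by rewrite /only; case: eqP; rewrite ?mulr1 ?mulr0.
rewrite (oE (rc (Num.sqrt z)^-1) i) (oE (rc (Num.sqrt z)^-1) j).
rewrite (oE (conjc (conjc lam - rc w) * (1 + rc w - lam - conjc lam)^-1) i).
rewrite (oE (conjc (conjc lam - rc w) * (1 + rc w - lam - conjc lam)^-1) j).
have oc l : conjc (only k 1 l) = only k 1 l :> C.
  by rewrite /only; case: eqP => _; [exact: rmorph1|exact: rmorph0].
have conjD (a b : C) : conjc (a + b) = conjc a + conjc b by exact: rmorphD.
rewrite !(conjB, conjM, conjD, conjcK, conj_rc, oc).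
rewrite (mulrACA (rc (Num.sqrt z)^-1)) -(rcM (Num.sqrt z)^-1) -expr2 (sqrtV2 (ltW z0)) (rcV z) rc_z.
have kC := rc_ka0 lw.
have conjV : conjc (1 + rc w - lam - conjc lam)^-1 = (1 + rc w - lam - conjc lam)^-1.
  by rewrite -rc_z -rcV conj_rc.
rewrite ?conjV.
by field; rewrite kC zC.
Qed.

End Genie.
End GenieBounds.

(** * Gaps between informations and their Gaussian values *)

Section GenieGaps.
Context {R : realType} {n : nat} {M : finType}.
Local Notation JJ := ('I_n * bool)%type.
Local Notation IX := (bool * bool * JJ)%type.
Local Notation N := #|{: IX}|.
Local Notation C := R[i].
Variable x : 'I_3 -> M -> 'I_n -> C.
Hypothesis M0 : (0 < #|M|)%N.
Variable g : probability (N.-tuple R) R.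
Hypothesis gG : gaussm g.
Variable mix : 'I_3 -> M -> M -> M.
Hypothesis mixP : forall k (f : M -> R), avg (fun w => avg (fun v => f (mix k w v))) = avg f.
Hypothesis mixX : forall k j w v, x j (mix k w v) = if j == k then x j w else x j v.
Hypothesis x0 : forall k j, avg (fun m => comp (x k m) j) = 0.
Variable P : 'I_3 -> R.
Hypothesis P0 : forall k, 0 < P k.
Hypothesis xP : forall k, avg (fun m => \sum_t sqn (x k m t)) <= n%:R * P k.
Implicit Types (c e y s : 'I_3 -> C).

Section Genie.
Variables (lam : C) (w : R).
Hypothesis lw : sqn lam < w.
Let ka := w - sqn lam.

(** The covariance determinant of y + Z and s + W for independent inputs of full power. *)
Definition wdet y s : R := (1 + nrm P y) * (w + nrm P s) - sqn (ip P y s + conjc lam).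

(** [p] is the coefficient of the best linear estimate of y + Z from s + W, so the residual variance
    is a ratio of determinants. *)
Lemma wit_min y s (p : C) : p = (ip P y s + conjc lam) * rc (w + nrm P s)^-1 ->
  1 + w / ka * (nrm P (fun j => y j - p * s j) + w * sqn (p - conjc lam * rc w^-1)) =
  w * wdet y s / ((w + nrm P s) * ka).
Proof.
have w0 : w != 0 by rewrite gt_eqF// (w_gt0 lw).
have k0 : ka != 0 by rewrite gt_eqF// subr_gt0.
have q0 : w + nrm P s != 0 by rewrite gt_eqF// ltr_wpDr ?nrm_ge0 ?(w_gt0 lw).
rewrite nrm_sub => ->; rewrite /wdet; move: k0 q0; rewrite /ka.
move: (nrm P y) (nrm P s) => Y S; case: (ip P y s) => i1 i2; case: (lam) => l1 l2.
rewrite /sqn /= => k0 q0; field; by rewrite w0 q0 k0.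
Qed.

Lemma wdet_gt0 y s : 0 < wdet y s.
Proof.
have w0 := w_gt0 lw; have k0 : 0 < ka by rewrite subr_gt0.
have q0 : 0 < w + nrm P s by rewrite ltr_wpDr ?nrm_ge0.
have := @wit_min y s _ erefl; set A := w / ka * _.
have A0 : 0 <= A.
  rewrite mulr_ge0 ?divr_ge0 ?(ltW w0) ?(ltW k0)// addr_ge0 ?nrm_ge0//.
  by rewrite mulr_ge0 ?sqn_ge0// ltW.
have A1 : 0 < 1 + A by rewrite ltr_pwDl.
have X0 : 0 < (w + nrm P s) * ka by rewrite mulr_gt0.
by move=> E; move: A1; rewrite E pmulr_lgt0 ?invr_gt0// pmulr_rgt0.
Qed.

Lemma ln_wit_min (S D : R) : 0 < w + S -> 0 < D ->
  ln (w * D / ((w + S) * ka)) + (ln (1 + S / w) - ln 1) = ln D - ln ka.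
Proof.
have w0 := w_gt0 lw; have k0 : 0 < ka by rewrite subr_gt0.
move=> q0 D0.
have -> : 1 + S / w = (w + S) / w by rewrite mulrDl mulfV// gt_eqF.
rewrite ln_div ?posrE ?mulr_gt0// lnM ?posrE// (lnM (x := w + S)) ?posrE//.
by rewrite ln_div ?posrE// ln1; ring.
Qed.

Lemma gap_arith3 (n' A B a b c d e : R) : A <= n' * a -> B <= n' * (b - c) ->
  a + (b - 0) = d - e -> A + B <= n' * (d - e - c).
Proof.
move=> h1 h2 h3; apply: le_trans (lerD h1 h2) _; rewrite -mulrDr.
by rewrite le_eqVlt -h3 subr0 addrA eqxx.
Qed.

(** The gap splits in two: the received signal is added to the genie signal at noise [w], controlled
    by [Jf_add], and the noise of the genie signal alone is raised from [w] to [d], controlled by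
    [Jf_snrV]. *)
Lemma Jf_wit_add y s (d : R) : w <= d ->
  Jf x g y (wit y s lam w) - Jf x g (scl (rc (Num.sqrt d)^-1) s) row0 <=
  n%:R * (ln (wdet y s) - ln ka - ln (1 + nrm P s / d)).
Proof.
move=> wd; have w0 := w_gt0 lw; have k0 : 0 < ka by rewrite subr_gt0.
have q0 : 0 < w + nrm P s by rewrite ltr_wpDr ?nrm_ge0.
have kw0 : 0 < ka / w by rewrite divr_gt0.
set c0 := scl (rc (Num.sqrt w)^-1) s.
pose t := (Num.sqrt (ka / w))^-1.
pose c1 := scl (rc t) (fun j => y j - conjc lam * rc w^-1 * s j).
pose p := (ip P y s + conjc lam) * rc (w + nrm P s)^-1.
(* Chosen so that [c1 - mu c0] is [t] times [y - p s]. *)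
pose mu := rc (t * Num.sqrt w) * (p - conjc lam * rc w^-1).
pose s2 := w / ka * (nrm P (fun j => y j - p * s j) + w * sqn (p - conjc lam * rc w^-1)).
have t2 : t ^+ 2 = w / ka by rewrite /t (sqrtV2 (ltW kw0)) invf_div.
have s20 : 0 <= s2.
  rewrite mulr_ge0 ?divr_ge0 ?(ltW w0) ?(ltW k0)// addr_ge0 ?nrm_ge0//.
  by rewrite mulr_ge0 ?sqn_ge0// ltW.
have sw : Num.sqrt w * (Num.sqrt w)^-1 = 1 by rewrite mulfV// gt_eqF// sqrtr_gt0.
have cond : \sum_k sqn (c1 k - mu * c0 k) * P k + sqn mu <= s2.
  rewrite le_eqVlt; apply/orP; left; apply/eqP.
  have cE j : c1 j - mu * c0 j = rc t * (y j - p * s j).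
    have swC : rc (Num.sqrt w) * rc (Num.sqrt w)^-1 = 1 :> C by rewrite -rcM sw.
    rewrite /c1 /mu /c0 /scl rcM.
    rewrite [X in _ - X](_ : _ = rc t * (p - conjc lam * rc w^-1) *
      (rc (Num.sqrt w) * rc (Num.sqrt w)^-1) * s j); last by ring.
    by rewrite swC; ring.
  rewrite /mu sqnM sqn_rc exprMn t2 sqr_sqrtr ?ltW//.
  rewrite /s2 [RHS]mulrDr (mulrA (w / ka) w); congr (_ + _).
  rewrite /nrm mulr_sumr; apply: eq_bigr => j _.
  by rewrite cE sqnM sqn_rc t2 mulrA.
have r01 : 0 <= (0 : R) <= 1 by rewrite lexx ler01.
have h1 := Jf_add M0 gG mixP mixX x0 xP r01 cond s20.
have e1 : (fun k => rc 1 * c1 k) = c1 by apply/funext => k; rewrite rc1 mul1r.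
have e0 : (fun k => rc 0 * c1 k) = row0 by apply/funext => k; rewrite rc0 mul0r.
rewrite e1 e0 in h1.
have h2 := Jf_snrV M0 gG mixP mixX x0 P0 xP s (z := w) (v := d).
rewrite w0 wd in h2; have {}h2 := h2 isT.
rewrite (Jf_wit_swap x M0 gG _ _ lw).
rewrite (_ : _ - _ = (Jf x g c0 c1 - Jf x g c0 row0) +
  (Jf x g c0 row0 - Jf x g (scl (rc (Num.sqrt d)^-1) s) row0)); last first.
  by rewrite addrA subrK.
apply: (gap_arith3 _ h2 (a := ln (1 + s2))).
  apply: le_trans h1 _.
  by rewrite expr1n mul1r expr0n mul0r addr0 ln1 subr0.
by rewrite /s2 wit_min// -(ln_wit_min q0 (wdet_gt0 y s)) ln1.
Qed.

Let z := 1 + w - 2 * complex.Re lam.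

Lemma gap_arith4 (n' A B C' D' E' a b c d e f : R) :
  A - B - C' <= n' * (a - b - c - d) -> B - D' <= n' * (c - e) -> C' - E' <= n' * (d - f) ->
  A - D' - E' <= n' * (a - b - e - f).
Proof.
move=> h1 h2 h3; have := lerD (lerD h1 h2) h3.
congr (_ <= _); ring.
Qed.

(** [Jf_pair] compares with noises [z] and [w]; these are then raised to [v] and 1, and each
    increase costs at most its Gaussian value. *)
Lemma Jf_wit_pair_le k e (v : R) : e k = 0 -> w <= 1 -> z <= v ->
  Jf x g (withsig k e) (wit (withsig k e) e lam w)
  - Jf x g (only k (rc (Num.sqrt v)^-1)) row0 - Jf x g e row0 <=
  n%:R * (ln ((z + P k) * (w + nrm P e) - sqn (conjc lam - rc w)) - ln ka
          - ln (1 + P k / v) - ln (1 + nrm P e)).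
Proof.
move=> ek w1 zv; have w0 := w_gt0 lw; have k0 : 0 < ka by rewrite subr_gt0.
have z0 : 0 < z := z_gt0 lw.
have czw : sqn (conjc lam - rc w) < z * w by rewrite -subr_gt0 det_z.
have h1 := Jf_pair M0 gG mixP mixX x0 P0 xP ek z0 w0 czw.
rewrite -(Jf_wit_pairE x M0 gG lw ek) det_z in h1.
have oE r : only k (rc r) = scl (rc r) (only k 1) :> ('I_3 -> C).
  by apply/funext => j; rewrite /only /scl; case: ifP; rewrite ?mulr1 ?mulr0.
have n1 : nrm P (only k 1) = P k by rewrite nrm_only /sqn /= expr1n expr0n addr0 mul1r.
have h2 := Jf_snrV M0 gG mixP mixX x0 P0 xP (only k 1) (z := z) (v := v).
rewrite z0 zv in h2; have {}h2 := h2 isT; rewrite -!oE n1 in h2.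
have h3 := Jf_snrV M0 gG mixP mixX x0 P0 xP e (z := w) (v := 1).
rewrite w0 w1 in h3; have {}h3 := h3 isT; rewrite sqrtr1 invr1 rc1 scl1 mulr1 in h3.
have l1 (a b : R) : 0 < a -> 0 <= b -> ln (a + b) - ln a = ln (1 + b / a).
  move=> a0 b0; rewrite -ln_div ?posrE//; last by rewrite ltr_pwDl.
  by rewrite mulrDl mulfV// gt_eqF.
have Pk := ltW (P0 k).
rewrite -/(nrm P e) (l1 _ _ z0 Pk) (l1 _ _ w0 (nrm_ge0 P0 e)) in h1.
exact: gap_arith4 h1 h2 h3.
Qed.

End Genie.
End GenieGaps.

(** * Regrouping the nine rate bounds around the cycle of users *)

Section Groups.
Context {R : realType} {n : nat} {M : finType}.
Local Notation JJ := ('I_n * bool)%type.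
Local Notation IX := (bool * bool * JJ)%type.
Local Notation N := #|{: IX}|.
Local Notation C := R[i].
Variable x : 'I_3 -> M -> 'I_n -> C.
Hypothesis M0 : (0 < #|M|)%N.
Variable g : probability (N.-tuple R) R.
Hypothesis gG : gaussm g.
Variable mix : 'I_3 -> M -> M -> M.
Hypothesis mixP : forall k (f : M -> R), avg (fun w => avg (fun v => f (mix k w v))) = avg f.
Hypothesis mixX : forall k j w v, x j (mix k w v) = if j == k then x j w else x j v.
Hypothesis x0 : forall k j, avg (fun m => comp (x k m) j) = 0.
Variable P : 'I_3 -> R.
Hypothesis P0 : forall k, 0 < P k.
Hypothesis xP : forall k, avg (fun m => \sum_t sqn (x k m t)) <= n%:R * P k.
Variable h : 'I_3 -> 'I_3 -> C.
Implicit Types k : 'I_3.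

Definition intf k : 'I_3 -> C := fun j => if j == k then 0 else h k j.
Definition rcv k : 'I_3 -> C := withsig k (intf k).

Lemma intf_id k : intf k k = 0. Proof. by rewrite /intf eqxx. Qed.
Lemma drop_rcv k : drop k (rcv k) = intf k.
Proof. by apply/funext => j; rewrite /drop /rcv /withsig /intf; case: eqP. Qed.
Lemma drop_intf k : drop k (intf k) = intf k.
Proof. by apply/funext => j; rewrite /drop /intf; case: eqP. Qed.

Lemma ord3_neq k j : j != k -> j != k + 1 -> j = k + 2.
Proof.
by case: k j => [[|[|[|?]]] ?] [[|[|[|?]]] ?] //= a b; apply: val_inj; move: a b; rewrite /eq_op.
Qed.

Lemma ord3_add k : (k + 1 != k) * (k + 2 != k) * (k + 2 != k + 1).
Proof. by case: k => [[|[|[|?]]] ?]. Qed.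

Lemma drop2_only k (c : 'I_3 -> C) : drop (k + 1) (drop k c) = only (k + 2) (c (k + 2)).
Proof.
apply/funext => j; rewrite /drop /only.
have [->|j1] := eqVneq j (k + 1); first by rewrite eq_sym (negbTE (ord3_add k).2).
have [->|j0] := eqVneq j k; first by rewrite eq_sym (negbTE (ord3_add k).1.2).
by rewrite (ord3_neq j0 j1) eqxx.
Qed.

Lemma sum_shift (F : 'I_3 -> R) (i : 'I_3) : \sum_k F (k + i) = \sum_k F k.
Proof. by rewrite [RHS](reindex_inj (addIr i)). Qed.

(* [lw, w] are E[W Z*], E|W|^2 and [ln, nn] are E[N Z*], E|N|^2. *)
Variables (lw : 'I_3 -> C) (w : 'I_3 -> R) (ln' : 'I_3 -> C) (nn : 'I_3 -> R).
(** [v j] is the noise variance of the best combination of Y_(j+2) and S_(j+2) once X_j is the only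
    unknown input. *)
Variable v : 'I_3 -> R.
Hypothesis lnn : forall k, sqn (ln' k) < nn k.
Let kaN k := nn k - sqn (ln' k).
Let zz k := 1 + w k - 2 * complex.Re (lw k).
Hypothesis v0 : forall k, 0 < v k.
Hypothesis vE : forall k, (v (k + 2))^-1 = sqn (h (k + 1) (k + 2)) +
  sqn (h k (k + 2) - ln' (k + 1) * h (k + 1) (k + 2)) / kaN (k + 1).
Hypothesis zv : forall k, zz k <= v k.

Let yN k := drop k (rcv (k + 1)).
Let JYS k := Jf x g (yN k) (wit (yN k) (intf k) (ln' (k + 1)) (nn (k + 1))).

Variable L : 'I_3 -> R.
Hypothesis rate0 : forall k, L k <= Jf x g (rcv k) row0 - Jf x g (drop k (rcv k)) row0.
Hypothesis rate1 : forall k j, j != k -> L k <= Jf x g (drop j (rcv k)) row0 -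
  Jf x g (drop k (drop j (rcv k))) row0.
Hypothesis rate2 : forall k j j', j != k -> j' != k ->
  L k <= Jf x g (drop j' (drop j (rcv k))) row0 -
    Jf x g (drop k (drop j' (drop j (rcv k)))) row0.

(** Given X_k, knowing X_(k+1) as well leaves only X_(k+2), for which the two observations merge by
    [Jf_wit_only]. *)
Lemma rate_YS k : L (k + 1) <= JYS k - Jf x g (only (k + 2) (rc (Num.sqrt (v (k + 2)))^-1)) row0.
Proof.
apply: le_trans (rate1 (k := k + 1) (j := k) _) _; first by rewrite eq_sym (ord3_add k).1.1.
apply: le_trans (Jf_mono M0 gG mixP mixX (k + 1) (yN k)
  (wit (yN k) (intf k) (ln' (k + 1)) (nn (k + 1)))) _.
rewrite wit_drop lerD2l lerN2 /yN drop2_only.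
have -> : drop (k + 1) (intf k) = only (k + 2) (h k (k + 2)).
  by rewrite -(drop_intf k) drop2_only /intf (negbTE (ord3_add k).1.2).
have -> : rcv (k + 1) (k + 2) = h (k + 1) (k + 2).
  by rewrite /rcv /withsig /intf (negbTE (ord3_add k).2).
by rewrite (Jf_wit_only x M0 gG (lnn (k + 1)) (k + 2) (v0 (k + 2)) (vE k)).
Qed.

Definition gYS k (d : R) : R := ln (wdet P (ln' (k + 1)) (nn (k + 1)) (yN k) (intf k))
  - ln (kaN (k + 1)) - ln (1 + nrm P (intf k) / d).

Section PartA.
Hypothesis lww : forall k, sqn (lw k) < w k.
Let ka k := w k - sqn (lw k).
Hypothesis w1 : forall k, w k <= 1.
Hypothesis nka : forall k, nn (k + 1) <= ka k / zz k.

(** Once X_k is known, Y_k and U_k are two views of the same interference. *)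
Lemma rate_YU k : L k <= Jf x g (rcv k) (wit (rcv k) (intf k) (lw k) (w k)) -
  Jf x g (scl (rc (Num.sqrt (ka k / zz k))^-1) (intf k)) row0.
Proof.
apply: le_trans (rate0 k) _.
apply: le_trans (Jf_mono M0 gG mixP mixX k (rcv k) (wit (rcv k) (intf k) (lw k) (w k))) _.
by rewrite wit_drop drop_rcv drop_intf (Jf_wit_same x M0 gG (lww k)).
Qed.

Definition gA k : R := ln (1 + nrm P (rcv k)) +
  (ln ((zz k + P k) * (w k + nrm P (intf k)) - sqn (conjc (lw k) - rc (w k))) - ln (ka k)
   - ln (1 + P k / v k) - ln (1 + nrm P (intf k))) + gYS k (ka k / zz k).

Lemma group_a_arith (n' l0 l1 a0 b0 a1 b1 a2 b2 c0 g0 g1 g2 : R) :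
  l0 <= a0 - b0 -> l0 <= a1 - b1 -> l1 <= a2 - b2 ->
  a0 <= n' * g0 -> a1 - c0 - b0 <= n' * g1 -> a2 - b1 <= n' * g2 ->
  2 * l0 + l1 <= n' * (g0 + g1 + g2) + c0 - b2.
Proof. by rewrite !mulrDr => *; lra. Qed.

(** Around the cycle the terms [c] cancel and each rate is counted three times. *)
Lemma cyclic_sum (n' : R) (l G c : 'I_3 -> R) :
  (forall k, 2 * l k + l (k + 1) <= n' * G k + c k - c (k + 2)) ->
  3 * \sum_k l k <= n' * \sum_k G k.
Proof.
move=> H; have : \sum_k (2 * l k + l (k + 1)) <= \sum_k (n' * G k + c k - c (k + 2)).
  by apply: ler_sum => k _; exact: H.
rewrite sumrB 2!big_split /= (sum_shift l) (sum_shift c) -!mulr_sumr addrK.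
by congr (_ <= _); ring.
Qed.

Lemma group_a : 3 * \sum_k L k <= n%:R * \sum_k gA k.
Proof.
pose c k := Jf x g (only k (rc (Num.sqrt (v k))^-1)) row0.
apply: (cyclic_sum (c := c)) => k; have r0 := rate0 k; rewrite drop_rcv in r0.
exact: (group_a_arith r0 (rate_YU k) (rate_YS k)
  (Jf_ub M0 gG mixP mixX x0 P0 xP (rcv k))
  (Jf_wit_pair_le M0 gG mixP mixX x0 P0 xP (lww k) (intf_id k) (w1 k) (zv k))
  (Jf_wit_add M0 gG mixP mixX x0 P0 xP (lnn (k + 1)) (yN k) (intf k) (nka k))).
Qed.

End PartA.

Section PartB.
Hypothesis z01 : forall k, 0 < zz k <= 1.
Hypothesis n1 : forall k, nn k <= 1.

Definition gB k : R := ln (1 + nrm P (rcv k)) +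
  (ln (1 + P k / zz k) - ln (1 + P k / v k)) + gYS k 1.

(** In part (b) this takes the place of the bound from (Y_k, U_k), so that W_k = 0 is allowed. Both
    other codewords are given, leaving X_k in unit noise; a second view of X_k lowers the noise to
    [zz k]. *)
Lemma rate_X k : L k <= Jf x g (only k (rc (Num.sqrt (zz k))^-1)) row0.
Proof.
apply: le_trans (rate2 (j := k + 1) (j' := k + 2) _ _) _; first by rewrite ord3_add.
  by rewrite ord3_add.
have -> : drop (k + 2) (drop (k + 1) (rcv k)) = only k 1.
  apply/funext => j; rewrite /drop /only /rcv /withsig /intf.
  case: (eqVneq j k) => [->|j0].
    by rewrite !(eq_sym k) (negbTE (ord3_add k).1.2) (negbTE (ord3_add k).1.1).
  case: (eqVneq j (k + 2)) => [//|j2]; case: (eqVneq j (k + 1)) => [//|j1].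
  by move: j2; rewrite (ord3_neq j0 j1) eqxx.
have -> : drop k (only k 1) = row0 :> ('I_3 -> C).
  by apply/funext => j; rewrite /drop /only; case: eqP.
rewrite (Jf00 x M0) subr0.
have /andP[z0 z1] := z01 k.
(* The amplitude for which 1 + t^2 is the target signal-to-noise factor 1 / [zz k]. *)
pose t := Num.sqrt ((zz k)^-1 - 1).
have t2 : t ^+ 2 = (zz k)^-1 - 1 by rewrite sqr_sqrtr// subr_ge0 invf_ge1.
have dO (a : C) : drop k (only k a) = row0.
  by apply/funext => j; rewrite /drop /only; case: eqP.
have J01 := Jf_mono M0 gG mixP mixX k (only k 1) (only k (rc t)).
rewrite (dO 1) (dO (rc t)) (Jf00 x M0 g) in J01.
have H a b : a - 0 <= b - 0 -> a <= b :> R by rewrite !subr0.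
apply: le_trans (H _ _ J01) _.
rewrite le_eqVlt; apply/orP; left; apply/eqP; apply: (Jf_gram x M0 gG) => i j.
rewrite /gram /only /row0; case: (i == k) (j == k) => [] [];
  rewrite ?(mulr0, mul0r, conjc0, addr0)//.
rewrite -rc1 !conj_rc -!rcM -rcD; congr rc.
by rewrite -!expr2 t2 (sqrtV2 (ltW z0)) expr1n addrC subrK.
Qed.

Lemma group_b_arith (n' l0 l1 a0 b0 a1 a2 b2 c0 g0 g1 g2 : R) :
  l0 <= a0 - b0 -> l0 <= a1 -> l1 <= a2 - b2 ->
  a0 <= n' * g0 -> a1 - c0 <= n' * g1 -> a2 - b0 <= n' * g2 ->
  2 * l0 + l1 <= n' * (g0 + g1 + g2) + c0 - b2.
Proof. by rewrite !mulrDr => *; lra. Qed.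

Lemma group_b : 3 * \sum_k L k <= n%:R * \sum_k gB k.
Proof.
pose c k := Jf x g (only k (rc (Num.sqrt (v k))^-1)) row0.
have oE k r : only k (rc r) = scl (rc r) (only k 1) :> ('I_3 -> C).
  by apply/funext => j; rewrite /only /scl; case: ifP; rewrite ?mulr1 ?mulr0.
have n1k k : nrm P (only k 1) = P k by rewrite nrm_only /sqn /= expr1n expr0n addr0 mul1r.
apply: (cyclic_sum (c := c)) => k; have r0 := rate0 k; rewrite drop_rcv in r0.
have /andP[z0 _] := z01 k.
have h2 := Jf_snrV M0 gG mixP mixX x0 P0 xP (only k 1) (z := zz k) (v := v k).
rewrite z0 zv in h2; have {}h2 := h2 isT; rewrite -!oE n1k in h2.
have h3 := Jf_wit_add M0 gG mixP mixX x0 P0 xP (lnn (k + 1)) (yN k) (intf k) (n1 (k + 1)).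
have e1 : scl (rc (Num.sqrt 1)^-1) (intf k) = intf k by rewrite sqrtr1 invr1 rc1 scl1.
rewrite e1 in h3.
exact: (group_b_arith r0 (rate_X k) (rate_YS k)
  (Jf_ub M0 gG mixP mixX x0 P0 xP (rcv k)) h2 h3).
Qed.

End PartB.
End Groups.

(** * Centring the codewords *)

Section Centering.
Context {R : realType} {n : nat} {M : finType}.
Local Notation JJ := ('I_n * bool)%type.
Local Notation IX := (bool * bool * JJ)%type.
Local Notation N := #|{: IX}|.
Local Notation C := R[i].
Variable x : 'I_3 -> M -> 'I_n -> C.
Hypothesis M0 : (0 < #|M|)%N.
Variable g : probability (N.-tuple R) R.
Hypothesis gG : gaussm g.

(** Subtracting the mean codeword does not increase the power, and being a translation it preserves
    every information. *)
Definition centre k t : C :=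
  Complex (avg (fun m => complex.Re (x k m t))) (avg (fun m => complex.Im (x k m t))).
Definition ctr k m t : C := x k m t - centre k t.

Lemma avg_comp_ctr k j : avg (fun m => comp (ctr k m) j) = 0.
Proof.
case: j => t b; rewrite /comp /ctr /=.
by case: b; under eq_avg do rewrite raddfB /=; rewrite avgB avg_cst// subrr.
Qed.

Lemma avg_sqr_ctr (f : M -> R) : avg (fun m => (f m - avg f) ^+ 2) <= avg (fun m => f m ^+ 2).
Proof.
under eq_avg => m do rewrite sqrrB -mulrnAr mulrC.
rewrite avgD avgB avgZ avg_cst//.
suff -> : avg f *+ 2 * avg f = avg f ^+ 2 *+ 2.
  by rewrite mulr2n opprD addrA subrK lerBlDr lerDl sqr_ge0.
by rewrite expr2 mulrnAl.
Qed.

Lemma power_ctr k : avg (fun m => \sum_t sqn (ctr k m t)) <=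
  avg (fun m => \sum_t sqn (x k m t)).
Proof.
rewrite !avg_sum; apply: ler_sum => t _; rewrite /sqn !avgD.
under [X in X + _ <= _]eq_avg do rewrite raddfB /=.
under [X in _ + X <= _]eq_avg do rewrite raddfB /=.
by apply: lerD; exact: avg_sqr_ctr.
Qed.

Lemma Jf_ctr c0 c1 : Jf ctr g c0 c1 = Jf x g c0 c1.
Proof.
pose shift i := comb (frame false false) (comp (fun t => \sum_k c0 k * centre k t)) i +
  comb (frame false true) (comp (fun t => \sum_k c1 k * centre k t)) i : R.
rewrite /Jf -(minfo_translate M0 gG (fam ctr false c0 c1) shift); congr minfo.
have rE c m : row x c m = fun t => row ctr c m t + \sum_k c k * centre k t.
  apply/funext => t; rewrite /row -big_split; apply: eq_bigr => k _ /=.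
  by rewrite /ctr mulrBr subrK.
apply/funext => m; apply/funext => i; rewrite /fam /shift !rE !compD !combD.
by rewrite addrACA.
Qed.

Variable mix : 'I_3 -> M -> M -> M.
Hypothesis mixP : forall k (f : M -> R), avg (fun w => avg (fun v => f (mix k w v))) = avg f.
Hypothesis mixX : forall k j w v, x j (mix k w v) = if j == k then x j w else x j v.

Lemma mix_ctr k j w v : ctr j (mix k w v) = if j == k then ctr j w else ctr j v.
Proof. by apply/funext => t; rewrite /ctr mixX; case: ifP. Qed.

Variable P : 'I_3 -> R.
Hypothesis P0 : forall k, 0 < P k.
Hypothesis xP : forall k, avg (fun m => \sum_t sqn (x k m t)) <= n%:R * P k.
Let xP' k := le_trans (power_ctr k) (xP k).

Variable A : 'I_3 -> finType.
Variable lab : forall k, M -> A k.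
Hypothesis lab_mix : forall k j w v, lab k (mix j w v) = if j == k then lab k w else lab k v.
Hypothesis lab_unif : forall k z, avg (fun w => (lab k w == z)%:R) = (#|A k|%:R)^-1 :> R.
Hypothesis A0 : forall k, (0 < #|A k|)%N.
Variable dec : forall k, N.-tuple R -> A k.
Hypothesis mdec : forall k z, measurable (dec k @^-1` [set z]).
Variable h : 'I_3 -> 'I_3 -> C.

Definition fano_rate k : R :=
  hit g (lab k) (dec k) (fam x false (rcv h k) row0) * ln #|A k|%:R - ln 2.

Variables (lw : 'I_3 -> C) (w : 'I_3 -> R) (ln' : 'I_3 -> C) (nn : 'I_3 -> R).
Variable v : 'I_3 -> R.
Hypothesis lnn : forall k, sqn (ln' k) < nn k.
Hypothesis v0 : forall k, 0 < v k.
Hypothesis vE : forall k, (v (k + 2))^-1 = sqn (h (k + 1) (k + 2)) +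
  sqn (h k (k + 2) - ln' (k + 1) * h (k + 1) (k + 2)) / (nn (k + 1) - sqn (ln' (k + 1))).
Hypothesis zv : forall k, 1 + w k - 2 * complex.Re (lw k) <= v k.

Let r0 k : fano_rate k <= Jf ctr g (rcv h k) row0 - Jf ctr g (drop k (rcv h k)) row0.
Proof.
rewrite !Jf_ctr.
exact: (rate_cond0 M0 gG mixP mixX (lab_mix k) (@lab_unif k) (A0 k) (@mdec k)).
Qed.
Let r1 k j : j != k -> fano_rate k <= Jf ctr g (drop j (rcv h k)) row0 -
  Jf ctr g (drop k (drop j (rcv h k))) row0.
Proof.
move=> jk; rewrite !Jf_ctr.
exact: (rate_cond1 M0 gG mixP mixX (lab_mix k) (@lab_unif k) (A0 k) (@mdec k)).
Qed.
Let r2 k j j' : j != k -> j' != k -> fano_rate k <= Jf ctr g (drop j' (drop j (rcv h k))) row0 -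
  Jf ctr g (drop k (drop j' (drop j (rcv h k)))) row0.
Proof.
move=> jk j'k; rewrite !Jf_ctr.
exact: (rate_cond2 M0 gG mixP mixX (lab_mix k) (@lab_unif k) (A0 k) (@mdec k)).
Qed.

Lemma fano_group_a : (forall k, sqn (lw k) < w k) -> (forall k, w k <= 1) ->
  (forall k, nn (k + 1) <= (w k - sqn (lw k)) / (1 + w k - 2 * complex.Re (lw k))) ->
  3 * \sum_k fano_rate k <= n%:R * \sum_k gA P h lw w ln' nn v k.
Proof.
exact: (group_a M0 gG mixP mix_ctr avg_comp_ctr P0 xP' lnn v0 vE zv r0 r1).
Qed.

Lemma fano_group_b : (forall k, 0 < 1 + w k - 2 * complex.Re (lw k) <= 1) ->
  (forall k, nn k <= 1) ->
  3 * \sum_k fano_rate k <= n%:R * \sum_k gB P h lw w ln' nn v k.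
Proof.
exact: (group_b M0 gG mixP mix_ctr avg_comp_ctr P0 xP' lnn v0 vE zv r0 r1 r2).
Qed.

End Centering.

(** * Independent uniform messages *)

Section Messages.
Context {R : realType} (M : 'I_3 -> nat).
Hypothesis M_gt0 : forall k, (0 < M k)%N.
Local Notation W := {dffun forall k : 'I_3, 'I_(M k)}.

Definition mixmsg k (w v : W) : W := [ffun j => if j == k then w j else v j].

Definition setmsg k (a : 'I_(M k)) (w : W) : W := [ffun j => @eqtype.dfwith _ _ (fun i => w i) k a j].

Lemma mixmsgE k w v j : mixmsg k w v j = if j == k then w j else v j.
Proof. by rewrite ffunE. Qed.

Lemma setmsg_in k a w : @setmsg k a w k = a.
Proof. by rewrite ffunE eqtype.dfwith_in. Qed.

Lemma setmsg_out k a w j : j != k -> @setmsg k a w j = w j.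
Proof. by move=> jk; rewrite ffunE eqtype.dfwith_out// eq_sym. Qed.

Lemma msg_gt0 : (0 < #|{: W}|)%N.
Proof. by apply/card_gt0P; exists [ffun k => Ordinal (M_gt0 k)]. Qed.

(** Exchanging component [k] between the two messages is an involution on pairs that turns the mixed
    message into the first one. *)
Lemma avg_mixmsg k (f : W -> R) : avg (fun w => avg (fun v => f (mixmsg k w v))) = avg f.
Proof.
have W0 : #|{: W}|%:R != 0 :> R by rewrite pnatr_eq0 -lt0n msg_gt0.
rewrite /avg -mulr_sumr pair_bigA /=.
pose sw (p : W * W) := (mixmsg k p.1 p.2, mixmsg k p.2 p.1).
have swK : involutive sw.
  by move=> [w v]; congr pair; apply/ffunP => j; rewrite !mixmsgE /=; case: eqP.
rewrite (reindex_inj (inv_inj swK)) /=.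
under eq_bigr => p _.
  rewrite (_ : mixmsg k _ _ = p.1); last first.
    by apply/ffunP => j; rewrite !mixmsgE /=; case: eqP.
  over.
rewrite -(pair_bigA _ (fun w _ => f w)) /=.
under eq_bigr do rewrite sumr_const -mulr_natl.
by rewrite -mulr_sumr mulKf.
Qed.

(** Resetting component [k] from one value to another is a bijection, so all values are equally
    frequent. *)
Lemma avg_msg_unif k (a : 'I_(M k)) :
  avg (fun w : W => (w k == a)%:R) = (#|'I_(M k)|%:R)^-1 :> R.
Proof.
pose c (a : 'I_(M k)) : R := \sum_(w : W) (w k == a)%:R.
have cE b : c a = c b.
  have E d : c d = \sum_(w : W | w k == d) 1.
    by rewrite [RHS]big_mkcond; apply: eq_bigr => w _; case: (_ == _).
  rewrite !E (reindex_onto (@setmsg k a) (@setmsg k b)) /=.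
    apply: eq_bigl => w; rewrite setmsg_in eqxx /=.
    apply/eqP/eqP => [<-|wb]; first by rewrite setmsg_in.
    apply/ffunP => j; have [->|jk] := eqVneq j k; first by rewrite setmsg_in.
    by rewrite !setmsg_out.
  move=> w /eqP wa; apply/ffunP => j; have [->|jk] := eqVneq j k; first by rewrite setmsg_in.
  by rewrite !setmsg_out.
have W0 : #|{: W}|%:R != 0 :> R by rewrite pnatr_eq0 -lt0n msg_gt0.
have A0 : #|'I_(M k)|%:R != 0 :> R by rewrite pnatr_eq0 -lt0n card_ord.
have : \sum_b c b = #|{: W}|%:R.
  rewrite /c exchange_big /= -sum1_card natr_sum; apply: eq_bigr => w _.
  by rewrite (bigD1 (w k))//= eqxx big1 ?addr0// => b; rewrite eq_sym => /negbTE ->.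
rewrite (eq_bigr (fun=> c a)) => [|b _]; last by rewrite (cE b).
rewrite sumr_const => cW.
have {}cW : #|'I_(M k)|%:R * c a = #|{: W}|%:R by rewrite -cW mulr_natl.
rewrite /avg -/(c a) -cW invfM -mulrA mulVf ?mulr1//.
by apply: contraNneq W0 => c0; rewrite -cW c0 mulr0.
Qed.

Lemma card_msg : #|{: W}| = \prod_(k < 3) M k.
Proof.
rewrite card_dep_ffun foldrE big_image /=.
by apply: eq_bigr => k _; rewrite card_ord.
Qed.

End Messages.

(** * A Gaussian vector extracted from the channel noise *)

Section NoiseLaw.
Context {R : realType} (n : nat).
Local Notation JJ := ('I_n * bool)%type.
Local Notation IX := (bool * bool * JJ)%type.
Local Notation N := #|{: IX}|.
Context d (T : measurableType d) (Pr : probability T R).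
Variable Zn : 'I_3 -> nat -> bool -> T -> R.
Hypothesis Zg : gauss_noise Pr Zn.
Variable k : 'I_3.

(* Coordinates outside the block (false, false) are noise samples at times beyond [n]. *)
Definition noise_at (i : 'I_N) : noise_index :=
  let: (b, s, (t, c)) := @enum_val IX predT i in (k, (t + n * (b.*2 + s))%N, c).

Lemma noise_at_inj : injective noise_at.
Proof.
move=> i j; rewrite /noise_at; have := enum_valK i; have := enum_valK j.
case: (enum_val i) => [[b s] [t c]]; case: (enum_val j) => [[b' s'] [t' c']] <- <- [E ->].
have n0 : (0 < n)%N by exact: leq_ltn_trans (ltn_ord t).
have Et : t = t'.
  apply: val_inj => /=; have := congr1 (modn^~ n) E.
  by rewrite ![(_ + n * _)%N]addnC ![(n * _)%N]mulnC !modnMDl !modn_small.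
have Eb : (b.*2 + s = b'.*2 + s')%N.
  by move: E; rewrite Et => /addnI /eqP; rewrite eqn_pmul2l// => /eqP.
by rewrite Et; move: Eb {E}; case: b; case: s; case: b'; case: s'.
Qed.

Definition noise_tuple (om : T) : N.-tuple R :=
  [tuple Zn (noise_at i).1.1 (noise_at i).1.2 (noise_at i).2 om | i < N].

Lemma measurable_noise_tuple : measurable_fun setT noise_tuple.
Proof.
apply/measurable_fun_tnthP => i; rewrite (_ : _ \o _ =
    fun om => Zn (noise_at i).1.1 (noise_at i).1.2 (noise_at i).2 om); first exact: Zg.1.
by apply/funext => om /=; rewrite tnth_mktuple.
Qed.

HB.instance Definition _ := isMeasurableFun.Build _ _ _ _ noise_tuple measurable_noise_tuple.

(** The law of 4n complex noise samples of one receiver, which supplies the Gaussian vector of the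
    analysis without constructing a product measure. *)
Definition noise_law : probability (N.-tuple R) R := distribution Pr noise_tuple.

Lemma gaussm_noise_law : gaussm noise_law.
Proof.
move=> B mB; rewrite /noise_law /= /pushforward.
pose X (i : noise_index) := Zn i.1.1 i.1.2 i.2.
(* Extends the sides of the rectangle to all noise indices, trivially off the range of
   [noise_at]. *)
pose Bn (j : noise_index) : set R := if [pick i | noise_at i == j] is Some i then B i else setT.
have BnE i : Bn (noise_at i) = B i.
  rewrite /Bn; case: pickP => [j /eqP /noise_at_inj -> //|/(_ i)].
  by rewrite eqxx.
have mBn j : measurable (Bn j) by rewrite /Bn; case: pickP.
have us : uniq (map noise_at (index_enum 'I_N)).
  by rewrite map_inj_uniq ?index_enum_uniq//; exact: noise_at_inj.
have := Zg.2.2 _ _ us mBn; rewrite !big_map -/X.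
rewrite (eq_bigr (fun i => X (noise_at i) @^-1` B i)); last by move=> i _; rewrite BnE.
rewrite [RHS](eq_bigr (fun i => normal_prob 0 hsd (B i))); last first.
  by move=> i _; rewrite BnE; exact: Zg.2.1.
move=> <-; congr (Pr _); apply/seteqP; split => om.
  by rewrite -bigcap_seq => H i _; move: (H i); rewrite /= tnth_mktuple.
by rewrite -bigcap_seq => H i; rewrite tnth_mktuple; apply: H; rewrite /= mem_index_enum.
Qed.

End NoiseLaw.

(** * Success probabilities of a code under relabelled users *)

Section Decoding.
Context {R : realType}.
Variables (h : 'I_3 -> 'I_3 -> R[i]) (s : 'S_3) (n : nat) (M : 'I_3 -> nat).
Hypothesis M_gt0 : forall k, (0 < M k)%N.
Local Notation JJ := ('I_n * bool)%type.
Local Notation IX := (bool * bool * JJ)%type.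
Local Notation N := #|{: IX}|.
Local Notation W := {dffun forall k : 'I_3, 'I_(M k)}.
Variable c : Defs.code R n M.
Hypothesis mdec : forall k (m : 'I_(M k)), measurable (dec c k @^-1` [set m]).
Context d (T : measurableType d) (Pr : probability T R).
Variable Zn : 'I_3 -> nat -> bool -> T -> R.
Hypothesis Zg : gauss_noise Pr Zn.
Variable g : probability (N.-tuple R) R.
Hypothesis gG : gaussm g.

Definition sent k (w : W) : 'I_n -> R[i] := enc c (w (s k)).
Definition wanted k (w : W) : 'I_(M (s k)) := w (s k).

Definition observed (y : N.-tuple R) : n.-tuple (R * R)%type :=
  [tuple (tnth y (enum_rank (false, false, (t, false))),
          tnth y (enum_rank (false, false, (t, true)))) | t < n].

Definition decode k (y : N.-tuple R) : 'I_(M (s k)) := dec c (s k) (observed y).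

Lemma measurable_observed : measurable_fun setT observed.
Proof.
apply/measurable_fun_tnthP => t; rewrite (_ : _ \o _ = fun y : N.-tuple R =>
    (tnth y (enum_rank (false, false, (t, false))), tnth y (enum_rank (false, false, (t, true))))).
  by apply: measurable_fun_pair => /=; exact: measurable_tnth.
by apply/funext => y /=; rewrite tnth_mktuple.
Qed.

Lemma measurable_decode k m : measurable (decode k @^-1` [set m]).
Proof.
rewrite /decode -[X in measurable X]setTI.
exact: (measurable_observed measurableT (mdec m)).
Qed.

Let hs i j := h (s i) (s j).
Definition received (w : W) om k := to_pairs (rx_signal h (fun j => enc c (w j))
             (fun t => Complex (Zn k t false om) (Zn k t true om)) k).
Definition clean k : W -> 'I_N -> R := fam sent false (rcv hs k) row0.

Lemma row_rcv k w t : row sent (rcv hs k) w t =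
  enc c (w (s k)) t + \sum_(j < 3 | j != s k) h (s k) j * enc c (w j) t.
Proof.
rewrite /row (bigD1 k)//= /rcv {1}/withsig eqxx mul1r; congr (_ + _).
rewrite [RHS](reindex_inj (@perm_inj _ s)) /=.
apply: eq_big => [j|j jk]; first by rewrite (inj_eq perm_inj).
by rewrite /withsig /intf (negbTE jk).
Qed.

Lemma observed_clean k w om :
  observed (tadd (clean k w) (noise_tuple n Zn (s k) om)) = received w om (s k).
Proof.
apply: eq_from_tnth => t; rewrite [LHS]tnth_mktuple [RHS]tnth_mktuple !tnth_tadd.
rewrite ![tnth (noise_tuple _ _ _ _) _]tnth_mktuple.
have nE b : noise_at (s k) (enum_rank (false, false, (t, b))) = (s k, nat_of_ord t, b).
  by rewrite /noise_at enum_rankK /= muln0 addn0.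
have cE b : clean k w (enum_rank (false, false, (t, b))) = comp (row sent (rcv hs k) w) (t, b).
  by rewrite /clean fam_row0 comb_at eqxx.
rewrite !nE !cE /= /comp /= row_rcv /rx_signal !raddfD /= (addrC (Zn _ _ _ _)).
by rewrite (addrC (Zn _ _ true _)).
Qed.

Definition failed w : set T := [set om | exists k : 'I_3, dec c k (received w om k) != w k].

Lemma measurable_failed_at w k :
  measurable [set om | dec c (s k) (received w om (s k)) != w (s k)].
Proof.
rewrite (_ : [set _ | _] = (fun om => tadd (clean k w) (noise_tuple n Zn (s k) om)) @^-1`
   ~` (decode k @^-1` [set w (s k)])).
  rewrite -[X in measurable X]setTI.
  have mt : measurable_fun setT (fun om => tadd (clean k w) (noise_tuple n Zn (s k) om)).
    apply: measurableT_comp; first exact: measurable_tadd.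
    exact: (measurable_noise_tuple Zg (s k)).
  by apply: (mt measurableT); apply: measurableC; exact: measurable_decode.
apply/seteqP; split => om /=; rewrite /decode observed_clean; first by move/eqP.
by move/eqP.
Qed.

Lemma measurable_failed w : measurable (failed w).
Proof.
rewrite (_ : failed w = \big[setU/set0]_(k < 3)
    [set om | dec c (s k) (received w om (s k)) != w (s k)]).
  by apply: bigsetU_measurable => k _; exact: measurable_failed_at.
apply/seteqP; split => om; rewrite -bigcup_seq /=.
  move=> [k H]; exists (s^-1%g k); first by rewrite /= mem_index_enum.
  by rewrite /= permKV.
by move=> [k _ H]; exists (s k).
Qed.

(** The error event of the code contains that of each receiver. The success probability depends only
    on the law of the noise, so [g] may be any measure with that law. *)
Lemma hit_clean k : 1 - avg_error h Pr Zn c <= hit g (@wanted k) (decode k) (clean k).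
Proof.
have MM : (\prod_(k < 3) M k)%:R = #|{: W}|%:R :> R by rewrite card_msg.
have -> : avg_error h Pr Zn c = avg (fun w => fine (Pr (failed w))).
  by rewrite /avg_error MM mulrC.
rewrite -[X in X - _](avg_cst (msg_gt0 M_gt0)) -avgB; apply: avg_le => w.
pose A : set (N.-tuple R) := (tadd (clean k w)) @^-1` (decode k @^-1` [set w (s k)]).
have mA : measurable A.
  rewrite /A -[X in measurable X]setTI.
  exact: (measurable_tadd _ measurableT (measurable_decode _)).
have -> : Ex g (fun y => (decode k (tadd (clean k w) y) == wanted k w)%:R) =
    fine (Pr [set om | dec c (s k) (received w om (s k)) == w (s k)]).
  rewrite (_ : (fun y => _) = \1_A); last first.
    apply/funext => y; rewrite indicE; congr (nat_of_bool _)%:R.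
    by apply/eqP/idP => [H|/set_mem //]; apply/mem_set.
  transitivity (fine (g A)); first by rewrite /Ex /Rintegral integral_indic// setIT.
  rewrite (gaussm_unique gG (gaussm_noise_law Zg (s k)) mA) /noise_law /= /pushforward.
  have dE om : decode k (tadd (clean k w) (noise_tuple n Zn (s k) om)) =
      dec c (s k) (received w om (s k)) by rewrite /decode observed_clean.
  congr (fine (Pr _)); apply/seteqP; split => om H.
    by apply/eqP; rewrite -dE; exact: H.
  by have /eqP := H; rewrite -dE.
set B := [set om | _].
have BC : B = ~` [set om | dec c (s k) (received w om (s k)) != w (s k)].
  by apply/seteqP; split => om /=; [move=> ->|move=> /negP; rewrite negbK].
have mF := measurable_failed_at w k.
have -> : fine (Pr B) = 1 - fine (Pr [set om | dec c (s k) (received w om (s k)) != w (s k)]).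
  rewrite BC probability_setC// fineB//; exact: fin_num_measure.
have mE := measurable_failed w.
rewrite lerD2l lerN2; apply: fine_le; try exact: fin_num_measure.
by apply: le_measure; [exact/mem_set|exact/mem_set|move=> om H; exists (s k)].
Qed.

End Decoding.

(** * From Fano bounds to achievable rates *)

Section Converse.
Context {R : realType}.

Lemma msize_ge n (r : R) : 2 `^ (n%:R * r) <= (msize n r)%:R.
Proof.
have p0 : 0 < 2 `^ (n%:R * r) :> R by rewrite powR_gt0.
rewrite /msize natr_absz ger0_norm; first exact: ceil_ge.
by rewrite ceil_ge0; apply: lt_trans p0; rewrite ltrN10.
Qed.

Lemma msize_gt0 n (r : R) : (0 < msize n r)%N.
Proof. by rewrite -(ltr_nat R); apply: lt_le_trans (msize_ge _ _); rewrite powR_gt0. Qed.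

Lemma ln_msize_ge n (r : R) : n%:R * r * ln 2 <= ln (msize n r)%:R.
Proof.
by rewrite -ln_powR ler_ln ?posrE ?powR_gt0 ?ltr0n ?msize_gt0 ?msize_ge.
Qed.

Lemma ln2_gt0 : 0 < ln (2 : R).
Proof. by rewrite ln_gt0// ltr1n. Qed.

Lemma rate_limit (e : nat -> R) (S G : R) : e @ \oo --> (0 : R) ->
  (forall n, 3 * ((1 - e n) * (n%:R * S * ln 2) - 3 * ln 2) <= n%:R * G) ->
  3 * S * ln 2 <= G.
Proof.
move=> e0 H.
(* The inequality for block length n + 1 divided by n + 1, so that [harmonic n] is the reciprocal
   block length. *)
pose f n : R := 3 * ((1 - e n.+1) * (S * ln 2) - 3 * ln 2 * harmonic n).
have fG n : f n <= G.
  have n0 : 0 < n.+1%:R :> R by rewrite ltr0n.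
  rewrite -(ler_pM2l n0); apply: le_trans (H n.+1); rewrite le_eqVlt; apply/orP; left.
  by apply/eqP; rewrite /f /harmonic /=; move: (n.+1%:R) n0 => a a0; field; rewrite gt_eqF.
have fc : f @ \oo --> 3 * ((1 - 0) * (S * ln 2) - 3 * ln 2 * 0).
  apply: cvgM; first exact: cvg_cst.
  apply: cvgB; last by apply: cvgM; [exact: cvg_cst|exact: cvg_harmonic].
  apply: cvgM; last exact: cvg_cst.
  by apply: cvgB; [exact: cvg_cst|rewrite (cvg_shiftS e)].
have <- : 3 * ((1 - 0) * (S * ln 2) - 3 * ln 2 * 0) = 3 * S * ln 2 by ring.
rewrite -(cvg_lim (@Rhausdorff R) fc); apply: limr_le; first by apply/cvg_ex; eexists; exact: fc.
by apply: nearW.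
Qed.

Variables (h : 'I_3 -> 'I_3 -> R[i]) (P : 'I_3 -> R) (s : 'S_3).
Hypothesis P0 : forall k, 0 < P k.
Let hs i j := h (s i) (s j).
Let Ps i := P (s i).

Lemma fano_rate_ge n (Rt : 'I_3 -> R) (c : Defs.code R n (fun k => msize n (Rt k)))
    d (T : measurableType d) (Pr : probability T R) Zn (Zg : gauss_noise Pr Zn) k0 k :
  0 <= Rt (s k) -> (forall k m, measurable (dec c k @^-1` [set m])) ->
  (1 - avg_error h Pr Zn c) * (n%:R * Rt (s k) * ln 2) - ln 2 <=
  fano_rate (sent s c) (noise_law n Zg k0) (@wanted s _) (decode s c) hs k.
Proof.
move=> R0 mdec; have M0 j := msize_gt0 n (Rt j).
have hc := hit_clean h s M0 mdec Zg (gaussm_noise_law (n := n) Zg k0) k.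
rewrite /fano_rate lerD2r; set hh := hit _ _ _ _ in hc *.
have h0 : 0 <= hh.
  apply: avg_ge0 => w; rewrite /Ex /Rintegral; apply: fine_ge0; apply: integral_ge0 => y _ /=.
  by rewrite lee_fin.
rewrite card_ord; apply: le_trans (_ : hh * (n%:R * Rt (s k) * ln 2) <= _).
  by rewrite ler_wpM2r// !mulr_ge0// ltW// ln2_gt0.
by rewrite ler_wpM2l// ln_msize_ge.
Qed.

(** The noise of receiver 0 serves for all three users, because each success probability involves
    the noise law of one receiver only. *)
Lemma converse (Rt : 'I_3 -> R) (G : R) : achievable h P Rt ->
  (forall n (c : Defs.code R n (fun k => msize n (Rt k))) g, good_code P c -> gaussm g ->
    3 * \sum_k fano_rate (sent s c) g (@wanted s _) (decode s c) hs k <= n%:R * G) ->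
  3 * (\sum_k Rt k) * ln 2 <= G.
Proof.
move=> [R0 [c [gc [d [T [Pr [Zn [Zg e0]]]]]]]] H.
apply: (rate_limit e0) => n; apply: le_trans (H n (c n) _ (gc n) (gaussm_noise_law (n := n) Zg 0)).
rewrite ler_pM2l//; cbv beta.
have -> : (1 - avg_error h Pr Zn (c n)) * (n%:R * (\sum_k Rt k) * ln 2) - 3 * ln 2 =
    \sum_k ((1 - avg_error h Pr Zn (c n)) * (n%:R * Rt (s k) * ln 2) - ln 2).
  rewrite sumrB sumr_const card_ord -[ln 2 *+ 3]mulr_natl; congr (_ - _).
  by rewrite -mulr_sumr -mulr_suml -mulr_sumr [in LHS](reindex_inj (@perm_inj _ s)).
by apply: ler_sum => k _; exact: fano_rate_ge (gc n).2.
Qed.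

Section Instance.
Variables (n : nat) (M : 'I_3 -> nat) (c : Defs.code R n M).
Hypothesis M_gt0 : forall k, (0 < M k)%N.
Hypothesis gc : good_code P c.
Variable g : probability (#|{: bool * bool * ('I_n * bool)}|.-tuple R) R.
Hypothesis gG : gaussm g.
Local Notation W := {dffun forall k : 'I_3, 'I_(M k)}.

Let mix k := @mixmsg M (s k).
Let mixP k (f : W -> R) : avg (fun w => avg (fun v => f (mix k w v))) = avg f.
Proof. exact: avg_mixmsg. Qed.
Let mixX k j w v : sent s c j (mix k w v) = if j == k then sent s c j w else sent s c j v.
Proof.
by apply/funext => t; rewrite /sent mixmsgE (inj_eq perm_inj); case: (j == k).
Qed.
Let lab_mix k j w v : @wanted s _ k (mix j w v) = if j == k then @wanted s _ k w else @wanted s _ k v.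
Proof. by rewrite /wanted mixmsgE (inj_eq perm_inj) eq_sym; case: (j == k). Qed.
Let Ps0 k : 0 < Ps k. Proof. exact: P0. Qed.
Let pow k : avg (fun w => \sum_t sqn (sent s c k w t)) <= n%:R * Ps k.
Proof.
rewrite -[leRHS](avg_cst (msg_gt0 M_gt0)); apply: avg_le => w; exact: gc.1.
Qed.
Let unif k (z : 'I_(M (s k))) : avg (fun w => (@wanted s _ k w == z)%:R) = (#|'I_(M (s k))|%:R)^-1 :> R.
Proof. exact: avg_msg_unif. Qed.
Let A0 k : (0 < #|'I_(M (s k))|)%N. Proof. by rewrite card_ord. Qed.
Let mdec k (z : 'I_(M (s k))) : measurable (decode s c k @^-1` [set z]).
Proof. by apply: measurable_decode; exact: gc.2. Qed.

Definition code_group_a lw w ln' nn v lnn v0 vE zv H1 H2 H3 :=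
  @fano_group_a R n _ (sent s c) (msg_gt0 M_gt0) g gG mix mixP mixX Ps Ps0 pow
    _ (@wanted s _) lab_mix unif A0 (decode s c) mdec hs lw w ln' nn v lnn v0 vE zv H1 H2 H3.

Definition code_group_b lw w ln' nn v lnn v0 vE zv H1 H2 :=
  @fano_group_b R n _ (sent s c) (msg_gt0 M_gt0) g gG mix mixP mixX Ps Ps0 pow
    _ (@wanted s _) lab_mix unif A0 (decode s c) mdec hs lw w ln' nn v lnn v0 vE zv H1 H2.
End Instance.

End Converse.

(** * Small determinants *)

Section Determinants.
Context {F : comNzRingType}.
Implicit Type f : nat -> nat -> F.

Lemma det1 f : \det (\matrix_(i < 1, j < 1) f i j) = f 0%N 0%N.
Proof. by rewrite det_mx11 mxE. Qed.

Lemma det_row0 m f : \det (\matrix_(i < m.+1, j < m.+1) f i j) =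
  \sum_(j < m.+1) f 0%N j * ((-1) ^+ j * \det (\matrix_(i < m, l < m) f i.+1 (bump j l))).
Proof.
rewrite (expand_det_row _ ord0); apply: eq_bigr => j _; rewrite mxE /cofactor add0n.
by congr (_ * (_ * _)); congr (\det _); apply/matrixP => a b; rewrite !mxE.
Qed.

Lemma det2 f : \det (\matrix_(i < 2, j < 2) f i j) =
  f 0%N 0%N * f 1%N 1%N - f 0%N 1%N * f 1%N 0%N.
Proof.
rewrite det_row0 !big_ord_recl big_ord0 /= !(det1 (fun i l => f i.+1 (bump _ l))) /bump /=.
by rewrite !expr0 !expr1; ring.
Qed.

Lemma det3 f : \det (\matrix_(i < 3, j < 3) f i j) =
  f 0%N 0%N * (f 1%N 1%N * f 2%N 2%N - f 1%N 2%N * f 2%N 1%N) -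
  f 0%N 1%N * (f 1%N 0%N * f 2%N 2%N - f 1%N 2%N * f 2%N 0%N) +
  f 0%N 2%N * (f 1%N 0%N * f 2%N 1%N - f 1%N 1%N * f 2%N 0%N).
Proof.
rewrite det_row0 !big_ord_recl big_ord0 /= !(det2 (fun i l => f i.+1 (bump _ l))) /bump /=.
by rewrite !expr0 !expr1; ring.
Qed.

Lemma det4 f : \det (\matrix_(i < 4, j < 4) f i j) =
  \sum_(j < 4) f 0%N j * ((-1) ^+ j *
   (f 1%N (bump j 0) * (f 2%N (bump j 1) * f 3%N (bump j 2) - f 2%N (bump j 2) * f 3%N (bump j 1)) -
    f 1%N (bump j 1) * (f 2%N (bump j 0) * f 3%N (bump j 2) - f 2%N (bump j 2) * f 3%N (bump j 0)) +
    f 1%N (bump j 2) * (f 2%N (bump j 0) * f 3%N (bump j 1) - f 2%N (bump j 1) * f 3%N (bump j 0)))).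
Proof.
by rewrite det_row0; apply: eq_bigr => j _; rewrite (det3 (fun i l => f i.+1 (bump j l))).
Qed.

End Determinants.

(** * Covariances of linear combinations of the base variables *)

Section Covariances.
Context {R : realType}.
Local Notation C := R[i].
Variables (P : 'I_3 -> R) (g : genie R) (vV vV' : 'I_3 -> R).
Implicit Types (e f : lin R) (c d : 'I_3 -> C).
Local Notation cov := (cov P g vV vV').
Local Notation base_cov := (base_cov P g vV vV').

Lemma covDl e1 e2 f : cov (ladd e1 e2) f = cov e1 f + cov e2 f.
Proof.
rewrite /cov; do 4 (rewrite -big_split; apply: eq_bigr => ? _ /=).
by rewrite /ladd !mulrDl.
Qed.

Lemma covDr e f1 f2 : cov e (ladd f1 f2) = cov e f1 + cov e f2.
Proof.
rewrite /cov; do 4 (rewrite -big_split; apply: eq_bigr => ? _ /=).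
by rewrite /ladd rmorphD mulrDr.
Qed.

Lemma covZl (a : C) e f : cov (lscale a e) f = a * cov e f.
Proof.
rewrite /cov; do 4 (rewrite mulr_sumr; apply: eq_bigr => ? _ /=).
by rewrite /lscale !mulrA.
Qed.

Lemma covZr (a : C) e f : cov e (lscale a f) = conjc a * cov e f.
Proof.
rewrite /cov; do 4 (rewrite mulr_sumr; apply: eq_bigr => ? _ /=).
by rewrite /lscale rmorphM mulrCA.
Qed.

Lemma covBl e1 e2 f : cov (lsub e1 e2) f = cov e1 f - cov e2 f.
Proof. by rewrite /lsub covDl covZl mulN1r. Qed.

Lemma covBr e f1 f2 : cov e (lsub f1 f2) = cov e f1 - cov e f2.
Proof. by rewrite /lsub covDr covZr rmorphN rmorph1 mulN1r. Qed.

Lemma cov0l f : cov (@lzero R) f = 0.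
Proof. by rewrite /cov; do 4 (apply: big1 => ? _); rewrite !mul0r. Qed.

Lemma cov0r e : cov e (@lzero R) = 0.
Proof. by rewrite /cov; do 4 (apply: big1 => ? _); rewrite conjc0 mulr0. Qed.

Lemma cov_bv a k b l : cov (bv R a k) (bv R b l) = base_cov a k b l.
Proof.
rewrite /cov (bigD1 a)//= [X in _ + X]big1 ?addr0; last first.
  move=> i /negbTE ia; do 3 (apply: big1 => ? _).
  by rewrite /bv ia !mul0r.
rewrite (bigD1 k)//= [X in _ + X]big1 ?addr0; last first.
  move=> i /negbTE ia; do 2 (apply: big1 => ? _).
  by rewrite /bv ia andbF !mul0r.
rewrite (bigD1 b)//= [X in _ + X]big1 ?addr0; last first.
  by move=> i /negbTE ia; apply: big1 => ? _; rewrite /bv ia conjc0 mulr0.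
rewrite (bigD1 l)//= [X in _ + X]big1 ?addr0; last first.
  by move=> i /negbTE ia; rewrite /bv ia andbF conjc0 mulr0.
by rewrite /bv !eqxx conjc1 mulr1 mul1r.
Qed.

Lemma kXE : kX = @Ordinal 6 0 isT. Proof. by apply: val_inj; rewrite /= inordK. Qed.
Lemma kZE : kZ = @Ordinal 6 1 isT. Proof. by apply: val_inj; rewrite /= inordK. Qed.
Lemma kWE : kW = @Ordinal 6 2 isT. Proof. by apply: val_inj; rewrite /= inordK. Qed.
Lemma kNE : kN = @Ordinal 6 3 isT. Proof. by apply: val_inj; rewrite /= inordK. Qed.
Lemma kVE : kV = @Ordinal 6 4 isT. Proof. by apply: val_inj; rewrite /= inordK. Qed.
Lemma kV'E : kV' = @Ordinal 6 5 isT. Proof. by apply: val_inj; rewrite /= inordK. Qed.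
Definition kE := (kXE, kZE, kWE, kNE, kVE, kV'E).

Lemma base_covX k b l : b != kX -> base_cov kX k b l = 0.
Proof.
rewrite /base_cov; case: (k == l) => //=; rewrite !kE /=.
by case: b => [[|[|[|[|[|[|?]]]]]] ?].
Qed.

Lemma base_covXr a k l : a != kX -> base_cov a k kX l = 0.
Proof.
rewrite /base_cov; case: (k == l) => //=; rewrite !kE /=.
by case: a => [[|[|[|[|[|[|?]]]]]] ?].
Qed.

Definition noisy e := forall k, e kX k = 0.

(** The received and genie variables are brought to the form [sg c e], a combination of inputs plus
    a term free of inputs; the two parts are uncorrelated. *)
Definition sig c : lin R := fun a k => if a == kX then c k else 0.
Definition sg c e : lin R := ladd (sig c) e.

Lemma cov_sig_noisy c f : noisy f -> cov (sig c) f = 0.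
Proof.
move=> f0; rewrite /cov big1// => a _; rewrite big1// => k _; rewrite big1// => b _.
rewrite big1// => l _; rewrite /sig; case: (eqVneq a kX) => [->|_]; last by rewrite !mul0r.
case: (eqVneq b kX) => [->|bX]; first by rewrite f0 conjc0 mulr0.
by rewrite base_covX// mulr0 mul0r.
Qed.

Lemma cov_noisy_sig c e : noisy e -> cov e (sig c) = 0.
Proof.
move=> f0; rewrite /cov big1// => a _; rewrite big1// => k _; rewrite big1// => b _.
rewrite big1// => l _; rewrite /sig; case: (eqVneq b kX) => [->|_]; last by rewrite conjc0 mulr0.
case: (eqVneq a kX) => [->|bX]; first by rewrite f0 !mul0r.
by rewrite base_covXr// mulr0 mul0r.
Qed.

Lemma cov_sig c d : cov (sig c) (sig d) = ip P c d.
Proof.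
rewrite /cov (bigD1 kX)//= [X in _ + X]big1 ?addr0; last first.
  move=> i /negbTE ia; do 3 (apply: big1 => ? _).
  by rewrite /sig ia !mul0r.
rewrite /ip; apply: eq_bigr => k _.
rewrite (bigD1 kX)//= [X in _ + X]big1 ?addr0; last first.
  by move=> i /negbTE ia; apply: big1 => ? _; rewrite /sig ia conjc0 mulr0.
rewrite (bigD1 k)//= [X in _ + X]big1 ?addr0; last first.
  by move=> i; rewrite eq_sym => ik; rewrite /base_cov ik mulr0 mul0r.
by rewrite /sig /base_cov !eqxx /= mulrAC.
Qed.

Lemma cov_sg c d e f : noisy e -> noisy f -> cov (sg c e) (sg d f) = ip P c d + cov e f.
Proof.
move=> e0 f0; rewrite /sg covDl !covDr cov_sig cov_sig_noisy// cov_noisy_sig//.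
by rewrite addr0 add0r.
Qed.

Lemma noisy_bv a k : a != kX -> noisy (bv R a k).
Proof. by move=> aX l; rewrite /bv eq_sym (negbTE aX). Qed.

Lemma noisyD e f : noisy e -> noisy f -> noisy (ladd e f).
Proof. by move=> e0 f0 k; rewrite /ladd e0 f0 addr0. Qed.

Lemma noisyZ a e : noisy e -> noisy (lscale a e).
Proof. by move=> e0 k; rewrite /lscale e0 mulr0. Qed.

Lemma kZX : kZ != kX. Proof. by rewrite !kE. Qed.
Lemma kWX : kW != kX. Proof. by rewrite !kE. Qed.
Lemma kNX : kN != kX. Proof. by rewrite !kE. Qed.

Lemma covZZ k : cov (Z R k) (Z R k) = 1.
Proof. by rewrite cov_bv /base_cov eqxx !kE. Qed.
Lemma covWW k : cov (W R k) (W R k) = rc (sW g k ^+ 2).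
Proof. by rewrite cov_bv /base_cov eqxx !kE. Qed.
Lemma covNN k : cov (N R k) (N R k) = rc (sN g k ^+ 2).
Proof. by rewrite cov_bv /base_cov eqxx !kE. Qed.
Lemma covWZ k : cov (W R k) (Z R k) = conjc (rW g k) * rc (sW g k).
Proof. by rewrite cov_bv /base_cov eqxx !kE. Qed.
Lemma covZW k : cov (Z R k) (W R k) = conjc (cov (W R k) (Z R k)).
Proof. by rewrite covWZ conjM conjcK conj_rc cov_bv /base_cov eqxx !kE. Qed.
Lemma covNZ k : cov (N R k) (Z R k) = conjc (rN g k) * rc (sN g k).
Proof. by rewrite cov_bv /base_cov eqxx !kE. Qed.
Lemma covZN k : cov (Z R k) (N R k) = conjc (cov (N R k) (Z R k)).
Proof. by rewrite covNZ conjM conjcK conj_rc cov_bv /base_cov eqxx !kE. Qed.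
Lemma covVV k : cov (bv R kV k) (bv R kV k) = rc (vV k).
Proof. by rewrite cov_bv /base_cov eqxx !kE. Qed.
Lemma covV'V' k : cov (bv R kV' k) (bv R kV' k) = rc (vV' k).
Proof. by rewrite cov_bv /base_cov eqxx !kE. Qed.

End Covariances.

(** * Received and genie variables as signal plus noise *)

Section Gdets.
Context {R : realType}.
Local Notation C := R[i].
Variables (h : 'I_3 -> 'I_3 -> C) (P : 'I_3 -> R) (g : genie R) (vV vV' : 'I_3 -> R).
Implicit Types (e f : lin R) (c d y s : 'I_3 -> C).
Local Notation cov := (cov P g vV vV').
Local Notation gdet := (gdet P g vV vV').

Lemma big_ladd (Q : pred 'I_3) (F : 'I_3 -> lin R) a l :
  (\big[@ladd R/@lzero R]_(j < 3 | Q j) F j) a l = \sum_(j < 3 | Q j) F j a l.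
Proof.
by elim/big_rec2: _ => // j x y _; rewrite /ladd => <-.
Qed.

Lemma X_sg k : X R k = sg (only k 1) (@lzero R).
Proof.
apply/funext => a; apply/funext => l; rewrite /X /bv /sg /ladd /sig /only /lzero addr0.
by case: (a == kX); case: (l == k).
Qed.

Lemma sum_scaleX k (c : 'I_3 -> C) a l :
  \sum_(j < 3 | j != k) lscale (c j) (X R j) a l = sig (fun j => if j == k then 0 else c j) a l.
Proof.
rewrite /sig /lscale /X /bv; case: (a == kX) => /=; last by rewrite big1// => j _; rewrite mulr0.
case: (eqVneq l k) => [->|lk].
  by rewrite big1// => j; rewrite eq_sym => /negbTE ->; rewrite mulr0.
rewrite (bigD1 l)//= eqxx mulr1 big1 ?addr0// => j /andP[_]; rewrite eq_sym => /negbTE ->.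
by rewrite mulr0.
Qed.

Lemma Y_sg k : Y h k = sg (rcv h k) (Z R k).
Proof.
apply/funext => a; apply/funext => l; rewrite /Y /sg /ladd big_ladd sum_scaleX addrA.
congr (_ + _); rewrite /X /bv /sig /rcv /withsig /intf.
case: (a == kX) => /=; last by rewrite addr0.
by case: eqP => _; rewrite ?addr0 ?add0r.
Qed.

Lemma U_sg k : U h k = sg (intf h k) (W R k).
Proof. by apply/funext => a; apply/funext => l; rewrite /U /sg /ladd big_ladd sum_scaleX. Qed.

(** Cyclic form of the genie signals: S_(k+1) is the interference at receiver k in the noise
    N_(k+1). *)
Definition Sg k : lin R := sg (intf h k) (N R (k + 1)).

Lemma u1E : u1 = 0 :> 'I_3. Proof. by apply: val_inj; rewrite /= inordK. Qed.
Lemma u2E : u2 = 1 :> 'I_3. Proof. by apply: val_inj; rewrite /= inordK. Qed.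
Lemma u3E : u3 = 2 :> 'I_3. Proof. by apply: val_inj; rewrite /= inordK. Qed.

Lemma sg_two (i j k : 'I_3) e : i != j -> i != k -> j != k ->
  ladd (ladd (lscale (h k i) (X R i)) (lscale (h k j) (X R j))) e = sg (intf h k) e.
Proof.
move=> ij ik jk; apply/funext => a; apply/funext => l; rewrite /sg /ladd -sum_scaleX.
congr (_ + _); rewrite (bigD1 i)//= (bigD1 j) /=; last by rewrite jk /= eq_sym ij.
rewrite big1 ?addr0// => o /andP[/andP[ok oi] oj].
by move: i j k o ij ik jk ok oi oj => [[|[|[|?]]] ?] [[|[|[|?]]] ?] [[|[|[|?]]] ?] [[|[|[|?]]] ?].
Qed.

Lemma S2_sg : S2 h = Sg 0.
Proof. by rewrite /S2 /Sg u1E u2E u3E sg_two// add0r. Qed.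
Lemma S3_sg : S3 h = Sg 1.
Proof. by rewrite /S3 /Sg u1E u2E u3E sg_two//; congr (sg _ (N _ _)); apply: val_inj. Qed.
Lemma S1_sg : S1 h = Sg 2.
Proof. by rewrite /S1 /Sg u1E u2E u3E sg_two//; congr (sg _ (N _ _)); apply: val_inj. Qed.

Lemma gdet0 : gdet [::] = 1.
Proof. by rewrite /gdet det_mx00. Qed.

Lemma gdet1 e : gdet [:: e] = complex.Re (cov e e).
Proof. by rewrite /gdet (det1 (fun i j => cov (nth (@lzero R) [:: e] i) (nth (@lzero R) [:: e] j))). Qed.

Lemma gdet2 e f : gdet [:: e; f] = complex.Re (cov e e * cov f f - cov e f * cov f e).
Proof.
by rewrite /gdet (det2 (fun i j => cov (nth (@lzero R) [:: e; f] i) (nth (@lzero R) [:: e; f] j))).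
Qed.

Lemma gdet3 e f e' : gdet [:: e; f; e'] = complex.Re
  (cov e e * (cov f f * cov e' e' - cov f e' * cov e' f) -
   cov e f * (cov f e * cov e' e' - cov f e' * cov e' e) +
   cov e e' * (cov f e * cov e' f - cov f f * cov e' e)).
Proof.
by rewrite /gdet (det3 (fun i j => cov (nth (@lzero R) [:: e; f; e'] i) (nth (@lzero R) [:: e; f; e'] j))).
Qed.

(** The last variable will be the conditioning input, uncorrelated with the other input and with the
    genie signal. *)
Lemma gdet4 e1 e2 e3 e4 : cov e1 e4 = 0 -> cov e4 e1 = 0 -> cov e3 e4 = 0 -> cov e4 e3 = 0 ->
  gdet [:: e1; e2; e3; e4] = complex.Re (cov e4 e4 *
  (cov e1 e1 * (cov e2 e2 * cov e3 e3 - cov e2 e3 * cov e3 e2) -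
   cov e1 e2 * (cov e2 e1 * cov e3 e3 - cov e2 e3 * cov e3 e1) +
   cov e1 e3 * (cov e2 e1 * cov e3 e2 - cov e2 e2 * cov e3 e1)) -
  cov e2 e4 * cov e4 e2 * (cov e1 e1 * cov e3 e3 - cov e1 e3 * cov e3 e1)).
Proof.
move=> h14 h41 h34 h43.
rewrite /gdet (det4 (fun i j => cov (nth (@lzero R) [:: e1; e2; e3; e4] i)
  (nth (@lzero R) [:: e1; e2; e3; e4] j))); congr complex.Re.
rewrite !big_ord_recl big_ord0 /= /bump /= h14 h41 h34 h43.
by rewrite !expr0 !expr1 expr2; ring.
Qed.

Lemma ip_conj c d : ip P d c = conjc (ip P c d).
Proof.
rewrite /ip rmorph_sum; apply: eq_bigr => j _ /=.
by rewrite [RHS]conjM conj_rc conjM conjcK; congr (_ * _); rewrite mulrC.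
Qed.

Lemma ip_nrm c : ip P c c = rc (nrm P c).
Proof.
rewrite /ip /nrm (big_morph (@rc R) (@rcD R) (erefl _)); apply: eq_bigr => j _.
by rewrite rcM rc_sqn.
Qed.

Lemma ip_only k (a : C) d : ip P (only k a) d = a * conjc (d k) * rc (P k).
Proof.
rewrite /ip (bigD1 k)//= /only eqxx big1 ?addr0// => j /negbTE ->.
by rewrite !mul0r.
Qed.

Lemma ip_onlyr k (a : C) d : ip P d (only k a) = d k * conjc a * rc (P k).
Proof. by rewrite ip_conj ip_only !conjM conjcK conj_rc; congr (_ * _); rewrite mulrC. Qed.

Lemma sum3 {V : zmodType} k (F : 'I_3 -> V) : \sum_j F j = F k + F (k + 1) + F (k + 2).
Proof.
rewrite (bigD1 k)//= (bigD1 (k + 1)) ?(ord3_add k)//= (bigD1 (k + 2)) ?(ord3_add k)//=.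
rewrite big1 ?addr0; first exact: addrA.
move=> j /andP[/andP[j0 j1]]; by rewrite (ord3_neq j0 j1) eqxx.
Qed.

Lemma nrm_rcv k : nrm P (rcv h k) = P k + nrm P (intf h k).
Proof.
rewrite /nrm !(sum3 k) /rcv /withsig /intf /= eqxx !(negbTE (ord3_add k).1.1) !(negbTE (ord3_add k).1.2).
by rewrite /sqn /=; ring.
Qed.

Lemma ip_rcv k : ip P (rcv h k) (intf h k) = rc (nrm P (intf h k)).
Proof.
rewrite -ip_nrm /ip; apply: eq_bigr => j _; rewrite /rcv /withsig.
by case: eqP => // ->; rewrite intf_id rmorph0 !mulr0.
Qed.

End Gdets.

(** * Values of the covariance determinants *)

Section GdetValues.
Context {R : realType}.
Local Notation C := R[i].
Variables (h : 'I_3 -> 'I_3 -> C) (P : 'I_3 -> R) (g : genie R) (vV vV' : 'I_3 -> R).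
Local Notation cov := (cov P g vV vV').
Local Notation gdet := (gdet P g vV vV').

Definition cWZ k : C := conjc (rW g k) * rc (sW g k).
Definition cNZ k : C := conjc (rN g k) * rc (sN g k).
Definition vW k : R := sW g k ^+ 2.
Definition vN k : R := sN g k ^+ 2.

Let nX : noisy (@lzero R). Proof. by []. Qed.
Let nZ k : noisy (Z R k). Proof. exact/noisy_bv/kZX. Qed.
Let nW k : noisy (W R k). Proof. exact/noisy_bv/kWX. Qed.
Let nN k : noisy (N R k). Proof. exact/noisy_bv/kNX. Qed.
#[local] Hint Resolve nX nZ nW nN : core.

Let covE := (@ip_only R, @ip_onlyr R, @ip_nrm R, @ip_rcv R, @cov0l R, @cov0r R, @covZZ R,
  @covWW R, @covNN R, @covZW R, @covZN R, @covWZ R, @covNZ R, @nrm_only R).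

Let Q k := nrm P (intf h k).

Lemma ip_intf_rcv k : ip P (intf h k) (rcv h k) = rc (Q k).
Proof. by rewrite ip_conj ip_rcv conj_rc. Qed.

Lemma rcv_id k : rcv h k k = 1. Proof. by rewrite /rcv /withsig eqxx. Qed.

Lemma only_id k (a : C) : only k a k = a. Proof. by rewrite /only eqxx. Qed.

Lemma gdet_X k : gdet [:: X R k] = P k.
Proof. by rewrite gdet1 X_sg cov_sg// !(covE, only_id) /=; ring. Qed.

Lemma gdet_Y k : gdet [:: Y h k] = 1 + nrm P (rcv h k).
Proof. by rewrite gdet1 Y_sg cov_sg// !(covE, only_id) addrC. Qed.

Lemma gdet_U k : gdet [:: U h k] = vW k + Q k.
Proof. by rewrite gdet1 U_sg cov_sg// !(covE, only_id) /= addrC. Qed.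

Lemma gdet_XY k : gdet [:: X R k; Y h k] = P k * (1 + Q k).
Proof.
rewrite gdet2 X_sg Y_sg !cov_sg// !(covE, only_id) rcv_id nrm_rcv -/(Q k).
by rewrite /= /sqn /=; ring.
Qed.

Lemma gdet_XU k : gdet [:: X R k; U h k] = P k * (vW k + Q k).
Proof.
rewrite gdet2 X_sg U_sg !cov_sg// !(covE, only_id) intf_id -/(Q k) -/(vW k).
by rewrite /= /sqn /=; ring.
Qed.

Lemma gdet_YU k : gdet [:: Y h k; U h k] =
  (1 + nrm P (rcv h k)) * (vW k + Q k) - sqn (rc (Q k) + conjc (cWZ k)).
Proof.
rewrite gdet2 Y_sg U_sg !cov_sg// !(covE, only_id) ip_intf_rcv -/(Q k) -/(vW k) -/(cWZ k).
by case: (cWZ k) => p q; rewrite /= /sqn /=; ring.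
Qed.

Lemma gdet_XYU k : gdet [:: X R k; Y h k; U h k] =
  P k * ((1 + Q k) * (vW k + Q k) - sqn (rc (Q k) + conjc (cWZ k))).
Proof.
rewrite gdet3 X_sg Y_sg U_sg !cov_sg// !(covE, only_id) ip_intf_rcv rcv_id intf_id nrm_rcv.
rewrite -/(Q k) -/(vW k) -/(cWZ k).
by case: (cWZ k) => p q; rewrite /= /sqn /=; ring.
Qed.

Lemma only_neq k j (a : C) : j != k -> only k a j = 0.
Proof. by rewrite /only => /negbTE ->. Qed.

Lemma ord3_add' (k : 'I_3) : k != k + 1. Proof. by rewrite eq_sym (ord3_add k). Qed.

Lemma nrm_drop j (c : 'I_3 -> C) : nrm P (drop j c) = nrm P c - sqn (c j) * P j.
Proof.
rewrite /nrm (bigD1 j)//= [in RHS](bigD1 j)//= [RHS]addrAC subrr add0r /drop eqxx.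
rewrite /sqn /= expr0n addr0 mul0r add0r; apply: eq_bigr => l /negbTE lj.
by rewrite lj.
Qed.

Lemma ip_drop j (c d : 'I_3 -> C) : ip P (drop j c) (drop j d) = ip P c d - c j * conjc (d j) * rc (P j).
Proof.
rewrite /ip (bigD1 j)//= [in RHS](bigD1 j)//= [RHS]addrAC subrr add0r /drop eqxx.
by rewrite !mul0r add0r; apply: eq_bigr => l /negbTE ->.
Qed.

Lemma gdet_XX k : gdet [:: X R (k + 1); X R k] = P (k + 1) * P k.
Proof.
rewrite gdet2 !X_sg !cov_sg// !(covE, only_id) (only_neq _ (ord3_add k).1.1).
by rewrite (only_neq _ (ord3_add' k)) /=; ring.
Qed.

Let y k := rcv h (k + 1).
Let s k := intf h k.

Lemma gdet_YSX k : gdet [:: Y h (k + 1); Sg h k; X R k] =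
  P k * wdet P (cNZ (k + 1)) (vN (k + 1)) (drop k (y k)) (s k).
Proof.
rewrite gdet3 X_sg Y_sg /Sg !cov_sg// !(covE, only_id) intf_id /wdet.
rewrite -[s k in RHS](drop_intf h k) ip_drop !nrm_drop intf_id (ip_conj P (s k)).
rewrite -/(y k) -/(s k) -/(vN (k + 1)) -/(cNZ (k + 1)).
case: (ip P _ _) (cNZ _) (y k k) => a b [p q] [e f].
by rewrite /= /sqn /=; ring.
Qed.

(** Two known inputs project out of the received and genie signals, leaving X_(k+2) alone in
    both. *)
Lemma gdet_XYSX k : gdet [:: X R (k + 1); Y h (k + 1); Sg h k; X R k] =
  P (k + 1) * P k * wdet P (cNZ (k + 1)) (vN (k + 1))
    (only (k + 2) (h (k + 1) (k + 2))) (only (k + 2) (h k (k + 2))).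
Proof.
have z1 : cov (X R (k + 1)) (X R k) = 0.
  by rewrite !X_sg cov_sg// !covE (only_neq _ (ord3_add k).1.1) conjc0 mulr0 mul0r addr0.
have z2 : cov (X R k) (X R (k + 1)) = 0.
  by rewrite !X_sg cov_sg// !covE (only_neq _ (ord3_add' k)) conjc0 mulr0 mul0r addr0.
have z3 : cov (Sg h k) (X R k) = 0.
  by rewrite /Sg !X_sg cov_sg// !covE intf_id !mul0r addr0.
have z4 : cov (X R k) (Sg h k) = 0.
  by rewrite /Sg !X_sg cov_sg// !covE intf_id conjc0 mulr0 mul0r addr0.
have -> : only (k + 2) (h (k + 1) (k + 2)) = drop (k + 1) (drop k (y k)).
  by rewrite drop2_only /y /rcv /withsig /intf (negbTE (ord3_add k).2).
have -> : only (k + 2) (h k (k + 2)) = drop (k + 1) (drop k (s k)).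
  by rewrite drop2_only /s /intf (negbTE (ord3_add k).1.2).
have dE c : drop k c (k + 1) = c (k + 1) by rewrite /drop (negbTE (ord3_add k).1.1).
rewrite (@gdet4 R P g vV vV' _ (Y h (k + 1)) _ _ z1 z2 z3 z4) !X_sg Y_sg /Sg !cov_sg// !(covE, only_id) /wdet.
rewrite !ip_drop !nrm_drop !dE /y /s intf_id rcv_id (ip_conj P (intf h k)).
rewrite -/(vN (k + 1)) -/(cNZ (k + 1)).
case: (ip P _ _) (cNZ _) (rcv h (k + 1) k) (intf h k (k + 1)) => a b [p q] [e f] [i j].
by rewrite /= /sqn /=; ring.
Qed.

Lemma wdet_only k (a b nu : C) (nn v : R) : sqn nu < nn ->
  v^-1 = sqn a + sqn (b - nu * a) / (nn - sqn nu) ->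
  wdet P nu nn (only k a) (only k b) = (nn - sqn nu) * (1 + P k / v).
Proof.
move=> nn0 ->; have k0 : nn - sqn nu != 0 by rewrite gt_eqF// subr_gt0.
rewrite /wdet !nrm_only ip_only only_id; move: k0.
by case: a b nu {nn0} => a1 a2 [b1 b2] [n1 n2]; rewrite /sqn /= => k0; field.
Qed.

End GdetValues.

(** * Closed forms of the Gaussian mutual informations *)

Section MutualInformations.
Context {R : realType}.
Local Notation C := R[i].
Variables (h : 'I_3 -> 'I_3 -> C) (P : 'I_3 -> R) (g : genie R) (vV vV' : 'I_3 -> R).
Hypothesis P0 : forall k, 0 < P k.
Local Notation gmi := (gmi P g vV vV').
Let Q k := nrm P (intf h k).
Let Q0 k : 0 <= Q k. Proof. exact: nrm_ge0. Qed.
Let zz k := 1 + vW g k - 2 * complex.Re (cWZ g k).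

Lemma log2K (x : R) : log2 x * ln 2 = ln x.
Proof. by rewrite /log2 divfK// gt_eqF// ln2_gt0. Qed.

Lemma gmi_XY k : gmi [:: X R k] [:: Y h k] [::] * ln 2 =
  ln (1 + nrm P (rcv h k)) - ln (1 + Q k).
Proof.
have q1 : 0 < 1 + Q k by rewrite ltr_pwDl.
have r1 : 0 < 1 + nrm P (rcv h k) by rewrite ltr_pwDl// nrm_ge0.
rewrite /gmi log2K !cats0 /= gdet_X gdet_Y gdet0 gdet_XY -ln_div ?posrE//.
by congr ln; rewrite -/(Q k); field; rewrite !gt_eqF.
Qed.

Lemma gmi_XYS k (v : R) : sqn (cNZ g (k + 1)) < vN g (k + 1) -> 0 < v ->
  v^-1 = sqn (h (k + 1) (k + 2)) + sqn (h k (k + 2) - cNZ g (k + 1) * h (k + 1) (k + 2)) /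
    (vN g (k + 1) - sqn (cNZ g (k + 1))) ->
  gmi [:: X R (k + 1)] [:: Y h (k + 1); Sg h k] [:: X R k] * ln 2 =
  ln (wdet P (cNZ g (k + 1)) (vN g (k + 1)) (drop k (rcv h (k + 1))) (intf h k))
  - ln (vN g (k + 1) - sqn (cNZ g (k + 1))) - ln (1 + P (k + 2) / v).
Proof.
move=> nn v0 vE; set wd := wdet _ _ _ _ _.
have wd0 : 0 < wd by exact: wdet_gt0.
have k0 : 0 < vN g (k + 1) - sqn (cNZ g (k + 1)) by rewrite subr_gt0.
have p0 : 0 < 1 + P (k + 2) / v by rewrite addr_gt0// divr_gt0.
rewrite /gmi log2K /= gdet_XX gdet_YSX gdet_X gdet_XYSX (wdet_only P (k + 2) nn vE) -/wd.
move: k0 p0; move: (vN _ _ - _) (1 + _) => K p K0 p0.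
rewrite -!ln_div ?posrE ?divr_gt0//; congr ln; field.
by rewrite !gt_eqF.
Qed.

Lemma gmi_XYU k : gmi [:: X R k] [:: Y h k] [:: U h k] * ln 2 =
  ln ((P k * (vW g k + Q k)) * ((zz k + P k) * (vW g k + Q k) - sqn (conjc (cWZ g k) - rc (vW g k)))
   / ((vW g k + Q k) * (P k * (vW g k - sqn (cWZ g k) + zz k * Q k)))).
Proof.
rewrite /gmi log2K /= gdet_XU gdet_YU gdet_U gdet_XYU -/(Q k) nrm_rcv -/(Q k).
congr (ln (_ * _ / (_ * (_ * _)))); rewrite /zz; case: (cWZ g k) => p q; rewrite /sqn /=; ring.
Qed.

Lemma gmi_XYU_a k : sqn (cWZ g k) < vW g k ->
  gmi [:: X R k] [:: Y h k] [:: U h k] * ln 2 =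
  ln ((zz k + P k) * (vW g k + Q k) - sqn (conjc (cWZ g k) - rc (vW g k)))
  - ln (vW g k - sqn (cWZ g k)) - ln (1 + Q k / ((vW g k - sqn (cWZ g k)) / zz k)).
Proof.
move=> lw; have z0 : 0 < zz k := z_gt0 lw; have w0 := w_gt0 lw.
have k0 : 0 < vW g k - sqn (cWZ g k) by rewrite subr_gt0.
have D0 : 0 < (zz k + P k) * (vW g k + Q k) - sqn (conjc (cWZ g k) - rc (vW g k)).
  have -> : (zz k + P k) * (vW g k + Q k) - sqn (conjc (cWZ g k) - rc (vW g k)) =
      zz k * vW g k - sqn (conjc (cWZ g k) - rc (vW g k)) + zz k * Q k + P k * (vW g k + Q k).
    by ring.
  have a1 : 0 <= zz k * Q k by rewrite mulr_ge0// ltW.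
  have a2 : 0 <= P k * (vW g k + Q k) by exact: mulr_ge0 (ltW (P0 k)) (addr_ge0 (ltW w0) (Q0 k)).
  by rewrite {1}/zz det_z; apply: ltr_pwDl => //; apply: ltr_pwDl.
have q1 : 0 < 1 + Q k / ((vW g k - sqn (cWZ g k)) / zz k).
  by rewrite ltr_wpDr// divr_ge0// divr_ge0// ltW.
have wq : 0 < vW g k + Q k by rewrite ltr_wpDr.
have p0 := P0 k; rewrite gmi_XYU.
set D := (zz k + P k) * _ - _ in D0 *.
rewrite -!ln_div ?posrE ?divr_gt0//; congr ln.
have e0 : 0 < vW g k - sqn (cWZ g k) + zz k * Q k.
  by rewrite ltr_wpDr// mulr_ge0// ltW.
set K := vW g k - sqn _ in k0 q1 e0 *; clearbody D K.
by field; rewrite !gt_eqF // [Q k * _]mulrC.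
Qed.

(** Here W_k is uncorrelated with Z_k - W_k, so Y_k - U_k shows X_k in noise of variance [zz k],
    uncorrelated with U_k. *)
Lemma gmi_XYU_b k : cWZ g k = rc (vW g k) -> 0 < vW g k + Q k -> 0 < zz k ->
  gmi [:: X R k] [:: Y h k] [:: U h k] * ln 2 = ln (1 + P k / zz k).
Proof.
move=> lw wq z0; rewrite gmi_XYU lw conj_rc subrr.
have -> : vW g k - sqn (rc (vW g k)) + zz k * Q k = zz k * (vW g k + Q k).
  by rewrite /zz lw /sqn /=; ring.
congr ln; rewrite [sqn 0]/sqn /= expr0n addr0 subr0.
by move: (P0 k) => p0; field; rewrite !gt_eqF.
Qed.

Lemma gmi_ge0 (e f : lin R) : (forall c : C, cov P g vV vV' e f = c -> cov P g vV vV' f e = conjc c) ->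
  complex.Im (cov P g vV vV' e e) = 0 -> complex.Im (cov P g vV vV' f f) = 0 ->
  0 <= gdet P g vV vV' [:: e] -> 0 <= gdet P g vV vV' [:: f] -> 0 <= gmi [:: e] [:: f] [::].
Proof.
move=> hc Ie If; rewrite /gmi !cats0 /= gdet0 !gdet1 gdet2 (hc _ erefl) => e0 f0.
have -> : complex.Re (cov P g vV vV' e e * cov P g vV vV' f f - cov P g vV vV' e f *
    conjc (cov P g vV vV' e f)) = complex.Re (cov P g vV vV' e e) *
    complex.Re (cov P g vV vV' f f) - sqn (cov P g vV vV' e f).
  move: Ie If; case: (cov P g vV vV' e e) (cov P g vV vV' f f) (cov P g vV vV' e f).
  by move=> a b [c d] [p q] /= -> ->; rewrite /sqn /=; ring.
have A0 := mulr_ge0 e0 f0; set A := complex.Re _ * complex.Re _ in A0 *.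
have := sqn_ge0 (cov P g vV vV' e f); set B := sqn _ => B0.
rewrite mul1r /log2 divr_ge0 ?(ltW ln2_gt0)//.
(* If the joint determinant is not positive, the quotient is at most 0 and [ln] takes its default
   value 0. *)
have [AB|AB] := ltP 0 (A - B).
  by rewrite ln_ge0// ler_pdivlMr// mul1r gerBl.
by rewrite ln0// mulr_ge0_le0// invr_le0.
Qed.

End MutualInformations.

(** * The bound A as a cyclic sum *)

Section BoundValues.
Context {R : realType}.
Local Notation C := R[i].
Variables (h : 'I_3 -> 'I_3 -> C) (P : 'I_3 -> R) (g : genie R).
Hypothesis P0 : forall k, 0 < P k.
Local Notation I := (Defs.I h P g).

Lemma u1S : (u1 + 1 = u2) * (u1 + 2 = u3) :> Prop.
Proof. by rewrite u1E u2E u3E; split; apply: val_inj. Qed.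
Lemma u2S : (u2 + 1 = u3) * (u2 + 2 = u1) :> Prop.
Proof. by rewrite u1E u2E u3E; split; apply: val_inj. Qed.
Lemma u3S : (u3 + 1 = u1) * (u3 + 2 = u2) :> Prop.
Proof. by rewrite u1E u2E u3E; split; apply: val_inj. Qed.
Definition uS := (u1S, u2S, u3S).

Lemma ord3_ind (T : 'I_3 -> Prop) : T u1 -> T u2 -> T u3 -> forall k, T k.
Proof.
rewrite u1E u2E u3E => t0 t1 t2 k.
have [->//|k0] := eqVneq k 0; have [->//|k1] := eqVneq k 1.
by rewrite (@ord3_neq 0 k k0 k1) add0r.
Qed.

Lemma ord3_cycle (k : 'I_3) : (k + 1 + 1 = k + 2) * (k + 1 + 2 = k) * (k + 2 + 1 = k) *
  (k + 2 + 2 = k + 1).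
Proof.
by rewrite -!addrA; split; [split; [split|]|]; apply: val_inj;
  case: k => [[|[|[|?]]] ?].
Qed.

Lemma sum_u (F : 'I_3 -> R) : \sum_k F k = F u1 + F u2 + F u3.
Proof. by rewrite (sum3 u1) !uS. Qed.

Definition gmi3 k : R := I [:: X R k] [:: Y h k] [::] +
  I [:: X R (k + 1)] [:: Y h (k + 1); Sg h k] [:: X R k] + I [:: X R k] [:: Y h k] [:: U h k].

Lemma third_sum9 (a1 b1 c1 a2 b2 c2 a3 b3 c3 : R) :
  3 * (3^-1 * (a1 + b1 + c3 + a2 + b2 + c1 + a3 + b3 + c2)) =
  a1 + b1 + c1 + (a2 + b2 + c2) + (a3 + b3 + c3).
Proof. by field. Qed.

Lemma boundAE : 3 * boundA h P g = \sum_k gmi3 k.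
Proof.
rewrite sum_u /boundA /gmi3 !uS S1_sg S2_sg S3_sg -u3E -u2E -u1E.
exact: third_sum9.
Qed.

Variable v : 'I_3 -> R.
Hypothesis nn : forall k, sqn (cNZ g k) < vN g k.
Hypothesis v0 : forall k, 0 < v k.
Hypothesis vE : forall k, (v (k + 2))^-1 = sqn (h (k + 1) (k + 2)) +
  sqn (h k (k + 2) - cNZ g (k + 1) * h (k + 1) (k + 2)) / (vN g (k + 1) - sqn (cNZ g (k + 1))).

(** For each k the two sides differ by ln(1 + P_(k+2) / v_(k+2)) - ln(1 + P_k / v_k), which sums to
    zero around the cycle. *)
Lemma boundA_gA : (forall k, sqn (cWZ g k) < vW g k) ->
  \sum_k gA P h (cWZ g) (vW g) (cNZ g) (vN g) v k = 3 * boundA h P g * ln 2.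
Proof.
move=> lw; pose l k := ln (1 + P k / v k).
have E k : gA P h (cWZ g) (vW g) (cNZ g) (vN g) v k = gmi3 k * ln 2 + (l (k + 2) - l k).
  rewrite /gmi3 !mulrDl /I (@gmi_XY R h P g (vVN h P g) (vVN' h P g) P0 k) (@gmi_XYU_a R h P g (vVN h P g) (vVN' h P g) P0 k (lw k)).
  rewrite (@gmi_XYS R h P g (vVN h P g) (vVN' h P g) P0 k (v (k + 2)) (nn (k + 1)) (v0 (k + 2)) (vE k)).
  by rewrite /gA /gYS -/(l k) -/(l (k + 2)); ring.
rewrite (eq_bigr _ (fun k _ => E k)) big_split /= sumrB (sum_shift l) subrr addr0 -mulr_suml.
by rewrite boundAE.
Qed.

Lemma boundA_gB : (forall k, cWZ g k = rc (vW g k)) ->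
  (forall k, 0 < vW g k + nrm P (intf h k)) ->
  (forall k, 0 < 1 + vW g k - 2 * complex.Re (cWZ g k)) ->
  \sum_k gB P h (cWZ g) (vW g) (cNZ g) (vN g) v k = 3 * boundA h P g * ln 2.
Proof.
move=> lw wq z0; pose l k := ln (1 + P k / v k).
have E k : gB P h (cWZ g) (vW g) (cNZ g) (vN g) v k = gmi3 k * ln 2 + (l (k + 2) - l k).
  rewrite /gmi3 !mulrDl /I (@gmi_XY R h P g (vVN h P g) (vVN' h P g) P0 k) (@gmi_XYU_b R h P g (vVN h P g) (vVN' h P g) P0 k (lw k) (wq k) (z0 k)).
  rewrite (@gmi_XYS R h P g (vVN h P g) (vVN' h P g) P0 k (v (k + 2)) (nn (k + 1)) (v0 (k + 2)) (vE k)).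
  by rewrite /gB /gYS divr1 -/(l k) -/(l (k + 2)); ring.
rewrite (eq_bigr _ (fun k _ => E k)) big_split /= sumrB (sum_shift l) subrr addr0 -mulr_suml.
by rewrite boundAE.
Qed.

End BoundValues.

(** * The conditional variances of the genie noises *)

Section GenieVariances.
Context {R : realType}.
Local Notation C := R[i].
Variables (h : 'I_3 -> 'I_3 -> C) (P : 'I_3 -> R) (g : genie R).
Local Notation zz k := (1 + vW g k - 2 * complex.Re (cWZ g k)).
Local Notation kN k := (vN g k - sqn (cNZ g k)).

Let covE := (@covBl R, @covBr R, @covZl R, @covZr R, @covZZ R, @covWW R, @covNN R, @covZW R, @covZN R,
  @covWZ R, @covNZ R).

Lemma sZWE k : sZW P g k = zz k.
Proof.
rewrite /sZW /var0 /var !covE -/(cWZ g k) -/(vW g k).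
by case: (cWZ g k) => p q /=; ring.
Qed.

Lemma sVWE k : zz k != 0 -> sVW P g k = (vW g k - sqn (cWZ g k)) / zz k.
Proof.
move=> z0; have vE : var P g (fun=> 0) (fun=> 0) (lsub (Z R k) (W R k)) = zz k by exact: sZWE.
rewrite /sVW /cv0 /condvar vE /var !covE -/(cWZ g k) -/(vW g k); move: z0.
by case: (cWZ g k) => p q; rewrite /sqn /= => z0; field.
Qed.

Definition dvar k (q : C) : R := 1 + sqn q * vN g k - 2 * complex.Re (q * cNZ g k).
Definition dvar' k (q : C) : R := vN g k + sqn q - 2 * complex.Re (conjc q * cNZ g k).

Lemma dvarE k q : var0 P g (lsub (Z R k) (lscale q (N R k))) = dvar k q.
Proof.
rewrite /var0 /var !covE -/(cNZ g k) -/(vN g k) /dvar.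
by case: (cNZ g k) q => n1 n2 [q1 q2]; rewrite /sqn /=; ring.
Qed.

Lemma dvar'E k q : var0 P g (lsub (N R k) (lscale q (Z R k))) = dvar' k q.
Proof.
rewrite /var0 /var !covE -/(cNZ g k) -/(vN g k) /dvar'.
by case: (cNZ g k) q => n1 n2 [q1 q2]; rewrite /sqn /=; ring.
Qed.

Lemma cvNE k q : dvar k q != 0 -> cv0 P g (N R k) (lsub (Z R k) (lscale q (N R k))) = kN k / dvar k q.
Proof.
move=> d0; rewrite /cv0 /condvar (dvarE k q : var _ _ _ _ _ = _); move: d0.
rewrite /var !covE -/(cNZ g k) -/(vN g k) /dvar.
by case: (cNZ g k) q => n1 n2 [q1 q2]; rewrite /sqn /= => d0; field.
Qed.

Lemma cvN'E k q : dvar' k q != 0 -> cv0 P g (Z R k) (lsub (N R k) (lscale q (Z R k))) = kN k / dvar' k q.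
Proof.
move=> d0; rewrite /cv0 /condvar (dvar'E k q : var _ _ _ _ _ = _); move: d0.
rewrite /var !covE -/(cNZ g k) -/(vN g k) /dvar'.
by case: (cNZ g k) q => n1 n2 [q1 q2]; rewrite /sqn /= => d0; field.
Qed.

Definition vIn (j : 'I_3) : R := (sqn (h (j + 2) j) +
  sqn (h (j + 1) j - cNZ g (j + 2) * h (j + 2) j) / kN (j + 2))^-1.

Lemma vInE k : (vIn (k + 2))^-1 = sqn (h (k + 1) (k + 2)) +
  sqn (h k (k + 2) - cNZ g (k + 1) * h (k + 1) (k + 2)) / kN (k + 1).
Proof. by rewrite /vIn !ord3_cycle invrK. Qed.

(** The variance of V_N over the squared gain: the second kind of condition in part (a) therefore
    says that the variance of Z - W is at most [vIn]. *)
Lemma vIn_dvar k : kN k != 0 -> h (k + 2) (k + 1) != 0 ->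
  vIn (k + 1) = (kN k / dvar k (h k (k + 1) / h (k + 2) (k + 1))) / sqn (h (k + 2) (k + 1)).
Proof.
move=> n0 b0; rewrite /vIn !ord3_cycle -[RHS]invrK; congr _^-1.
set b := h (k + 2) (k + 1) in b0 *; set q := _ / b.
have -> : h k (k + 1) = q * b by rewrite divfK.
have sb : sqn b != 0 by rewrite -[_ == _](inj_eq (@complexI R)) [_%:C%C]rc_sqn mulf_neq0 ?conjc_eq0.
rewrite invf_div invf_div /dvar; clearbody b q; move: n0 sb.
case: b {b0} (cNZ g k) q => b1 b2 [c1 c2] [q1 q2]; rewrite /sqn /= => n0 sb.
by field; rewrite n0.
Qed.

(** The same [vIn] written through V'_N, so both parts of the theorem use one effective noise
    variance. *)
Lemma vIn_dvar' k : kN k != 0 -> h k (k + 1) != 0 ->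
  vIn (k + 1) = (kN k / dvar' k (h (k + 2) (k + 1) / h k (k + 1))) / sqn (h k (k + 1)).
Proof.
move=> n0 b0; rewrite /vIn !ord3_cycle -[RHS]invrK; congr _^-1.
set b := h k (k + 1) in b0 *; set q := _ / b.
have -> : h (k + 2) (k + 1) = q * b by rewrite divfK.
rewrite invf_div invf_div /dvar'; clearbody b q; move: n0.
case: b {b0} (cNZ g k) q => b1 b2 [c1 c2] [q1 q2]; rewrite /sqn /= => n0.
by field; rewrite n0.
Qed.

End GenieVariances.

(** * The hypotheses in cyclic form and what they force *)

Section Conditions.
Context {R : realType}.
Local Notation C := R[i].
Variables (h : 'I_3 -> 'I_3 -> C) (P : 'I_3 -> R) (g : genie R).
Local Notation zz k := (1 + vW g k - 2 * complex.Re (cWZ g k)).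
Local Notation kW k := (vW g k - sqn (cWZ g k)).
Local Notation kN k := (vN g k - sqn (cNZ g k)).

Let gq (k : 'I_3) := h k (k + 1) / h (k + 2) (k + 1).
Let gq' (k : 'I_3) := h (k + 2) (k + 1) / h k (k + 1).

Lemma condA_all : condA h P g -> forall k, [/\ h (k + 2) (k + 1) != 0,
  0 < var0 P g (lsub (Z R k) (lscale (gq k) (N R k))),
  vN g (k + 1) <= sVW P g k &
  sqn (h (k + 2) (k + 1)) * sZW P g (k + 1) <=
    cv0 P g (N R k) (lsub (Z R k) (lscale (gq k) (N R k)))].
Proof.
case=> b1 b2 b3 [d1 d2 d3] [[w1 n2] [w2 n3] [w3 n1]].
by apply: ord3_ind; rewrite /gq /= !uS.
Qed.

Lemma condB_all : condB h P g -> forall k, [/\ h k (k + 1) != 0,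
  0 < var0 P g (lsub (N R k) (lscale (gq' k) (Z R k))),
  vW g k <= sVW P g k &
  sqn (h k (k + 1)) * sZW P g (k + 1) <=
    cv0 P g (Z R k) (lsub (N R k) (lscale (gq' k) (Z R k)))].
Proof.
case=> b1 b2 b3 [d1 d2 d3] [[w1 n2] [w2 n3] [w3 n1]].
by apply: ord3_ind; rewrite /gq' /= !uS.
Qed.

Lemma sqn_gt0 (a : C) : a != 0 -> 0 < sqn a.
Proof.
move=> a0; rewrite lt_neqAle sqn_ge0 andbT eq_sym.
by rewrite -[_ == _](inj_eq (@complexI R)) [_%:C%C]rc_sqn mulf_neq0 ?conjc_eq0.
Qed.

Hypothesis gok : genie_ok P g.

Lemma zz_gt0 k : 0 < zz k.
Proof. by have [_ _ _ _] := gok k; rewrite sZWE. Qed.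

Lemma vW_le1 k : 0 <= vW g k <= 1.
Proof.
have [/andP[w0 w1] _ _ _ _] := gok k.
by rewrite /vW sqr_ge0 expr2 mulr_ile1.
Qed.

Lemma vN_le1 k : vN g k <= 1.
Proof.
have [_ /andP[w0 w1] _ _ _] := gok k.
by rewrite /vN expr2 mulr_ile1.
Qed.

(** Strictness propagates: a nonzero gain and a positive variance of Z - W force [kN] to be
    positive, hence [vN], and through the first condition [kW]. *)
Lemma condA_facts : condA h P g -> [/\ forall k, 0 < kN k, forall k, 0 < kW k,
  forall k, zz k <= vIn h g k & forall k, vN g (k + 1) <= kW k / zz k].
Proof.
move=> /condA_all cA.
have B k : 0 < sqn (h (k + 2) (k + 1)) by have [b _ _ _] := cA k; exact: sqn_gt0.
have D k : 0 < dvar g k (gq k) by have [_ d _ _] := cA k; rewrite -(dvarE P).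
have S k : sqn (h (k + 2) (k + 1)) * zz (k + 1) <= kN k / dvar g k (gq k).
  by have [_ _ _] := cA k; rewrite sZWE cvNE// gt_eqF.
have N0 k : 0 < kN k.
  have : 0 < kN k / dvar g k (gq k) by apply: lt_le_trans (S k); rewrite mulr_gt0// zz_gt0.
  by rewrite pmulr_lgt0// invr_gt0.
have W1 k : vN g (k + 1) <= kW k / zz k.
  by have [_ _ w _] := cA k; rewrite -(sVWE P)// gt_eqF// zz_gt0.
have W0 k : 0 < kW k.
  have : 0 < kW k / zz k.
    by apply: lt_le_trans (W1 k); apply: le_lt_trans (sqn_ge0 (cNZ g (k + 1))) _; rewrite -subr_gt0.
  by rewrite pmulr_lgt0// invr_gt0 zz_gt0.
have V k : zz (k + 1) <= vIn h g (k + 1).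
  have [b _ _ _] := cA k; rewrite vIn_dvar//; last by rewrite gt_eqF.
  by rewrite -/(gq k) ler_pdivlMr// mulrC; exact: S.
by split=> // k; have := V (k + 2); rewrite !ord3_cycle.
Qed.

Lemma condB_facts : condB h P g -> [/\ forall k, 0 < kN k, forall k, cWZ g k = rc (vW g k),
  forall k, zz k <= vIn h g k & forall k, 0 < sqn (h k (k + 1))].
Proof.
move=> /condB_all cB.
have B k : 0 < sqn (h k (k + 1)) by have [b _ _ _] := cB k; exact: sqn_gt0.
have D k : 0 < dvar' g k (gq' k) by have [_ d _ _] := cB k; rewrite -(dvar'E P).
have S k : sqn (h k (k + 1)) * zz (k + 1) <= kN k / dvar' g k (gq' k).
  by have [_ _ _] := cB k; rewrite sZWE cvN'E// gt_eqF.
have N0 k : 0 < kN k.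
  have : 0 < kN k / dvar' g k (gq' k) by apply: lt_le_trans (S k); rewrite mulr_gt0// zz_gt0.
  by rewrite pmulr_lgt0// invr_gt0.
have V k : zz (k + 1) <= vIn h g (k + 1).
  have [b _ _ _] := cB k; rewrite vIn_dvar'//; last by rewrite gt_eqF.
  by rewrite -/(gq' k) ler_pdivlMr// mulrC; exact: S.
split=> // k.
  have [_ _ w _] := cB k; move: w; rewrite sVWE ?gt_eqF ?zz_gt0// ler_pdivlMr ?zz_gt0//.
  have [w0 _] := andP (vW_le1 k); move: w0; case: (cWZ g k) => p q; rewrite /sqn /rc /= => w0 w.
  (* Completing the square in the first condition of part (b): it can hold only if E[W Z^*] equals
     the variance of W. *)
  have : (p - vW g k) ^+ 2 + q ^+ 2 <= 0 by rewrite -oppr_ge0; move: w; rewrite -subr_ge0; congr (_ <= _); ring.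
  move=> le0; have : (p - vW g k) ^+ 2 + q ^+ 2 == 0 by rewrite eq_le le0 addr_ge0 ?sqr_ge0.
  by rewrite paddr_eq0 ?sqr_ge0// !sqrf_eq0 subr_eq0 => /andP[/eqP -> /eqP ->].
by have := V (k + 2); rewrite !ord3_cycle.
Qed.

End Conditions.

(** * Nonnegativity of the side informations *)

Section SideInformations.
Context {R : realType}.
Local Notation C := R[i].
Variables (h : 'I_3 -> 'I_3 -> C) (P : 'I_3 -> R) (g : genie R).
Hypothesis P0 : forall k, 0 < P k.

Lemma gmi_U_ge0 (vV vV' : 'I_3 -> R) (kv : 'I_6) k j (a r : R) : (kv == kV) || (kv == kV') ->
  cov P g vV vV' (bv R kv j) (bv R kv j) = rc r -> 0 <= r ->
  0 <= gmi P g vV vV' [:: U h k] [:: ladd (Y h k) (lscale (rc a) (bv R kv j))] [::].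
Proof.
move=> kvE vr r0.
have kvX : kv != kX by case/orP: kvE => /eqP ->; rewrite !kE.
have z e l : (e == kZ) || (e == kW) ->
    (cov P g vV vV' (bv R e l) (bv R kv j) = 0) * (cov P g vV vV' (bv R kv j) (bv R e l) = 0).
  move=> eE; rewrite !cov_bv /base_cov; case: (l != j) (j != l) => [] [] //=;
  by case/orP: kvE => /eqP ->; case/orP: eE => /eqP ->; rewrite !kE.
have -> : ladd (Y h k) (lscale (rc a) (bv R kv j)) =
    sg (rcv h k) (ladd (Z R k) (lscale (rc a) (bv R kv j))).
  by rewrite Y_sg; apply/funext => i; apply/funext => l; rewrite /sg /ladd addrA.
have nZ : noisy (Z R k) by exact/noisy_bv/kZX.
have nW : noisy (W R k) by exact/noisy_bv/kWX.
have nV : noisy (ladd (Z R k) (lscale (rc a) (bv R kv j))).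
  by apply: noisyD => //; apply: noisyZ; exact: noisy_bv.
have zZ := z kZ k (introT orP (or_introl (eqxx kZ))).
have zW := z kW k (introT orP (or_intror (eqxx kW))).
have eU : cov P g vV vV' (U h k) (U h k) = rc (nrm P (intf h k) + vW g k).
  by rewrite U_sg cov_sg// ip_nrm covWW rcD.
have eY : cov P g vV vV' (sg (rcv h k) (ladd (Z R k) (lscale (rc a) (bv R kv j))))
    (sg (rcv h k) (ladd (Z R k) (lscale (rc a) (bv R kv j)))) =
    rc (nrm P (rcv h k) + (1 + a ^+ 2 * r)).
  rewrite cov_sg// ip_nrm covDl !covDr !covZl !covZr covZZ vr !zZ conj_rc.
  rewrite !rcD (rcM _ r) expr2 rcM rc1; ring.
apply: gmi_ge0; rewrite ?gdet1 ?eU ?eY//=.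
- move=> c <-; rewrite U_sg !cov_sg// covDr covDl covZl covZr !zW !mulr0 !addr0.
  rewrite ip_intf_rcv ip_rcv covZW.
  rewrite -[RHS]/(conjc (_ + _)) (_ : conjc (_ + _) = conjc (rc (nrm P (intf h k))) +
     conjc (cov P g vV vV' (W R k) (Z R k))); last exact: rmorphD.
  by rewrite conj_rc.
- by rewrite addr_ge0 ?nrm_ge0 ?sqr_ge0.
- have ar : 0 <= a ^+ 2 * r by rewrite mulr_ge0// sqr_ge0.
  exact: addr_ge0 (nrm_ge0 P0 _) (addr_ge0 ler01 ar).
Qed.

Lemma third_sum_ge0 (a b c : R) : 0 <= a -> 0 <= b -> 0 <= c -> 0 <= 3^-1 * (a + b + c).
Proof. by move=> a0 b0 c0; rewrite mulr_ge0 ?invr_ge0// !addr_ge0. Qed.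

Lemma u_neq : (u2 == u1 = false) * (u3 == u1 = false) * (u3 == u2 = false).
Proof. by rewrite u1E u2E u3E. Qed.

Hypothesis gok : genie_ok P g.

Lemma sqnZW_ge0 (a : C) k : 0 <= sqn a * sZW P g k.
Proof. by rewrite mulr_ge0 ?sqn_ge0//; have [_ _ _ _ /ltW] := gok k. Qed.

Lemma boundI0_ge0 : condA h P g -> 0 <= boundI0 h P g.
Proof.
case=> _ _ _ _ [[_ n2] [_ n3] [_ n1]].
by apply: third_sum_ge0; apply: (gmi_U_ge0 (kv := kV)); rewrite ?eqxx// ?covVV /vVN ?eqxx ?u_neq//;
  [apply: le_trans n3|apply: le_trans n1|apply: le_trans n2]; exact: sqnZW_ge0.
Qed.

Lemma boundI1_ge0 : condB h P g -> 0 <= boundI1 h P g.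
Proof.
case=> _ _ _ _ [[_ n2] [_ n3] [_ n1]].
by apply: third_sum_ge0; apply: (gmi_U_ge0 (kv := kV')); rewrite ?eqxx ?orbT// ?covV'V' /vVN' ?eqxx ?u_neq//;
  [apply: le_trans n3|apply: le_trans n1|apply: le_trans n2]; exact: sqnZW_ge0.
Qed.

End SideInformations.

(** * The sum-rate bounds *)

Section SumRate.
Context {R : realType}.
Variables (h : 'I_3 -> 'I_3 -> R[i]) (P : 'I_3 -> R) (g : genie R) (s : 'S_3).
Hypothesis P0 : forall k, 0 < P k.
Hypothesis gok : genie_ok P g.
Let h' i j := h (s i) (s j).
Let P' i := P (s i).
Variable Rt : 'I_3 -> R.
Hypothesis ach : achievable h P Rt.

Let P'0 k : 0 < P' k. Proof. exact: P0. Qed.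
Let gok' : genie_ok P' g.
Proof.
by move=> k; have [a b c d] := gok k; split=> //; move: p; rewrite !sZWE.
Qed.

Lemma scale3ln2 (x y : R) : 3 * x * ln 2 <= 3 * y * ln 2 -> x <= y.
Proof. by rewrite ler_pM2r ?ln2_gt0// ler_pM2l. Qed.

Lemma sum_rate_a : condA h' P' g -> \sum_k Rt k <= boundA h' P' g.
Proof.
move=> cA; have [N0 W0 V W1] := condA_facts gok' cA.
have nn k : sqn (cNZ g k) < vN g k by rewrite -subr_gt0.
have ww k : sqn (cWZ g k) < vW g k by rewrite -subr_gt0.
have v0 k : 0 < vIn h' g k by apply: lt_le_trans (V k); exact: zz_gt0 gok' k.
apply: scale3ln2; rewrite -(boundA_gA P'0 nn v0 (vInE h' g) ww).
apply: (converse (s := s) ach) => n c gg gc gG.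
have w1 k : vW g k <= 1 by have /andP[] := vW_le1 gok' k.
exact: (code_group_a P0 (fun k => msize_gt0 n (Rt k)) gc gG nn v0 (vInE h' g) V ww w1 W1).
Qed.

Lemma sum_rate_b : condB h' P' g -> \sum_k Rt k <= boundA h' P' g.
Proof.
move=> cB; have [N0 W0 V b0] := condB_facts gok' cB.
have nn k : sqn (cNZ g k) < vN g k by rewrite -subr_gt0.
have z0 := zz_gt0 gok'.
have v0 k : 0 < vIn h' g k by apply: lt_le_trans (V k); exact: z0.
(* W_k may vanish in part (b); a nonzero cross gain still makes the variance of U_k positive. *)
have wq k : 0 < vW g k + nrm P' (intf h' k).
  have /andP[w0 _] := vW_le1 gok' k; apply: ltr_wpDl w0 _.
  rewrite /nrm (sum3 k) intf_id [intf h' k (k + 1)]/intf (negbTE (ord3_add k).1.1).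
  have a0 (a : R[i]) l : 0 <= sqn a * P' l by rewrite mulr_ge0 ?sqn_ge0// ltW.
  by apply: ltr_pwDl => //; apply: ltr_wpDl => //; rewrite mulr_gt0.
apply: scale3ln2; rewrite -(boundA_gB P'0 nn v0 (vInE h' g) W0 wq z0).
apply: (converse (s := s) ach) => n c gg gc gG.
have z01 k : 0 < 1 + vW g k - 2 * complex.Re (cWZ g k) <= 1.
  rewrite z0 W0 /=; have /andP[w0 _] := vW_le1 gok' k.
  by rewrite lerBlDr lerD2l mulr_natl mulr2n lerDl.
exact: (code_group_b P0 (fun k => msize_gt0 n (Rt k)) gc gG nn v0 (vInE h' g) V z01 (vN_le1 gok')).
Qed.

End SumRate.


(* For every relabelling s of the users (s = 1 gives the statement for the   *)
(* original indices), the bounds (a), (b) and the sum-capacity bound hold,   *)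
(* where the bound expressions are evaluated on the relabelled channel        *)
(* h'_{ij} = h_{s(i) s(j)}, P'_i = P_{s(i)}.                                  *)
Theorem theorem3 (R : realType) (h : 'I_3 -> 'I_3 -> R[i]) (P : 'I_3 -> R)
    (g : genie R) (s : 'S_3) :
  (forall k, 0 < P k) -> genie_ok P g ->
  let h' := fun i j => h (s i) (s j) in
  let P' := fun i => P (s i) in
  [/\ condA h' P' g ->
        forall Rt : 'I_3 -> R, achievable h P Rt ->
          \sum_(k < 3) Rt k <= boundA h' P' g + boundI0 h' P' g,
      condB h' P' g ->
        forall Rt : 'I_3 -> R, achievable h P Rt ->
          \sum_(k < 3) Rt k <= boundA h' P' g + boundI1 h' P' g &
      condA h' P' g -> condB h' P' g ->
        (sum_capacity h P <=
         (boundA h' P' g + Num.min (boundI0 h' P' g) (boundI1 h' P' g))%:E)%E].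
Proof.
move=> P0 gok h' P'.
have P'0 k : 0 < P' k by exact: P0.
have gok' : genie_ok P' g by move=> k; have [a b c d e] := gok k; split=> //; rewrite sZWE -(sZWE P).
split.
- move=> cA Rt ach; apply: le_trans (sum_rate_a P0 gok ach cA) _.
  by rewrite lerDl; exact: boundI0_ge0.
- move=> cB Rt ach; apply: le_trans (sum_rate_b P0 gok ach cB) _.
  by rewrite lerDl; exact: boundI1_ge0.
move=> cA cB; apply: ub_ereal_sup => _ [Rt ach <-]; rewrite lee_fin.
have i0 := boundI0_ge0 P'0 gok' cA; have i1 := boundI1_ge0 P'0 gok' cB.
have le_addr_min (r a b c : R) : r <= a -> 0 <= b -> 0 <= c -> r <= a + Num.min b c.
  by move=> ra b0 c0; apply: le_trans ra _; rewrite lerDl le_min b0.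
exact: le_addr_min (sum_rate_a P0 gok ach cA) i0 i1.
Qed.
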